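(* Let $d\ge2$, $0<\lambda_-<\lambda_+<\infty$ and $\mathcal K=\{\Sigma\in\mathcal S^{++}(d):\lambda_- I\preceq\Sigma\preceq\lambda_+ I\}$. Assume that $X_1,X_2,\dots$ are i.i.d. from $\mathrm{HWN}_d(\mu_0,\Sigma_0)$, that $(\mu_0,\Sigma_0)\in\mathbb H^d\times\operatorname{int}(\mathcal K)$, and that the Fisher information matrix $\mathcal I(\vartheta_0)$ is positive definite. Let $(\hat\mu_n,\hat\Sigma_n)$ be any measurable maximizer of $\ell_n$ over $\mathbb H^d\times\mathcal K$, and let $\hat\vartheta_n=(\operatorname{Log}_{\mu_0}(\hat\mu_n),\operatorname{vech}(\log\hat\Sigma_n))$. Then $$\sqrt n\,(\hat\vartheta_n-\vartheta_0)=\mathcal I(\vartheta_0)^{-1}\frac1{\sqrt n}\sum_{i=1}^n\mathsf s_{\vartheta_0}(X_i)+o_p(1),$$ and hence $$\sqrt n\,(\hat\vartheta_n-\vartheta_0)\Rightarrow N\bigl(0,\mathcal I(\vartheta_0)^{-1}\bigr).$$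
   Context: Hyperbolic space (Lorentz model): for $x,y\in\mathbb R^{d+1}$ let $\langle x,y\rangle_L=-x_0y_0+\sum_{j=1}^d x_jy_j$, and $\mathbb H^d=\{x\in\mathbb R^{d+1}:\langle x,x\rangle_L=-1,\ x_0>0\}$ with the Riemannian metric induced by $\langle\cdot,\cdot\rangle_L$ on tangent spaces. Let $o=(1,0,\dots,0)$. $\operatorname{Exp}_\mu:T_\mu\mathbb H^d\to\mathbb H^d$ is the Riemannian exponential map (a global diffeomorphism), $\operatorname{Log}_\mu$ its inverse, $PT_{x\to y}:T_x\mathbb H^d\to T_y\mathbb H^d$ parallel transport along the unique geodesic from $x$ to $y$. $T_o\mathbb H^d$ is identified with $\mathbb R^d$ by $(0,v)\leftrightarrow v$, and $T_{\mu_0}\mathbb H^d$ with $\mathbb R^d$ by a fixed linear isometry. Set $\mathsf T_\mu(x)=PT_{o\to\mu}^{-1}(\operatorname{Log}_\mu(x))\in\mathbb R^d$. $\mathcal S^{++}(d)$ is the set of real symmetric positive definite $d\times d$ matrices; $\preceq$ is the Loewner order. For $\mu\in\mathbb H^d$, $\Sigma\in\mathcal S^{++}(d)$, $\mathrm{HWN}_d(\mu,\Sigma)$ is the law of $\operatorname{Exp}_\mu(PT_{o\to\mu}Z)$ with $Z\sim N_d(0,\Sigma)$. Let $\varphi(v)=\log(\sinh\|v\|/\|v\|)$ for $v\in\mathbb R^d\setminus\{0\}$, $\varphi(0)=0$. The log-density with respect to Riemannian volume, up to the additive constant $-(d/2)\log(2\pi)$, is $$m_{\mu,\Sigma}(x)=-\tfrac12\log\det\Sigma-\tfrac12\mathsf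 T_\mu(x)^\top\Sigma^{-1}\mathsf T_\mu(x)-(d-1)\varphi(\mathsf T_\mu(x)),$$ and $\ell_n(\mu,\Sigma)=\sum_{i=1}^n m_{\mu,\Sigma}(X_i)$. Charts: $\alpha=\operatorname{Log}_{\mu_0}(\mu)\in\mathbb R^d$, $\mu(\alpha)=\operatorname{Exp}_{\mu_0}(\alpha)$; $\beta=\operatorname{vech}(\log\Sigma)\in\mathbb R^{d(d+1)/2}$, $\Sigma(\beta)=\exp(\operatorname{mat}(\beta))$, where $\operatorname{vech}$ is half-vectorization and $\operatorname{mat}$ its inverse onto symmetric matrices. Put $\vartheta=(\alpha,\beta)\in\mathbb R^p$, $p=d+d(d+1)/2$, $\vartheta_0=(0,\operatorname{vech}(\log\Sigma_0))$, $m_\vartheta=m_{\mu(\alpha),\Sigma(\beta)}$. The score is $\mathsf s_\vartheta(x)=\partial_\vartheta m_\vartheta(x)$ and the Fisher information is $\mathcal I(\vartheta)=\mathbb E_\vartheta[\mathsf s_\vartheta(X)\mathsf s_\vartheta(X)^\top]$, with $X\sim\mathrm{HWN}_d(\mu(\alpha),\Sigma(\beta))$ under $\mathbb E_\vartheta$. $\Rightarrow$ is convergence in distribution. *)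

(* Defs.v *)
(* Vectors of R^n are row vectors 'rV[R]_n, so matrices act on the right: the   *)
(* column expressions A x, x^T A x, x x^T of the usual notation read            *)
(* x *m A^T, x *m A *m x^T, x^T *m x here.                                      *)
From HB Require Import structures.
From mathcomp Require Import all_boot all_order all_algebra finmap.
From mathcomp Require Import all_classical all_reals all_analysis.

Set Implicit Arguments.
Unset Strict Implicit.
Unset Printing Implicit Defensive.

Import Order.TTheory GRing.Theory Num.Theory.
Import numFieldNormedType.Exports.

Local Open Scope classical_set_scope.
Local Open Scope ring_scope.

Section matrices.
Context {R : realType}.

Definition quad n (A : 'M[R]_n) (v : 'rV[R]_n) : R := (v *m A *m v^T) ord0 ord0.

(* The norm of the library on 'rV[R]_n is the sup norm. *)
Definition enorm n (v : 'rV[R]_n) : R := Num.sqrt ((v *m v^T) ord0 ord0).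

Definition posdef n (A : 'M[R]_n) : Prop :=
  A^T = A /\ forall v, v != 0 -> 0 < quad A v.

Definition possemidef n (A : 'M[R]_n) : Prop :=
  A^T = A /\ forall v, 0 <= quad A v.

Definition loewner_le n (A B : 'M[R]_n) : Prop := possemidef (B - A).

Definition covK n (lm lp : R) : set 'M[R]_n :=
  [set S | posdef S /\ loewner_le lm%:M S /\ loewner_le S lp%:M].

(* Interior for the relative topology of the space of positive definite        *)
(* matrices, which is open in the space of symmetric matrices (a set of         *)
(* symmetric matrices has empty interior in 'M[R]_n).                           *)
Definition posdef_interior n (K : set 'M[R]_n) : set 'M[R]_n :=
  [set S | posdef S /\ within (@posdef n) (nbhs S) K].

Definition mexp n (A : 'M[R]_n) : 'M[R]_n :=
  limn (series (fun k => k`!%:R^-1 *: (A ^+ k : 'M[R]_n))).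

(* A positive definite matrix has exactly one symmetric logarithm and exactly   *)
(* one positive definite square root.                                           *)
Definition mlog n (S : 'M[R]_n) : 'M[R]_n :=
  xget 0 [set A | A^T = A /\ mexp A = S].

Definition msqrt n (S : 'M[R]_n) : 'M[R]_n :=
  xget 0 [set A | posdef A /\ A *m A = S].

End matrices.

Section half_vectorization.

Definition vech_dim d := (d * d.+1)./2.

(* positions on and below the diagonal, column by column *)
Definition vech_seq d : seq ('I_d * 'I_d) :=
  [seq (i, j) | j : 'I_d <- enum 'I_d, i : 'I_d <- [seq i : 'I_d <- enum 'I_d | (j <= i)%N]].

Lemma size_vech_seq d : size (vech_seq d) == vech_dim d.
Proof.
have size_col (j : 'I_d) : size [seq i : 'I_d <- enum 'I_d | (j <= i)%N] = (d - j)%N.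
  have -> : size [seq i : 'I_d <- enum 'I_d | (j <= i)%N] =
            count (leq j) (iota 0 d).
    by rewrite -val_enum_ord count_map size_filter.
  have le_jd := ltnW (ltn_ord j); move: (nat_of_ord j) le_jd => m le_md.
  rewrite -[in iota 0 d](subnKC le_md) iotaD count_cat add0n.
  rewrite (_ : count _ (iota 0 m) = 0)%N ?add0n; last first.
    apply/eqP; rewrite -leqn0 leqNgt -has_count; apply/hasPn => k.
    by rewrite mem_iota add0n /= -ltnNge.
  rewrite -[RHS](size_iota m); apply/eqP; rewrite -all_count.
  by apply/allP => k; rewrite mem_iota => /andP[].
rewrite /vech_seq size_allpairs_dep /vech_dim.
rewrite (eq_map size_col) sumnE big_map -[X in _ == X]/((d * d.+1)./2).
rewrite big_enum /= (reindex_inj rev_ord_inj) /=.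
rewrite (eq_bigr (fun i : 'I_d => (i : nat).+1)); last first.
  by move=> i _; rewrite subKn.
have -> : (\sum_(i < d) i.+1 = \sum_(i < d.+1) i)%N.
  by rewrite [RHS]big_ord_recl add0n; apply: eq_bigr => i _.
by rewrite -(big_mkord xpredT id) bin2_sum bin2 mulnC.
Qed.

Definition vech_pos d : (vech_dim d).-tuple ('I_d * 'I_d) :=
  Tuple (size_vech_seq d).

Context {R : realType}.

Definition vech d (A : 'M[R]_d) : 'rV[R]_(vech_dim d) :=
  \row_k A (tnth (vech_pos d) k).1 (tnth (vech_pos d) k).2.

(* For all (i, j), exactly one k contributes to the sum (lemma vechK).          *)
Definition mat d (b : 'rV[R]_(vech_dim d)) : 'M[R]_d :=
  \matrix_(i, j)
    \sum_(k | tnth (vech_pos d) k \in [:: (i, j); (j, i)]) b ord0 k.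

Lemma vech_posP d (p : 'I_d * 'I_d) :
  (p \in vech_seq d) = (p.2 <= p.1)%N.
Proof.
apply/allpairsPdep/idP => [[j [i [_ + ->]]]|le21].
  by rewrite mem_filter => /andP[].
case: p le21 => i j /= le_ji; exists j, i.
by rewrite mem_enum mem_filter mem_enum le_ji.
Qed.

Lemma uniq_vech_seq d : uniq (vech_seq d).
Proof.
apply: allpairs_uniq_dep; rewrite ?enum_uniq //.
- by move=> j _; rewrite filter_uniq ?enum_uniq.
- by move=> [i j] [i' j'] _ _ /= [-> ->].
Qed.

Lemma mat_sym d (b : 'rV[R]_(vech_dim d)) : (mat b)^T = mat b.
Proof.
apply/matrixP => i j; rewrite !mxE; apply: eq_bigl => k.
by rewrite !inE orbC.
Qed.

Lemma mat_vech_pos d (b : 'rV[R]_(vech_dim d)) k :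
  mat b (tnth (vech_pos d) k).1 (tnth (vech_pos d) k).2 = b ord0 k.
Proof.
rewrite mxE (big_pred1 k) // => l; rewrite !inE -surjective_pairing.
have pos_inj : injective (tnth (vech_pos d)) by apply/tuple_uniqP/uniq_vech_seq.
apply/orP/eqP => [[/eqP/pos_inj //|/eqP lk]|->]; last by left.
apply: pos_inj; have := mem_tnth l (vech_pos d); have := mem_tnth k (vech_pos d).
move: lk; case: (tnth (vech_pos d) k) => i j /= ->.
rewrite !vech_posP /= => le_ji le_ij.
by have -> : i = j by apply/val_inj/eqP; rewrite eqn_leq le_ji le_ij.
Qed.

Lemma matK d : cancel (@mat d) (@vech d).
Proof. by move=> b; apply/rowP => k; rewrite mxE mat_vech_pos. Qed.

Lemma vechK d (A : 'M[R]_d) : A^T = A -> mat (vech A) = A.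
Proof.
move=> symA; apply/matrixP => i j.
wlog le_ji : i j / (j <= i)%N => [hw|].
  have [/hw //|/ltnW/hw] := leqP j i.
  by rewrite -[in LHS]mat_sym -[in RHS]symA !mxE.
have /tnthP[k Ek] : (i, j) \in vech_pos d by rewrite vech_posP.
have /= := mat_vech_pos (vech A) k; rewrite -Ek /= => ->.
by rewrite mxE -Ek.
Qed.

End half_vectorization.

Section hyperbolic_space.
Context {R : realType} {d : nat}.
Implicit Types (x y mu v w : 'rV[R]_d.+1) (g V : R -> 'rV[R]_d.+1).

Definition lorentz x y : R :=
  - (x ord0 ord0 * y ord0 ord0)
  + \sum_(j < d) x ord0 (lift ord0 j) * y ord0 (lift ord0 j).

Definition hyperboloid : set 'rV[R]_d.+1 :=
  [set x | lorentz x x = -1 /\ 0 < x ord0 ord0].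

Definition tangent x : set 'rV[R]_d.+1 := [set v | lorentz x v = 0].

(* Projection onto the tangent space along the normal direction x; since       *)
(* lorentz x x = -1, the normal component of w is - lorentz x w *: x.           *)
Definition tangent_proj x w : 'rV[R]_d.+1 := w + lorentz x w *: x.

(* The Levi-Civita connection of a submanifold with the induced metric is the   *)
(* tangential part of the ambient (flat) connection.                            *)
Definition covariant_derivative g V : R -> 'rV[R]_d.+1 :=
  fun t => tangent_proj (g t) (derive1 V t).

Definition parallel_along g V : Prop :=
  (forall t, tangent (g t) (V t)) /\
  (forall t, derivable V t 1) /\
  (forall t, covariant_derivative g V t = 0).

Definition geodesic g : Prop :=
  (forall t, hyperboloid (g t)) /\
  (forall t, derivable g t 1) /\
  parallel_along g (derive1 g).

(* In Exp, Log, PT and Tmap the set given to xget is a singleton when the       *)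
(* arguments lie in the hyperboloid and in the appropriate tangent space; the   *)
(* first argument of xget is the irrelevant default value.                      *)
Definition Exp mu v : 'rV[R]_d.+1 :=
  xget mu [set x | exists g, [/\ geodesic g, g 0 = mu, derive1 g 0 = v & g 1 = x]].

Definition Log mu x : 'rV[R]_d.+1 :=
  xget 0 [set v | tangent mu v /\ Exp mu v = x].

Definition PT x y v : 'rV[R]_d.+1 :=
  xget 0 [set w | exists g V,
    [/\ geodesic g, g 0 = x & g 1 = y] /\
    [/\ parallel_along g V, V 0 = v & V 1 = w]].

Definition origin : 'rV[R]_d.+1 := row_mx (const_mx 1 : 'rV_1) (0 : 'rV[R]_d).

Definition origin_frame (z : 'rV[R]_d) : 'rV[R]_d.+1 := row_mx (0 : 'rV_1) z.

Definition Tmap mu x : 'rV[R]_d :=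
  xget 0 [set z | PT origin mu (origin_frame z) = Log mu x].

Definition linear_isometry_onto_tangent mu
    (iota : {linear 'rV[R]_d -> 'rV[R]_d.+1}) : Prop :=
  range iota = tangent mu /\
  forall a b, lorentz (iota a) (iota b) = (a *m b^T) ord0 ord0.

End hyperbolic_space.

Section normal_laws.
Context {R : realType}.

(* R^n (and R^(m x n)) with its Borel sigma-algebra *)
Definition borel m n := g_sigma_algebraType (@open 'M[R]_(m, n)).

Section product_probability.
Context {disp : measure_display} {T : measurableType disp}.
Variable P : probability T R.

Definition cons_pair n (x : T * n.-tuple T) : n.+1.-tuple T :=
  [tuple of x.1 :: x.2].

Lemma measurable_cons_pair n : measurable_fun setT (@cons_pair n).
Proof. by apply: measurable_cons; [exact: measurable_fst|exact: measurable_snd]. Qed.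

HB.instance Definition _ n :=
  isMeasurableFun.Build _ _ _ _ (@cons_pair n) (@measurable_cons_pair n).

Fixpoint power_prob n : probability (n.-tuple T) R :=
  if n is m.+1 then distribution (P \x^ power_prob m)%E (@cons_pair m)
  else \d_([tuple] : 0.-tuple T).

End product_probability.

(* N(0, S) is the law of G *m S^(1/2) for G with i.i.d. N(0, 1) coordinates.    *)
Definition normal_law n (S : 'M[R]_n) : set (borel 1 n) -> \bar R :=
  pushforward (power_prob (normal_prob 0 1 : probability (measurableTypeR R) R) n)
    (fun z : n.-tuple (measurableTypeR R) =>
      (\row_i tnth z i) *m msqrt S : borel 1 n).

End normal_laws.

Arguments borel R m n : clear implicits.

Section wrapped_normal.
Context {R : realType} {d : nat}.
Implicit Types (mu x : 'rV[R]_d.+1) (S : 'M[R]_d).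

Definition HWN mu S : set (borel R 1 d.+1) -> \bar R :=
  pushforward (normal_law S)
    (fun z : borel R 1 d => Exp mu (PT origin mu (origin_frame z)) : borel R 1 d.+1).

Definition sinh (r : R) : R := (expR r - expR (- r)) / 2.

Definition phi (v : 'rV[R]_d) : R :=
  if v == 0 then 0 else ln (sinh (enorm v) / enorm v).

Definition logdens mu S x : R :=
  - 2^-1 * ln (\det S) - 2^-1 * quad (invmx S) (Tmap mu x)
  - d.-1%:R * phi (Tmap mu x).

Definition loglik (n : nat) (X : nat -> 'rV[R]_d.+1) mu S : R :=
  \sum_(i < n) logdens mu S (X i).

(* Charts at mu0; iota is the isometry of R^d onto the tangent space at mu0.    *)
Variables (mu0 : 'rV[R]_d.+1) (iota : {linear 'rV[R]_d -> 'rV[R]_d.+1}).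

Definition chart mu S : 'rV[R]_(d + vech_dim d) :=
  row_mx (xget 0 [set a | iota a = Log mu0 mu]) (vech (mlog S)).

Definition mu_of (t : 'rV[R]_(d + vech_dim d)) : 'rV[R]_d.+1 := Exp mu0 (iota (lsubmx t)).

Definition Sigma_of (t : 'rV[R]_(d + vech_dim d)) : 'M[R]_d := mexp (mat (rsubmx t)).

Definition score (t : 'rV[R]_(d + vech_dim d)) x : 'rV[R]_(d + vech_dim d) :=
  \row_k 'D_(delta_mx ord0 k)
    (fun u : 'rV[R]_(d + vech_dim d) => logdens (mu_of u) (Sigma_of u) x) t.

Definition fisher (t : 'rV[R]_(d + vech_dim d)) : 'M[R]_(d + vech_dim d) :=
  \matrix_(k, l) fine (\int[HWN (mu_of t) (Sigma_of t)]_x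
    (((score t x)^T *m score t x) k l)%:E)%E.

End wrapped_normal.

Section limit_theory.
Context {R : realType} {disp : measure_display} {Omega : measurableType disp}.
Variable P : probability Omega R.

Definition mutually_independent m n (X : nat -> Omega -> borel R m n) : Prop :=
  forall (J : {fset nat}) (A : nat -> set (borel R m n)),
    (forall i, measurable (A i)) ->
    P (\bigcap_(i in [set` J]) X i @^-1` A i) =
    (\prod_(i <- J) P (X i @^-1` A i))%E.

Definition iid_from m n (X : nat -> Omega -> borel R m n)
    (Q : set (borel R m n) -> \bar R) : Prop :=
  (forall i, measurable_fun setT (X i)) /\
  mutually_independent X /\
  (forall i A, measurable A -> P (X i @^-1` A) = Q A).

Definition o_p1 p (Y : nat -> Omega -> 'rV[R]_p) : Prop :=
  (forall n, measurable_fun setT (Y n : Omega -> borel R 1 p)) /\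
  forall e : R, 0 < e ->
    P [set w | e < enorm (Y n w)] @[n --> \oo] --> 0%E.

Definition cvg_in_distribution p (Y : nat -> Omega -> 'rV[R]_p)
    (Q : set (borel R 1 p) -> \bar R) : Prop :=
  (forall n, measurable_fun setT (Y n : Omega -> borel R 1 p)) /\
  forall f : 'rV[R]_p -> R, continuous f -> (exists M, forall y, `|f y| <= M) ->
    (\int[P]_w (f (Y n w))%:E)%E @[n --> \oo] --> (\int[Q]_y (f y)%:E)%E.

Definition measurable_maximizer d (X : nat -> Omega -> 'rV[R]_d.+1)
    (K : set 'M[R]_d) (mu_hat : nat -> Omega -> 'rV[R]_d.+1)
    (Sigma_hat : nat -> Omega -> 'M[R]_d) : Prop :=
  forall n, (0 < n)%N ->
  [/\ measurable_fun setT (mu_hat n : Omega -> borel R 1 d.+1),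
      measurable_fun setT (Sigma_hat n : Omega -> borel R d d)
    & forall w, [/\ hyperboloid (mu_hat n w), K (Sigma_hat n w)
      & forall mu S, hyperboloid mu -> K S ->
          loglik n (X ^~ w) mu S
          <= loglik n (X ^~ w) (mu_hat n w) (Sigma_hat n w)]].

End limit_theory.

(* Main.v *)
(* In the Lorentz model geodesics and parallel transport are explicit, and the    *)
(* density of HWN(mu, S) depends on x only through c = - <mu, x> and the Lorentz  *)
(* boost taking mu to the origin.  Since r / sinh r, r = arccosh c, is an integral *)
(* of rational functions of c, the log-likelihood ratio D(h, x) between           *)
(* theta0 + h and theta0 has a second-order expansion in h with remainder         *)
(* O((1 + dist(m, x))^2 |h|^3).  The total mass of HWN(mu, S) is 1: the density is *)
(* integrated by boosts, polar coordinates and linear maps, all reduced to        *)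
(* one-dimensional substitutions.  Expanding E[exp D(h, X)] = 1 gives             *)
(* E[score] = 0 and E[Hessian] = - I(theta0).                                     *)
(* Consistency is Wald's argument: Gibbs' inequality is strict because            *)
(* x |-> log-density is maximal exactly at mu, far away mu are excluded by the    *)
(* triangle inequality, and the rest of the parameter space is compact.  Near     *)
(* theta0, comparing the maximiser with theta0 + Delta / sqrt n in the quadratic  *)
(* expansion forces sqrt n (that - theta0) - Delta -> 0 in probability.  The      *)
(* central limit theorem for Delta is Lindeberg's replacement argument, applied   *)
(* to test functions smoothed by a small Gaussian convolution.                    *)
Require Import Defs.
From HB Require Import structures.
From mathcomp Require Import all_boot all_order all_algebra finmap.
From mathcomp Require Import all_classical all_reals all_analysis.
From mathcomp Require Import measurable_realfun ring lra.
Set Implicit Arguments.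
Unset Strict Implicit.
Unset Printing Implicit Defensive.
Import Order.TTheory GRing.Theory Num.Theory.
Import numFieldNormedType.Exports.
Local Open Scope classical_set_scope.
Local Open Scope ring_scope.

(** * Borel sets of matrix spaces and product probabilities *)

(** Near [theta0] and at scale 1/sqrt n the log-likelihood ratio is a concave quadratic up to a
    negligible error, and the maximiser of such a function lies close to the vertex of the
    quadratic. With u = sqrt n (theta - theta0), V the Fisher information and L the normalised sum
    of the scores multiplied by the inverse of V, the quadratic is L V u - u V u / 2 with vertex L
    ([loglik_expansion]). Comparing the maximiser with theta0 + L / sqrt n gives the linearisation
    ([quadratic_argmax], [linearization]); the limit law then follows from the central limit theorem
    for L ([clt_nonneg]) and [slutsky].

    The expansion must be controlled for unbounded x. By the explicit geodesics and transports
    ([ExpE], [LogE], [PTE]) the log-density is a function of k = - <mu, x> and of a boost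
    ([logdensE]). Moving mu multiplies k by 1 + eta with eta small uniformly in x, and r / sinh r, r
    = arccosh k, is an integral of rational kernels ([Gfun_Gmom]) whose expansion is uniform under
    relative perturbations of k. The only growing factor is (r coth r)^2 <= (1 + r)^2, so
    [has_jet_logdens] holds with weight (1 + r)^2. Under the model r is the norm of a Gaussian
    vector, hence the weight has an exponential moment ([wt_exp]).

    The identities E[score] = 0 and E[Hessian] = - V are obtained without differentiating under the
    integral: the likelihood ratio integrates to 1 for every h ([likelihood_ratio]), and the
    coefficients of its expansion in h must vanish ([score_identity]). The unit mass rests on
    invariance of the volume under boosts ([hypI_boost]) and on the Jacobian of the exponential map
    ([hypI_exp]). The same [score_identity], applied to the shift family of the standard Gaussian,
    supplies the Gaussian moments.

    Consistency follows Wald. By [gibbs] the mean log-likelihood ratio is negative away from the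
    truth; [far_cover] and [local_cover] give integrable majorants that keep a negative mean, the
    first for all distant mu, the second on a neighbourhood of each remaining parameter;
    [vanishing_contrast] turns each majorant into an event of vanishing probability, and compactness
    leaves finitely many. *)

Section borel_measurability.
Context {R : realType}.

Lemma measurable_preimage_open d (T : measurableType d) m n
    (f : T -> 'M[R]_(m, n)) :
  (forall B, open B -> measurable (f @^-1` B)) ->
  measurable_fun setT (f : T -> borel R m n).
Proof.
move=> mf; refine (@measurability _ _ T (borel R m n) setT f (@open 'M[R]_(m, n)) erefl _).
by move=> A [B oB <-]; rewrite setTI; exact: mf.
Qed.

Let fin_bigcap_meas d (T : measurableType d) (I : finType) (F : I -> set T) :
  (forall i, setT i -> measurable (F i)) -> measurable (\bigcap_(i in setT) F i).
Proof.
move=> mF; rewrite -[X in measurable X]setCK setC_bigcap; apply: measurableC.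
by apply: fin_bigcup_measurable; [exact: finite_finset|move=> i _; apply/measurableC/mF].
Qed.

Lemma measurable_open m n (B : set 'M[R]_(m, n)) :
  open B -> measurable (B : set (borel R m n)).
Proof. by move=> oB; exact: sub_sigma_algebra. Qed.

Lemma measurable_closed m n (B : set 'M[R]_(m, n)) :
  closed B -> measurable (B : set (borel R m n)).
Proof.
by move=> cB; rewrite -[B]setCK; apply: measurableC; apply: measurable_open;
  exact: closed_openC.
Qed.

Lemma measurable_continuousR m n (f : 'M[R]_(m, n) -> R) :
  continuous f -> measurable_fun setT (f : borel R m n -> R).
Proof.
move=> /continuousP cf.
apply: (measurability _ (measurable_realfun.RGenOpens.measurableE R)) => _ [_ [a [b ->] <-]].
by rewrite setTI; apply: measurable_open; apply: cf; exact: interval_open.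
Qed.

Lemma measurable_coord m n i j :
  measurable_fun setT (fun M : borel R m n => (M : 'M[R]_(m, n)) i j).
Proof. by apply: measurable_continuousR; exact: coord_continuous. Qed.

(* An open set is a countable union of boxes with rational centres and radii. *)
Lemma measurable_mxP d (T : measurableType d) m n (f : T -> 'M[R]_(m, n)) :
  (forall i j, measurable_fun setT (fun x => f x i j)) ->
  measurable_fun setT (f : T -> borel R m n).
Proof.
move=> mf; apply: measurable_preimage_open => B oB.
pose box (qk : 'M[rat]_(m, n) * nat) : set 'M[R]_(m, n) :=
  [set M | forall i j, `|ratr (qk.1 i j) - M i j| < qk.2.+1%:R^-1].
(* Pairs of a rational centre and a radius are countable, so the union runs over codes in nat; a
   code that decodes to nothing, or to a box not inside B, contributes the empty set. *)
have -> : f @^-1` B = \bigcup_(c in [set: nat])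
    (if choice.unpickle c is Some qk then
      if `[< box qk `<=` B >] then f @^-1` box qk else set0 else set0).
  rewrite eqEsubset; split => [x /= Bfx|x [c _]]; last first.
    by case: choice.unpickle => // qk; case: asboolP => // sub /sub.
  have /nbhs_ballP[e /= e0 be] : nbhs (f x) B by exact: open_nbhs_nbhs.
  have [k ke] : exists k : nat, k.+1%:R^-1 < e / 2.
    have [k _ /(_ k (leqnn k)) /=] := near_infty_natSinv_lt (PosNum (divr_gt0 e0 (ltr0n _ 2))).
    by exists k.
  have hq i j : exists q : rat, `|ratr q - f x i j| < k.+1%:R^-1.
    have hlt : f x i j < f x i j + k.+1%:R^-1 by rewrite ltrDl invr_gt0 ltr0n.
    have [q] := rat_in_itvoo hlt.
    rewrite in_itv /= => /andP[h1 h2]; exists q.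
    by rewrite gtr0_norm ?subr_gt0// ltrBlDl.
  pose q : 'M[rat]_(m, n) := \matrix_(i, j) xget 0 [set q | `|ratr q - f x i j| < k.+1%:R^-1].
  have hqk i j : `|ratr (q i j) - f x i j| < k.+1%:R^-1.
    by rewrite mxE; have [q' hq'] := hq i j; exact: (@xgetPex _ 0 [set q : rat | `|ratr q - f x i j| < k.+1%:R^-1] (ex_intro _ q' hq')).
  exists (choice.pickle (q, k)) => //; rewrite choice.pickleK.
  have sub : box (q, k) `<=` B.
    move=> M hM; apply: be; split => // i j /=.
    rewrite /ball /= -(subrKA (ratr (q i j))) (le_lt_trans (ler_normD _ _))//.
    rewrite [e]splitr; apply: ltrD; apply: lt_trans ke; last exact: hM i j.
    by rewrite distrC; exact: hqk.
  by rewrite (asboolT sub).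
apply: bigcupT_measurable => c; case: choice.unpickle => // qk.
case: asboolP => // _.
have -> : f @^-1` box qk = \bigcap_(i in [set: 'I_m]) \bigcap_(j in [set: 'I_n])
    (fun x => f x i j) @^-1` [set y | `|ratr (qk.1 i j) - y| < qk.2.+1%:R^-1].
  by rewrite eqEsubset; split => x /= h i => [_ j _|j]; exact: h.
apply: fin_bigcap_meas.
move=> i _; apply: fin_bigcap_meas.
move=> j _; rewrite -[X in measurable X]setTI; apply: mf => //.
rewrite (_ : [set y | _] = ball (ratr (qk.1 i j) : R) (qk.2.+1%:R^-1))//.
by rewrite ball_itv; exact: measurable_itv.
Qed.

End borel_measurability.

(** * Integration over powers of a probability *)

Section power_probability.
Context {R : realType} {dT : measure_display} {T : measurableType dT}.
Variable P : probability T R.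
Local Open Scope ereal_scope.

(** Tonelli for the recursive construction of [power_prob]: it peels off one observation, and every
    induction on the sample size or the dimension uses it. *)
Lemma ge0_integral_power_prob n (F : n.+1.-tuple T -> \bar R) :
  measurable_fun [set: n.+1.-tuple T] F -> (forall t, 0 <= F t) ->
  \int[power_prob P n.+1]_t F t =
  \int[P]_x \int[power_prob P n]_t F (cons_pair (x, t)).
Proof.
move=> mF F0; rewrite /= ge0_integral_distribution//.
have mFc : measurable_fun setT (F \o @cons_pair _ T n).
  by apply: measurableT_comp => //; exact: measurable_cons_pair.
have F0' x : 0 <= (F \o @cons_pair _ T n) x by exact: F0.
rewrite -(@fubini_tonelli1 _ _ _ _ _ P (power_prob P n) _ mFc F0').
apply: eq_measure_integral => A mA _.
apply: (@product_measure_unique _ _ _ _ _ P (power_prob P n) (P \x^ power_prob P n)%E _ A mA) => B C mB mC || (apply/esym; apply: (@product_measure_unique _ _ _ _ _ P (power_prob P n) (P \x^ power_prob P n)%E _ A mA) => B C mB mC).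
exact: product_measure2E.
Qed.

End power_probability.

(** * Measures given by a density *)

Section density.
Context d (T : measurableType d) (R : realType).
Variables (mu : {measure set T -> \bar R}) (p : T -> R).
Hypotheses (mp : measurable_fun setT p) (p0 : forall x, 0 <= p x).
Local Open Scope ereal_scope.

(** The two proofs are arguments so that the measure structure declared below can be recovered from
    the term itself. *)
Definition density_measure & measurable_fun setT p & (forall x, (0 <= p x)%R) :=
  fun A : set T => \int[mu]_(x in A) (p x)%:E.

Local Notation nu := (density_measure mp p0).

Let nu0 : nu set0 = 0. Proof. exact: integral_set0. Qed.

Let nu_ge0 A : 0 <= nu A.
Proof. by apply: integral_ge0 => x _; rewrite lee_fin. Qed.

Let nu_sigma_additive : semi_sigma_additive nu.
Proof.
move=> F mF tF mUF; rewrite /density_measure ge0_integral_bigcup//.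
- by apply: is_cvg_ereal_nneg_natsum_cond => n _ _; exact: nu_ge0.
- by apply/measurable_EFinP; exact: measurable_funTS.
- by move=> x _; rewrite lee_fin.
Qed.

HB.instance Definition _ := isMeasure.Build _ _ _ nu nu0 nu_ge0 nu_sigma_additive.

Import HBNNSimple.

(** Both sides agree on indicators by hypothesis, hence on simple functions, hence on f by monotone
    convergence along a simple approximation. *)
Lemma ge0_integral_density (m : {measure set T -> \bar R}) (f : T -> \bar R) :
  (forall A, measurable A -> m A = \int[mu]_(x in A) (p x)%:E) ->
  measurable_fun setT f -> (forall x, 0 <= f x) ->
  \int[m]_x f x = \int[mu]_x (f x * (p x)%:E).
Proof.
move=> mE mf f0; pose f_ := nnsfun_approx measurableT mf.
have mEp : measurable_fun setT (EFin \o p) by exact/measurable_EFinP.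
have f_cvg x : EFin \o f_ ^~ x @ \oo --> f x by exact: cvg_nnsfun_approx.
have f_nd x : {homo (fun n => (f_ n x)%:E) : a b / (a <= b)%N >-> a <= b}.
  by move=> a b ab; rewrite lee_fin//; exact/lefP/nd_nnsfun_approx.
have stepE (h : {nnsfun T >-> R}) :
    \int[m]_x (h x)%:E = \int[mu]_x ((h x)%:E * (p x)%:E).
  under eq_integral do rewrite fimfunE -fsumEFin//.
  rewrite ge0_integral_fsum//; last 2 first.
  - by move=> r; exact/measurable_EFinP/measurableT_comp.
  - by move=> r x _; rewrite EFinM nnfun_muleindic_ge0.
  transitivity (\int[mu]_x (\sum_(r \in range h) ((r * \1_(h @^-1` [set r]) x)%:E * (p x)%:E))); last first.
    apply: eq_integral => x _; rewrite fimfunE -fsumEFin// ge0_mule_fsuml//.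
    by move=> r; rewrite EFinM nnfun_muleindic_ge0.
  rewrite ge0_integral_fsum//; last 2 first.
  - move=> r; apply: emeasurable_funM => //.
    exact/measurable_EFinP/measurableT_comp.
  - by move=> r x _; apply: mule_ge0; [rewrite EFinM; exact: nnfun_muleindic_ge0|rewrite lee_fin].
  apply: eq_fsbigr => r _; have [r0|r0] := ltP r 0%R.
    have -> : h @^-1` [set r] = set0.
      by rewrite -subset0 => x /= hx; move: r0; rewrite -hx ltNge fun_ge0.
    by rewrite !integral0_eq// => x _; rewrite indic0 mulr0 ?mul0e.
  have mh : measurable (h @^-1` [set r]) by [].
  have mI : measurable_fun setT (fun x => (\1_(h @^-1` [set r]) x : R)%:E).
    by apply/measurable_EFinP; exact: measurable_indic.
  under eq_integral do rewrite EFinM.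
  rewrite (ge0_integralZl m measurableT mI)//.
  rewrite integral_indic// setIT mE//.
  under [RHS]eq_integral do rewrite EFinM -muleA.
  have mIp : measurable_fun setT (fun x => (\1_(h @^-1` [set r]) x : R)%:E * (p x)%:E).
    exact: emeasurable_funM.
  rewrite (ge0_integralZl mu measurableT mIp)//; last first.
    by move=> x _; rewrite mule_ge0 ?lee_fin// indicE ler0n.
  congr (_ * _); rewrite integral_mkcond; apply: eq_integral => x _.
  by rewrite patchE indicE; case: ifP => _; rewrite ?mul1e ?mul0e.
transitivity (limn (fun n => \int[m]_x (f_ n x)%:E)).
  rewrite -monotone_convergence//=.
  - by apply: eq_integral => x _; apply/esym/cvg_lim => //; exact: f_cvg.
  - by move=> n; exact/measurable_EFinP.
  - by move=> n x _; rewrite lee_fin.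
under eq_fun do rewrite stepE.
rewrite -monotone_convergence//=.
- apply: eq_integral => x _; apply: cvg_lim => //.
  apply: cvgeZr => //; exact: f_cvg.
- by move=> n; apply: emeasurable_funM => //; exact/measurable_EFinP.
- by move=> n x _; rewrite mule_ge0// lee_fin.
- by move=> x _ a b ab; rewrite lee_wpmul2r ?lee_fin//; have := f_nd x _ _ ab; rewrite lee_fin.
Qed.

End density.

Section measurable_matrix_operations.
Context {R : realType} {d : measure_display} {T : measurableType d}.

Lemma measurable_entry m n (f : T -> 'M[R]_(m, n)) i j :
  measurable_fun setT (f : T -> borel R m n) ->
  measurable_fun setT (fun x => f x i j).
Proof. by move=> mf; exact: (measurableT_comp (measurable_coord i j) mf). Qed.

Lemma measurable_addmx m n (f g : T -> 'M[R]_(m, n)) :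
  measurable_fun setT (f : T -> borel R m n) ->
  measurable_fun setT (g : T -> borel R m n) ->
  measurable_fun setT ((fun x => f x + g x) : T -> borel R m n).
Proof.
move=> mf mg; apply: measurable_mxP => i j; under eq_fun do rewrite mxE.
by apply: measurable_funD; exact: measurable_entry.
Qed.

Lemma measurable_scalemx m n (c : T -> R) (f : T -> 'M[R]_(m, n)) :
  measurable_fun setT c ->
  measurable_fun setT (f : T -> borel R m n) ->
  measurable_fun setT ((fun x => c x *: f x) : T -> borel R m n).
Proof.
move=> mc mf; apply: measurable_mxP => i j; under eq_fun do rewrite mxE.
by apply: measurable_funM => //; exact: measurable_entry.
Qed.

Lemma measurable_mulmx m n p (f : T -> 'M[R]_(m, n)) (g : T -> 'M[R]_(n, p)) :
  measurable_fun setT (f : T -> borel R m n) ->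
  measurable_fun setT (g : T -> borel R n p) ->
  measurable_fun setT ((fun x => f x *m g x) : T -> borel R m p).
Proof.
move=> mf mg; apply: measurable_mxP => i j; under eq_fun do rewrite mxE.
by apply: measurable_sum => k; apply: measurable_funM; exact: measurable_entry.
Qed.

Lemma measurable_cstmx m n (a : 'M[R]_(m, n)) :
  measurable_fun setT ((fun=> a) : T -> borel R m n).
Proof. exact: measurable_cst. Qed.

End measurable_matrix_operations.

(** * Lebesgue integration through Gaussian tuples *)

Section substitution.
Context {R : realType}.
Notation lebesgue := (@lebesgue_measure R).
Local Open Scope ereal_scope.

Lemma is_derive_mull (r x : R) : is_derive x 1%R (fun s => r * s)%R r.
Proof.
have h : is_derive x 1%R (r \*: (id : R^o -> R^o))%R (r *: 1)%R by apply: is_deriveZ.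
by rewrite /GRing.scale/= mulr1 in h; exact: h.
Qed.

Lemma is_derive_addr (r x : R) : is_derive x 1%R (fun s => s + r)%R 1%R.
Proof.
have h : is_derive x 1%R ((id : R^o -> R^o) + cst r)%R (1 + 0)%R by apply: is_deriveD.
by rewrite addr0 in h; exact: h.
Qed.

(** Stating the change of variables for all nonnegative F at once lets it be applied on each line of
    a Tonelli decomposition. *)
Definition substitution (phi D : R -> R) : Prop :=
  forall F : R -> \bar R, measurable_fun setT F -> (forall y, 0 <= F y) ->
  \int[lebesgue]_s (F (phi s) * (D s)%:E) = \int[lebesgue]_y F y.

(** The image under phi of the measure with density D gives ]phi a, phi b] the mass phi b - phi a by
    the fundamental theorem of calculus, so it is Lebesgue measure by uniqueness on intervals. *)
Lemma substitution_increasing (phi D : R -> R) :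
  (forall x : R, is_derive x 1%R phi (D x)) -> continuous D ->
  (forall x, (0 < D x)%R) -> (forall y, exists x, phi x = y) ->
  substitution phi D.
Proof.
move=> dphi cD D0 sphi.
have cphi : continuous phi.
  by move=> x; apply/differentiable_continuous/derivable1_diffP; case: (dphi x).
have incr x y : (x < y)%R -> (phi x < phi y)%R.
  move=> xy; have [|c _ e] := @MVT _ phi D _ _ xy (fun x _ => dphi x).
    exact: continuous_subspaceT.
  by rewrite -subr_gt0 e mulr_gt0// subr_gt0.
have incr_le x y : (phi x <= phi y)%R = (x <= y)%R.
  by apply/idP/idP; [apply: contraTT; rewrite -!ltNge => /incr|
     rewrite le_eqVlt => /predU1P[->//|/incr/ltW]].
have incr_lt x y : (phi x < phi y)%R = (x < y)%R.
  by rewrite !ltNge incr_le.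
have mphi : measurable_fun setT phi by exact: continuous_measurable_fun.
have mD : measurable_fun setT D by exact: continuous_measurable_fun.
have D0' x : (0 <= D x)%R by exact: ltW.
pose dm : {measure set (measurableTypeR R) -> \bar R} := density_measure lebesgue mD D0'.
have mphi' : @measurable_fun _ _ (measurableTypeR R) (measurableTypeR R) setT phi by [].
pose m0 : {measure set (measurableTypeR R) -> \bar R} := pushforward dm (phi : measurableTypeR R -> measurableTypeR R).
pose m1 := m0 mphi'.
have lm1 A : measurable A -> lebesgue A = m1 A.
  apply: lebesgue_measure_unique => X /ocitvP[->|[[a b] /= ab ->]].
    by rewrite !measure0.
  (* Surjectivity makes every interval one with endpoints in the image, so that its preimage is
     again an interval. *)
  have [a' ea] := sphi a; have [b' eb] := sphi b; subst a b.
  have ab' : (a' < b')%R by rewrite -incr_lt.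
  rewrite lebesgue_measure_itv /= lte_fin ab.
  rewrite /m1 /m0 /= /pushforward /=.
  have -> : (phi @^-1` `]phi a', phi b']%classic = `]a', b']%classic)%R.
    by apply/seteqP; split => x /=; rewrite !in_itv /= incr_lt incr_le.
  rewrite /dm /density_measure /=.
  rewrite integral_itv_obnd_cbnd; last first.
    by apply/measurable_EFinP; exact: measurable_funTS.
  rewrite (@continuous_FTC2 _ D phi)//.
  - exact: continuous_subspaceT.
  - split; first by move=> x _; case: (dphi x).
    + by apply: cvg_at_right_filter; exact: cphi.
    + by apply: cvg_at_left_filter; exact: cphi.
  - by move=> x _; rewrite derive1E; case: (dphi x).
move=> F mF F0; rewrite [RHS](eq_measure_integral m1); last by move=> A mA _; exact: lm1.
rewrite [RHS]ge0_integral_pushforward//.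
rewrite preimage_setT (@ge0_integral_density _ _ _ lebesgue D mD D0' dm)//.
  exact: measurableT_comp.
by move=> x; exact: F0.
Qed.

Lemma substitution_opp : substitution -%R (fun=> 1%R).
Proof.
move=> F mF F0; under eq_integral do rewrite mule1.
have mopp : measurable_fun setT (-%R : R -> measurableTypeR R).
  exact: oppr_measurable.
pose m0 : {measure set (measurableTypeR R) -> \bar R} :=
  pushforward lebesgue (-%R : measurableTypeR R -> measurableTypeR R).
pose m1 := m0 mopp.
rewrite [RHS](eq_measure_integral m1); last first.
  by move=> A mA _; apply/esym; exact: lebesgue_measureN.
by rewrite [RHS]ge0_integral_pushforward.
Qed.

Lemma substitution_scale c : c != 0%R -> substitution (fun s => c * s)%R (fun=> `|c|%R).
Proof.
have pos r : (0 < r)%R -> substitution (fun s => r * s)%R (fun=> r).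
  move=> r0; apply: substitution_increasing => //.
  - exact: is_derive_mull.
  - by move=> x; exact: cvg_cst.
  - by move=> y; exists (r^-1 * y)%R; rewrite mulrA divff ?mul1r// gt_eqF.
move=> c0 F mF F0; have [cn|cp|c00] := ltrgtP c 0%R; last by rewrite c00 eqxx in c0.
  have mFN : measurable_fun setT (fun y : R => F (- y)%R).
    apply: (measurableT_comp mF); exact: oppr_measurable.
  have cN0 : (0 < - c)%R by rewrite oppr_gt0.
  transitivity (\int[lebesgue]_s (F (- (- c * s))%R * (- c)%:E)).
    by apply: eq_integral => s _; rewrite mulNr opprK ltr0_norm.
  rewrite (pos (- c)%R cN0 (fun y => F (- y)%R))//.
  rewrite -(substitution_opp mF F0).
  by apply: eq_integral => s _; rewrite mule1.
by rewrite gtr0_norm//; exact: pos.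
Qed.

Lemma substitution_shift a : substitution (fun s => s + a)%R (fun=> 1%R).
Proof.
apply: substitution_increasing => //.
- by move=> x; exact: is_derive_addr.
- by move=> x; exact: cvg_cst.
- by move=> y; exists (y - a)%R; rewrite subrK.
Qed.

End substitution.

(** * Gaussian tuples and the Lebesgue integral over R^n *)

Section gaussian_vectors.
Context {R : realType}.
Local Open Scope ereal_scope.

Definition gauss n : probability (n.-tuple (measurableTypeR R)) R :=
  power_prob (normal_prob 0 1 : probability (measurableTypeR R) R) n.

Definition tuple_row n (t : n.-tuple (measurableTypeR R)) : 'rV[R]_n :=
  (\row_i tnth t i)%R.

Definition cons_row n (x : R) (v : 'rV[R]_n) : 'rV[R]_n.+1 :=
  row_mx (x%:M : 'M[R]_1) v.

Lemma cons_row0 n x (v : 'rV[R]_n) : cons_row x v ord0 ord0 = x.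
Proof.
have := row_mxEl (x%:M : 'M[R]_1) v ord0 (ord0 : 'I_1); rewrite [RHS]mxE eqxx mulr1n => h; rewrite -[RHS]h.
by rewrite /cons_row; congr (fun_of_matrix _ _ _); apply: val_inj.
Qed.

Lemma cons_rowS n x (v : 'rV[R]_n) j : cons_row x v ord0 (lift ord0 j) = v ord0 j.
Proof.
rewrite -[RHS](row_mxEr (x%:M : 'M[R]_1) v ord0 j).
by rewrite /cons_row; congr (fun_of_matrix _ _ _); apply: val_inj.
Qed.

Lemma tuple_row_cons n x (t : n.-tuple (measurableTypeR R)) :
  tuple_row (cons_pair (x, t)) = cons_row x (tuple_row t).
Proof.
apply/rowP => i; have [j ->|->] := unliftP ord0 i; rewrite mxE.
  by rewrite cons_rowS mxE tnthS.
by rewrite cons_row0 tnth0.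
Qed.

Lemma cons_row_eta n (v : 'rV[R]_n.+1) :
  v = cons_row (v ord0 ord0) (\row_j v ord0 (lift ord0 j)).
Proof.
apply/rowP => i; have [j|] := unliftP ord0 i; last by move=> ->; rewrite cons_row0.
by move=> ->; rewrite cons_rowS mxE.
Qed.

Lemma measurable_tuple_row n :
  measurable_fun setT (@tuple_row n : _ -> borel R 1 n).
Proof.
apply: measurable_mxP => i j; under eq_fun do rewrite mxE.
exact: measurable_tnth.
Qed.

Lemma measurable_cons_row d (T : measurableType d) n (f : T -> R) (g : T -> 'rV[R]_n) :
  measurable_fun setT f -> measurable_fun setT (g : T -> borel R 1 n) ->
  measurable_fun setT ((fun x => cons_row (f x) (g x)) : T -> borel R 1 n.+1).
Proof.
move=> mf mg; apply: measurable_mxP => i j; rewrite [i]ord1.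
have [k|] := unliftP ord0 j => ->.
  by under eq_fun do rewrite cons_rowS; exact: measurable_entry.
by under eq_fun do rewrite cons_row0.
Qed.

Lemma ge0_integral_gauss n (F : borel R 1 n.+1 -> \bar R) :
  measurable_fun setT F -> (forall v, 0 <= F v) ->
  \int[gauss n.+1]_t F (tuple_row t) =
  \int[normal_prob 0 1]_x \int[gauss n]_t F (cons_row x (tuple_row t)).
Proof.
move=> mF F0.
have mF' : measurable_fun setT (fun t : n.+1.-tuple (measurableTypeR R) => F (tuple_row t)).
  by apply: (measurableT_comp mF); exact: measurable_tuple_row.
rewrite (ge0_integral_power_prob _ mF' (fun t => F0 (tuple_row t))).
by under eq_integral do under eq_integral do rewrite tuple_row_cons.
Qed.

Definition gauss_weight n (v : 'rV[R]_n) : R :=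
  (\prod_i (normal_pdf 0 1 (v ord0 i))^-1)%R.

(* The Lebesgue integral over R^n, written as a Gaussian integral of F divided *)
(* by the Gaussian density, so that every measure in sight is a probability.   *)
Definition lebesgueI n (F : 'rV[R]_n -> \bar R) : \bar R :=
  \int[gauss n]_t (F (tuple_row t) * (gauss_weight (tuple_row t))%:E).

Lemma gauss_weight_ge0 n (v : 'rV[R]_n) : (0 <= gauss_weight v)%R.
Proof. by apply: prodr_ge0 => i _; rewrite invr_ge0 normal_pdf_ge0. Qed.

Lemma gauss_weight_cons n x (v : 'rV[R]_n) :
  gauss_weight (cons_row x v) = ((normal_pdf 0 1 x)^-1 * gauss_weight v)%R.
Proof.
rewrite /gauss_weight big_ord_recl cons_row0; congr (_ * _)%R.
by apply: eq_bigr => i _; rewrite cons_rowS.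
Qed.

Lemma normal_pdf01_gt0 (x : R) : (0 < normal_pdf 0 1 x)%R.
Proof.
by rewrite normal_pdfE// mulr_gt0 ?normal_peak_gt0// expR_gt0.
Qed.

Lemma measurable_gauss_weight n :
  measurable_fun setT (@gauss_weight n : borel R 1 n -> R).
Proof.
apply: measurable_prod => i _.
apply: (@measurableT_comp _ _ _ _ _ _ (fun x : R => (normal_pdf 0 1 x)^-1)%R); last exact: measurable_coord.
apply: continuous_measurable_fun => x; apply: cvgV.
  by rewrite gt_eqF// normal_pdf01_gt0.
exact: continuous_normal_pdf.
Qed.

Lemma measurable_swap_section n (G : R -> 'rV[R]_n -> \bar R) :
  measurable_fun setT ((fun z => G z.1 z.2) : (measurableTypeR R * borel R 1 n)%type -> \bar R) ->
  measurable_fun setT ((fun z => G z.1 (tuple_row z.2) * (gauss_weight (tuple_row z.2))%:E)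
    : (measurableTypeR R * n.-tuple (measurableTypeR R))%type -> \bar R).
Proof.
move=> mG; apply: emeasurable_funM.
  apply: (@measurableT_comp _ _ _ (measurableTypeR R * n.-tuple (measurableTypeR R))%type
    (measurableTypeR R * borel R 1 n)%type _ (fun z => G z.1 z.2) _
    (fun z => (z.1, tuple_row z.2 : borel R 1 n))) => //.
  apply/prod_measurable_funP; split; first exact: measurable_fst.
  exact: (measurableT_comp (@measurable_tuple_row n) measurable_snd).
apply/measurable_EFinP; apply: (measurableT_comp (@measurable_gauss_weight n)).
exact: (measurableT_comp (@measurable_tuple_row n) measurable_snd).
Qed.

Lemma lebesgueI_swap n (G : R -> 'rV[R]_n -> \bar R) :
  measurable_fun setT ((fun z => G z.1 z.2) : (measurableTypeR R * borel R 1 n)%type -> \bar R) ->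
  (forall x v, 0 <= G x v) ->
  \int[lebesgue_measure]_x lebesgueI (G x) =
  lebesgueI (fun v => \int[lebesgue_measure]_x G x v).
Proof.
move=> mG G0; rewrite /lebesgueI.
have mG' := measurable_swap_section mG.
rewrite (@fubini_tonelli _ _ _ _ _ lebesgue_measure (gauss n) _ mG'); last first.
  by move=> z; rewrite mule_ge0// lee_fin gauss_weight_ge0.
apply: eq_integral => t _; rewrite -ge0_integralZr//.
- exact: (measurable_fun_pair1 (tuple_row t : borel R 1 n) mG).
- by rewrite lee_fin gauss_weight_ge0.
Qed.

Lemma ge0_integral_normal (f : R -> \bar R) :
  measurable_fun setT f -> (forall x, 0 <= f x) ->
  \int[normal_prob 0 1]_x f x = \int[lebesgue_measure]_x (f x * (normal_pdf 0 1 x)%:E).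
Proof.
move=> mf f0; apply: ge0_integral_density => //.
- exact: measurable_normal_pdf.
- by move=> x; exact: normal_pdf_ge0.
Qed.

Lemma measurable_lebesgueI_section n (G : R -> 'rV[R]_n -> \bar R) :
  measurable_fun setT ((fun z => G z.1 z.2) : (measurableTypeR R * borel R 1 n)%type -> \bar R) ->
  (forall x v, 0 <= G x v) ->
  measurable_fun setT (fun x => lebesgueI (G x)).
Proof.
move=> mG G0; have mG' := measurable_swap_section mG.
have G0' z : 0 <= (fun z : measurableTypeR R * n.-tuple (measurableTypeR R) =>
    G z.1 (tuple_row z.2) * (gauss_weight (tuple_row z.2))%:E) z.
  by rewrite mule_ge0// lee_fin gauss_weight_ge0.
exact: (@measurable_fun_fubini_tonelli_F _ _ _ _ _ (gauss n) _ mG' G0').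
Qed.

Lemma measurable_cons_row2 n (F : borel R 1 n.+1 -> \bar R) :
  measurable_fun setT F ->
  measurable_fun setT ((fun z => F (cons_row z.1 z.2)) : (measurableTypeR R * borel R 1 n)%type -> \bar R).
Proof.
move=> mF; apply: (measurableT_comp mF); apply: measurable_cons_row.
  exact: measurable_fst.
exact: measurable_snd.
Qed.

(** The weight of the first coordinate cancels its Gaussian density and leaves a one-dimensional
    Lebesgue integral. This makes [lebesgueI] accessible by induction on the dimension. *)
Lemma lebesgueI_cons n (F : borel R 1 n.+1 -> \bar R) :
  measurable_fun setT F -> (forall v, 0 <= F v) ->
  lebesgueI F = \int[lebesgue_measure]_x lebesgueI (fun v => F (cons_row x v)).
Proof.
move=> mF F0; rewrite /lebesgueI.
have mW := @measurable_gauss_weight n.+1.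
have F0' v : 0 <= F v * (gauss_weight v)%:E by rewrite mule_ge0// lee_fin gauss_weight_ge0.
have mFW : measurable_fun setT (fun v : borel R 1 n.+1 => F v * (gauss_weight v)%:E).
  by apply: emeasurable_funM => //; exact/measurable_EFinP.
rewrite (ge0_integral_gauss mFW F0').
have E x : \int[gauss n]_t (F (cons_row x (tuple_row t)) * (gauss_weight (cons_row x (tuple_row t)))%:E)
    = lebesgueI (fun v => F (cons_row x v)) * ((normal_pdf 0 1 x)^-1)%:E.
  rewrite -ge0_integralZr//; last 3 first.
  - apply: emeasurable_funM.
      apply: (@measurableT_comp _ _ _ _ _ _ (fun v : borel R 1 n => F (cons_row x v))).
        by apply: (measurableT_comp mF); apply: measurable_cons_row => //; exact: measurable_id.
      exact: measurable_tuple_row.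
    by apply/measurable_EFinP; apply: (measurableT_comp (@measurable_gauss_weight n)); exact: measurable_tuple_row.
  - by move=> t _; rewrite mule_ge0// lee_fin gauss_weight_ge0.
  - by rewrite lee_fin invr_ge0 normal_pdf_ge0.
  apply: eq_integral => t _; rewrite gauss_weight_cons -muleA -EFinM.
  by rewrite [in RHS]mulrC.
under eq_integral do rewrite E.
have mL := measurable_lebesgueI_section (G := fun x v => F (cons_row x v)) (measurable_cons_row2 mF) (fun x v => F0 _).
have L0 x : 0 <= lebesgueI (fun v => F (cons_row x v)).
  by apply: integral_ge0 => t _; rewrite mule_ge0// lee_fin gauss_weight_ge0.
rewrite ge0_integral_normal.
- apply: eq_integral => x _; rewrite -muleA -EFinM mulVf ?mule1//.
  by rewrite gt_eqF// normal_pdf01_gt0.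
- apply: emeasurable_funM => //; apply/measurable_EFinP.
  apply: continuous_measurable_fun => x; apply: cvgV; last exact: continuous_normal_pdf.
  by rewrite gt_eqF// normal_pdf01_gt0.
- by move=> x; rewrite mule_ge0// lee_fin invr_ge0 normal_pdf_ge0.
Qed.

End gaussian_vectors.

(** * Translations, dilations and displacements along a direction *)

Section lebesgue_change_of_variables.
Context {R : realType}.
Local Open Scope ereal_scope.

Lemma cons_rowD n x y (v w : 'rV[R]_n) :
  (cons_row x v + cons_row y w = cons_row (x + y) (v + w))%R.
Proof.
by apply/rowP => i; have [j ->|->] := unliftP ord0 i; rewrite mxE ?cons_rowS ?cons_row0 ?mxE.
Qed.

Lemma cons_rowZ n c x (v : 'rV[R]_n) :
  (c *: cons_row x v = cons_row (c * x) (c *: v))%R.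
Proof.
by apply/rowP => i; have [j ->|->] := unliftP ord0 i; rewrite mxE ?cons_rowS ?cons_row0 ?mxE.
Qed.

Lemma lebesgueI_ge0 n (F : 'rV[R]_n -> \bar R) :
  (forall v, 0 <= F v) -> 0 <= lebesgueI F.
Proof.
by move=> F0; apply: integral_ge0 => t _; rewrite mule_ge0// lee_fin gauss_weight_ge0.
Qed.

Lemma eq_lebesgueI n (F G : 'rV[R]_n -> \bar R) : F =1 G -> lebesgueI F = lebesgueI G.
Proof. by move=> /funext ->. Qed.

Lemma measurable_comp_borel n m (F : borel R 1 m -> \bar R) (g : 'rV[R]_n -> 'rV[R]_m) :
  measurable_fun setT F -> measurable_fun setT (g : borel R 1 n -> borel R 1 m) ->
  measurable_fun setT ((fun v => F (g v)) : borel R 1 n -> \bar R).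
Proof. by move=> mF mg; exact: (measurableT_comp mF mg). Qed.

Lemma measurable_idrow n : measurable_fun setT ((fun v => v) : borel R 1 n -> borel R 1 n).
Proof. exact: measurable_id. Qed.

Lemma measurable_lebesgueI_cons n (F : borel R 1 n.+1 -> \bar R) :
  measurable_fun setT F -> (forall v, 0 <= F v) ->
  measurable_fun setT (fun x => lebesgueI (fun v => F (cons_row x v))).
Proof.
move=> mF F0.
exact: (measurable_lebesgueI_section (G := fun x v => F (cons_row x v)) (measurable_cons_row2 mF) (fun x v => F0 _)).
Qed.

Lemma lebesgueI_shift n (F : borel R 1 n -> \bar R) (a : 'rV[R]_n) :
  measurable_fun setT F -> (forall v, 0 <= F v) ->
  lebesgueI (fun v => F (v + a)%R) = lebesgueI F.
Proof.
elim: n => [|n IH] in F a *; move=> mF F0.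
  by apply: eq_lebesgueI => v; rewrite [(v + a)%R]thinmx0 [v]thinmx0.
have mFa : measurable_fun setT ((fun v => F (v + a)%R) : borel R 1 n.+1 -> \bar R).
  apply: measurable_comp_borel => //.
  by apply: measurable_addmx; [exact: measurable_idrow|exact: measurable_cstmx].
rewrite (lebesgueI_cons mFa)// (lebesgueI_cons mF F0).
set a0 := a ord0 ord0; pose a' : 'rV[R]_n := (\row_j a ord0 (lift ord0 j))%R.
pose H x := lebesgueI (fun v => F (cons_row x v)).
transitivity (\int[lebesgue_measure]_x (H (x + a0)%R * 1%:E)).
  apply: eq_integral => x _; rewrite mule1 /H.
  rewrite -(IH (fun v => F (cons_row (x + a0)%R v)) a')//.
    by apply: eq_lebesgueI => v; rewrite [a in LHS]cons_row_eta cons_rowD.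
  apply: measurable_comp_borel => //.
  by apply: measurable_cons_row; [exact: measurable_cst|exact: measurable_idrow].
apply: (substitution_shift a0).
  exact: measurable_lebesgueI_cons.
by move=> x; exact: lebesgueI_ge0.
Qed.

Lemma lebesgueI_scale n (F : borel R 1 n -> \bar R) (c : R) : c != 0%R ->
  measurable_fun setT F -> (forall v, 0 <= F v) ->
  lebesgueI (fun v => F (c *: v)%R) * (`|c| ^+ n)%:E = lebesgueI F.
Proof.
move=> c0; elim: n => [|n IH] in F *; move=> mF F0.
  by rewrite expr0 mule1; apply: eq_lebesgueI => v; rewrite [(c *: v)%R]thinmx0 [v]thinmx0.
have mFa : measurable_fun setT ((fun v => F (c *: v)%R) : borel R 1 n.+1 -> \bar R).
  apply: measurable_comp_borel => //.
  by apply: measurable_scalemx; [exact: measurable_cst|exact: measurable_idrow].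
rewrite (lebesgueI_cons mFa)// (lebesgueI_cons mF F0).
pose H x := lebesgueI (fun v => F (cons_row x v)).
have mH : measurable_fun setT H by exact: measurable_lebesgueI_cons.
have H0 x : 0 <= H x by exact: lebesgueI_ge0.
rewrite -ge0_integralZr//; last 2 first.
- exact: (measurable_lebesgueI_cons mFa (fun v => F0 _)).
- by move=> x _; exact: lebesgueI_ge0.
rewrite -[RHS](substitution_scale c0 mH H0).
apply: eq_integral => x _; rewrite exprSr EFinM muleA; congr (_ * _).
rewrite /H -(IH (fun v => F (cons_row (c * x)%R v)))//.
  by congr (_ * _); apply: eq_lebesgueI => v; rewrite cons_rowZ.
apply: measurable_comp_borel => //.
by apply: measurable_cons_row; [exact: measurable_cst|exact: measurable_idrow].
Qed.

(** Integration along lines parallel to (e0, e): rescale the first coordinate to e0 s, then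
    translate the other coordinates by s e inside each slice. *)
Lemma lebesgueI_shear n (F : borel R 1 n.+1 -> \bar R) (e0 : R) (e : 'rV[R]_n) :
  e0 != 0%R -> measurable_fun setT F -> (forall v, 0 <= F v) ->
  lebesgueI F = lebesgueI (fun y => \int[lebesgue_measure]_s
    F (cons_row 0 y + s *: cons_row e0 e)%R) * `|e0|%:E.
Proof.
move=> e00 mF F0; rewrite (lebesgueI_cons mF F0).
pose H x := lebesgueI (fun v => F (cons_row x v)).
have mH : measurable_fun setT H by exact: measurable_lebesgueI_cons.
have H0 x : 0 <= H x by exact: lebesgueI_ge0.
rewrite -(substitution_scale e00 mH H0).
have mHc : measurable_fun setT (fun s => H (e0 * s)%R).
  exact: (@measurableT_comp _ _ _ R R (\bar R) H setT (fun s => e0 * s)%R mH (mulrl_measurable _)).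
rewrite (ge0_integralZr lebesgue_measure measurableT mHc (fun x _ => H0 _)); last by rewrite lee_fin.
congr (_ * _).
pose G s y := F (cons_row 0 y + s *: cons_row e0 e)%R.
have mG : measurable_fun setT ((fun z => G z.1 z.2) : (measurableTypeR R * borel R 1 n)%type -> \bar R).
  apply: (measurableT_comp mF); apply: measurable_addmx.
    by apply: measurable_cons_row; [exact: measurable_cst|exact: measurable_snd].
  by apply: measurable_scalemx; [exact: measurable_fst|exact: measurable_cstmx].
rewrite -(lebesgueI_swap mG (fun x v => F0 _)).
apply: eq_integral => s _; rewrite /H.
rewrite -(lebesgueI_shift (F := fun v => F (cons_row (e0 * s)%R v)) (s *: e)%R).
- by apply: eq_lebesgueI => v; rewrite /G cons_rowZ cons_rowD add0r mulrC.
- apply: measurable_comp_borel => //.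
  by apply: measurable_cons_row; [exact: measurable_cst|exact: measurable_idrow].
- by move=> v; exact: F0.
Qed.

(* Displacement along a fixed direction e reduces to one-dimensional            *)
(* substitutions on the lines parallel to e.                                    *)
Lemma lebesgueI_directional n (e : 'rV[R]_n) (psi D : 'rV[R]_n -> R) :
  e != 0%R ->
  measurable_fun setT (psi : borel R 1 n -> R) ->
  measurable_fun setT (D : borel R 1 n -> R) -> (forall x, 0 <= D x)%R ->
  (forall x, substitution (fun s => s + psi (x + s *: e))%R (fun s => D (x + s *: e)%R)) ->
  forall F : borel R 1 n -> \bar R,
  measurable_fun setT F -> (forall v, 0 <= F v) ->
  lebesgueI (fun x => F (x + psi x *: e)%R * (D x)%:E) = lebesgueI F.
Proof.
elim: n => [|n IH] in e psi D *.
  by rewrite [e]thinmx0 eqxx.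
move=> e_neq0 mpsi mD D0 hsub F mF F0.
pose e0 := e ord0 ord0; pose e' : 'rV[R]_n := (\row_j e ord0 (lift ord0 j))%R.
have eE : e = cons_row e0 e' by exact: cons_row_eta.
have mG : measurable_fun setT ((fun x => F (x + psi x *: e)%R * (D x)%:E) : borel R 1 n.+1 -> \bar R).
  apply: emeasurable_funM; last exact/measurable_EFinP.
  apply: measurable_comp_borel => //; apply: measurable_addmx; first exact: measurable_idrow.
  by apply: measurable_scalemx => //; exact: measurable_cstmx.
have G0 x : 0 <= F (x + psi x *: e)%R * (D x)%:E by rewrite mule_ge0// lee_fin.
(* If the first coordinate of e is nonzero, the lines parallel to e cross the slices and the shear
   applies; otherwise the displacement stays inside each slice and the induction hypothesis does the
   work. *)
have [e00|e00] := eqVneq e0 0%R; last first.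
  rewrite (lebesgueI_shear e' e00 mG G0) (lebesgueI_shear e' e00 mF F0).
  congr (_ * _); apply: eq_lebesgueI => y; rewrite -eE.
  rewrite -[RHS](hsub (cons_row 0 y)).
  - by apply: eq_integral => s _; rewrite scalerDl addrA.
  - apply: (measurableT_comp mF); apply: measurable_addmx; first exact: measurable_cstmx.
    by apply: measurable_scalemx; [exact: measurable_id|exact: measurable_cstmx].
  - by move=> s; exact: F0.
rewrite (lebesgueI_cons mG G0) (lebesgueI_cons mF F0).
have e'0 : e' != 0%R.
  apply: contra e_neq0 => /eqP e'0; rewrite eE e00 e'0.
  by apply/eqP/rowP => i; have [j ->|->] := unliftP ord0 i; rewrite ?cons_rowS ?cons_row0 !mxE.
have mc x : measurable_fun setT ((fun v => cons_row x v) : borel R 1 n -> borel R 1 n.+1).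
  by apply: measurable_cons_row; [exact: measurable_cst|exact: measurable_idrow].
have consE x v s : (cons_row x (v + s *: e') = cons_row x v + s *: e)%R.
  by rewrite eE e00 cons_rowZ cons_rowD mulr0 addr0.
apply: eq_integral => x _.
rewrite -[RHS](IH e' (fun v => psi (cons_row x v)) (fun v => D (cons_row x v)) e'0)//.
- by apply: eq_lebesgueI => v; rewrite consE.
- exact: (measurableT_comp mpsi (mc x)).
- exact: (measurableT_comp mD (mc x)).
- move=> v.
  have -> : (fun s => s + psi (cons_row x (v + s *: e')))%R = (fun s => s + psi (cons_row x v + s *: e))%R.
    by apply/funext => s; rewrite consE.
  have -> : (fun s => D (cons_row x (v + s *: e')))%R = (fun s => D (cons_row x v + s *: e))%R.
    by apply/funext => s; rewrite consE.
  exact: hsub.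
- exact: (measurableT_comp mF (mc x)).
Qed.

End lebesgue_change_of_variables.

(** * Hyperbolic volume *)

Section dot_product.
Context {R : realType}.

Definition dot n (u v : 'rV[R]_n) : R := (u *m v^T) ord0 ord0.

Lemma dotE n (u v : 'rV[R]_n) : dot u v = \sum_i u ord0 i * v ord0 i.
Proof. by rewrite /dot mxE; apply: eq_bigr => i _; rewrite mxE. Qed.

Lemma dotC n (u v : 'rV[R]_n) : dot u v = dot v u.
Proof. by rewrite !dotE; apply: eq_bigr => i _; rewrite mulrC. Qed.

Lemma dotDl n (u v w : 'rV[R]_n) : dot (u + v) w = dot u w + dot v w.
Proof. by rewrite /dot mulmxDl mxE. Qed.

Lemma dotZl n c (u w : 'rV[R]_n) : dot (c *: u) w = c * dot u w.
Proof. by rewrite /dot -scalemxAl mxE. Qed.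

Lemma dotNl n (u w : 'rV[R]_n) : dot (- u) w = - dot u w.
Proof. by rewrite -scaleN1r dotZl mulN1r. Qed.

Lemma dotDr n (u v w : 'rV[R]_n) : dot w (u + v) = dot w u + dot w v.
Proof. by rewrite !(dotC w) dotDl. Qed.

Lemma dotZr n c (u w : 'rV[R]_n) : dot w (c *: u) = c * dot w u.
Proof. by rewrite !(dotC w) dotZl. Qed.

Lemma dotNr n (u w : 'rV[R]_n) : dot w (- u) = - dot w u.
Proof. by rewrite !(dotC w) dotNl. Qed.

Lemma dot0l n (w : 'rV[R]_n) : dot 0 w = 0.
Proof. by rewrite /dot mul0mx mxE. Qed.

Lemma dot0r n (w : 'rV[R]_n) : dot w 0 = 0.
Proof. by rewrite dotC dot0l. Qed.

Lemma dot_ge0 n (v : 'rV[R]_n) : 0 <= dot v v.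
Proof. by rewrite dotE; apply: sumr_ge0 => i _; rewrite -expr2 sqr_ge0. Qed.

Lemma dot_eq0 n (v : 'rV[R]_n) : (dot v v == 0) = (v == 0).
Proof.
apply/eqP/eqP => [|->]; last by rewrite dot0l.
rewrite dotE => /eqP; rewrite psumr_eq0; last by move=> i _; rewrite -expr2 sqr_ge0.
move=> /allP h; apply/rowP => i; rewrite mxE; apply/eqP.
by have := h i (mem_index_enum _); rewrite mulf_eq0 orbb.
Qed.

Lemma dot_mulmxl n p (u : 'rV[R]_n) (A : 'M[R]_(n, p)) (v : 'rV[R]_p) :
  dot (u *m A) v = dot u (v *m A^T).
Proof. by rewrite /dot trmx_mul trmxK mulmxA. Qed.

Lemma cauchy_schwarz n (u v : 'rV[R]_n) : dot u v ^+ 2 <= dot u u * dot v v.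
Proof.
have [->|v0] := eqVneq v 0; first by rewrite !dot0r expr0n mulr0.
have vv : 0 < dot v v by rewrite lt_def dot_eq0 v0 dot_ge0.
have := dot_ge0 (dot v v *: u - dot u v *: v).
rewrite !(dotDl, dotDr, dotZl, dotZr, dotNl, dotNr) (dotC v u) => h.
rewrite -(ler_pM2l vv); nra.
Qed.

Lemma enormE n (v : 'rV[R]_n) : enorm v = Num.sqrt (dot v v). Proof. by []. Qed.

Lemma enorm_sqr n (v : 'rV[R]_n) : enorm v ^+ 2 = dot v v.
Proof. by rewrite sqr_sqrtr// dot_ge0. Qed.

Lemma enorm_ge0 n (v : 'rV[R]_n) : 0 <= enorm v. Proof. exact: sqrtr_ge0. Qed.

Lemma enorm_eq0 n (v : 'rV[R]_n) : (enorm v == 0) = (v == 0).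
Proof. by rewrite -[LHS]sqrf_eq0 enorm_sqr dot_eq0. Qed.

Lemma enorm0 n : enorm (0 : 'rV[R]_n) = 0.
Proof. by apply/eqP; rewrite enorm_eq0. Qed.

Lemma enormZ n c (v : 'rV[R]_n) : enorm (c *: v) = `|c| * enorm v.
Proof.
by rewrite !enormE dotZl dotZr mulrA -expr2 sqrtrM ?sqr_ge0// sqrtr_sqr.
Qed.

Lemma ler_dot n (u v : 'rV[R]_n) : `|dot u v| <= enorm u * enorm v.
Proof.
rewrite -(@ler_pXn2r _ 2)// ?nnegrE ?mulr_ge0 ?enorm_ge0//.
by rewrite exprMn !enorm_sqr real_normK ?num_real// cauchy_schwarz.
Qed.

Lemma enormD n (u v : 'rV[R]_n) : enorm (u + v) <= enorm u + enorm v.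
Proof.
rewrite -(@ler_pXn2r _ 2)// ?nnegrE ?addr_ge0 ?enorm_ge0//.
rewrite sqrrD !enorm_sqr !(dotDl, dotDr) (dotC v u).
have := ler_dot u v; rewrite ler_norml => /andP[_ h].
rewrite mulr2n; lra.
Qed.

Lemma enorm_coord n (v : 'rV[R]_n) i : `|v ord0 i| <= enorm v.
Proof.
rewrite -sqrtr_sqr ler_sqrt ?sqr_ge0 ?dot_ge0//.
rewrite -/(dot v v) dotE (bigD1 i)//= -expr2 lerDl.
by apply: sumr_ge0 => j _; rewrite -expr2 sqr_ge0.
Qed.

Lemma enorm_le_sum n (v : 'rV[R]_n) : enorm v <= \sum_i `|v ord0 i|.
Proof.
rewrite -(@ler_pXn2r _ 2)// ?nnegrE ?enorm_ge0 ?sumr_ge0//.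
rewrite enorm_sqr dotE expr2 mulr_suml; apply: ler_sum => i _.
rewrite -expr2 -(real_normK (num_real _)) expr2; apply: ler_wpM2l => //.
by rewrite (bigD1 i)//= lerDl sumr_ge0.
Qed.

Lemma continuous_coord n i : continuous (fun v : 'rV[R]_n => v ord0 i).
Proof. exact: coord_continuous. Qed.

Lemma continuous_sum (T : topologicalType) (I : Type) (r : seq I) (F : I -> T -> R) :
  (forall i, continuous (F i)) -> continuous (fun x => \sum_(i <- r) F i x).
Proof.
move=> cF x; elim: r => [|i r IH].
  by rewrite (_ : (fun y => _) = cst 0) ?funeqE => [|y]; [exact: cvg_cst|rewrite big_nil].
rewrite (_ : (fun y => _) = (fun y => F i y + \sum_(j <- r) F j y)); last first.
  by apply/funext => y; rewrite big_cons.
by apply: cvgD => //; exact: cF.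
Qed.

Lemma continuous_dot n : continuous (fun v : 'rV[R]_n => dot v v).
Proof.
under eq_fun do rewrite dotE.
by apply: continuous_sum => i x; apply: continuousM; exact: continuous_coord.
Qed.

Lemma continuous_enorm n : continuous (@enorm R n).
Proof.
move=> x; apply: (@continuous_comp _ _ _ (fun v => dot v v) Num.sqrt).
  exact: continuous_dot.
exact: sqrt_continuous.
Qed.

Lemma quadE n (A : 'M[R]_n) v : quad A v = dot (v *m A) v.
Proof. by []. Qed.

End dot_product.

(** * Hyperbolic functions *)

Section hyperbolic_functions.
Context {R : realType}.

Definition cosh (r : R) : R := (expR r + expR (- r)) / 2.

Lemma is_derive_expRN (x : R) : is_derive x 1 (fun y => expR (- y)) (- expR (- x)).
Proof.
have h : is_derive x 1 (expR \o -%R) (expR (- x) *: (- 1)).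
  exact: is_derive1_comp.
by rewrite /GRing.scale/= mulrN1 in h; exact: h.
Qed.

Lemma is_derive_sinh (x : R) : is_derive x 1 (@sinh R) (cosh x).
Proof.
have h1 := is_derive_expRN x.
have h : is_derive x 1 (2^-1 \*: ((expR : R -> R^o) - (fun y => expR (- y))))
    (2^-1 *: (expR x - - expR (- x))) by apply: is_deriveZ.
have e : (2^-1 *: (expR x - - expR (- x))) = cosh x.
  by rewrite /cosh opprK mulrC.
rewrite -e; rewrite (_ : sinh = 2^-1 \*: ((expR : R -> R^o) - (fun y => expR (- y))))//.
by apply/funext => y; rewrite /sinh mulrC.
Qed.

Lemma is_derive_cosh (x : R) : is_derive x 1 cosh (sinh x).
Proof.
have h1 := is_derive_expRN x.
have h : is_derive x 1 (2^-1 \*: ((expR : R -> R^o) + (fun y => expR (- y))))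
    (2^-1 *: (expR x + - expR (- x))) by apply: is_deriveZ.
have e : (2^-1 *: (expR x + - expR (- x))) = sinh x.
  by rewrite /sinh mulrC.
rewrite -e; rewrite (_ : cosh = 2^-1 \*: ((expR : R -> R^o) + (fun y => expR (- y))))//.
by apply/funext => y; rewrite /cosh mulrC.
Qed.

Lemma cosh2_sinh2 (r : R) : cosh r ^+ 2 = 1 + sinh r ^+ 2.
Proof.
have h : expR r * expR (- r) = 1 by rewrite -expRD subrr expR0.
by rewrite /cosh /sinh; field : h.
Qed.

Lemma cosh_gt0 (r : R) : 0 < cosh r.
Proof. by rewrite divr_gt0// addr_gt0// expR_gt0. Qed.

Lemma cosh_ge1 (r : R) : 1 <= cosh r.
Proof.
have h1 := cosh_gt0 r; have h2 := cosh2_sinh2 r; have h3 := sqr_ge0 (sinh r).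
by nra.
Qed.

Lemma sinhN (r : R) : sinh (- r) = - sinh r.
Proof. by rewrite /sinh opprK -mulNr opprB. Qed.

Lemma coshN (r : R) : cosh (- r) = cosh r.
Proof. by rewrite /cosh opprK addrC. Qed.

Lemma cosh_norm (r : R) : cosh `|r| = cosh r.
Proof. by case: (ler0P r) => _; rewrite ?coshN. Qed.

Lemma sinh0 : sinh 0 = 0 :> R.
Proof. by rewrite /sinh oppr0 subrr mul0r. Qed.

Lemma cosh0 : cosh 0 = 1 :> R.
Proof. by rewrite /cosh oppr0 expR0 -mulr2n -[X in X / _]mulr_natr mul1r divff. Qed.

Lemma sinh_surj (y : R) : exists x, sinh x = y.
Proof.
pose s := Num.sqrt (y ^+ 2 + 1).
have s2 : s ^+ 2 = y ^+ 2 + 1 by rewrite sqr_sqrtr// addr_ge0// sqr_ge0.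
have ys : `|y| < s.
  rewrite -(@ltr_pXn2r _ 2)// ?nnegrE ?sqrtr_ge0//.
  by rewrite s2 real_normK ?num_real// ltrDl.
have [ys1 ys2] : - s < y /\ y < s by move: ys; rewrite ltr_norml => /andP[].
exists (ln (y + s)); rewrite /sinh expRN lnK ?posrE; last by lra.
have -> : (y + s)^-1 = s - y.
  apply: (@mulfI _ (y + s)); first by apply/eqP; lra.
  by rewrite divff; [ring: s2|apply/eqP; lra].
by field.
Qed.

Lemma cvg_sinh_continuous : continuous (@sinh R).
Proof.
by move=> x; apply/differentiable_continuous/derivable1_diffP; case: (is_derive_sinh x).
Qed.

Lemma continuous_cosh : continuous cosh.
Proof.
by move=> x; apply/differentiable_continuous/derivable1_diffP; case: (is_derive_cosh x).
Qed.

(** The value 1 at 0 is the continuous extension, so that [sinhc] r times r is sinh r everywhere. *)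
Definition sinhc (r : R) : R := if r == 0 then 1 else sinh r / r.

Lemma mul_sinhc (r : R) : sinhc r * r = sinh r.
Proof. by rewrite /sinhc; case: eqVneq => [->|r0]; rewrite ?mul1r ?sinh0// divfK. Qed.

Lemma sinhc_norm (r : R) : sinhc `|r| = sinhc r.
Proof.
case: (ler0P r) => // r0; rewrite /sinhc oppr_eq0 sinhN; case: eqP => // /eqP rn0.
by rewrite invrN mulrNN.
Qed.

Lemma measurable_funV d (T : measurableType d) (f : T -> R) :
  measurable_fun setT f -> measurable_fun setT (fun x => (f x)^-1).
Proof.
suff h : measurable_fun setT (@GRing.inv R) by move=> mf; exact: (measurableT_comp h mf).
rewrite -(setUv [set (0 : R)]); apply/measurable_funU => //.
  exact: measurableC.
split; first exact: measurable_fun_set1.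
apply: open_continuous_measurable_fun; first by rewrite openC; exact: closed_eq.
by move=> x; rewrite inE /= => /eqP x0; apply: cvgV => //; exact: cvg_id.
Qed.

Lemma measurable_sinhc : measurable_fun setT sinhc.
Proof.
apply: measurable_fun_ifT.
- apply: (measurable_fun_bool true) => /=.
  rewrite setTI (_ : _ @^-1` _ = [set (0 : R)]); first exact: measurable_set1.
  by apply/seteqP; split => x /= /eqP.
- exact: measurable_cst.
- apply: measurable_funM; last by apply: measurable_funV; exact: measurable_id.
  exact: (continuous_measurable_fun cvg_sinh_continuous).
Qed.

End hyperbolic_functions.

Section hyperbolic_volume.
Context {R : realType}.
Local Open Scope ereal_scope.

Lemma sinhc_gt0 (r : R) : (0 < sinhc r)%R.
Proof.
have sp x : (0 < x)%R -> (0 < @sinh R x)%R.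
  by move=> x0; rewrite /sinh divr_gt0// subr_gt0 ltr_expR; lra.
rewrite /sinhc; case: eqVneq => [//|r0].
have [rn|rp] := ltP r 0%R; last by rewrite divr_gt0// ?sp// lt_def r0.
rewrite -mulrNN -invrN -sinhN divr_gt0 ?sp ?oppr_gt0//.
Qed.

Lemma measurable_enorm n : measurable_fun setT (@enorm R n : borel R 1 n -> R).
Proof. by apply: measurable_continuousR; exact: continuous_enorm. Qed.

(** Polar coordinates without a sphere: directions are represented by (1, u) with u in R^n, and s
    runs over the whole real line, which reaches every point with nonzero first coordinate. *)
Lemma lebesgueI_polar n (F : borel R 1 n.+1 -> \bar R) :
  measurable_fun setT F -> (forall v, 0 <= F v) ->
  lebesgueI F = lebesgueI (fun u : 'rV[R]_n => \int[lebesgue_measure]_s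
    (F (s *: cons_row 1 u)%R * (`|s| ^+ n)%:E)).
Proof.
move=> mF F0; rewrite (lebesgueI_cons mF F0).
pose G (s : R) (u : 'rV[R]_n) := F (s *: cons_row 1 u)%R * (`|s| ^+ n)%:E.
have mG : measurable_fun setT ((fun z => G z.1 z.2) : (measurableTypeR R * borel R 1 n)%type -> \bar R).
  apply: emeasurable_funM.
    apply: (measurableT_comp mF); apply: measurable_scalemx; first exact: measurable_fst.
    by apply: measurable_cons_row; [exact: measurable_cst|exact: measurable_snd].
  apply/measurable_EFinP; apply: measurable_funX.
  by apply: measurableT_comp => //; exact: measurable_fst.
have G0 x v : 0 <= G x v by rewrite mule_ge0// lee_fin exprn_ge0.
rewrite -[RHS](lebesgueI_swap mG G0).
have mF' x : measurable_fun setT ((fun v => F (cons_row x v)) : borel R 1 n -> \bar R).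
  apply: measurable_comp_borel => //.
  by apply: measurable_cons_row; [exact: measurable_cst|exact: measurable_idrow].
have mR0 : measurable ([set: measurableTypeR R] `\ (0%R : R)).
  by apply: measurableD => //; exact: measurable_set1.
(* The slice at first coordinate 0 is null; it is removed because the dilation below needs a nonzero
   factor. *)
rewrite -(integral_setD1 mR0); last first.
  by apply: measurable_funTS; exact: measurable_lebesgueI_cons.
rewrite -[RHS](integral_setD1 mR0); last first.
  by apply: measurable_funTS; exact: (measurable_lebesgueI_section mG G0).
apply: eq_integral => x; rewrite inE => -[_ /= /eqP x0].
rewrite -(lebesgueI_scale x0 (mF' x) (fun v => F0 _)).
have mFx : measurable_fun setT ((fun v => F (x *: cons_row 1 v)%R) : borel R 1 n -> \bar R).
  apply: measurable_comp_borel => //; apply: measurable_scalemx; first exact: measurable_cst.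
  by apply: measurable_cons_row; [exact: measurable_cst|exact: measurable_idrow].
have hm : measurable_fun setT (fun t : n.-tuple (measurableTypeR R) =>
    F (cons_row x (x *: tuple_row t)%R) * (gauss_weight (tuple_row t))%:E).
  apply: emeasurable_funM.
    apply: (measurableT_comp (mF' x)); apply: measurable_scalemx; first exact: measurable_cst.
    exact: measurable_tuple_row.
  apply/measurable_EFinP; apply: (measurableT_comp (@measurable_gauss_weight R n)).
  exact: measurable_tuple_row.
have h0 t : [set: n.-tuple (measurableTypeR R)] t ->
    0 <= F (cons_row x (x *: tuple_row t)%R) * (gauss_weight (tuple_row t))%:E.
  by move=> _; rewrite mule_ge0// lee_fin gauss_weight_ge0.
rewrite /lebesgueI -(ge0_integralZr (gauss n) measurableT hm h0); last first.
  by rewrite lee_fin exprn_ge0.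
by apply: eq_integral => t _; rewrite /G cons_rowZ mulr1 -!muleA; congr (_ * _); rewrite muleC.
Qed.

(** The map z to sinhc(|z|) z preserves each line through 0. On the line spanned by (1, u), of norm
    k, it reads s to sinh(k s) / k, so polar coordinates reduce it to a substitution in one
    variable. *)
Lemma lebesgueI_sinh n (F : borel R 1 n.+1 -> \bar R) :
  measurable_fun setT F -> (forall v, 0 <= F v) ->
  lebesgueI (fun z : 'rV[R]_n.+1 => F (sinhc (enorm z) *: z)%R *
    (sinhc (enorm z) ^+ n * cosh (enorm z))%:E) = lebesgueI F.
Proof.
move=> mF F0.
have msc : measurable_fun setT ((fun z => sinhc (enorm z)) : borel R 1 n.+1 -> R).
  by apply: (measurableT_comp measurable_sinhc); exact: measurable_enorm.
have mF' : measurable_fun setT ((fun z : 'rV[R]_n.+1 => F (sinhc (enorm z) *: z)%R *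
    (sinhc (enorm z) ^+ n * cosh (enorm z))%:E) : borel R 1 n.+1 -> \bar R).
  apply: emeasurable_funM.
    apply: measurable_comp_borel => //.
    by apply: measurable_scalemx => //; exact: measurable_idrow.
  apply/measurable_EFinP; apply: measurable_funM; first exact: measurable_funX.
  apply: measurableT_comp; last exact: measurable_enorm.
  exact: (continuous_measurable_fun continuous_cosh).
have F0' z : 0 <= F (sinhc (enorm z) *: z)%R * (sinhc (enorm z) ^+ n * cosh (enorm z))%:E.
  by rewrite mule_ge0// lee_fin mulr_ge0 ?exprn_ge0 ?ltW ?cosh_gt0 ?sinhc_gt0.
rewrite (lebesgueI_polar mF' F0') (lebesgueI_polar mF F0).
apply: eq_lebesgueI => u; set c := cons_row 1 u; pose k := enorm c.
have k0 : (0 < k)%R.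
  rewrite lt_def enorm_ge0 andbT enorm_eq0; apply/eqP => c0.
  by have := cons_row0 1%R u; rewrite -/c c0 mxE => /eqP; rewrite eq_sym oner_eq0.
have phiE (s : R) : (sinh (k * s) / k = sinhc (s * k) * s)%R.
  rewrite -mul_sinhc (mulrC s k); field.
  by rewrite gt_eqF.
have hs : substitution (fun s => sinh (k * s) / k)%R (fun s => cosh (k * s)).
  apply: substitution_increasing.
  - move=> x; have h1 := is_derive_mull k x; have h2 := is_derive_sinh (k * x).
    have h3 : is_derive x 1%R (@sinh R \o (fun s => k * s))%R (cosh (k * x) *: k)%R.
      exact: is_derive1_comp.
    have h : is_derive x 1%R (k^-1 \*: (@sinh R \o (fun s => k * s)%R : R -> R^o))%R (k^-1 *: (cosh (k * x) *: k))%R.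
      exact: is_deriveZ.
    have e : (k^-1 *: (cosh (k * x) *: k) = cosh (k * x))%R.
      by rewrite /GRing.scale /= mulrC mulfK// gt_eqF.
    rewrite -e (_ : (fun s => _) = (k^-1 \*: (@sinh R \o (fun s => k * s)%R : R -> R^o))%R)//.
    by apply/funext => s; rewrite mulrC.
  - move=> x; apply: (@continuous_comp _ _ _ (fun s => k * s)%R (@cosh R)); last exact: continuous_cosh.
    exact: mulrl_continuous.
  - by move=> x; exact: cosh_gt0.
  - move=> y; have [x hx] := sinh_surj (y * k)%R; exists (k^-1 * x)%R.
    by rewrite mulVKf ?gt_eqF// hx mulfK// gt_eqF.
have mFc : measurable_fun setT (fun s : R => F (s *: c)%R * (`|s| ^+ n)%:E).
  apply: emeasurable_funM.
    apply: (measurableT_comp mF); apply: measurable_scalemx; first exact: measurable_id.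
    exact: measurable_cst.
  apply/measurable_EFinP; apply: measurable_funX.
  exact: normr_measurable.
rewrite -[RHS](hs _ mFc); last by move=> s; rewrite mule_ge0// lee_fin exprn_ge0.
apply: eq_integral => s _; rewrite phiE enormZ -/k.
have -> : sinhc (`|s| * k)%R = sinhc (s * k)%R.
  by rewrite -[in RHS]sinhc_norm normrM (gtr0_norm k0).
have -> : cosh (`|s| * k)%R = cosh (k * s)%R.
  by rewrite -[in RHS]cosh_norm normrM (gtr0_norm k0) mulrC.
rewrite scalerA -!muleA; congr (_ * _); rewrite -!EFinM; congr EFin.
rewrite normrM (gtr0_norm (sinhc_gt0 _)) exprMn; ring.
Qed.

(* For a point of the hyperboloid with spatial part x, hyp0 x is its time       *)
(* coordinate, and the volume measure is dx / hyp0 x.                           *)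
Definition hyp0 n (x : 'rV[R]_n) : R := Num.sqrt (1 + dot x x).

Lemma hyp0_sqr n (x : 'rV[R]_n) : (hyp0 x ^+ 2 = 1 + dot x x)%R.
Proof. by rewrite sqr_sqrtr// addr_ge0// dot_ge0. Qed.

Lemma hyp0_ge1 n (x : 'rV[R]_n) : (1 <= hyp0 x)%R.
Proof. by rewrite -[leLHS]sqrtr1 ler_sqrt ?addr_ge0 ?dot_ge0// lerDl dot_ge0. Qed.

Lemma hyp0_gt0 n (x : 'rV[R]_n) : (0 < hyp0 x)%R.
Proof. by rewrite (lt_le_trans _ (hyp0_ge1 x)). Qed.

Lemma enorm_lt_hyp0 n (x : 'rV[R]_n) : (enorm x < hyp0 x)%R.
Proof. by rewrite /enorm -/(dot x x) ltr_sqrt ?ltr_pwDl ?dot_ge0//; lra. Qed.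

Lemma continuous_hyp0 n : continuous (@hyp0 n).
Proof.
move=> x; apply: (@continuous_comp _ _ _ (fun v => 1 + dot v v)%R Num.sqrt); last exact: sqrt_continuous.
by apply: continuousD; [exact: cst_continuous|exact: continuous_dot].
Qed.

(** For spatial parts m and x of points of the hyperboloid this is minus their Lorentz product, that
    is the cosine hyperbolic of their distance. It is the time coordinate of x after the Lorentz
    boost taking m to the origin; [boost] is the spatial part. *)
Definition boost0 n (m x : 'rV[R]_n) : R := (hyp0 m * hyp0 x - dot m x)%R.

Definition boost n (m x : 'rV[R]_n) : 'rV[R]_n :=
  (x - ((hyp0 x + boost0 m x) / (1 + hyp0 m)) *: m)%R.

Lemma boost0_gt0 n (m x : 'rV[R]_n) : (0 < boost0 m x)%R.
Proof.
rewrite subr_gt0 (le_lt_trans (ler_norm _))// (le_lt_trans (ler_dot _ _))//.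
by apply: ltr_pM; rewrite ?enorm_ge0 ?enorm_lt_hyp0.
Qed.

Lemma hyp0_boost n (m x : 'rV[R]_n) : hyp0 (boost m x) = boost0 m x.
Proof.
rewrite -[RHS]ger0_norm ?ltW ?boost0_gt0// -sqrtr_sqr; congr Num.sqrt.
rewrite /boost !(dotDl, dotDr, dotZl, dotZr, dotNl, dotNr) (dotC x m) /boost0.
have hm := hyp0_sqr m; have hx := hyp0_sqr x.
have hm1 : (1 + hyp0 m != 0)%R by rewrite gt_eqF// addr_gt0// hyp0_gt0.
have -> : dot m m = (hyp0 m ^+ 2 - 1)%R by rewrite hm addrC addKr.
have -> : dot x x = (hyp0 x ^+ 2 - 1)%R by rewrite hx addrC addKr.
by field.
Qed.

End hyperbolic_volume.

(** * Boost invariance and the Jacobian of the exponential map *)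

Section boost_invariance.
Context {R : realType}.

(** With slope at least kappa, phi moves by at least kappa t on an interval of length t, so the
    intermediate value theorem reaches any y. *)
Lemma derive_ge_surjective (phi D : R -> R) (kappa : R) :
  (forall x : R, is_derive x 1 phi (D x)) -> 0 < kappa ->
  (forall x, kappa <= D x) -> forall y, exists x, phi x = y.
Proof.
move=> dphi k0 kD y.
have cphi : continuous phi.
  by move=> x; apply/differentiable_continuous/derivable1_diffP; case: (dphi x).
have grow a b : a < b -> kappa * (b - a) <= phi b - phi a.
  move=> ab; have [|c _ ->] := @MVT _ phi D _ _ ab (fun x _ => dphi x).
    exact: continuous_subspaceT.
  by rewrite ler_wpM2r// subr_ge0 ltW.
pose t := (`|y - phi 0| + 1) / kappa.
have t0 : 0 < t by rewrite divr_gt0// ltr_pwDr.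
have kt : kappa * t = `|y - phi 0| + 1 by rewrite /t mulrC divfK// gt_eqF.
have h1 := grow 0 t t0; have h2 := grow (- t) 0 (ltac:(by rewrite oppr_lt0)).
rewrite subr0 kt in h1; rewrite sub0r opprK kt in h2.
have := ler_norm (y - phi 0); have := ler_norm (- (y - phi 0)); rewrite normrN => h3 h4.
have [|||c _ hc] := @IVT _ phi (- t) t y; last by exists c.
- by rewrite (@le_trans _ _ 0)// ?oppr_le0 ltW.
- exact: continuous_subspaceT.
- by rewrite ge_min le_max; apply/andP; split; apply/orP; [left|right]; lra.
Qed.

Lemma is_derive_hyp0_line n (x m : 'rV[R]_n) (s : R) :
  is_derive s 1 (fun s => hyp0 (x + s *: m)) (dot m (x + s *: m) / hyp0 (x + s *: m)).
Proof.
pose p : {poly R} := (dot m m)%:P * 'X^2 + (2 * dot m x)%:P * 'X + (1 + dot x x)%:P.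
have pE t : p.[t] = 1 + dot (x + t *: m) (x + t *: m).
  rewrite /p !(hornerD, hornerM, hornerC, hornerXn, hornerX).
  by rewrite !(dotDl, dotDr, dotZl, dotZr) (dotC x m); ring.
have p0 : 0 < p.[s] by rewrite pE ltr_pwDl// dot_ge0.
have h1 := is_derive_poly p s; have h2 := is_derive1_sqrt p0.
have h : is_derive s 1 (Num.sqrt \o horner p) ((2 * Num.sqrt p.[s])^-1 *: (deriv p).[s]).
  exact: is_derive1_comp.
have dpE : (deriv p).[s] = 2 * dot m (x + s *: m).
  rewrite /p !poly.derivE !(hornerD, hornerM, hornerC, hornerXn, hornerX, hornerMn, horner0).
  by rewrite dotDr dotZr; ring.
have <- : (2 * Num.sqrt p.[s])^-1 *: (deriv p).[s] = dot m (x + s *: m) / hyp0 (x + s *: m).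
  rewrite dpE pE -/(hyp0 _) /GRing.scale /=.
  have : hyp0 (x + s *: m) != 0 by rewrite gt_eqF// hyp0_gt0.
  by move=> ?; field.
by rewrite (_ : (fun s => _) = Num.sqrt \o horner p)//; apply/funext => t /=; rewrite pE.
Qed.

(** The gap hyp0 m - |m| is positive and independent of x. It makes boosts surjective along lines,
    and later bounds the coordinates of x by the cosh of its distance to m. *)
Lemma boost0_slope n (m x : 'rV[R]_n) :
  hyp0 m - enorm m <= boost0 m x / hyp0 x.
Proof.
have hx := hyp0_gt0 x; rewrite ler_pdivlMr// /boost0 mulrBl lerB//.
rewrite (le_trans (ler_norm _))// (le_trans (ler_dot _ _))//.
by rewrite ler_wpM2l ?enorm_ge0// ltW// enorm_lt_hyp0.
Qed.

Definition hypI n (F : 'rV[R]_n -> \bar R) : \bar R :=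
  lebesgueI (fun x => F x * ((hyp0 x)^-1)%:E)%E.

Lemma measurable_hyp0 n : measurable_fun setT (@hyp0 R n : borel R 1 n -> R).
Proof. by apply: measurable_continuousR; exact: continuous_hyp0. Qed.

Lemma measurable_dotl n (m : 'rV[R]_n) : measurable_fun setT (dot m : borel R 1 n -> R).
Proof.
rewrite (_ : dot m = fun v => \sum_i m ord0 i * v ord0 i); last by apply/funext => v; rewrite dotE.
apply: measurable_sum => i.
by apply: measurable_funM; [exact: measurable_cst|exact: measurable_coord].
Qed.

Lemma measurable_boost0 n (m : 'rV[R]_n) : measurable_fun setT (boost0 m : borel R 1 n -> R).
Proof.
apply: measurable_funB; last exact: measurable_dotl.
by apply: measurable_funM; [exact: measurable_cst|exact: measurable_hyp0].
Qed.

Lemma measurable_boost n (m : 'rV[R]_n) :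
  measurable_fun setT (boost m : borel R 1 n -> borel R 1 n).
Proof.
rewrite (_ : boost m = fun x => x + (- ((hyp0 x + boost0 m x) / (1 + hyp0 m))) *: m); last first.
  by apply/funext => x; rewrite scaleNr.
apply: measurable_addmx; first exact: measurable_idrow.
apply: measurable_scalemx; last exact: measurable_cstmx.
under eq_fun do rewrite -mulNr; apply: measurable_funM; last exact: measurable_cst.
under eq_fun do rewrite opprD; apply: measurable_funB; last exact: measurable_boost0.
by apply: measurableT_comp => //; exact: measurable_hyp0.
Qed.

(** A boost displaces every point in the fixed direction m, so [lebesgueI_directional] applies. Its
    Jacobian boost0 m x / hyp0 x is exactly the quotient of the volume densities at the two
    points. *)
Lemma hypI_boost n (m : 'rV[R]_n) (F : borel R 1 n -> \bar R) :
  measurable_fun setT F -> (forall v, 0 <= F v)%E ->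
  hypI (fun x => F (boost m x)) = hypI F.
Proof.
move=> mF F0; have [->|m0] := eqVneq m 0.
  by apply: eq_lebesgueI => x; rewrite /boost scaler0 subr0.
pose psi (x : 'rV[R]_n) : R := - ((hyp0 x + boost0 m x) / (1 + hyp0 m)).
pose D (x : 'rV[R]_n) : R := boost0 m x / hyp0 x.
have D0 x : 0 < D x by rewrite divr_gt0 ?boost0_gt0 ?hyp0_gt0.
have mD : measurable_fun setT (D : borel R 1 n -> R).
  apply: measurable_funM; first exact: measurable_boost0.
  by apply: measurable_funV; exact: measurable_hyp0.
have mpsi : measurable_fun setT (psi : borel R 1 n -> R).
  rewrite /psi; under eq_fun do rewrite -mulNr; apply: measurable_funM; last exact: measurable_cst.
  under eq_fun do rewrite opprD; apply: measurable_funB; last exact: measurable_boost0.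
  by apply: measurableT_comp => //; exact: measurable_hyp0.
have hm1 : 1 + hyp0 m != 0 by rewrite gt_eqF// addr_gt0// hyp0_gt0.
have dE x (s : R) : is_derive s 1 (fun s => s + psi (x + s *: m)) (D (x + s *: m)).
  pose X := fun s => hyp0 (x + s *: m).
  have hX := is_derive_hyp0_line x m s.
  have hl := is_derive_mull (1 + dot m m / (1 + hyp0 m)) s.
  have h : is_derive s 1 (((fun s => (1 + dot m m / (1 + hyp0 m)) * s) : R -> R^o) - X + cst (dot m x / (1 + hyp0 m)))
      ((1 + dot m m / (1 + hyp0 m)) - dot m (x + s *: m) / hyp0 (x + s *: m) + 0).
    apply: is_deriveD.
  have e : (1 + dot m m / (1 + hyp0 m)) - dot m (x + s *: m) / hyp0 (x + s *: m) + 0 = D (x + s *: m).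
    have hx : hyp0 (x + s *: m) != 0 by rewrite gt_eqF// hyp0_gt0.
    rewrite /D /boost0; have -> : dot m m = hyp0 m ^+ 2 - 1 by rewrite hyp0_sqr addrC addKr.
    by field; rewrite hm1 hx.
  rewrite -e (_ : (fun s => s + _) = ((fun s => (1 + dot m m / (1 + hyp0 m)) * s) : R -> R^o) - X + cst (dot m x / (1 + hyp0 m)))//.
  by apply/funext => t; rewrite /psi /boost0 !fctE /= /X !(dotDr, dotZr); field.
have hsub x : substitution (fun s => s + psi (x + s *: m)) (fun s => D (x + s *: m)).
  apply: substitution_increasing.
  - have cX : continuous (fun s : R => hyp0 (x + s *: m)).
      by move=> s; apply/differentiable_continuous/derivable1_diffP; case: (is_derive_hyp0_line x m s).
    have cd : continuous (fun s : R => dot m (x + s *: m)).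
      rewrite (_ : (fun s => _) = fun s : R => dot m x + s * dot m m); last first.
        by apply/funext => s; rewrite dotDr dotZr.
      by move=> s; apply: cvgD; [exact: cvg_cst|apply: cvgM; [exact: cvg_id|exact: cvg_cst]].
    move=> s; rewrite /D /boost0; apply: cvgM; last first.
      by apply: cvgV; [rewrite gt_eqF// hyp0_gt0|exact: cX].
    by apply: cvgB; [apply: cvgM; [exact: cvg_cst|exact: cX]|exact: cd].
  - by move=> s; exact: D0.
  - apply: (derive_ge_surjective (dE x) (kappa := hyp0 m - enorm m)).
      by rewrite subr_gt0 enorm_lt_hyp0.
    by move=> s; exact: boost0_slope.
pose F' y := (F y * ((hyp0 y)^-1)%:E)%E.
have mF' : measurable_fun setT (F' : borel R 1 n -> \bar R).
  apply: emeasurable_funM => //; apply/measurable_EFinP; apply: measurable_funV.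
  exact: measurable_hyp0.
have F'0 y : (0 <= F' y)%E by rewrite mule_ge0// lee_fin invr_ge0 ltW// hyp0_gt0.
rewrite /hypI -[RHS](lebesgueI_directional m0 mpsi mD (fun x => ltW (D0 x)) hsub mF' F'0).
apply: eq_lebesgueI => x.
have bE : x + psi x *: m = boost m x by rewrite /boost scaleNr.
rewrite bE /F' hyp0_boost -muleA -EFinM; congr (_ * _%:E)%E.
by rewrite /D mulrA mulVf ?mul1r// gt_eqF// boost0_gt0.
Qed.

Lemma hyp0_sinhc n (z : 'rV[R]_n) : hyp0 (sinhc (enorm z) *: z) = cosh (enorm z).
Proof.
rewrite -[RHS]ger0_norm ?ltW ?cosh_gt0// -sqrtr_sqr; congr Num.sqrt.
by rewrite dotZl dotZr cosh2_sinh2 -mul_sinhc exprMn enorm_sqr; ring.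
Qed.

(** The factor cosh in the Jacobian of [lebesgueI_sinh] is the time coordinate of the image and
    cancels the volume density. The remaining power of [sinhc] is what the term in [phi] of the
    log-density compensates. *)
Lemma hypI_exp n (F : borel R 1 n.+1 -> \bar R) :
  measurable_fun setT F -> (forall v, 0 <= F v)%E ->
  hypI F = lebesgueI (fun z : 'rV[R]_n.+1 =>
    F (sinhc (enorm z) *: z) * (sinhc (enorm z) ^+ n)%:E)%E.
Proof.
move=> mF F0; rewrite /hypI -lebesgueI_sinh.
- apply: eq_lebesgueI => z; rewrite hyp0_sinhc -muleA -EFinM; congr (_ * _%:E)%E.
  by rewrite mulrC mulfK// gt_eqF// cosh_gt0.
- apply: emeasurable_funM => //; apply/measurable_EFinP; apply: measurable_funV.
  exact: measurable_hyp0.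
- by move=> y; rewrite mule_ge0// lee_fin invr_ge0 ltW// hyp0_gt0.
Qed.

End boost_invariance.

(** * Symmetric matrices: square root, exponential, logarithm *)

Section spectral_theorem.
Context {R : realType}.

(** First-order optimality at a maximum; t = a / (|b| + 1) makes the linear term win unless a =
    0. *)
Lemma linear_term_eq0 (a b : R) : (forall t, a * t + b * t ^+ 2 <= 0) -> a = 0.
Proof.
move=> h; have hb : 0 < `|b| + 1 by rewrite ltr_pwDr.
have := h (a / (`|b| + 1)).
have -> : a * (a / (`|b| + 1)) + b * (a / (`|b| + 1)) ^+ 2 =
    (a / (`|b| + 1)) ^+ 2 * (`|b| + b + 1).
  by field; rewrite gt_eqF.
have hb' : 0 < `|b| + b + 1.
  by have := ler_norm (- b); rewrite normrN; lra.
rewrite pmulr_lle0// => h2.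
have : (a / (`|b| + 1)) ^+ 2 == 0 by rewrite eq_le h2 sqr_ge0.
by rewrite sqrf_eq0 mulf_eq0 invr_eq0 (gt_eqF hb) orbF => /eqP.
Qed.

Lemma continuous_quad n (S : 'M[R]_n) : continuous (quad S).
Proof.
rewrite (_ : quad S = fun v => \sum_j (\sum_i v ord0 i * S i j) * v ord0 j).
  apply: continuous_sum => j v; apply: continuousM; last exact: continuous_coord.
  apply: (@continuous_sum _ _ _ _ (fun i (v : 'rV[R]_n) => v ord0 i * S i j)) => i w.
  by apply: continuousM; [exact: continuous_coord|exact: cst_continuous].
apply/funext => v; rewrite quadE dotE; apply: eq_bigr => j _.
by rewrite mxE.
Qed.

Lemma compact_sphere n : compact [set v : 'rV[R]_n | dot v v = 1].
Proof.
apply: bounded_closed_compact.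
  exists 1; split; first exact: num_real.
  move=> M M1 v /= v1; rewrite [leLHS]mx_normrE; apply: bigmax_le.
    by rewrite ltW// (lt_trans _ M1).
  move=> -[i j] _ /=; rewrite [i]ord1 (le_trans (enorm_coord v j))//.
  by rewrite enormE v1 sqrtr1 ltW.
apply: (@preimage_closed _ _ (fun v : 'rV[R]_n => dot v v) [set 1]).
  by move=> v _; exact: continuous_dot.
exact: closed_eq.
Qed.

(** A maximiser of the quadratic form on the unit sphere is an eigenvector, with the maximum as
    eigenvalue. *)
Lemma symmetric_eigenvector n (S : 'M[R]_n.+1) : S^T = S ->
  exists v l, dot v v = 1 /\ v *m S = l *: v.
Proof.
move=> symS.
have [||v] := @EVT_max_rV R _ (quad S) _ _ (@compact_sphere n.+1).
- exists (delta_mx ord0 ord0); rewrite /= dotE (bigD1 ord0)//= big1 ?addr0.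
    by rewrite !mxE !eqxx mulr1.
  by move=> i i0; rewrite !mxE (negbTE i0) andbF mul0r.
- exact/continuous_subspaceT/continuous_quad.
rewrite inE /= => v1 vmax; exists v, (quad S v); split => //.
have homog w : quad S w <= quad S v * dot w w.
  have [->|w0] := eqVneq w 0.
    by rewrite quadE mul0mx !dot0l mulr0.
  have ww : 0 < dot w w by rewrite lt_def dot_eq0 w0 dot_ge0.
  have wn : 0 < enorm w by rewrite lt_def enorm_eq0 w0 enorm_ge0.
  have := vmax ((enorm w)^-1 *: w); rewrite inE /= dotZl dotZr mulrA -expr2.
  rewrite exprVn enorm_sqr mulVf ?gt_eqF// => /(_ erefl).
  rewrite !quadE -scalemxAl dotZl dotZr mulrA -expr2 exprVn enorm_sqr.
  by rewrite mulrC ler_pdivrMr.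
apply/eqP; rewrite -subr_eq0 -dot_eq0; set u := v *m S - _.
suff : forall w, dot u w = 0 by move=> ->.
move=> w; rewrite -[LHS](@mulfK _ 2)// (_ : dot u w * 2 = 0) ?mul0r//.
(* Putting v + t w into [homog] gives a polynomial in t with no constant term that is never
   positive; its linear coefficient is 2 u.w. *)
apply: (@linear_term_eq0 _ (quad S w - quad S v * dot w w)) => t.
have := homog (v + t *: w).
have E : dot (w *m S) v = dot (v *m S) w by rewrite dot_mulmxl symS dotC.
rewrite /u !quadE mulmxDl -scalemxAl !(dotDl, dotDr, dotZl, dotZr, dotNl) E v1 (dotC w v).
by move=> h; lra.
Qed.

(** The Householder reflection in the hyperplane orthogonal to e - v, or the identity when v is
    already the first basis vector e. *)
Lemma orthogonal_first_row n (v : 'rV[R]_n.+1) : dot v v = 1 ->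
  exists H : 'M[R]_n.+1, [/\ H^T = H, H *m H = 1%:M & delta_mx ord0 ord0 *m H = v].
Proof.
move=> v1; pose e : 'rV[R]_n.+1 := delta_mx ord0 ord0.
have [->|ve] := eqVneq v e.
  by exists 1%:M; split; rewrite ?trmx1 ?mulmx1.
have [u uE] : exists u, u = e - v by exists (e - v).
have u0 : dot u u != 0 by rewrite dot_eq0 uE subr_eq0 eq_sym.
pose c := 2 / dot u u.
have uuE : u *m u^T = (dot u u)%:M by rewrite [u *m u^T]mx11_scalar.
exists (1%:M - c *: (u^T *m u)); split.
- by rewrite linearB /= linearZ /= trmx1 trmx_mul trmxK.
- rewrite mulmxBl mul1mx mulmxBr mulmx1 -!scalemxAl -!scalemxAr mulmxA -(mulmxA _ u) uuE.
  rewrite -mulmxA mul_scalar_mx -scalemxAr scalerA scalerA.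
  rewrite (_ : c * (c * dot u u) = c + c); last by rewrite /c; field.
  by rewrite scalerDl opprB addrK subrK.
- have ee : dot e e = 1.
    rewrite dotE (bigD1 ord0)//= big1 ?addr0; first by rewrite !mxE !eqxx mulr1.
    by move=> i i0; rewrite !mxE (negbTE i0) andbF mul0r.
  have euE : e *m u^T = (dot e u)%:M by rewrite [e *m u^T]mx11_scalar.
  rewrite mulmxBr mulmx1 -scalemxAr mulmxA euE mul_scalar_mx scalerA.
  have -> : c * dot e u = 1.
    have : dot u u = 2 * dot e u.
      by rewrite uE !(dotDl, dotDr, dotNl, dotNr) v1 ee (dotC v e); ring.
    by move=> h; rewrite /c mulrAC -h divff.
  by rewrite scale1r uE opprB addrC subrK.
Qed.

(** Conjugating by a reflection that sends a unit eigenvector to the first basis vector leaves, by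
    symmetry, a block diagonal matrix; the induction hypothesis diagonalises the lower block. *)
Theorem spectral_decomposition n (S : 'M[R]_n) : S^T = S ->
  exists (U : 'M[R]_n) (d : 'rV[R]_n), U *m U^T = 1%:M /\ S = U^T *m diag_mx d *m U.
Proof.
elim: n => [|n IH] in S *; move=> symS.
  by exists 1%:M, 0; split; apply/matrixP => -[].
have [v [l [v1 vS]]] := symmetric_eigenvector symS.
have [H [symH HH eH]] := orthogonal_first_row v1.
have [M MEq] : exists M, M = H *m S *m H by eexists.
have symM : M^T = M by rewrite MEq !trmx_mul symH symS mulmxA.
have eM : (delta_mx ord0 ord0 : 'rV_n.+1) *m M = l *: delta_mx ord0 ord0.
  by rewrite MEq !mulmxA eH vS -scalemxAl -eH -mulmxA HH mulmx1.
pose M' : 'M[R]_(1 + n) := M.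
have [|U' [d' [UU' dE]]] := IH (drsubmx M').
  by rewrite trmx_drsub -[M'^T]/(M^T) symM.
have ord0E : (lshift n ord0 : 'I_(1 + n)) = ord0 :> 'I_n.+1 by exact: val_inj.
have M0 j : M ord0 j = l * (j == ord0)%:R.
  have /matrixP/(_ ord0 j) := eM; rewrite -rowE !mxE => ->.
  by rewrite eqxx.
have ME : M = block_mx l%:M 0 0 (drsubmx M') :> 'M[R]_(1 + n).
  rewrite -[LHS](@submxK _ 1 n 1 n); congr block_mx.
  - by apply/matrixP => i j; rewrite !mxE !ord1 ord0E M0 eqxx mulr1.
  - by apply/matrixP => i j; rewrite !mxE !ord1 ord0E M0 mulr0.
  - apply/matrixP => i j; rewrite !mxE !ord1 ord0E -symM mxE M0.
    by rewrite mulr0.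
pose V : 'M[R]_(1 + n) := block_mx 1%:M 0 0 U'.
pose D : 'rV[R]_(1 + n) := row_mx l%:M d'.
have VV : V *m V^T = 1%:M.
  rewrite /V tr_block_mx mulmx_block !trmx0 trmx1 !mulmx0 !mul0mx !mulmx1 !addr0 add0r UU'.
  rewrite (scalar_mx_block 1 n 1); reflexivity.
exists (V *m H : 'M[R]_n.+1), (D : 'rV[R]_n.+1); split.
  by rewrite trmx_mul symH mulmxA -(mulmxA V) HH mulmx1 VV.
have -> : S = H *m M *m H.
  by rewrite MEq !mulmxA HH mul1mx -mulmxA HH mulmx1.
rewrite trmx_mul symH !mulmxA; congr (_ *m _); rewrite -!mulmxA; congr (_ *m _).
suff : (M : 'M[R]_(1 + n)) = V^T *m (diag_mx D *m V) by [].
have -> : diag_mx D = block_mx (diag_mx l%:M) 0 0 (diag_mx d') by rewrite -diag_mx_row.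
rewrite ME /V tr_block_mx !mulmx_block !trmx0 trmx1.
rewrite !(mul0mx, mulmx0, mul1mx, mulmx1, addr0, add0r) dE mulmxA; congr block_mx.
by apply/matrixP => i j; rewrite !ord1 !mxE.
Qed.

End spectral_theorem.

Section spectral_calculus.
Context {R : realType}.

Definition specmx n (U : 'M[R]_n) (d : 'rV[R]_n) : 'M[R]_n := U^T *m diag_mx d *m U.

Section fixed_basis.
Variables (n : nat) (U : 'M[R]_n).
Hypothesis UU : U *m U^T = 1%:M.
Implicit Types (d e : 'rV[R]_n).

Let UtU : U^T *m U = 1%:M. Proof. exact: mulmx1C. Qed.

Lemma specmx_sym d : (specmx U d)^T = specmx U d.
Proof. by rewrite /specmx !trmx_mul trmxK tr_diag_mx mulmxA. Qed.

Lemma specmxM d e : specmx U d *m specmx U e = specmx U (\row_i (d ord0 i * e ord0 i)).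
Proof.
rewrite /specmx !mulmxA -(mulmxA _ U) UU mulmx1 -(mulmxA U^T) mulmx_diag.
by [].
Qed.

Lemma specmx1 : specmx U (const_mx 1) = 1%:M.
Proof. by rewrite /specmx diag_const_mx mulmx1 UtU. Qed.

Lemma specmxN d : - specmx U d = specmx U (- d).
Proof. by rewrite /specmx raddfN mulmxN mulNmx. Qed.

Lemma specmx_entry d i j : specmx U d i j = \sum_k d ord0 k * (U k i * U k j).
Proof.
rewrite /specmx mul_mx_diag mxE; apply: eq_bigr => k _; rewrite !mxE; ring.
Qed.

Lemma det_specmx d : \det (specmx U d) = \prod_i d ord0 i.
Proof.
rewrite /specmx !det_mulmx det_diag mulrAC -det_mulmx UtU det1 mul1r.
by [].
Qed.

Lemma quad_specmx d v : quad (specmx U d) v = \sum_i d ord0 i * (v *m U^T) ord0 i ^+ 2.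
Proof.
rewrite quadE /specmx !mulmxA dot_mulmxl dotE mul_mx_diag.
by apply: eq_bigr => i _; rewrite !mxE; ring.
Qed.

Lemma dot_orthogonal v : dot (v *m U^T) (v *m U^T) = dot v v.
Proof. by rewrite dot_mulmxl trmxK -mulmxA UtU mulmx1. Qed.

Lemma specmx_posdef d : (forall i, 0 < d ord0 i) -> posdef (specmx U d).
Proof.
move=> d0; split; first exact: specmx_sym.
move=> v v0; rewrite quad_specmx lt_def sumr_ge0; last first.
  by move=> i _; rewrite mulr_ge0 ?sqr_ge0// ltW.
rewrite andbT psumr_eq0; last by move=> i _; rewrite mulr_ge0 ?sqr_ge0// ltW.
apply: contra v0 => /allP h; rewrite -dot_eq0 -dot_orthogonal dotE big1// => i _.
have := h i (mem_index_enum _); rewrite /= mulf_eq0 (gt_eqF (d0 i)) sqrf_eq0 => /eqP ->.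
by rewrite mul0r.
Qed.

Lemma eigen_row i : delta_mx ord0 i *m U *m U^T = delta_mx ord0 i :> 'rV[R]_n.
Proof. by rewrite -mulmxA UU mulmx1. Qed.

Lemma quad_eigen d i : quad (specmx U d) (delta_mx ord0 i *m U) = d ord0 i.
Proof.
rewrite quad_specmx eigen_row (bigD1 i)//= big1 ?addr0.
  by rewrite mxE !eqxx expr1n mulr1.
by move=> j ji; rewrite mxE (negbTE ji) andbF expr0n mulr0.
Qed.

Lemma dot_eigen i : dot (delta_mx ord0 i *m U) (delta_mx ord0 i *m U) = 1.
Proof.
rewrite dot_mulmxl eigen_row dotE (bigD1 i)//= big1 ?addr0.
  by rewrite mxE !eqxx mulr1.
by move=> j ji; rewrite mxE (negbTE ji) andbF mul0r.
Qed.

Lemma posdef_specmx d : posdef (specmx U d) -> forall i, 0 < d ord0 i.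
Proof.
move=> [_ pd] i; rewrite -(quad_eigen d i); apply: pd.
by rewrite -dot_eq0 dot_eigen oner_eq0.
Qed.

Lemma specmx_unit d : (forall i, 0 < d ord0 i) ->
  specmx U d \in unitmx /\ invmx (specmx U d) = specmx U (\row_i (d ord0 i)^-1).
Proof.
move=> d0.
have h : specmx U d *m specmx U (\row_i (d ord0 i)^-1) = 1%:M.
  rewrite specmxM -specmx1; congr specmx; apply/rowP => i; rewrite !mxE divff//.
  by rewrite gt_eqF.
have [u1 _] := mulmx1_unit h; split => //.
by apply: (can_inj (mulKmx u1)); rewrite mulmxV// h.
Qed.

Lemma entry_orthogonal k i : `|U k i| <= 1.
Proof.
have := dot_eigen k; set u := _ *m U => u1.
have -> : U k i = u ord0 i by rewrite /u -rowE mxE.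
by rewrite (le_trans (enorm_coord _ _))// enormE u1 sqrtr1.
Qed.

End fixed_basis.

Lemma specP n (S : 'M[R]_n) : posdef S ->
  exists U d, [/\ U *m U^T = 1%:M, S = specmx U d & forall i, 0 < d ord0 i].
Proof.
move=> pS; have [U [d [UU SE]]] := spectral_decomposition pS.1.
by exists U, d; split => //; apply: (posdef_specmx UU); rewrite /specmx -SE.
Qed.

Lemma posdef_unit n (S : 'M[R]_n) : posdef S -> S \in unitmx.
Proof. by move=> /specP[U [d [UU -> d0]]]; have [] := specmx_unit UU d0. Qed.

Lemma posdef_det n (S : 'M[R]_n) : posdef S -> 0 < \det S.
Proof.
by move=> /specP[U [d [UU -> d0]]]; rewrite det_specmx//; apply: prodr_gt0.
Qed.

Lemma posdef_inv n (S : 'M[R]_n) : posdef S -> posdef (invmx S).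
Proof.
move=> /specP[U [d [UU -> d0]]]; have [_ ->] := specmx_unit UU d0.
by apply: specmx_posdef => // i; rewrite mxE invr_gt0.
Qed.

Lemma msqrtP n (S : 'M[R]_n) : posdef S ->
  posdef (msqrt S) /\ msqrt S *m msqrt S = S.
Proof.
move=> pS; rewrite /msqrt.
apply: (@xgetPex _ 0 [set A : 'M[R]_n | posdef A /\ A *m A = S]).
have [U [d [UU SE d0]]] := specP pS.
exists (specmx U (\row_i Num.sqrt (d ord0 i))); split.
  by apply: specmx_posdef => // i; rewrite mxE sqrtr_gt0.
rewrite specmxM// SE; congr specmx; apply/rowP => i; rewrite !mxE -expr2 sqr_sqrtr//.
exact: ltW.
Qed.

End spectral_calculus.

(** * The matrix exponential series *)

Section exponential_series.
Context {R : realType}.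

Lemma cvg_bigsum (T : Type) (F : set_system T) (FF : Filter F) (I : Type) (r : seq I)
    (f : I -> T -> R) (l : I -> R) :
  (forall i, f i x @[x --> F] --> l i) ->
  (\sum_(i <- r) f i x) @[x --> F] --> \sum_(i <- r) l i.
Proof.
move=> h; elim: r => [|i r IH].
  by rewrite big_nil (_ : (fun x => _) = cst 0) ?funeqE => [|x]; [exact: cvg_cst|rewrite big_nil].
rewrite big_cons (_ : (fun x => _) = (fun x => f i x + \sum_(j <- r) f j x)); last first.
  by apply/funext => x; rewrite big_cons.
by apply: cvgD => //; exact: h.
Qed.

Lemma cvg_mxP m n (u : nat -> 'M[R]_(m, n)) (L : 'M[R]_(m, n)) :
  (forall i j, u k i j @[k --> \oo] --> L i j) -> u @ \oo --> L.
Proof.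
move=> h; apply/cvgrPdist_le => /= e e0; near=> k.
rewrite [leLHS]mx_normrE (bigmax_le _ (ltW e0))//= => -[i j] _ /=.
rewrite !mxE; move: i j; near: k.
have : \forall k \near \oo, forall ij : 'I_m * 'I_n, `|L ij.1 ij.2 - u k ij.1 ij.2| <= e.
  apply: filter_forall => ij.
  exact: ((cvgrPdist_le _ _).1 (h ij.1 ij.2)).
by apply: filterS => k hk i j; exact: (hk (i, j)).
Unshelve. all: by end_near. Qed.

Lemma series_exp_bound (u : nat -> R) (K a : R) : 0 <= a ->
  (forall k, `|u k| <= K * (a ^+ k / k`!%:R)) ->
  cvgn (series u) /\ `|limn (series u)| <= K * expR a.
Proof.
move=> a0 hu.
have K0 : 0 <= K.
  by have := le_trans (normr_ge0 _) (hu 0%N); rewrite expr0 fact0 divr1 mulr1.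
have cK : cvgn (series (K *: exp_coeff a)).
  by apply: is_cvg_seriesZ; exact: is_cvg_series_exp_coeff.
have cn : cvgn [normed series u].
  have v0 k : 0 <= K * (a ^+ k / k`!%:R) by rewrite mulr_ge0// divr_ge0// exprn_ge0.
  exact: (@series_le_cvg _ _ (K *: exp_coeff a) (fun k => normr_ge0 (u k)) v0 hu cK).
split; first exact: normed_cvg.
rewrite (le_trans (lim_series_norm cn))//.
have -> : K * expR a = limn (series (K *: exp_coeff a)).
  by rewrite lim_seriesZ//; exact: is_cvg_series_exp_coeff.
by apply: ler_lim => //; near=> k; apply: ler_sum => i _; exact: hu.
Unshelve. all: by end_near. Qed.

(** The entrywise l1 norm: submultiplicative, and it dominates every entry. The identity does not
    have norm 1, hence the factor [mnorm] of 1 in bounds on powers. *)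
Definition mnorm n (A : 'M[R]_n) : R := \sum_i \sum_j `|A i j|.

Lemma mnorm_ge0 n (A : 'M[R]_n) : 0 <= mnorm A.
Proof. by apply: sumr_ge0 => i _; apply: sumr_ge0 => j _. Qed.

Lemma mnorm_entry n (A : 'M[R]_n) i j : `|A i j| <= mnorm A.
Proof.
rewrite /mnorm (bigD1 i)//= (bigD1 j)//= -addrA lerDl addr_ge0//.
  by apply: sumr_ge0.
by apply: sumr_ge0 => k _; apply: sumr_ge0.
Qed.

Lemma mnormD n (A B : 'M[R]_n) : mnorm (A + B) <= mnorm A + mnorm B.
Proof.
rewrite /mnorm -big_split; apply: ler_sum => i _; rewrite -big_split.
by apply: ler_sum => j _; rewrite mxE ler_normD.
Qed.

Lemma mnormM n (A B : 'M[R]_n) : mnorm (A *m B) <= mnorm A * mnorm B.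
Proof.
rewrite {1}/mnorm.
have h i j : `|(A *m B) i j| <= \sum_k `|A i k| * `|B k j|.
  by rewrite mxE (le_trans (ler_norm_sum _ _ _))//; apply: ler_sum => k _; rewrite normrM.
have step i : \sum_j `|(A *m B) i j| <= (\sum_k `|A i k|) * mnorm B.
  apply: (@le_trans _ _ (\sum_k `|A i k| * (\sum_j `|B k j|))).
    apply: (@le_trans _ _ (\sum_j \sum_k `|A i k| * `|B k j|)).
      by apply: ler_sum => j _; exact: h.
    by rewrite exchange_big; apply: ler_sum => k _; rewrite mulr_sumr.
  rewrite mulr_suml; apply: ler_sum => k _; rewrite ler_wpM2l//.
  by rewrite /mnorm [leRHS](bigD1 k)//= lerDl; apply: sumr_ge0 => l _; apply: sumr_ge0.
by rewrite [X in _ <= X * _]/mnorm mulr_suml; apply: ler_sum => i _; exact: step.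
Qed.

Lemma mnormX n (A : 'M[R]_n) (c : R) k : mnorm A <= c ->
  mnorm (A ^+ k) <= mnorm (1%:M : 'M[R]_n) * c ^+ k.
Proof.
move=> Ac; elim: k => [|k IH]; first by rewrite !expr0 mulr1.
have c0 : 0 <= c by rewrite (le_trans _ Ac)// mnorm_ge0.
rewrite exprS (le_trans (mnormM _ _))// exprS mulrCA.
by apply: ler_pM => //; rewrite mnorm_ge0.
Qed.

Lemma mexp_series n (A : 'M[R]_n) i j :
  cvgn (series (fun k => k`!%:R^-1 * (A ^+ k) i j)).
Proof.
apply: (@series_exp_bound _ (mnorm (1%:M : 'M[R]_n)) (mnorm A) (mnorm_ge0 _) _).1 => k.
rewrite normrM ger0_norm ?invr_ge0// mulrC mulrA ler_wpM2r ?invr_ge0//.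
by rewrite (le_trans (mnorm_entry _ _ _))// mnormX.
Qed.

Lemma mexp_entry n (A : 'M[R]_n) i j :
  mexp A i j = limn (series (fun k => k`!%:R^-1 * (A ^+ k) i j)).
Proof.
pose L : 'M[R]_n := \matrix_(i, j) limn (series (fun k => k`!%:R^-1 * (A ^+ k) i j)).
suff -> : mexp A = L by rewrite mxE.
apply: cvg_lim => //; apply: cvg_mxP => a b; rewrite mxE.
rewrite (_ : (fun k => _) = series (fun k => k`!%:R^-1 * (A ^+ k) a b)); first exact: mexp_series.
apply/funext => k; rewrite /series /= summxE; apply: eq_bigr => l _.
by rewrite mxE.
Qed.

Lemma specmxX n (U : 'M[R]_n) d k : U *m U^T = 1%:M ->
  (specmx U d) ^+ k = specmx U (\row_i d ord0 i ^+ k).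
Proof.
move=> UU; elim: k => [|k IH].
  rewrite expr0 -[LHS](specmx1 UU); congr specmx; apply/rowP => i.
  by rewrite !mxE expr0.
rewrite exprS IH -[_ * _]/(_ *m _) specmxM//; congr specmx; apply/rowP => i.
by rewrite !mxE exprS.
Qed.

Lemma mexp_specmx n (U : 'M[R]_n) d : U *m U^T = 1%:M ->
  mexp (specmx U d) = specmx U (\row_i expR (d ord0 i)).
Proof.
move=> UU; apply/matrixP => i j; rewrite mexp_entry specmx_entry.
apply: cvg_lim => //.
rewrite (_ : series _ = fun N => \sum_k series (exp_coeff (d ord0 k)) N * (U k i * U k j)); last first.
  apply/funext => N; rewrite /series /=; under [RHS]eq_bigr do rewrite mulr_suml.
  rewrite exchange_big; apply: eq_bigr => l _ /=.
  rewrite specmxX// specmx_entry mulr_sumr; apply: eq_bigr => k _.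
  by rewrite mxE [LHS]mulrA; congr (_ * _); rewrite mulrC.
apply: cvg_bigsum => k; rewrite mxE; apply: cvgMr_tmp.
exact: is_cvg_series_exp_coeff.
Qed.

End exponential_series.

Section exponential_taylor.
Context {R : realType}.

Lemma expR_taylor2 (u : R) : `|expR u - (1 + u + u ^+ 2 / 2)| <= `|u| ^+ 3 * expR `|u|.
Proof.
pose w k : R := u ^+ k.+3 / k.+3`!%:R.
have hw k : `|w k| <= `|u| ^+ 3 * (`|u| ^+ k / k`!%:R).
  rewrite normrM normrX (@ger0_norm _ (_^-1)) ?invr_ge0// -addn3 exprD mulrA (mulrC (_ ^+ 3)).
  apply: ler_wpM2l; first by rewrite mulr_ge0// exprn_ge0.
  rewrite lef_pV2 ?posrE ?ltr0n ?fact_gt0// ler_nat addn3 !factS !mulnA.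
  by rewrite leq_pmull.
have [cw bw] := series_exp_bound (normr_ge0 u) hw.
suff -> : expR u - (1 + u + u ^+ 2 / 2) = limn (series w) by [].
rewrite /expR; apply/eqP; rewrite subr_eq; apply/eqP.
apply: cvg_lim => //; rewrite -(cvg_shiftn 3) /=.
rewrite (_ : (fun n => _) = fun n => series w n + (1 + u + u ^+ 2 / 2)).
  by apply: cvgD; [exact: cw|exact: cvg_cst].
apply/funext => n; rewrite /series /= addn3; elim: n => [|n IH].
  rewrite 3?big_nat_recr//= !big_geq// !add0r /exp_coeff /= fact0 expr0 expr1.
  by rewrite (_ : 1`! = 1%N :> nat)// (_ : 2`! = 2%N :> nat)// !divr1.
by rewrite big_nat_recr//= IH [in RHS]big_nat_recr//= addrAC.
Qed.

Lemma cosh_taylor (r : R) : 0 <= r -> `|(expR r + expR (- r)) / 2 - 1 - r ^+ 2 / 2| <= r ^+ 3 * expR r.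
Proof.
move=> r0; have h1 := expR_taylor2 r; have h2 := expR_taylor2 (- r).
rewrite normrN (ger0_norm r0) in h2; rewrite (ger0_norm r0) in h1.
rewrite sqrrN in h2.
move: h1 h2; rewrite !ler_norml => /andP[a b] /andP[c e]; apply/andP; split; lra.
Qed.

Lemma sinh_taylor (r : R) : 0 <= r -> `|sinh r - r| <= r ^+ 3 * expR r.
Proof.
move=> r0; have h1 := expR_taylor2 r; have h2 := expR_taylor2 (- r).
rewrite normrN (ger0_norm r0) in h2; rewrite (ger0_norm r0) in h1.
rewrite sqrrN in h2; rewrite /sinh.
move: h1 h2; rewrite !ler_norml => /andP[a b] /andP[c e]; apply/andP; split; lra.
Qed.

End exponential_taylor.

Section matrix_logarithm.
Context {R : realType}.

Lemma symP n (A : 'M[R]_n) : A^T = A -> exists U d, U *m U^T = 1%:M /\ A = specmx U d.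
Proof. exact: spectral_decomposition. Qed.

Lemma mexp_posdef n (A : 'M[R]_n) : A^T = A -> posdef (mexp A).
Proof.
move=> /symP[U [d [UU ->]]]; rewrite mexp_specmx//.
by apply: specmx_posdef => // i; rewrite mxE expR_gt0.
Qed.

Lemma det_mexp n (A : 'M[R]_n) : A^T = A -> \det (mexp A) = expR (\tr A).
Proof.
move=> /symP[U [d [UU ->]]]; rewrite mexp_specmx// det_specmx// /specmx.
rewrite mxtrace_mulC mulmxA UU mul1mx mxtrace_diag expR_sum.
by apply: eq_bigr => i _; rewrite mxE.
Qed.

Lemma invmx_mexp n (A : 'M[R]_n) : A^T = A -> invmx (mexp A) = mexp (- A).
Proof.
move=> /symP[U [d [UU ->]]]; rewrite specmxN// !mexp_specmx//.
have [|_ ->] := @specmx_unit _ _ U UU (\row_i expR (d ord0 i)).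
  by move=> i; rewrite mxE expR_gt0.
by congr specmx; apply/rowP => i; rewrite !mxE expRN.
Qed.

(** With W = U V^T between the two eigenbases, equality of the exponentials says exp(a_i) W_ij =
    W_ij exp(b_j). Wherever W_ij is nonzero a_i = b_j, so W intertwines the diagonal matrices a and
    b themselves. *)
Lemma mexp_inj n (A B : 'M[R]_n) : A^T = A -> B^T = B -> mexp A = mexp B -> A = B.
Proof.
move=> /symP[U [a [UU ->]]] /symP[V [b [VV ->]]]; rewrite !mexp_specmx//.
have UtU : U^T *m U = 1%:M by exact: mulmx1C.
have VtV : V^T *m V = 1%:M by exact: mulmx1C.
have [W WE] : exists W, W = U *m V^T by eexists.
move=> h.
have W1 : diag_mx (\row_i expR (a ord0 i)) *m W = W *m diag_mx (\row_i expR (b ord0 i)).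
  have := congr1 (fun M => U *m M *m V^T) h; rewrite /specmx !mulmxA UU mul1mx.
  by rewrite -(mulmxA _ V) VV mulmx1 WE ?mulmxA.
have W2 : diag_mx a *m W = W *m diag_mx b.
  apply/matrixP => i j; have := congr1 (fun M : 'M[R]_n => M i j) W1.
  rewrite !mul_diag_mx !mul_mx_diag !mxE.
  have [->|w0] := eqVneq (W i j) 0; first by rewrite !mulr0 !mul0r.
  by rewrite mulrC => /(mulfI w0)/expR_inj ->; rewrite mulrC.
rewrite /specmx -[LHS]mulmx1 -VtV.
transitivity (U^T *m (diag_mx a *m W) *m V); first by rewrite WE !mulmxA.
by rewrite W2 WE !mulmxA UtU mul1mx.
Qed.

Lemma mlogP n (S : 'M[R]_n) : posdef S -> (mlog S)^T = mlog S /\ mexp (mlog S) = S.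
Proof.
move=> pS; rewrite /mlog; apply: (@xgetPex _ 0 [set A : 'M[R]_n | A^T = A /\ mexp A = S]).
have [U [d [UU SE d0]]] := specP pS.
exists (specmx U (\row_i ln (d ord0 i))); split; first exact: specmx_sym.
rewrite mexp_specmx// SE; congr specmx; apply/rowP => i; rewrite !mxE lnK//.
exact: d0.
Qed.

Lemma mlogK n (A : 'M[R]_n) : A^T = A -> mlog (mexp A) = A.
Proof.
move=> sA; have [s1 e1] := mlogP (mexp_posdef sA).
exact: mexp_inj.
Qed.

Lemma quad_scalar n (l : R) (v : 'rV[R]_n) : quad l%:M v = l * dot v v.
Proof. by rewrite quadE mul_mx_scalar dotZl. Qed.

Lemma quadB n (A B : 'M[R]_n) (v : 'rV[R]_n) : quad (A - B) v = quad A v - quad B v.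
Proof. by rewrite !quadE mulmxBr dotDl dotNl. Qed.

Lemma covK_spec n (lm lp : R) (S : 'M[R]_n) : covK lm lp S ->
  exists U d, [/\ U *m U^T = 1%:M, S = specmx U d & forall i, lm <= d ord0 i <= lp].
Proof.
move=> [pS [[_ hm] [_ hp]]]; have [U [d [UU SE d0]]] := specP pS.
exists U, d; split => // i; have u1 := dot_eigen UU i.
have := hm (delta_mx ord0 i *m U); have := hp (delta_mx ord0 i *m U).
by rewrite !quadB !quad_scalar u1 SE quad_eigen// !mulr1 !subr_ge0 => -> ->.
Qed.

Lemma covK_quad_inv n (lm lp : R) (S : 'M[R]_n) v : 0 < lm -> covK lm lp S ->
  lp^-1 * dot v v <= quad (invmx S) v <= lm^-1 * dot v v.
Proof.
move=> lm0 /covK_spec[U [d [UU -> hd]]].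
have d0 i : 0 < d ord0 i by have /andP[h _] := hd i; rewrite (lt_le_trans lm0).
have [_ ->] := specmx_unit UU d0; rewrite quad_specmx// -(dot_orthogonal UU v) dotE !mulr_sumr.
have E i : (\row_k (d ord0 k)^-1) ord0 i = (d ord0 i)^-1 by rewrite mxE.
apply/andP; split; apply: ler_sum => i _; rewrite E -expr2; apply: ler_wpM2r; rewrite ?sqr_ge0//.
  by have /andP[h1 h2] := hd i; rewrite lef_pV2 ?posrE// (lt_le_trans (d0 i)).
by have /andP[h1 h2] := hd i; rewrite lef_pV2 ?posrE.
Qed.

Lemma covK_det n (lm lp : R) (S : 'M[R]_n) : 0 < lm -> covK lm lp S ->
  lm ^+ n <= \det S.
Proof.
move=> lm0 /covK_spec[U [d [UU -> hd]]]; rewrite det_specmx//.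
rewrite -[n in lm ^+ n]card_ord -prodr_const; apply: ler_prod => i _.
by rewrite ltW//=; have /andP[] := hd i.
Qed.

(** Eigenvalues of S lie in [lm, lp], so those of its logarithm are bounded. This keeps the
    covariance part of the parameter in a compact set of the chart. *)
Lemma covK_mlog_bound n (lm lp : R) : 0 < lm -> exists c, forall S : 'M[R]_n,
  covK lm lp S -> forall i j, `|mlog S i j| <= c.
Proof.
move=> lm0; exists (n%:R * (`|ln lm| + `|ln lp|)) => S KS i j.
have [U [d [UU SE hd]]] := covK_spec KS.
have d0 k : 0 < d ord0 k by have /andP[h _] := hd k; rewrite (lt_le_trans lm0).
have -> : mlog S = specmx U (\row_k ln (d ord0 k)).
  rewrite -[RHS]mlogK ?specmx_sym// mexp_specmx// SE; congr (mlog (specmx _ _)).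
  by apply/rowP => k; rewrite !mxE lnK// posrE.
rewrite specmx_entry// (le_trans (ler_norm_sum _ _ _))//.
rewrite mulr_natl -[n in leRHS]card_ord -sumr_const; apply: ler_sum => k _.
rewrite mxE normrM normrM -[leRHS]mulr1; apply: ler_pM; rewrite ?mulr_ge0//; last first.
  by rewrite mulr_ile1// entry_orthogonal.
have /andP[h1 h2] := hd k.
have l1 : ln lm <= ln (d ord0 k) by rewrite ler_ln ?posrE.
have l2 : ln (d ord0 k) <= ln lp by rewrite ler_ln ?posrE// (lt_le_trans (d0 k)).
have := ler_norm (ln lp); have := ler_norm (- ln lm); rewrite normrN => a b.
have := normr_ge0 (ln lp); have := normr_ge0 (ln lm) => c e.
by rewrite ler_norml; apply/andP; split; lra.
Qed.

End matrix_logarithm.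

(** * Second-order expansion of the matrix exponential *)

Section exponential_expansion.
Context {R : realType} {n : nat}.
Implicit Types B H K : 'M[R]_n.

(** [dpow1] and [dpow2] collect the terms of degree 1 and 2 in H of (B + H)^k without commuting
    factors, by splitting off the leftmost factor. [dpow2] is polarised, with H to the left of K, to
    make bilinearity visible. *)
Fixpoint dpow1 B H (k : nat) : 'M[R]_n :=
  if k is k'.+1 then B *m dpow1 B H k' + H *m B ^+ k' else 0.

Fixpoint dpow2 B H K (k : nat) : 'M[R]_n :=
  if k is k'.+1 then B *m dpow2 B H K k' + H *m dpow1 B K k' else 0.

Lemma dpow1_linear B a H K k : dpow1 B (a *: H + K) k = a *: dpow1 B H k + dpow1 B K k.
Proof.
elim: k => [|k IH] /=; first by rewrite scaler0 addr0.
by rewrite IH mulmxDr mulmxDl -scalemxAr -scalemxAl scalerDr addrACA.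
Qed.

Lemma dpow2_linearl B a H K L k :
  dpow2 B (a *: H + K) L k = a *: dpow2 B H L k + dpow2 B K L k.
Proof.
elim: k => [|k IH] /=; first by rewrite scaler0 addr0.
by rewrite IH mulmxDr mulmxDl -scalemxAr -scalemxAl scalerDr addrACA.
Qed.

Lemma dpow2_linearr B a H K L k :
  dpow2 B L (a *: H + K) k = a *: dpow2 B L H k + dpow2 B L K k.
Proof.
elim: k => [|k IH] /=; first by rewrite scaler0 addr0.
by rewrite IH dpow1_linear !mulmxDr -!scalemxAr scalerDr addrACA.
Qed.

Let N1 := mnorm (1%:M : 'M[R]_n).

(** The base is larger than needed for B alone so that at each step it also absorbs the new summand
    of the recursion. *)
Lemma dpow1_bound B H k : mnorm (dpow1 B H k) <= N1 * mnorm H * (2 * (mnorm B + 1)) ^+ k.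
Proof.
have b0 := mnorm_ge0 B; have h0 := mnorm_ge0 H; have n0 : 0 <= N1 := mnorm_ge0 _.
elim: k => [|k IH] /=.
  rewrite expr0 mulr1 /mnorm big1 ?mulr_ge0// => i _.
  by rewrite big1// => j _; rewrite mxE normr0.
rewrite (le_trans (mnormD _ _))//.
have h1 := mnormM B (dpow1 B H k); have h2 := mnormM H (B ^+ k).
have h3 : mnorm (B ^+ k) <= N1 * (2 * (mnorm B + 1)) ^+ k.
  by apply: mnormX; lra.
set Q := (2 * (mnorm B + 1)) ^+ k in IH h3 *.
have Q0 : 0 <= Q by rewrite exprn_ge0//; lra.
rewrite exprS -/Q.
have := ler_wpM2l b0 IH; have := ler_wpM2l h0 h3 => a1 a2.
have a3 : 0 <= N1 * mnorm H * Q by rewrite !mulr_ge0.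
have : 0 <= N1 * mnorm H * Q * mnorm B by rewrite mulr_ge0.
lra.
Qed.

Lemma dpow2_bound B H K k :
  mnorm (dpow2 B H K k) <= N1 * mnorm H * mnorm K * (2 * (mnorm B + 1)) ^+ k.
Proof.
have b0 := mnorm_ge0 B; have h0 := mnorm_ge0 H; have n0 : 0 <= N1 := mnorm_ge0 _.
have k0 := mnorm_ge0 K.
elim: k => [|k IH] /=.
  rewrite expr0 mulr1 /mnorm big1 ?mulr_ge0// => i _.
  by rewrite big1// => j _; rewrite mxE normr0.
rewrite (le_trans (mnormD _ _))//.
have h1 := mnormM B (dpow2 B H K k); have h2 := mnormM H (dpow1 B K k).
have h3 := dpow1_bound B K k.
set Q := (2 * (mnorm B + 1)) ^+ k in IH h3 *.
have Q0 : 0 <= Q by rewrite exprn_ge0//; lra.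
rewrite exprS -/Q.
have := ler_wpM2l b0 IH; have := ler_wpM2l h0 h3 => a1 a2.
have a3 : 0 <= N1 * mnorm H * mnorm K * Q by rewrite !mulr_ge0.
have : 0 <= N1 * mnorm H * mnorm K * Q * mnorm B by rewrite mulr_ge0.
lra.
Qed.

Definition rpow B H k := (B + H) ^+ k - B ^+ k - dpow1 B H k - dpow2 B H H k.

Lemma rpowS B H k : rpow B H k.+1 = (B + H) *m rpow B H k + H *m dpow2 B H H k.
Proof.
have -> : rpow B H k.+1 = (B + H) *m (B + H) ^+ k - B *m B ^+ k - (B *m dpow1 B H k + H *m B ^+ k) -
  (B *m dpow2 B H H k + H *m dpow1 B H k) by rewrite /rpow !exprS.
rewrite /rpow !mulmxBr !mulmxDl.
set a1 := B *m (B + H) ^+ k; set a2 := H *m (B + H) ^+ k; set a3 := B *m B ^+ k.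
set a4 := H *m B ^+ k; set a5 := B *m dpow1 _ _ _; set a6 := H *m dpow1 _ _ _.
set a7 := B *m dpow2 _ _ _ _; set a8 := H *m dpow2 _ _ _ _.
by apply/matrixP => i j; rewrite !mxE; ring.
Qed.

Lemma rpow_bound B H k : mnorm H <= 1 ->
  mnorm (rpow B H k) <= N1 * mnorm H ^+ 3 * (2 * (mnorm B + 1)) ^+ k.
Proof.
move=> H1.
have b0 := mnorm_ge0 B; have h0 := mnorm_ge0 H; have n0 : 0 <= N1 := mnorm_ge0 _.
elim: k => [|k IH].
  rewrite expr0 mulr1 /rpow !expr0 /= subrr !subr0 /mnorm big1 ?mulr_ge0 ?exprn_ge0// => i _.
  by rewrite big1// => j _; rewrite mxE normr0.
rewrite rpowS (le_trans (mnormD _ _))//.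
have h1 := mnormM (B + H) (rpow B H k); have h2 := mnormM H (dpow2 B H H k).
have h3 := dpow2_bound B H H k; have h4 := mnormD B H.
set Q := (2 * (mnorm B + 1)) ^+ k in IH h3 *.
have Q0 : 0 <= Q by rewrite exprn_ge0//; lra.
rewrite [X in _ <= _ * X]exprS -/Q.
have a1 := ler_wpM2l h0 h3.
have a2 : mnorm (B + H) * mnorm (rpow B H k) <= (mnorm B + 1) * (N1 * mnorm H ^+ 3 * Q).
  by apply: ler_pM; rewrite ?mnorm_ge0//; lra.
have a3 : 0 <= N1 * mnorm H ^+ 3 * Q.
  by apply: mulr_ge0 => //; apply: mulr_ge0 => //; exact: exprn_ge0.
have : 0 <= N1 * mnorm H ^+ 3 * Q * mnorm B by rewrite mulr_ge0.
lra.
Qed.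

Let ser (u : nat -> 'M[R]_n) i j := limn (series (fun k => k`!%:R^-1 * u k i j)).

Let ser_bound (u : nat -> 'M[R]_n) (c a : R) i j : 0 <= a ->
  (forall k, mnorm (u k) <= c * a ^+ k) ->
  cvgn (series (fun k => k`!%:R^-1 * u k i j)) /\ `|ser u i j| <= c * expR a.
Proof.
move=> a0 hu; apply: series_exp_bound => // k.
rewrite normrM ger0_norm ?invr_ge0// mulrC mulrA ler_wpM2r ?invr_ge0//.
exact: le_trans (mnorm_entry _ _ _) (hu k).
Qed.

Let ser_linear (u v : nat -> 'M[R]_n) (a : R) i j :
  cvgn (series (fun k => k`!%:R^-1 * u k i j)) ->
  cvgn (series (fun k => k`!%:R^-1 * v k i j)) ->
  ser (fun k => a *: u k + v k) i j = a * ser u i j + ser v i j.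
Proof.
move=> cu cv; rewrite /ser; apply: cvg_lim => //.
rewrite (_ : series _ = fun N => a * series (fun k => k`!%:R^-1 * u k i j) N +
    series (fun k => k`!%:R^-1 * v k i j) N).
  by apply: cvgD; [apply: cvgMl_tmp; exact: cu|exact: cv].
apply/funext => N; rewrite /series /= mulr_sumr -big_split; apply: eq_bigr => k _ /=.
by rewrite !mxE mulrDr mulrCA.
Qed.

(** Dividing the expansion of each power by k! and summing: the geometric bounds on the terms and on
    the remainder become exponential series. Only linearity of L and bilinearity of Q are
    retained. *)
Lemma mexp_expansion B i j : exists (L : 'M[R]_n -> R) (Q : 'M[R]_n -> 'M[R]_n -> R) (C : R),
  [/\ forall a H K, L (a *: H + K) = a * L H + L K,
      forall a H K M, Q (a *: H + K) M = a * Q H M + Q K M,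
      forall a H K M, Q M (a *: H + K) = a * Q M H + Q M K &
      forall H, mnorm H <= 1 ->
        `|mexp (B + H) i j - mexp B i j - L H - Q H H| <= C * mnorm H ^+ 3].
Proof.
have a0 : 0 <= 2 * (mnorm B + 1) by have := mnorm_ge0 B; lra.
have [c1 _] : (forall H, cvgn (series (fun k => k`!%:R^-1 * dpow1 B H k i j))) /\ True.
  by split => // H; have [] := ser_bound i j a0 (dpow1_bound B H).
have [c2 _] : (forall H K, cvgn (series (fun k => k`!%:R^-1 * dpow2 B H K k i j))) /\ True.
  by split => // H K; have [] := ser_bound i j a0 (dpow2_bound B H K).
exists (fun H => ser (dpow1 B H) i j), (fun H K => ser (dpow2 B H K) i j), (N1 * expR (2 * (mnorm B + 1))); split.
- move=> a H K; rewrite -ser_linear//; congr (limn (series _)); apply/funext => k.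
  by rewrite dpow1_linear.
- move=> a H K M; rewrite -ser_linear//; congr (limn (series _)); apply/funext => k.
  by rewrite dpow2_linearl.
- move=> a H K M; rewrite -ser_linear//; congr (limn (series _)); apply/funext => k.
  by rewrite dpow2_linearr.
move=> H H1; have [c3 b3] := ser_bound i j a0 (fun k => rpow_bound B k H1).
suff -> : mexp (B + H) i j - mexp B i j - ser (dpow1 B H) i j - ser (dpow2 B H H) i j = ser (rpow B H) i j.
  by rewrite mulrAC.
have cB := @mexp_series _ _ B i j.
have e1 : ser (fun k => 1 *: dpow1 B H k + dpow2 B H H k) i j = 1 * ser (dpow1 B H) i j + ser (dpow2 B H H) i j.
  exact: ser_linear.
have c12 : cvgn (series (fun k => k`!%:R^-1 * (1 *: dpow1 B H k + dpow2 B H H k) i j)).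
  rewrite (_ : (fun k => _) = (fun k => k`!%:R^-1 * dpow1 B H k i j) + (fun k => k`!%:R^-1 * dpow2 B H H k i j)).
    exact: is_cvg_seriesD.
  by apply/funext => k; rewrite scale1r mxE mulrDr.
have e2 : ser (fun k => 1 *: (1 *: dpow1 B H k + dpow2 B H H k) + B ^+ k) i j = 1 * ser (fun k => 1 *: dpow1 B H k + dpow2 B H H k) i j + ser (fun k => B ^+ k) i j.
  exact: ser_linear.
have c123 : cvgn (series (fun k => k`!%:R^-1 * (1 *: (1 *: dpow1 B H k + dpow2 B H H k) + B ^+ k) i j)).
  rewrite (_ : (fun k => _) = (fun k => k`!%:R^-1 * (1 *: dpow1 B H k + dpow2 B H H k) i j) + (fun k => k`!%:R^-1 * (B ^+ k) i j)).
    exact: is_cvg_seriesD.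
  by apply/funext => k; rewrite [in LHS]scale1r mxE mulrDr.
have e3 : ser (fun k => 1 *: rpow B H k + (1 *: (1 *: dpow1 B H k + dpow2 B H H k) + B ^+ k)) i j =
   1 * ser (rpow B H) i j + ser (fun k => 1 *: (1 *: dpow1 B H k + dpow2 B H H k) + B ^+ k) i j.
  exact: ser_linear.
have e4 : ser (fun k => 1 *: rpow B H k + (1 *: (1 *: dpow1 B H k + dpow2 B H H k) + B ^+ k)) i j = mexp (B + H) i j.
  rewrite mexp_entry; congr (limn (series _)); apply/funext => k; congr (_ * _).
  rewrite !scale1r /rpow !mxE; ring.
rewrite -e4 e3 e2 e1 (mexp_entry B) /ser; ring.
Qed.

End exponential_expansion.

(** * Weighted second-order expansions *)

Section jets.
Context {R : realType} {disp : measure_display} {T : measurableType disp} {p : nat}.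
Variable D : set T.
Implicit Types (w : T -> R).

(* The weight w controls the growth in x of the coefficients and of the remainder. *)
Definition jet w (f : 'rV[R]_p -> T -> R) (f0 : T -> R) (f1 : T -> 'rV[R]_p) (f2 : T -> 'M[R]_p) : Prop :=
  [/\ measurable_fun setT f0, measurable_fun setT (f1 : T -> borel R 1 p),
      measurable_fun setT (f2 : T -> borel R p p) &
      exists C rho, [/\ 0 < C, 0 < rho &
        forall x, D x ->
          [/\ 0 <= w x, `|f0 x| <= C * w x, enorm (f1 x) <= C * w x, mnorm (f2 x) <= C * w x &
          forall h, enorm h <= rho ->
            `|f h x - (f0 x + dot (f1 x) h + quad (f2 x) h)| <= C * w x * enorm h ^+ 3]]].

Definition has_jet w f := exists f0 f1 f2, jet w f f0 f1 f2.

Lemma normM_le (a b A B : R) : `|a| <= A -> `|b| <= B -> `|a * b| <= A * B.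
Proof. by move=> ha hb; rewrite normrM ler_pM. Qed.

Lemma normD_le (a b A B : R) : `|a| <= A -> `|b| <= B -> `|a + b| <= A + B.
Proof. by move=> ha hb; rewrite (le_trans (ler_normD _ _))// lerD. Qed.

Lemma quad_bound n (M : 'M[R]_n) h : `|quad M h| <= mnorm M * enorm h ^+ 2.
Proof.
rewrite quadE dotE (le_trans (ler_norm_sum _ _ _))//.
rewrite /mnorm exchange_big mulr_suml; apply: ler_sum => j _.
rewrite mxE mulr_suml (le_trans (ler_norm_sum _ _ _))// mulr_suml; apply: ler_sum => i _.
rewrite !normrM mulrAC mulrC; apply: ler_wpM2l => //.
by rewrite expr2; apply: ler_pM => //; exact: enorm_coord.
Qed.

Lemma jet_bounds C (w0 : R) (f0 : R) (f1 : 'rV[R]_p) (f2 : 'M[R]_p) h :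
  `|f0| <= C * w0 -> enorm f1 <= C * w0 -> mnorm f2 <= C * w0 ->
  `|dot f1 h| <= C * w0 * enorm h /\ `|quad f2 h| <= C * w0 * enorm h ^+ 2.
Proof.
move=> b0 b1 b2; split.
  by rewrite (le_trans (ler_dot _ _))// ler_wpM2r ?enorm_ge0.
by rewrite (le_trans (quad_bound _ _))// ler_wpM2r ?sqr_ge0.
Qed.

Lemma quadDl n (A B : 'M[R]_n) h : quad (A + B) h = quad A h + quad B h.
Proof. by rewrite !quadE mulmxDr dotDl. Qed.

Lemma quadZl n c (A : 'M[R]_n) h : quad (c *: A) h = c * quad A h.
Proof. by rewrite !quadE -scalemxAr dotZl. Qed.

Lemma quad_outer n (u v h : 'rV[R]_n) : quad (u^T *m v) h = dot u h * dot v h.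
Proof.
rewrite quadE mulmxA -[(h *m u^T)]/(h *m u^T) [h *m u^T]mx11_scalar mul_scalar_mx dotZl.
by rewrite -/(dot h u) dotC.
Qed.

Lemma mnormZ n c (A : 'M[R]_n) : mnorm (c *: A) = `|c| * mnorm A.
Proof.
rewrite /mnorm mulr_sumr; apply: eq_bigr => i _; rewrite mulr_sumr.
by apply: eq_bigr => j _; rewrite mxE normrM.
Qed.

Lemma mnorm_outer n (u v : 'rV[R]_n) : mnorm (u^T *m v) <= n%:R ^+ 2 * (enorm u * enorm v).
Proof.
have -> : n%:R ^+ 2 * (enorm u * enorm v) = \sum_(i < n) \sum_(j < n) (enorm u * enorm v).
  by rewrite !sumr_const !card_ord -mulrnA -[RHS]mulr_natl natrM expr2.
rewrite /mnorm; apply: ler_sum => i _; apply: ler_sum => j _.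
by rewrite mxE big_ord1 mxE normrM; apply: ler_pM => //; exact: enorm_coord.
Qed.

Lemma jet_ext w f g f0 f1 f2 r : 0 < r ->
  (forall h x, D x -> enorm h <= r -> f h x = g h x) ->
  jet w f f0 f1 f2 -> jet w g f0 f1 f2.
Proof.
move=> r0 fg [m0 m1 m2 [C [rho [C0 rho0 H]]]]; split => //.
exists C, (Num.min rho r); split => //; first by rewrite lt_min rho0.
move=> x Dx; have [w0 b0 b1 b2 b3] := H x Dx; split => // h.
by rewrite le_min => /andP[h1 h2]; rewrite -fg// b3.
Qed.

Lemma has_jet_ext w f g r : 0 < r ->
  (forall h x, D x -> enorm h <= r -> f h x = g h x) -> has_jet w f -> has_jet w g.
Proof. by move=> r0 fg [f0 [f1 [f2 H]]]; exists f0, f1, f2; exact: (jet_ext r0 fg H). Qed.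

Lemma has_jet_weaken w w' f K : 0 < K -> (forall x, D x -> w x <= K * w' x) ->
  has_jet w f -> has_jet w' f.
Proof.
move=> K0 ww [f0 [f1 [f2 [m0 m1 m2 [C [rho [C0 rho0 H]]]]]]]; exists f0, f1, f2; split => //.
exists (C * K), rho; split => //; first exact: mulr_gt0.
move=> x Dx; have [w0 b0 b1 b2 b3] := H x Dx.
have hw : C * w x <= C * K * w' x by rewrite -mulrA ler_wpM2l ?ww// ltW.
have w'0 : 0 <= w' x by rewrite -(pmulr_rge0 _ K0) (le_trans w0)// ww.
split; rewrite ?(le_trans _ hw)// => h /b3 hb; rewrite (le_trans hb)//.
by rewrite ler_wpM2r// exprn_ge0// enorm_ge0.
Qed.

Lemma has_jet_fun w (a : T -> R) C : 0 < C -> measurable_fun setT a ->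
  (forall x, D x -> 0 <= w x /\ `|a x| <= C * w x) -> has_jet w (fun=> a).
Proof.
move=> C0 ma H; exists a, (fun=> 0), (fun=> 0); split => //; try exact: measurable_cstmx.
exists C, 1; split => // x /H[w0 ab]; have Cw : 0 <= C * w x by rewrite mulr_ge0// ltW.
have q0 : quad (0 : 'M[R]_p) = fun=> 0.
  by apply/funext => h; rewrite quadE mulmx0 dot0l.
split => //; rewrite ?enorm0// /mnorm ?big1//.
  by move=> i _; rewrite big1// => j _; rewrite mxE normr0.
move=> h _; rewrite dot0l q0 !addr0 subrr normr0.
by rewrite mulr_ge0// exprn_ge0// enorm_ge0.
Qed.

Lemma has_jet_D w f g : has_jet w f -> has_jet w g -> has_jet w (fun h x => f h x + g h x).
Proof.
move=> [f0 [f1 [f2 [m0 m1 m2 [C [rho [C0 rho0 H]]]]]]].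
move=> [g0 [g1 [g2 [k0 k1 k2 [C' [rho' [C'0 rho'0 H']]]]]]].
exists (fun x => f0 x + g0 x), (fun x => f1 x + g1 x), (fun x => f2 x + g2 x); split.
- exact: measurable_funD.
- exact: measurable_addmx.
- exact: measurable_addmx.
exists (C + C'), (Num.min rho rho'); split; [exact: addr_gt0|by rewrite lt_min rho0|].
move=> x Dx; have [w0 b0 b1 b2 b3] := H x Dx; have [_ c0 c1 c2 c3] := H' x Dx.
rewrite mulrDl; split => //.
- exact: normD_le.
- by rewrite (le_trans (enormD _ _))// lerD.
- by rewrite (le_trans (mnormD _ _))// lerD.
move=> h; rewrite le_min => /andP[h1 h2].
rewrite mulrDl dotDl quadDl.
set a := (X in `|X| <= _); have -> : a = (f h x - (f0 x + dot (f1 x) h + quad (f2 x) h)) + (g h x - (g0 x + dot (g1 x) h + quad (g2 x) h)).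
  by rewrite /a; ring.
by apply: normD_le; [exact: b3|exact: c3].
Qed.

(** Weights multiply; for |h| <= 1 all products of order three or more are absorbed by |h|^3. *)
Lemma has_jet_M w w' f g : has_jet w f -> has_jet w' g ->
  has_jet (fun x => w x * w' x) (fun h x => f h x * g h x).
Proof.
move=> [f0 [f1 [f2 [m0 m1 m2 [C [rho [C0 rho0 H]]]]]]].
move=> [g0 [g1 [g2 [k0 k1 k2 [C' [rho' [C'0 rho'0 H']]]]]]].
exists (fun x => f0 x * g0 x), (fun x => f0 x *: g1 x + g0 x *: f1 x),
  (fun x => (f0 x *: g2 x + g0 x *: f2 x) + (f1 x)^T *m g1 x); split.
- exact: measurable_funM.
- by apply: measurable_addmx; apply: measurable_scalemx.
- apply: measurable_addmx; first by apply: measurable_addmx; apply: measurable_scalemx.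
  apply: measurable_mulmx => //.
  by apply: measurable_mxP => i j; under eq_fun do rewrite mxE; exact: measurable_entry.
(* Ten counts the products in the remainder: three of first- and second-order terms, four with the
   remainder of f, three with that of g. The square of p comes from the entries of the outer product
   of the gradients. *)
pose N : R := 10 + p%:R ^+ 2.
have N10 : 10 <= N by rewrite /N lerDl sqr_ge0.
have CC : 0 < C * C' by exact: mulr_gt0.
exists (N * (C * C')), (Num.min 1 (Num.min rho rho')); split; first by rewrite mulr_gt0//; lra.
  by rewrite !lt_min rho0 rho'0 ltr01.
move=> x Dx; have [w0 b0 b1 b2 b3] := H x Dx; have [w'0 c0 c1 c2 c3] := H' x Dx.
have -> : N * (C * C') * (w x * w' x) = N * ((C * w x) * (C' * w' x)) by ring.
set E := C * w x in b0 b1 b2 b3 *; set E' := C' * w' x in c0 c1 c2 c3 *.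
have E0 : 0 <= E by rewrite mulr_ge0// ltW.
have E'0 : 0 <= E' by rewrite mulr_ge0// ltW.
have EE : 0 <= E * E' by exact: mulr_ge0.
have pEE : 0 <= p%:R ^+ 2 * (E * E') by rewrite mulr_ge0// sqr_ge0.
have NE : N * (E * E') = 10 * (E * E') + p%:R ^+ 2 * (E * E') by rewrite /N mulrDl.
split.
- exact: mulr_ge0.
- by have := normM_le b0 c0; rewrite NE; lra.
- rewrite (le_trans (enormD _ _))// !enormZ.
  have h1 := ler_pM (normr_ge0 _) (enorm_ge0 _) b0 c1.
  have h2 := ler_pM (normr_ge0 _) (enorm_ge0 _) c0 b1.
  by rewrite NE; lra.
- rewrite (le_trans (mnormD _ _))//.
  have h0 := mnormD (f0 x *: g2 x) (g0 x *: f2 x); rewrite !mnormZ in h0.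
  have h1 := ler_pM (normr_ge0 _) (mnorm_ge0 _) b0 c2.
  have h2 := ler_pM (normr_ge0 _) (mnorm_ge0 _) c0 b2.
  have h3 := mnorm_outer (f1 x) (g1 x).
  have h4 : p%:R ^+ 2 * (enorm (f1 x) * enorm (g1 x)) <= p%:R ^+ 2 * (E * E').
    by rewrite ler_wpM2l ?sqr_ge0// ler_pM ?enorm_ge0.
  by rewrite NE; lra.
move=> h; rewrite !le_min => /and3P[h1 hr hr'].
have {b3}b3 := b3 h hr; have {c3}c3 := c3 h hr'.
have [a1 a2] := jet_bounds h b0 b1 b2; have [d1 d2] := jet_bounds h c0 c1 c2.
rewrite -/E in a1 a2; rewrite -/E' in d1 d2.
rewrite !(dotDl, dotZl, quadDl, quadZl) quad_outer.
set t := enorm h in h1 a1 a2 d1 d2 b3 c3 *.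
have t0 : 0 <= t by exact: enorm_ge0.
set F1 := dot (f1 x) h in a1 b3 *; set F2 := quad (f2 x) h in a2 b3 *.
set G1 := dot (g1 x) h in d1 c3 *; set G2 := quad (g2 x) h in d2 c3 *.
set r := f h x - _ in b3; set s := g h x - _ in c3.
have fE : f h x = f0 x + F1 + F2 + r by rewrite /r; ring.
have gE : g h x = g0 x + G1 + G2 + s by rewrite /s; ring.
rewrite fE gE.
have t2 : t ^+ 2 <= 1 by rewrite expr_le1.
have t3 : 0 <= t ^+ 3 by rewrite exprn_ge0.
have t31 : t ^+ 3 <= 1 by rewrite expr_le1.
have le1 (A B : R) : 0 <= A -> B <= 1 -> A * B <= A by move=> ? ?; rewrite ler_piMr.
have ->: (f0 x + F1 + F2 + r) * (g0 x + G1 + G2 + s) - (f0 x * g0 x + (f0 x * G1 + g0 x * F1) +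
   (f0 x * G2 + g0 x * F2 + F1 * G1)) = F1 * G2 + F2 * G1 + F2 * G2 + r * (g0 x + G1 + G2 + s) + (f0 x + F1 + F2) * s.
  by ring.
have e1 := normM_le a1 d2; have e2 := normM_le a2 d1; have e3 := normM_le a2 d2.
have F1' : `|F1| <= E by rewrite (le_trans a1)// le1.
have F2' : `|F2| <= E by rewrite (le_trans a2)// le1.
have G1' : `|G1| <= E' by rewrite (le_trans d1)// le1.
have G2' : `|G2| <= E' by rewrite (le_trans d2)// le1.
have s' : `|s| <= E' by rewrite (le_trans c3)// le1.
have e4 := normM_le b3 (normD_le (normD_le (normD_le c0 G1') G2') s').
have e5 := normM_le (normD_le (normD_le b0 F1') F2') c3.
have e6 := normD_le (normD_le (normD_le (normD_le e1 e2) e3) e4) e5.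
rewrite (le_trans e6)//.
have t43 : t ^+ 4 <= t ^+ 3 by rewrite (exprS t 3) ler_piMl.
have h43 : E * E' * t ^+ 4 <= E * E' * t ^+ 3 by rewrite ler_wpM2l.
have hp : 0 <= p%:R ^+ 2 * (E * E') * t ^+ 3 by rewrite mulr_ge0.
rewrite NE; lra.
Qed.

Definition has_gjet w (g : T -> R -> R) := exists g0 g1 g2 : T -> R,
  [/\ measurable_fun setT g0, measurable_fun setT g1, measurable_fun setT g2 &
   exists C r, [/\ 0 < C, 0 < r & forall x, D x ->
     [/\ 0 <= w x, `|g0 x| <= C * w x, `|g1 x| <= C * w x, `|g2 x| <= C * w x &
     forall e, `|e| <= r -> `|g x e - (g0 x + g1 x * e + g2 x * e ^+ 2)| <= C * w x * `|e| ^+ 3]]].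

(** Chain rule: since f vanishes at h = 0, its value is O(|h|) uniformly in x and stays in the range
    where g is expanded. *)
Lemma has_jet_comp w (g : T -> R -> R) f :
  has_gjet w g -> has_jet (fun=> 1) f -> (forall x, D x -> f 0 x = 0) ->
  has_jet w (fun h x => g x (f h x)).
Proof.
move=> [g0 [g1 [g2 [k0 k1 k2 [C' [r [C'0 r0 H']]]]]]].
move=> [f0 [f1 [f2 [m0 m1 m2 [C [rho [C0 rho0 H]]]]]]] fx0.
exists g0, (fun x => g1 x *: f1 x), (fun x => g1 x *: f2 x + g2 x *: ((f1 x)^T *m f1 x)); split => //.
- exact: measurable_scalemx.
- apply: measurable_addmx; first exact: measurable_scalemx.
  apply: measurable_scalemx => //; apply: measurable_mulmx => //.
  by apply: measurable_mxP => i j; under eq_fun do rewrite mxE; exact: measurable_entry.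
(* 27 C^3 comes from |f| <= 3 C |h| cubed, 8 C^2 from the difference between f^2 and the square of
   its linear part, C from the remainder and coefficients of f, p^2 C^2 from the outer product, 1
   from g0. *)
pose K := 1 + C + 27 * C ^+ 3 + 8 * C ^+ 2 + p%:R ^+ 2 * C ^+ 2.
have C20 : 0 <= C ^+ 2 by rewrite sqr_ge0.
have C30 : 0 <= C ^+ 3 by rewrite exprn_ge0// ltW.
have pC : 0 <= p%:R ^+ 2 * C ^+ 2 by rewrite mulr_ge0// sqr_ge0.
have K1 : 1 <= K by rewrite /K; lra.
(* The radius r / (3 C) forces |f h x| <= r. *)
exists (K * C'), (Num.min 1 (Num.min rho (r / (3 * C)))); split.
- by rewrite mulr_gt0//; lra.
- by rewrite !lt_min ltr01 rho0 divr_gt0// mulr_gt0.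
move=> x Dx; have [_ b0 b1 b2 b3] := H x Dx; have [w0 c0 c1 c2 c3] := H' x Dx.
rewrite mulr1 in b0 b1 b2.
rewrite -mulrA; set E' := C' * w x in c0 c1 c2 c3 *.
have E0 : 0 <= E' by rewrite mulr_ge0// ltW.
have CE : 0 <= C * E' by rewrite mulr_ge0// ltW.
have C2E : 0 <= C ^+ 2 * E' by rewrite mulr_ge0.
have C3E : 0 <= C ^+ 3 * E' by rewrite mulr_ge0.
have pCE : 0 <= p%:R ^+ 2 * C ^+ 2 * E' by rewrite mulr_ge0.
have KE : K * E' = E' + C * E' + 27 * (C ^+ 3 * E') + 8 * (C ^+ 2 * E') + p%:R ^+ 2 * C ^+ 2 * E'.
  by rewrite /K; ring.
have f00 : f0 x = 0.
  have := b3 0; rewrite enorm0 => /(_ (ltW rho0)).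
  rewrite fx0// dot0r quadE mul0mx dot0l !addr0 expr0n mulr0 sub0r normrN normr_le0.
  by move=> /eqP.
split => //.
- by rewrite KE; lra.
- rewrite enormZ; have := ler_pM (normr_ge0 _) (enorm_ge0 _) c1 b1; rewrite KE; lra.
- rewrite (le_trans (mnormD _ _))// !mnormZ.
  have h1 := ler_pM (normr_ge0 _) (mnorm_ge0 _) c1 b2.
  have h2 := mnorm_outer (f1 x) (f1 x).
  have h3 : p%:R ^+ 2 * (enorm (f1 x) * enorm (f1 x)) <= p%:R ^+ 2 * C ^+ 2.
    by rewrite ler_wpM2l ?sqr_ge0// expr2 ler_pM ?enorm_ge0.
  have h4 := ler_pM (normr_ge0 _) (mnorm_ge0 _) c2 (le_trans h2 h3).
  by rewrite KE; lra.
move=> h; rewrite !le_min => /and3P[h1 hr hr'].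
have {b3}b3 := b3 h hr; have [a1 a2] := @jet_bounds C 1 0 (f1 x) (f2 x) h
  ltac:(by rewrite normr0 mulr1 ltW) ltac:(by rewrite mulr1) ltac:(by rewrite mulr1).
rewrite mulr1 in a1 a2 b3.
rewrite !(dotZl, quadDl, quadZl) quad_outer.
set t := enorm h in h1 hr' a1 a2 b3 *.
have t0 : 0 <= t by exact: enorm_ge0.
set F1 := dot (f1 x) h in a1 b3 *; set F2 := quad (f2 x) h in a2 b3 *.
set s := f h x - _ in b3.
have fE : f h x = F1 + F2 + s by rewrite /s f00; ring.
have t1 : t ^+ 2 <= t by rewrite expr2 ler_piMl.
have t31 : t ^+ 3 <= t by rewrite exprS ler_piMr// expr_le1.
have t32 : t ^+ 3 <= t ^+ 2 by rewrite exprS ler_piMl// sqr_ge0.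
have Ct : 0 <= C * t by rewrite mulr_ge0// ltW.
have g2t : C * t ^+ 2 <= C * t by rewrite ler_wpM2l// ltW.
have g3t : C * t ^+ 3 <= C * t by rewrite ler_wpM2l// ltW.
have g32t : C * t ^+ 3 <= C * t ^+ 2 by rewrite ler_wpM2l// ltW.
have feps : `|f h x| <= 3 * C * t.
  by rewrite fE; have := normD_le (normD_le a1 a2) b3; lra.
have fr : `|f h x| <= r.
  rewrite (le_trans feps)// mulrC -ler_pdivlMr// ?mulr_gt0//.
have gr := c3 _ fr.
have -> : g x (f h x) - (g0 x + g1 x * F1 + (g1 x * F2 + g2 x * (F1 * F1))) =
  (g x (f h x) - (g0 x + g1 x * f h x + g2 x * f h x ^+ 2)) + g1 x * s + g2 x * ((F2 + s) * (F1 + f h x)).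
  by rewrite fE; ring.
have e1 : E' * `|f h x| ^+ 3 <= 27 * (C ^+ 3 * E') * t ^+ 3.
  have : `|f h x| ^+ 3 <= (3 * C * t) ^+ 3 by rewrite lerXn2r ?nnegrE ?(le_trans _ feps).
  move=> /(ler_wpM2l E0) /le_trans; apply.
  by rewrite !exprMn (_ : (3 : R) ^+ 3 = 27); [lra|ring].
have e2 := normM_le c1 b3.
have e3 := normM_le c2 (normM_le (normD_le a2 b3) (normD_le a1 feps)).
have e4 : E' * ((C * t ^+ 2 + C * t ^+ 3) * (C * t + 3 * C * t)) <= 8 * (C ^+ 2 * E') * t ^+ 3.
  have : (C * t ^+ 2 + C * t ^+ 3) * (C * t + 3 * C * t) <= (2 * (C * t ^+ 2)) * (4 * (C * t)).
    by apply: ler_pM; rewrite ?addr_ge0 ?mulr_ge0 ?exprn_ge0// ?(ltW C0)//; lra.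
  move=> /(ler_wpM2l E0) /le_trans; apply.
  by rewrite [leRHS](_ : _ = E' * (2 * (C * t ^+ 2) * (4 * (C * t))))//; ring.
have e5 := normD_le (normD_le (le_trans gr e1) e2) (le_trans e3 e4).
rewrite (le_trans e5)// KE.
have t3 : 0 <= t ^+ 3 by rewrite exprn_ge0.
have := mulr_ge0 E0 t3; have := mulr_ge0 pCE t3; lra.
Qed.

Lemma has_jet_poly (c : R) (u : 'rV[R]_p) (M : 'M[R]_p) (f : 'rV[R]_p -> R) C rho : 0 < rho -> 0 <= C ->
  (forall h, enorm h <= rho -> `|f h - (c + dot u h + quad M h)| <= C * enorm h ^+ 3) ->
  has_jet (fun=> 1) (fun h _ => f h).
Proof.
move=> rho0 C0 H; exists (fun=> c), (fun=> u), (fun=> M); split.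
- exact: measurable_cst.
- exact: measurable_cstmx.
- exact: measurable_cstmx.
exists (C + `|c| + enorm u + mnorm M + 1), rho; split => //.
  by rewrite ltr_pwDr// !addr_ge0// ?enorm_ge0 ?mnorm_ge0.
have := normr_ge0 c; have := enorm_ge0 u; have := mnorm_ge0 M => a1 a2 a3.
move=> x _; rewrite !mulr1; split; [exact: ler01|lra|lra|lra|].
move=> h hr; rewrite (le_trans (H h hr))// ler_wpM2r ?exprn_ge0 ?enorm_ge0//; lra.
Qed.

Lemma has_jet_lin (u : 'rV[R]_p) : has_jet (fun=> 1) (fun h _ => dot u h).
Proof.
apply: (@has_jet_poly 0 u 0 _ 0 1) => // h _.
by rewrite quadE mulmx0 dot0l add0r addr0 subrr normr0 mul0r.
Qed.

Lemma has_jet_cst (c : R) : has_jet (fun=> 1) (fun _ _ => c).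
Proof.
apply: (@has_jet_poly c 0 0 _ 0 1) => // h _.
by rewrite quadE mulmx0 !dot0l !addr0 subrr normr0 mul0r.
Qed.

Lemma has_jet_N w f : has_jet w f -> has_jet w (fun h x => - f h x).
Proof.
move=> /(has_jet_M (has_jet_cst (-1))); rewrite (_ : (fun x => 1 * w x) = w).
  apply: (@has_jet_ext _ _ _ 1) => // h x _ _; exact: mulN1r.
by apply/funext => x; rewrite mul1r.
Qed.

Lemma has_jet_sum w (I : Type) (s : seq I) (F : I -> 'rV[R]_p -> T -> R) :
  (forall x, D x -> 0 <= w x) ->
  (forall i, has_jet w (F i)) -> has_jet w (fun h x => \sum_(i <- s) F i h x).
Proof.
move=> w0 HF; elim: s => [|i s IH].
  apply: (@has_jet_ext _ (fun _ _ => 0) _ 1) => // [h x _ _|]; first by rewrite big_nil.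
  apply: (@has_jet_fun _ _ 1) => // x /w0 h; split => //.
  by rewrite normr0 mul1r.
apply: (@has_jet_ext _ (fun h x => F i h x + \sum_(j <- s) F j h x) _ 1) => // [h x _ _|].
  by rewrite big_cons.
exact: has_jet_D.
Qed.

Lemma has_jet_Ml w f g : has_jet (fun=> 1) f -> has_jet w g ->
  has_jet w (fun h x => f h x * g h x).
Proof.
move=> hf hg; have := has_jet_M hf hg.
by rewrite (_ : (fun x => 1 * w x) = w)//; apply/funext => x; rewrite mul1r.
Qed.

Lemma has_jet_lip w f : has_jet w f -> exists C rho, [/\ 0 < C, 0 < rho &
  forall x h, D x -> enorm h <= rho -> `|f h x - f 0 x| <= C * w x * enorm h].
Proof.
move=> [f0 [f1 [f2 [m0 m1 m2 [C [rho [C0 rho0 H]]]]]]].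
exists (3 * C), (Num.min 1 rho); split; [by rewrite mulr_gt0|by rewrite lt_min ltr01|].
move=> x h Dx; rewrite le_min => /andP[h1 hr]; have [w0 b0 b1 b2 b3] := H x Dx.
have E0 : 0 <= C * w x by rewrite mulr_ge0// ltW.
have fx0 : f 0 x = f0 x.
  have := b3 0; rewrite enorm0 => /(_ (ltW rho0)).
  rewrite dot0r quadE mul0mx dot0l !addr0 expr0n mulr0 normr_le0 subr_eq0.
  by move=> /eqP.
have [a1 a2] := jet_bounds h b0 b1 b2; have {}b3 := b3 h hr.
set t := enorm h in h1 a1 a2 b3 *; have t0 : 0 <= t by exact: enorm_ge0.
have t1 : t ^+ 2 <= t by rewrite expr2 ler_piMl.
have t31 : t ^+ 3 <= t by rewrite exprS ler_piMr// expr_le1.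
have u1 := ler_wpM2l E0 t1; have u2 := ler_wpM2l E0 t31.
rewrite fx0 (_ : f h x - f0 x = dot (f1 x) h + quad (f2 x) h +
  (f h x - (f0 x + dot (f1 x) h + quad (f2 x) h))); last by ring.
by have := normD_le (normD_le a1 a2) b3; lra.
Qed.

End jets.

(** * Geodesics, parallel transport and the charts *)

Section lorentz_form.
Context {R : realType} {d : nat}.
Implicit Types (x y mu v w : 'rV[R]_d.+1).

Definition spatial x : 'rV[R]_d := \row_j x ord0 (lift ord0 j).

Lemma lorentzE x y : lorentz x y = - (x ord0 ord0 * y ord0 ord0) + dot (spatial x) (spatial y).
Proof. by rewrite /lorentz dotE; congr (_ + _); apply: eq_bigr => j _; rewrite !mxE. Qed.

Lemma spatialD x y : spatial (x + y) = spatial x + spatial y.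
Proof. by apply/rowP => j; rewrite !mxE. Qed.

Lemma spatialZ a x : spatial (a *: x) = a *: spatial x.
Proof. by apply/rowP => j; rewrite !mxE. Qed.

Lemma lorentzC x y : lorentz x y = lorentz y x.
Proof. by rewrite !lorentzE mulrC dotC. Qed.

Lemma lorentzDl x y w : lorentz (x + y) w = lorentz x w + lorentz y w.
Proof. by rewrite !lorentzE spatialD dotDl !mxE; ring. Qed.

Lemma lorentzZl a x w : lorentz (a *: x) w = a * lorentz x w.
Proof. by rewrite !lorentzE spatialZ dotZl !mxE; ring. Qed.

Lemma lorentzDr x y w : lorentz w (x + y) = lorentz w x + lorentz w y.
Proof. by rewrite !(lorentzC w) lorentzDl. Qed.

Lemma lorentzZr a x w : lorentz w (a *: x) = a * lorentz w x.
Proof. by rewrite !(lorentzC w) lorentzZl. Qed.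

Lemma lorentzBr x y w : lorentz w (x - y) = lorentz w x - lorentz w y.
Proof. by rewrite -scaleN1r lorentzDr lorentzZr mulN1r. Qed.

Lemma lorentzBl x y w : lorentz (x - y) w = lorentz x w - lorentz y w.
Proof. by rewrite !(lorentzC _ w) lorentzBr. Qed.

Lemma lorentz0r w : lorentz w 0 = 0.
Proof. by rewrite -(scale0r 0) lorentzZr mul0r. Qed.

Lemma lorentz0l w : lorentz 0 w = 0.
Proof. by rewrite lorentzC lorentz0r. Qed.

Lemma row_spatial_eta x : x = cons_row (x ord0 ord0) (spatial x).
Proof. exact: cons_row_eta. Qed.

Lemma spatial_cons a (z : 'rV[R]_d) : spatial (cons_row a z) = z.
Proof. by apply/rowP => j; rewrite mxE cons_rowS. Qed.

Definition lift_point (z : 'rV[R]_d) : 'rV[R]_d.+1 := cons_row (hyp0 z) z.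

Lemma hyperboloidP x : hyperboloid x <-> x ord0 ord0 = hyp0 (spatial x).
Proof.
split=> [[]|e].
  rewrite lorentzE => h x0; rewrite -[LHS]ger0_norm ?ltW// -sqrtr_sqr; congr Num.sqrt.
  by lra.
have h := hyp0_sqr (spatial x); have h0 := hyp0_gt0 (spatial x).
by split; rewrite ?lorentzE e//; lra.
Qed.

Lemma hyperboloid_lift z : hyperboloid (lift_point z).
Proof. by apply/hyperboloidP; rewrite spatial_cons cons_row0. Qed.

Lemma hyperboloid_eta x : hyperboloid x -> x = lift_point (spatial x).
Proof. by move=> /hyperboloidP e; rewrite /lift_point -e -row_spatial_eta. Qed.

Lemma lorentz_hyp x y : hyperboloid x -> hyperboloid y ->
  lorentz x y = - boost0 (spatial x) (spatial y).
Proof.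
by move=> /hyperboloidP ex /hyperboloidP ey; rewrite lorentzE ex ey /boost0; ring.
Qed.

Lemma boost0_ge1 (a b : 'rV[R]_d) : 1 <= boost0 a b.
Proof. by rewrite -hyp0_boost hyp0_ge1. Qed.

(** Cauchy-Schwarz on spatial parts: the Lorentz form is positive definite on tangent spaces. The
    bound on the time component is what keeps geodesics on the upper sheet. *)
Lemma tangent_lorentz mu v : hyperboloid mu -> tangent mu v ->
  [/\ 0 <= lorentz v v, (lorentz v v = 0 -> v = 0) &
      `|v ord0 ord0| <= Num.sqrt (lorentz v v) * mu ord0 ord0].
Proof.
move=> hmu; rewrite /tangent /=; have := hmu => /hyperboloidP em.
have m2 := hyp0_sqr (spatial mu); have m0 := hyp0_gt0 (spatial mu); rewrite -em in m2 m0.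
rewrite lorentzE => tv; have cs := cauchy_schwarz (spatial mu) (spatial v).
have vE := lorentzE v v.
set V := dot (spatial v) (spatial v) in cs vE; set q := lorentz v v in vE *.
set M := dot (spatial mu) (spatial mu) in cs m2.
set a := mu ord0 ord0 in m2 m0 tv *; set b := v ord0 ord0 in tv vE *.
have e : dot (spatial mu) (spatial v) = a * b by lra.
rewrite e in cs.
have V0 : 0 <= V by exact: dot_ge0.
have M0 : 0 <= M by exact: dot_ge0.
have qb : b ^+ 2 <= q * M by rewrite (_ : q = V - b ^+ 2); [nra|rewrite vE; ring].
have q0 : 0 <= q.
  have [M00|M1] := eqVneq M 0.
    rewrite M00 mulr0 in qb; have b00 : b = 0 by apply/eqP; rewrite -sqrf_eq0 eq_le qb sqr_ge0.
    by rewrite vE b00 mulr0 oppr0 add0r.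
  have Mp : 0 < M by rewrite lt_def M1.
  by have := sqr_ge0 b; nra.
split => //.
  move=> q00; have b0 : b = 0 by apply/eqP; rewrite -sqrf_eq0 eq_le sqr_ge0 andbT; nra.
  have V00 : V = 0 by nra.
  rewrite [v]row_spatial_eta -/b b0; have /eqP := V00; rewrite dot_eq0 => /eqP ->.
  by apply/rowP => i; have [j ->|->] := unliftP ord0 i; rewrite ?cons_rowS ?cons_row0 !mxE.
have hs : 0 <= Num.sqrt q * a by rewrite mulr_ge0 ?sqrtr_ge0// ltW.
by rewrite -ler_sqr ?nnegrE// real_normK ?num_real// exprMn sqr_sqrtr//; nra.
Qed.

End lorentz_form.

Section inverse_cosh.
Context {R : realType}.

Definition acosh (k : R) : R := ln (k + Num.sqrt (k ^+ 2 - 1)).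

Lemma acosh_ge0 k : 1 <= k -> 0 <= acosh k.
Proof. by move=> k1; rewrite ln_ge0// (le_trans k1)// lerDl sqrtr_ge0. Qed.

Lemma cosh_acosh k : 1 <= k -> cosh (acosh k) = k.
Proof.
move=> k1; set s := Num.sqrt (k ^+ 2 - 1).
have s2 : s ^+ 2 = k ^+ 2 - 1 by rewrite sqr_sqrtr//; nra.
have s0 : 0 <= s by exact: sqrtr_ge0.
have ks : 0 < k + s by lra.
rewrite /cosh /acosh -/s expRN lnK ?posrE//.
have -> : (k + s)^-1 = k - s.
  apply: (@mulfI _ (k + s)); first by rewrite gt_eqF.
  by rewrite divff ?gt_eqF//; ring: s2.
by field.
Qed.

Lemma acosh_cosh c : 0 <= c -> acosh (cosh c) = c.
Proof.
move=> c0; rewrite /acosh; have -> : cosh c ^+ 2 - 1 = sinh c ^+ 2.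
  by rewrite cosh2_sinh2 addrC addKr.
have s0 : 0 <= sinh c.
  by rewrite -mul_sinhc mulr_ge0// ltW// sinhc_gt0.
rewrite sqrtr_sqr ger0_norm// (_ : cosh c + sinh c = expR c) ?expRK//.
by rewrite /cosh /sinh; field.
Qed.

(** This is r / sinh r as a function of k = cosh r, the factor in Log mu x = G(k) (x - k mu). *)
Definition Gfun (k : R) : R := (sinhc (acosh k))^-1.

Lemma Gfun_gt0 k : 0 < Gfun k.
Proof. by rewrite invr_gt0 sinhc_gt0. Qed.

End inverse_cosh.

Section vector_derivatives.
Context {R : realType} {n : nat}.
Implicit Types V W : R -> 'rV[R]_n.

Definition vder V V' : Prop := forall (t : R) i, is_derive t 1 (fun s => V s ord0 i) (V' t ord0 i).

Lemma derivable_vder V : (forall t, derivable V t 1) -> vder V (derive1 V).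
Proof.
move=> dV t i; apply: DeriveDef.
  by have /derivable_mxP := dV t; apply.
by rewrite derive1E derive_mx// mxE.
Qed.

Lemma vder_derivable V V' : vder V V' -> (forall t, derivable V t 1) /\ derive1 V = V'.
Proof.
move=> h; have dV t : derivable V t 1.
  by apply/derivable_mxP => i j; rewrite (ord1 i); case: (h t j).
split => //; apply/funext => t; apply/rowP => i.
by rewrite derive1E derive_mx// mxE; case: (h t i).
Qed.

Lemma vder_cst (m : 'rV[R]_n) : vder (fun=> m) (fun=> 0).
Proof. by move=> t i; rewrite mxE; exact: is_derive_cst. Qed.

Lemma vderD V V' W W' : vder V V' -> vder W W' ->
  vder (fun t => V t + W t) (fun t => V' t + W' t).
Proof.
move=> hV hW t i; rewrite mxE; have h1 := hV t i; have h2 := hW t i.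
have -> : (fun s => (V s + W s) ord0 i) = (fun s => V s ord0 i) + (fun s => W s ord0 i).
  by apply/funext => s; rewrite mxE.
exact: is_deriveD.
Qed.

Lemma vderZ (a a' : R -> R) V V' : (forall t : R, is_derive t 1 a (a' t)) -> vder V V' ->
  vder (fun t => a t *: V t) (fun t => a' t *: V t + a t *: V' t).
Proof.
move=> ha hV t i; rewrite !mxE; have h1 := hV t i; have h2 := ha t.
have -> : (fun s => (a s *: V s) ord0 i) = (a : R -> R^o) * (fun s => V s ord0 i).
  by apply/funext => s; rewrite mxE.
have h : is_derive t 1 ((a : R -> R^o) * (fun s => V s ord0 i)) (a t *: V' t ord0 i + V t ord0 i *: a' t).
  exact: is_deriveM.
have e : a t *: V' t ord0 i + V t ord0 i *: a' t = a' t * V t ord0 i + a t * V' t ord0 i.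
  by rewrite /GRing.scale /=; ring.
by rewrite -e.
Qed.

Lemma vderN V V' : vder V V' -> vder (fun t => - V t) (fun t => - V' t).
Proof.
move=> hV t i; rewrite mxE; have h1 := hV t i.
have -> : (fun s => (- V s) ord0 i) = - (fun s => V s ord0 i).
  by apply/funext => s; rewrite mxE.
exact: is_deriveN.
Qed.

Lemma vder0_cst V : vder V (fun=> 0) -> forall t, V t = V 0.
Proof.
move=> h t; apply/rowP => i.
have h' (s : R) : is_derive s 1 (fun s => V s ord0 i) 0 by have := h s i; rewrite mxE.
exact: (is_derive_0_is_cst _ _ h').
Qed.

Lemma vder_eq V V' V'' : vder V V' -> (forall t, V' t = V'' t) -> vder V V''.
Proof. by move=> h e t i; rewrite -e; exact: h. Qed.

End vector_derivatives.

Section lorentz_derivative.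
Context {R : realType} {d : nat}.
Implicit Types V W : R -> 'rV[R]_d.+1.

Lemma vder_lorentz V V' W W' : vder V V' -> vder W W' ->
  forall t : R, is_derive t 1 (fun s => lorentz (V s) (W s)) (lorentz (V' t) (W t) + lorentz (V t) (W' t)).
Proof.
move=> hV hW t.
have hm i : is_derive t 1 (((fun s => V s ord0 i) : R -> R^o) * (fun s => W s ord0 i))
     (V t ord0 i *: W' t ord0 i + W t ord0 i *: V' t ord0 i).
  by have h1 := hV t i; have h2 := hW t i; apply: is_deriveM.
have hs : is_derive t 1 (\sum_(j < d) (((fun s => V s ord0 (lift ord0 j)) : R -> R^o) * (fun s => W s ord0 (lift ord0 j))))
   (\sum_(j < d) (V t ord0 (lift ord0 j) *: W' t ord0 (lift ord0 j) + W t ord0 (lift ord0 j) *: V' t ord0 (lift ord0 j))).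
  by apply: is_derive_sum => j; exact: hm.
have h0 := hm ord0.
have h : is_derive t 1 (- (((fun s => V s ord0 ord0) : R -> R^o) * (fun s => W s ord0 ord0)) +
   \sum_(j < d) (((fun s => V s ord0 (lift ord0 j)) : R -> R^o) * (fun s => W s ord0 (lift ord0 j))))
   (- (V t ord0 ord0 *: W' t ord0 ord0 + W t ord0 ord0 *: V' t ord0 ord0) +
   \sum_(j < d) (V t ord0 (lift ord0 j) *: W' t ord0 (lift ord0 j) + W t ord0 (lift ord0 j) *: V' t ord0 (lift ord0 j))).
  exact: is_deriveD.
have e : - (V t ord0 ord0 *: W' t ord0 ord0 + W t ord0 ord0 *: V' t ord0 ord0) +
   \sum_(j < d) (V t ord0 (lift ord0 j) *: W' t ord0 (lift ord0 j) + W t ord0 (lift ord0 j) *: V' t ord0 (lift ord0 j))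
   = lorentz (V' t) (W t) + lorentz (V t) (W' t).
  rewrite /lorentz addrACA -big_split; congr (_ + _).
    by rewrite /GRing.scale /=; ring.
  by apply: eq_bigr => j _; rewrite /GRing.scale /=; ring.
rewrite -e; move: h; congr is_derive; apply/funext => s.
by rewrite /lorentz !fctE /= fct_sumE.
Qed.

End lorentz_derivative.

(** * Explicit geodesics, exponential map and parallel transport *)

Section geodesics.
Context {R : realType} {d : nat}.
Implicit Types (x y mu v w : 'rV[R]_d.+1) (g V : R -> 'rV[R]_d.+1).

(** Differentiating <g, V> = 0 replaces <g, V'> by - <g', V>, so that vanishing of the tangential
    part becomes an explicit linear equation. *)
Lemma parallel_derivative g V : (forall t, hyperboloid (g t)) -> (forall t, derivable g t 1) ->
  parallel_along g V -> forall t, derive1 V t = lorentz (derive1 g t) (V t) *: g t.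
Proof.
move=> hg dg [tV [dV cV]] t.
have h := vder_lorentz (derivable_vder dg) (derivable_vder dV) t.
have e0 : (fun s => lorentz (g s) (V s)) = cst 0 by apply/funext => s; exact: tV.
have e : lorentz (derive1 g t) (V t) + lorentz (g t) (derive1 V t) = 0.
  have := @derive_val _ _ _ _ _ _ _ h; rewrite e0 => <-.
  exact: derive_cst.
have := cV t; rewrite /covariant_derivative /tangent_proj => /eqP.
rewrite addr_eq0 => /eqP ->; rewrite -scaleNr; congr (_ *: _); lra.
Qed.

(** Along a geodesic both g'' and V' are multiples of g, which is orthogonal to V and to g'. Hence
    <g', V> is constant and can be evaluated at time 0. *)
Lemma geodesic_ode g : geodesic g ->
  [/\ forall t, derive1 (derive1 g) t = lorentz (derive1 g 0) (derive1 g 0) *: g t &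
      forall V, parallel_along g V ->
        forall t, derive1 V t = lorentz (derive1 g 0) (V 0) *: g t].
Proof.
move=> [hg [dg pg]]; have gg' := parallel_derivative hg dg pg.
have dg' : forall t, derivable (derive1 g) t 1 by case: pg => _ [].
have tg t : lorentz (g t) (derive1 g t) = 0 by case: pg => + _; apply.
suff main V : parallel_along g V -> forall t, derive1 V t = lorentz (derive1 g 0) (V 0) *: g t.
  by split; [exact: main|].
move=> pV t; rewrite (parallel_derivative hg dg pV); congr (_ *: _).
have [tV [dV _]] := pV; have V'E := parallel_derivative hg dg pV.
have h (s : R) : is_derive s 1 (fun s => lorentz (derive1 g s) (V s)) 0.
  have h := vder_lorentz (derivable_vder dg') (derivable_vder dV) s.
  have e : lorentz (derive1 (derive1 g) s) (V s) + lorentz (derive1 g s) (derive1 V s) = 0.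
    by rewrite gg' V'E lorentzZl lorentzZr tV (lorentzC _ (g s)) tg !mulr0 addr0.
  by move: h; rewrite e.
exact: (is_derive_0_is_cst _ _ h).
Qed.

(** The operator factors into first-order ones: exp(- c t) (h' + c h) is constant, hence zero, and
    then exp(c t) h is constant. *)
Lemma second_order_ode_unique c (h : R -> 'rV[R]_d.+1) h' :
  vder h h' -> vder h' (fun t => c ^+ 2 *: h t) -> h 0 = 0 -> h' 0 = 0 -> forall t, h t = 0.
Proof.
move=> dh dh' h0 h'0.
have dexp (a : R) (t : R) : is_derive t 1 (fun s => expR (a * s)) (a * expR (a * t)).
  have h1 := is_derive_mull a t.
  by rewrite mulrC; exact: (@is_derive1_comp R expR (fun s => a * s) t (expR (a * t)) a _ h1).
have e1 : vder (fun t => expR (- c * t) *: (h' t + c *: h t)) (fun=> 0).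
  have cst_c (t : R) : is_derive t 1 (cst c : R -> R) 0 by exact: is_derive_cst.
  have hh := vderZ (dexp (- c)) (vderD dh' (vderZ cst_c dh)).
  apply: (vder_eq hh) => t; rewrite /cst scale0r add0r !scalerDr !scalerA.
  apply/rowP => i; rewrite !mxE; ring.
have E1 t : h' t = - c *: h t.
  have := vder0_cst e1 t; rewrite h0 h'0 scaler0 addr0 scaler0 => /eqP.
  rewrite scaler_eq0 gt_eqF ?expR_gt0//= addr_eq0 => /eqP ->.
  by rewrite scaleNr.
have e2 : vder (fun t => expR (c * t) *: h t) (fun=> 0).
  apply: (vder_eq (vderZ (dexp c) dh)) => t; rewrite E1.
  apply/rowP => i; rewrite !mxE; ring.
move=> t; have := vder0_cst e2 t; rewrite h0 scaler0 => /eqP.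
by rewrite scaler_eq0 gt_eqF ?expR_gt0//= => /eqP.
Qed.

(** The solution of y'' = c^2 y with y(0) = 0 and y'(0) = 1, including the constant geodesic case c
    = 0. *)
Definition arcs (c t : R) : R := if c == 0 then t else sinh (c * t) / c.

Lemma arcs1 c : arcs c 1 = sinhc c.
Proof.
rewrite /arcs; have [->|c0] := eqVneq c 0; first by rewrite /sinhc eqxx.
by rewrite mulr1 -mul_sinhc mulfK.
Qed.

Lemma mul_arcs c t : c * arcs c t = sinh (c * t).
Proof.
rewrite /arcs; have [->|c0] := eqVneq c 0; first by rewrite !mul0r sinh0.
by field.
Qed.

Definition geo mu v (t : R) : 'rV[R]_d.+1 :=
  let c := Num.sqrt (lorentz v v) in cosh (c * t) *: mu + arcs c t *: v.

Definition geo' mu v (t : R) : 'rV[R]_d.+1 :=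
  let c := Num.sqrt (lorentz v v) in (c * sinh (c * t)) *: mu + cosh (c * t) *: v.

Lemma is_derive_coshc (c t : R) : is_derive t 1 (fun s : R => cosh (c * s)) (c * sinh (c * t)).
Proof.
have h1 := is_derive_mull c t; have h2 := is_derive_cosh (c * t).
have := @is_derive1_comp R cosh (fun s => c * s) t (sinh (c * t)) c h2 h1.
by rewrite mulrC.
Qed.

Lemma is_derive_sinhc (c t : R) : is_derive t 1 (fun s : R => sinh (c * s)) (c * cosh (c * t)).
Proof.
have h1 := is_derive_mull c t; have h2 := is_derive_sinh (c * t).
have := @is_derive1_comp R sinh (fun s => c * s) t (cosh (c * t)) c h2 h1.
by rewrite mulrC.
Qed.

Lemma is_derive_arcs (c t : R) : is_derive t 1 (arcs c) (cosh (c * t)).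
Proof.
rewrite /arcs; have [->|c0] := eqVneq c 0.
  by rewrite mul0r cosh0; exact: is_derive_id.
have h := is_derive_sinhc c t.
have := @is_deriveZ R R^o R^o (fun s => sinh (c * s)) c^-1 t 1 _ h.
rewrite /GRing.scale /= mulrA mulVf// mul1r; congr is_derive.
by apply/funext => s; rewrite mulrC.
Qed.

Lemma vder_geo mu v : vder (geo mu v) (geo' mu v).
Proof.
have h := vderD (vderZ (is_derive_coshc (Num.sqrt (lorentz v v))) (vder_cst mu))
  (vderZ (is_derive_arcs (Num.sqrt (lorentz v v))) (vder_cst v)).
by apply: (vder_eq h) => t; rewrite !scaler0 !addr0.
Qed.

Lemma vder_geo' mu v : 0 <= lorentz v v ->
  vder (geo' mu v) (fun t => lorentz v v *: geo mu v t).
Proof.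
move=> v0; set c := Num.sqrt (lorentz v v).
have hc (t : R) : is_derive t 1 (fun s : R => c * sinh (c * s)) (c ^+ 2 * cosh (c * t)).
  have h := is_derive_sinhc c t.
  have := @is_deriveZ R R^o R^o (fun s => sinh (c * s)) c t 1 _ h.
  by rewrite /GRing.scale /= mulrA -expr2.
have h := vderD (vderZ hc (vder_cst mu)) (vderZ (is_derive_coshc c) (vder_cst v)).
apply: (vder_eq h) => t; rewrite !scaler0 !addr0 /geo -/c scalerDr !scalerA.
have c2 : c ^+ 2 = lorentz v v by rewrite sqr_sqrtr.
have -> : lorentz v v * arcs c t = c * sinh (c * t) by rewrite -c2 -mul_arcs; ring.
by rewrite c2.
Qed.

Lemma geo0 mu v : geo mu v 0 = mu.
Proof. by rewrite /geo mulr0 cosh0 scale1r /arcs mulr0 sinh0 mul0r; case: ifP; rewrite scale0r addr0. Qed.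

Lemma geo'0 mu v : geo' mu v 0 = v.
Proof. by rewrite /geo' mulr0 cosh0 sinh0 mulr0 scale0r add0r scale1r. Qed.

Lemma hyperboloid_geo mu v t : hyperboloid mu -> tangent mu v -> hyperboloid (geo mu v t).
Proof.
move=> hmu tv; have [v0 v00 vle] := tangent_lorentz hmu tv.
have [hm m0] := hmu; have := tv; rewrite /tangent /= => tv'.
set c := Num.sqrt (lorentz v v) in vle.
have c0 : 0 <= c by exact: sqrtr_ge0.
have c2 : c ^+ 2 = lorentz v v by rewrite sqr_sqrtr.
have CS := cosh2_sinh2 (c * t).
split.
  rewrite /geo -/c lorentzDl !lorentzDr !lorentzZl !lorentzZr hm tv' (lorentzC v) tv' -c2.
  transitivity ((c * arcs c t) ^+ 2 - cosh (c * t) ^+ 2); first by ring.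
  by rewrite mul_arcs; lra.
rewrite /geo -/c !mxE.
have C0 := cosh_gt0 (c * t).
have [c00|cn0] := eqVneq c 0.
  rewrite c00 mul0r in vle; move: vle; rewrite normr_le0 => /eqP ->.
  by rewrite mulr0 addr0 mulr_gt0.
have cp : 0 < c by rewrite lt_def cn0.
(* Positivity of the time coordinate: the contribution of v is at most |sinh| mu_0, smaller than
   cosh times mu_0. *)
have h1 : `|arcs c t * v ord0 ord0| <= `|sinh (c * t)| * mu ord0 ord0.
  by rewrite normrM -mul_arcs normrM (ger0_norm c0) (mulrC c) -mulrA ler_wpM2l.
have h2 : `|sinh (c * t)| < cosh (c * t).
  by rewrite -[ltRHS]gtr0_norm// -ltr_sqr ?nnegrE// !real_normK ?num_real//; lra.
have := ler_norm (- (arcs c t * v ord0 ord0)); rewrite normrN => h3.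
by nra.
Qed.

Lemma tangent_geo' mu v t : hyperboloid mu -> tangent mu v -> lorentz (geo mu v t) (geo' mu v t) = 0.
Proof.
move=> hmu tv; have [v0 v00 vle] := tangent_lorentz hmu tv.
have [hm m0] := hmu; have := tv; rewrite /tangent /= => tv'.
rewrite /geo /geo'; set c := Num.sqrt (lorentz v v).
have c2 : c ^+ 2 = lorentz v v by rewrite sqr_sqrtr.
rewrite lorentzDl !lorentzDr !lorentzZl !lorentzZr hm tv' (lorentzC v) tv' -c2.
transitivity (c * cosh (c * t) * (c * arcs c t - sinh (c * t))); first by ring.
by rewrite mul_arcs subrr mulr0.
Qed.

Lemma geodesic_geo mu v : hyperboloid mu -> tangent mu v -> geodesic (geo mu v).
Proof.
move=> hmu tv; have [v0 v00 vle] := tangent_lorentz hmu tv.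
have [dg g'E] := vder_derivable (vder_geo mu v).
have [dg' g''E] := vder_derivable (vder_geo' mu v0).
have hg t := hyperboloid_geo t hmu tv.
split; first exact: hg.
split; first exact: dg.
rewrite g'E; split; first by move=> t; exact: tangent_geo'.
split; first exact: dg'.
move=> t; rewrite /covariant_derivative /tangent_proj g''E lorentzZr.
by have [-> _] := hg t; rewrite mulrN1 scaleNr subrr.
Qed.

Lemma geodesic_unique g : geodesic g -> g = geo (g 0) (derive1 g 0).
Proof.
move=> gg; have [g''E _] := geodesic_ode gg; have [hg [dg [tg [dg' cg]]]] := gg.
have tv : tangent (g 0) (derive1 g 0) by exact: tg.
have [v0 v00 vle] := tangent_lorentz (hg 0) tv.
set mu := g 0; set v := derive1 g 0; apply/funext => t; apply/eqP; rewrite -subr_eq0; apply/eqP.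
move: t; apply: (@second_order_ode_unique (Num.sqrt (lorentz v v)) _ (fun t => derive1 g t - geo' mu v t)).
- by apply: vderD; [exact: derivable_vder|apply: vderN; exact: vder_geo].
- have h := vderD (derivable_vder dg') (vderN (vder_geo' mu v0)).
  by apply: (vder_eq h) => t; rewrite g''E sqr_sqrtr// scalerBr.
- by rewrite geo0 subrr.
- by rewrite geo'0 subrr.
Qed.

Lemma ExpE mu v : hyperboloid mu -> tangent mu v ->
  Exp mu v = cosh (Num.sqrt (lorentz v v)) *: mu + sinhc (Num.sqrt (lorentz v v)) *: v.
Proof.
move=> hmu tv; apply: xget_unique => /=.
  exists (geo mu v); split; rewrite ?geo0//; first exact: geodesic_geo.
    by have [_ ->] := vder_derivable (vder_geo mu v); rewrite geo'0.
  by rewrite /geo mulr1 arcs1.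
move=> y [g [gg g0 g'0 <-]]; rewrite (geodesic_unique gg) g0 g'0.
by rewrite /geo mulr1 arcs1.
Qed.

Lemma hyperboloid_Exp mu v : hyperboloid mu -> tangent mu v -> hyperboloid (Exp mu v).
Proof.
move=> hmu tv; rewrite ExpE//; have := hyperboloid_geo 1 hmu tv.
by rewrite /geo mulr1 arcs1.
Qed.

Lemma lorentz_Exp mu v : hyperboloid mu -> tangent mu v ->
  - lorentz mu (Exp mu v) = cosh (Num.sqrt (lorentz v v)).
Proof.
move=> hmu tv; rewrite ExpE// lorentzDr !lorentzZr; have [-> _] := hmu.
by have := tv; rewrite /tangent /= => ->; ring.
Qed.

(** The product - <mu, Exp mu v> is cosh |v|, so x determines |v| = acosh k, and then v from the
    formula for Exp. *)
Lemma LogE mu x : hyperboloid mu -> hyperboloid x ->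
  let k := - lorentz mu x in
  [/\ Log mu x = Gfun k *: (x - k *: mu), tangent mu (Log mu x),
      Exp mu (Log mu x) = x & Num.sqrt (lorentz (Log mu x) (Log mu x)) = acosh k].
Proof.
move=> hmu hx k; set v := Gfun k *: (x - k *: mu).
have k1 : 1 <= k by rewrite /k lorentz_hyp// opprK boost0_ge1.
have [hm m0] := hmu; have [hx' x0] := hx.
have tv : tangent mu v by rewrite /tangent /= lorentzZr lorentzBr lorentzZr hm /k; ring.
have G0 := Gfun_gt0 k; have c0 := acosh_ge0 k1.
have GS : Gfun k * sinhc (acosh k) = 1 by rewrite /Gfun mulVf// gt_eqF// sinhc_gt0.
have k2 : k ^+ 2 - 1 = (sinhc (acosh k) * acosh k) ^+ 2.
  by rewrite mul_sinhc -{1}(cosh_acosh k1) cosh2_sinh2; ring.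
have vv : lorentz v v = acosh k ^+ 2.
  rewrite lorentzZl lorentzZr lorentzBl !lorentzBr !lorentzZl !lorentzZr hm hx'.
  rewrite (lorentzC x mu) -[lorentz mu x]opprK -/k.
  have -> : Gfun k * (Gfun k * (-1 - k * - k - (k * - k - k * (k * -1)))) = Gfun k ^+ 2 * (k ^+ 2 - 1) by ring.
  by rewrite k2 exprMn mulrA -exprMn GS expr1n mul1r.
have sv : Num.sqrt (lorentz v v) = acosh k by rewrite vv sqrtr_sqr ger0_norm.
have Ev : Exp mu v = x.
  by rewrite ExpE// sv cosh_acosh// scalerA mulrC GS scale1r addrC subrK.
have Lv : Log mu x = v.
  apply: xget_unique => //= w [tw Ew].
  have h := lorentz_Exp hmu tw; rewrite Ew -/k in h.
  have hw : Num.sqrt (lorentz w w) = acosh k by rewrite h acosh_cosh ?sqrtr_ge0.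
  have := ExpE hmu tw; rewrite Ew hw cosh_acosh// => xE.
  by rewrite /v xE addrC addKr scalerA GS scale1r.
by rewrite Lv.
Qed.

Lemma Log_Exp mu v : hyperboloid mu -> tangent mu v -> Log mu (Exp mu v) = v.
Proof.
move=> hmu tv; have hx := hyperboloid_Exp hmu tv.
have [-> _ _ _] := LogE hmu hx; rewrite lorentz_Exp// /Gfun acosh_cosh ?sqrtr_ge0//.
by rewrite ExpE// addrC addKr scalerA mulVf ?scale1r// gt_eqF// sinhc_gt0.
Qed.

(** The geodesic from x to y is unique, with initial velocity u = Log x y. Along it V' and g'' are
    proportional, so V minus a multiple of g' is constant; the value at time 1 is then simplified
    with |u| = acosh k. *)
Lemma PTE x y v : hyperboloid x -> hyperboloid y -> tangent x v ->
  PT x y v = v + (lorentz y v / (1 - lorentz x y)) *: (x + y).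
Proof.
move=> hx hy tv; have [Lv tL EL sL] := LogE hx hy.
set k := - lorentz x y in Lv sL; set u := Log x y in Lv tL EL sL.
have k1 : 1 <= k by rewrite /k lorentz_hyp// opprK boost0_ge1.
have [u0 u00 _] := tangent_lorentz hx tL; have ge := geodesic_geo hx tL.
have [dgg gg'] := vder_derivable (vder_geo x u).
have [dgg' gg''] := vder_derivable (vder_geo' x u0).
have gy : geo x u 1 = y by rewrite -EL ExpE// /geo mulr1 arcs1.
set c := acosh k in sL.
have c2 : lorentz u u = c ^+ 2 by rewrite -sL sqr_sqrtr.
have [hx' _] := hx; have [hy' _] := hy; have := tv; rewrite /tangent /= => tv'.
have Ck : cosh c = k by exact: cosh_acosh.
have S2 : (sinhc c * c) ^+ 2 = k ^+ 2 - 1 by rewrite mul_sinhc -Ck cosh2_sinh2; ring.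
have Spos := sinhc_gt0 c.
set w := v + _.
have value V : parallel_along (geo x u) V -> V 0 = v -> V 1 = w.
  move=> pV V0; have [_ Vode] := geodesic_ode ge; have [tV [dV _]] := pV.
  have V'E := Vode _ pV; rewrite gg' geo'0 V0 in V'E.
  (* Length zero means x = y: the geodesic is constant and transport is the identity. *)
  have [uv0|cn0] := eqVneq c 0.
    have uE : u = 0 by apply: u00; rewrite c2 uv0 expr0n.
    have V1 : V 1 = V 0.
      apply: vder0_cst; apply: (vder_eq (derivable_vder dV)) => t.
      by rewrite V'E uE lorentz0l scale0r.
    rewrite V1 V0 /w; have -> : y = x by rewrite -gy uE /geo lorentz0l sqrtr0 mul0r cosh0 scale1r scaler0 addr0.
    by rewrite tv' mul0r scale0r addr0.
  set K := lorentz u v in V'E.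
  have hW : vder (fun t => V t + (- (K / c ^+ 2)) *: geo' x u t) (fun=> 0).
    have cst_c (t : R) : is_derive t 1 (cst (- (K / c ^+ 2)) : R -> R) 0 by exact: is_derive_cst.
    apply: (vder_eq (vderD (derivable_vder dV) (vderZ cst_c (vder_geo' x u0)))) => t.
    rewrite V'E scale0r add0r scalerA c2 -scalerDl.
    by rewrite /cst mulNr divfK ?expf_neq0// subrr scale0r.
  have := vder0_cst hW 1; rewrite V0 geo'0 => /(canRL (addrK _)) ->.
  have Sn0 : sinh c != 0 by rewrite -mul_sinhc mulf_neq0// gt_eqF.
  have Kval : K = Gfun k * lorentz y v.
    by rewrite /K Lv lorentzZl lorentzBl lorentzZl tv' mulr0 subr0.
  rewrite /w /geo' sL !mulr1 Ck Kval Lv -/c /Gfun -/c.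
  rewrite (_ : 1 - lorentz x y = 1 + k)//.
  have k1n : 1 + k != 0 by rewrite gt_eqF//; lra.
  have sn : sinhc c != 0 by rewrite gt_eqF.
  rewrite -mul_sinhc.
  have key1 : (k - 1) * (1 + k) = (sinhc c * c) ^+ 2 by rewrite S2; ring.
  set s := sinhc c in sn key1 *.
  have e1 : (1 + k)^-1 = (k - 1) / (s * c) ^+ 2.
    apply: (mulfI k1n); rewrite divff// mulrA (mulrC (1 + k)) key1 divff//.
    by rewrite expf_neq0// mulf_neq0.
  rewrite e1; apply/rowP => i; rewrite !mxE.
  have c22 : s ^+ 2 * c ^+ 2 = k ^+ 2 - 1 by rewrite -exprMn S2.
  have kk : k ^+ 2 = 1 + s ^+ 2 * c ^+ 2 by lra.
  field: kk.
  by rewrite sn cn0.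
apply: xget_unique => /=; last first.
  move=> w' [g [V [[gg g0 g1] [pV V0 V1]]]].
  have gE : g = geo x u.
    have := geodesic_unique gg; rewrite g0 => gE; rewrite gE; congr geo.
    have tg : tangent x (derive1 g 0) by have [_ [_ [tg _]]] := gg; rewrite -g0; exact: tg.
    move: (derive1 g 0) tg gE => v0 tg gE; rewrite /u -(Log_Exp hx tg); congr Log.
    by rewrite -g1 gE ExpE// /geo mulr1 arcs1.
  by rewrite gE in pV; rewrite -V1; exact: (value _ pV V0).
(* Existence: the same formula, read as a vector field along the geodesic, is parallel; its
   coefficient is 0 when c = 0, where <u, v> = 0 as well. *)
pose V t := v + (if c == 0 then 0 else lorentz u v / c ^+ 2) *: (geo' x u t - u).
exists (geo x u), V.
have V0 : V 0 = v by rewrite /V geo'0 subrr scaler0 addr0.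
have K0 : c = 0 -> lorentz u v = 0.
  by move=> c00; rewrite u00 ?lorentz0l// c2 c00 expr0n.
have pV : parallel_along (geo x u) V.
  set K := (if c == 0 then 0 else lorentz u v / c ^+ 2).
  have Kc : K * c ^+ 2 = lorentz u v.
    rewrite /K; case: eqP => [/[dup] /K0 -> ->|/eqP c0]; first by rewrite mul0r.
    by field.
  have cst_c (t : R) : is_derive t 1 (cst K : R -> R) 0 by exact: is_derive_cst.
  have hV : vder V (fun t => lorentz u v *: geo x u t).
    apply: (vder_eq (vderD (vder_cst v) (vderZ cst_c (vderD (vder_geo' x u0) (vder_cst (- u)))))) => t.
    by rewrite scale0r !add0r addr0 scalerA c2 Kc.
  have [dV V'E] := vder_derivable hV.
  split; last split => //.
    move=> t; rewrite /tangent /= /V -/K lorentzDr lorentzZr lorentzBr tangent_geo'//.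
    rewrite /geo sL !lorentzDl !lorentzZl tv' (_ : lorentz x u = 0)// c2 -Kc; ring.
  move=> t; rewrite /covariant_derivative /tangent_proj V'E lorentzZr.
  by have [-> _] := hyperboloid_geo t hx tL; rewrite mulrN1 scaleNr subrr.
split; split => //; [by rewrite geo0|exact: value].
Qed.

End geodesics.

(** * Tangent coordinates and the closed form of the log-density *)

Section tangent_coordinates.
Context {R : realType} {d : nat}.
Implicit Types (x y mu v w : 'rV[R]_d.+1) (z m : 'rV[R]_d).

Lemma originE : origin = cons_row 1 0 :> 'rV[R]_d.+1.
Proof.
have e : const_mx 1 = 1%:M :> 'M[R]_1.
  by apply/matrixP => i j; rewrite !mxE (ord1 i) (ord1 j) eqxx.
by rewrite /origin e.
Qed.

Lemma origin_frameE z : origin_frame z = cons_row 0 z.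
Proof.
have e : 0 = 0%:M :> 'M[R]_1 by apply/matrixP => i j; rewrite !mxE mul0rn.
by rewrite /origin_frame e.
Qed.

Lemma hyperboloid_origin : hyperboloid (origin : 'rV[R]_d.+1).
Proof.
by apply/hyperboloidP; rewrite originE spatial_cons cons_row0 /hyp0 dot0l addr0 sqrtr1.
Qed.

Lemma tangent_origin z : tangent origin (origin_frame z).
Proof.
by rewrite /tangent /= lorentzE originE origin_frameE !spatial_cons !cons_row0 dot0l; ring.
Qed.

Lemma spatial_inj x y : x ord0 ord0 = y ord0 ord0 -> spatial x = spatial y -> x = y.
Proof. by move=> e0 e; rewrite [x]row_spatial_eta [y]row_spatial_eta e0 e. Qed.

(** Closed form of the parallel transport from the origin to mu of (0, z); [unframe] is its inverse
    on the tangent space. *)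
Definition frame mu z : 'rV[R]_d.+1 :=
  cons_row (dot (spatial mu) z) (z + (dot (spatial mu) z / (1 + mu ord0 ord0)) *: spatial mu).

Lemma PT_originE mu z : hyperboloid mu -> PT origin mu (origin_frame z) = frame mu z.
Proof.
move=> hmu; rewrite PTE//; [|exact: hyperboloid_origin|exact: tangent_origin].
have [_ m0] := hmu.
have -> : lorentz mu (origin_frame z) = dot (spatial mu) z.
  by rewrite lorentzE origin_frameE spatial_cons cons_row0; ring.
have -> : lorentz origin mu = - mu ord0 ord0.
  by rewrite lorentzE originE spatial_cons cons_row0 dot0l; ring.
rewrite opprK originE origin_frameE; apply: spatial_inj.
  rewrite /frame cons_row0 mxE cons_row0 add0r mxE mxE cons_row0 divfK//.
  by rewrite gt_eqF// addr_gt0.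
by rewrite /frame spatialD spatialZ spatialD !spatial_cons add0r.
Qed.

Definition unframe mu v : 'rV[R]_d := spatial v - (v ord0 ord0 / (1 + mu ord0 ord0)) *: spatial mu.

Lemma unframeK mu z : hyperboloid mu -> unframe mu (frame mu z) = z.
Proof. by move=> _; rewrite /unframe /frame spatial_cons cons_row0 addrK. Qed.

Lemma frameK mu v : hyperboloid mu -> tangent mu v -> frame mu (unframe mu v) = v.
Proof.
move=> hmu; rewrite /tangent /= lorentzE => tv; have [_ m0] := hmu.
have m1 : 1 + mu ord0 ord0 != 0 by rewrite gt_eqF// addr_gt0.
have m2 := hyp0_sqr (spatial mu); rewrite -(hyperboloidP mu).1// in m2.
have e : dot (spatial mu) (unframe mu v) = v ord0 ord0.
  rewrite /unframe dotDr dotNr dotZr.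
  have -> : dot (spatial mu) (spatial v) = mu ord0 ord0 * v ord0 ord0 by lra.
  have -> : dot (spatial mu) (spatial mu) = mu ord0 ord0 ^+ 2 - 1 by lra.
  by field.
by apply: spatial_inj; rewrite /frame ?cons_row0// spatial_cons e /unframe subrK.
Qed.

Lemma tangent_frame mu z : hyperboloid mu -> tangent mu (frame mu z).
Proof.
move=> hmu; rewrite /tangent /= lorentzE /frame cons_row0 spatial_cons dotDr dotZr.
have [_ m0] := hmu; have m1 : 1 + mu ord0 ord0 != 0 by rewrite gt_eqF// addr_gt0.
have m2 := hyp0_sqr (spatial mu); rewrite -(hyperboloidP mu).1// in m2.
have -> : dot (spatial mu) (spatial mu) = mu ord0 ord0 ^+ 2 - 1 by lra.
by field.
Qed.

Lemma lorentz_frame mu z (w : 'rV[R]_d) : hyperboloid mu -> lorentz (frame mu z) (frame mu w) = dot z w.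
Proof.
move=> hmu; rewrite lorentzE /frame !cons_row0 !spatial_cons !dotDl !dotDr !dotZl !dotZr.
have [_ m0] := hmu; have m1 : 1 + mu ord0 ord0 != 0 by rewrite gt_eqF// addr_gt0.
have m2 := hyp0_sqr (spatial mu); rewrite -(hyperboloidP mu).1// in m2.
have -> : dot (spatial mu) (spatial mu) = mu ord0 ord0 ^+ 2 - 1 by lra.
by rewrite (dotC z (spatial mu)); field.
Qed.

(** Transporting Log back to the origin is the same as boosting mu to the origin and taking Log
    there. *)
Definition Tcoord mu x : 'rV[R]_d :=
  Gfun (boost0 (spatial mu) (spatial x)) *: boost (spatial mu) (spatial x).

Lemma unframe_Log mu x : hyperboloid mu -> hyperboloid x -> unframe mu (Log mu x) = Tcoord mu x.
Proof.
move=> hmu hx; have [-> _ _ _] := LogE hmu hx; rewrite lorentz_hyp// opprK.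
have [_ m0] := hmu; have m1 : 1 + mu ord0 ord0 != 0 by rewrite gt_eqF// addr_gt0.
have em := (hyperboloidP mu).1 hmu; have ex := (hyperboloidP x).1 hx.
rewrite /unframe /Tcoord /boost -em -ex; set k := boost0 _ _.
by apply/rowP => j; rewrite !mxE; field.
Qed.

Lemma TmapE mu x : hyperboloid mu -> hyperboloid x -> Tmap mu x = Tcoord mu x.
Proof.
move=> hmu hx; have [_ tL _ _] := LogE hmu hx.
apply: xget_unique => /=; first by rewrite PT_originE// -unframe_Log// frameK.
by move=> z; rewrite PT_originE// -unframe_Log// => <-; rewrite unframeK.
Qed.

Lemma Tmap_wrap mu z : hyperboloid mu -> Tmap mu (Exp mu (frame mu z)) = z.
Proof.
move=> hmu; have tf := tangent_frame z hmu; have hx := hyperboloid_Exp hmu tf.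
by rewrite TmapE// -unframe_Log// Log_Exp// unframeK.
Qed.

Lemma wrap_Tmap mu x : hyperboloid mu -> hyperboloid x -> Exp mu (frame mu (Tmap mu x)) = x.
Proof.
move=> hmu hx; rewrite TmapE// -unframe_Log// frameK//; first by have [] := LogE hmu hx.
by have [] := LogE hmu hx.
Qed.

Lemma enorm_Tmap mu x : hyperboloid mu -> hyperboloid x ->
  enorm (Tmap mu x) = acosh (boost0 (spatial mu) (spatial x)).
Proof.
move=> hmu hx; have [_ tL _ sL] := LogE hmu hx.
rewrite TmapE// -unframe_Log// enormE -(lorentz_frame _ _ hmu) frameK// sL.
by rewrite lorentz_hyp// opprK.
Qed.

Lemma phiE (v : 'rV[R]_d) : phi v = ln (sinhc (enorm v)).
Proof.
rewrite /phi /sinhc enorm_eq0; case: eqP => // _; by rewrite ln1.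
Qed.

(** Since the norm of T is acosh k, exp(phi) is the inverse of [Gfun] k; x enters only through k and
    the boost. *)
Lemma logdensE mu (S : 'M[R]_d) x : hyperboloid mu -> hyperboloid x ->
  logdens mu S x = - 2^-1 * ln (\det S)
    - 2^-1 * Gfun (boost0 (spatial mu) (spatial x)) ^+ 2 * quad (invmx S) (boost (spatial mu) (spatial x))
    + d.-1%:R * ln (Gfun (boost0 (spatial mu) (spatial x))).
Proof.
move=> hmu hx; rewrite /logdens phiE enorm_Tmap// -[in ln (sinhc _)](invrK (sinhc _)) -/(Gfun _).
rewrite lnV ?posrE ?Gfun_gt0// mulrN opprK TmapE// /Tcoord.
by rewrite !quadE -scalemxAl dotZl dotZr; ring.
Qed.

Lemma ExpE_frame mu z : hyperboloid mu ->
  Exp mu (frame mu z) = cosh (enorm z) *: mu + sinhc (enorm z) *: frame mu z.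
Proof.
move=> hmu; rewrite ExpE//; last exact: tangent_frame.
by rewrite lorentz_frame.
Qed.

End tangent_coordinates.

(** * The chart of the parameter space at mu0 *)

Section charts.
Context {R : realType} {d : nat}.
Implicit Types (x y mu v w : 'rV[R]_d.+1).
Variables (mu0 : 'rV[R]_d.+1) (iota : {linear 'rV[R]_d -> 'rV[R]_d.+1}).
Hypothesis hmu0 : hyperboloid mu0.
Hypothesis iso : linear_isometry_onto_tangent mu0 iota.

Lemma tangent_iota a : tangent mu0 (iota a).
Proof. by case: iso => <- _; exists a. Qed.

Lemma lorentz_iota a b : lorentz (iota a) (iota b) = dot a b.
Proof. by case: iso => _ ->. Qed.

Lemma iota_inj : injective iota.
Proof.
move=> a b e; apply/eqP; rewrite -subr_eq0 -dot_eq0 -lorentz_iota.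
have -> : iota (a - b) = 0 by rewrite linearB /= e subrr.
by rewrite lorentz0l.
Qed.

Lemma mu_ofE (t : 'rV[R]_(d + vech_dim d)) :
  mu_of mu0 iota t = cosh (enorm (lsubmx t)) *: mu0 + sinhc (enorm (lsubmx t)) *: iota (lsubmx t).
Proof.
by rewrite /mu_of ExpE ?lorentz_iota//; exact: tangent_iota.
Qed.

Lemma hyperboloid_mu_of (t : 'rV[R]_(d + vech_dim d)) : hyperboloid (mu_of mu0 iota t).
Proof. by apply: hyperboloid_Exp => //; exact: tangent_iota. Qed.

Lemma chart_iota mu : hyperboloid mu ->
  iota (xget 0 [set a | iota a = Log mu0 mu]) = Log mu0 mu.
Proof.
move=> hmu; have [_ tL _ _] := LogE hmu0 hmu.
have [a _ ia] : range iota (Log mu0 mu) by case: iso => -> _.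
by case: xgetP => [b -> //|/(_ a)].
Qed.

Lemma mu_of_chart mu S : hyperboloid mu -> mu_of mu0 iota (chart mu0 iota mu S) = mu.
Proof.
move=> hmu; rewrite /mu_of /chart row_mxKl chart_iota//.
by have [] := LogE hmu0 hmu.
Qed.

Lemma Sigma_of_chart mu (S : 'M[R]_d) : posdef S -> Sigma_of (chart mu0 iota mu S) = S.
Proof.
move=> pS; rewrite /Sigma_of /chart row_mxKr.
by have [sy e] := mlogP pS; rewrite vechK.
Qed.

Lemma Sigma_of_posdef (t : 'rV[R]_(d + vech_dim d)) : posdef (Sigma_of t).
Proof. by apply: mexp_posdef; exact: mat_sym. Qed.

Lemma enorm_chart mu : hyperboloid mu ->
  enorm (xget 0 [set a | iota a = Log mu0 mu]) = acosh (boost0 (spatial mu0) (spatial mu)).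
Proof.
move=> hmu; have [_ _ _ sL] := LogE hmu0 hmu.
by rewrite enormE -lorentz_iota chart_iota// sL lorentz_hyp// opprK.
Qed.

(** The inverse of the isometry is selected by [xget]; pairing with basis vectors makes its
    coordinates explicit, hence measurable in mu. *)
Lemma chart_coord mu i : hyperboloid mu ->
  (xget 0 [set a | iota a = Log mu0 mu] : 'rV[R]_d) ord0 i =
  Gfun (boost0 (spatial mu0) (spatial mu)) * lorentz (iota (delta_mx ord0 i)) mu.
Proof.
move=> hmu; set a := xget _ _; have -> : a ord0 i = dot (delta_mx ord0 i) a.
  rewrite dotE (bigD1 i)//= big1 ?addr0 ?mxE ?eqxx ?mul1r// => j ji.
  by rewrite mxE (negPf ji) andbF mul0r.
rewrite -lorentz_iota chart_iota//; have [-> _ _ _] := LogE hmu0 hmu.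
rewrite lorentzZr lorentzBr lorentzZr (lorentzC _ mu0).
have -> : lorentz mu0 (iota (delta_mx ord0 i)) = 0 by exact: tangent_iota.
by rewrite mulr0 subr0 lorentz_hyp// opprK.
Qed.

End charts.

Definition rectangle d2 (T : measurableType d2) n (A : nat -> set T) : set (n.-tuple T) :=
  [set t | forall i : 'I_n, A i (tnth t i)].
Arguments rectangle {d2 T} n A.

Lemma integral_prob_cst {R : realType} d2 (T : measurableType d2) (Q : probability T R) (c : R) :
  (\int[Q]_x c%:E = c%:E)%E.
Proof.
have := @integral_cst _ _ R Q setT measurableT c%:E; rewrite /cst => ->.
by rewrite [X in (_ * X)%E]probability_setT mule1.
Qed.

(** * Samples *)

Section power_law.
Context {R : realType} {d2 : measure_display} {T : measurableType d2}.
Variable Q : probability T R.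
Local Open Scope ereal_scope.

Lemma measurable_rectangle n (A : nat -> set T) : (forall i, measurable (A i)) -> measurable (rectangle n A).
Proof.
move=> mA; rewrite (_ : rectangle n A = \big[setI/setT]_(i < n) (fun t => tnth t i) @^-1` A i).
  apply: bigsetI_measurable => i _; rewrite -[_ @^-1` _]setTI.
  exact: (@measurable_tnth _ T n i).
rewrite -bigcap_seq; apply/seteqP; split => [t tA i _|t tA i]; first exact: tA.
by apply: tA; rewrite /= mem_index_enum.
Qed.

Lemma power_prob_rectangle n (A : nat -> set T) : (forall i, measurable (A i)) ->
  power_prob Q n (rectangle n A) = \prod_(i < n) Q (A i).
Proof.
elim: n => [|n IH] in A *; move=> mA.
  rewrite big_ord0 /= diracE mem_set//= => i; by have := ltn_ord i.
rewrite big_ord_recl -(IH (fun i => A i.+1))//.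
have mR := @measurable_rectangle n (fun i => A i.+1) (fun i => mA i.+1).
rewrite /= -[RHS](@product_measure2E _ _ _ _ _ Q (power_prob Q n) _ _ (mA 0%N) mR).
rewrite /distribution /pushforward; congr (_ _); apply/seteqP; split => [[x t] /= h|[x t] [/= hx ht] i].
  split; first by have := h ord0.
  by move=> i; have := h (lift ord0 i); rewrite tnthS.
by have [j ->|->] := unliftP ord0 i; [rewrite tnthS; exact: ht|rewrite tnth0].
Qed.

Lemma tuple_measurable_rectangles n :
  @measurable _ (n.-tuple T) = <<s [set rectangle n A | A in [set A | forall i, measurable (A i)]] >>.
Proof.
apply/seteqP; split => [B|B].
  apply: smallest_sub; first exact: smallest_sigma_algebra.
  rewrite -bigcup_seq => C [i _ [Y mY <-]]; apply: sub_sigma_algebra.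
  exists (fun j : nat => if j == i :> nat then Y else setT).
    by move=> j; case: ifP => // _; exact: measurableT.
  rewrite setTI; apply/seteqP; split => [t /(_ i)|t tY j]; first by rewrite eqxx.
  by case: ifP => // /eqP ji; rewrite (_ : j = i)//; exact: val_inj.
apply: smallest_sub; first exact: sigma_algebra_measurable.
by move=> _ [A mA <-]; exact: measurable_rectangle.
Qed.

End power_law.

Section sample_law.
Context {R : realType} {d1 : measure_display} {Omega : measurableType d1}.
Variable P : probability Omega R.
Context {d2 : measure_display} {T : measurableType d2}.
Variables (Q : probability T R) (X : nat -> Omega -> T).
Hypothesis mX : forall i, measurable_fun setT (X i).
Hypothesis indep : forall n (A : nat -> set T), (forall i, measurable (A i)) ->
  P (\bigcap_(i < n) X i @^-1` A i) = (\prod_(i < n) Q (A i))%E.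
Local Open Scope ereal_scope.

Definition sample n (w : Omega) : n.-tuple T := [tuple X i w | i < n].

Lemma measurable_sample n : measurable_fun setT (sample n).
Proof.
apply/measurable_fun_tnthP => i; rewrite (_ : _ \o _ = X i)//.
by apply/funext => w /=; rewrite tnth_mktuple.
Qed.

(** The two laws agree on rectangles, a generating family stable under intersection, hence
    everywhere. *)
Lemma sample_lawE n B : measurable B -> P (sample n @^-1` B) = power_prob Q n B.
Proof.
move=> mB; pose W : {mfun Omega >-> n.-tuple T} := mfun_Sub (mem_set (@measurable_sample n)).
rewrite -[LHS]/(distribution P W B).
pose G := [set rectangle n A | A in [set A : nat -> set T | forall i, measurable (A i)]].
apply: (@measure_unique _ R _ G (fun=> setT)) => //.
- by rewrite /G -tuple_measurable_rectangles.
- move=> _ _ [A mA <-] [A' mA' <-]; exists (fun i => A i `&` A' i).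
    by move=> i; exact: measurableI.
  apply/seteqP; split => [t h|t [h h'] i]; last by split; [exact: h|exact: h'].
  by split => i; have [] := h i.
- move=> _; exists (fun=> setT) => //; apply/seteqP; split => //.
- by rewrite bigcup_const//; exists 0%N.
- move=> _ [A mA <-]; transitivity (\prod_(i < n) Q (A i)); last by symmetry; exact: power_prob_rectangle.
  rewrite -indep//.
  rewrite /distribution /pushforward /=; congr (P _); apply/seteqP; split => [w h i /= ni|w h i].
    by have := h (Ordinal ni); rewrite tnth_mktuple.
  change (A i (tnth (sample n w) i)); rewrite tnth_mktuple; exact: (h i (ltn_ord i)).
- by move=> _; rewrite (le_lt_trans (probability_le1 _ _))// ltry.
Qed.

Lemma ge0_integral_sample n (F : n.-tuple T -> \bar R) : measurable_fun setT F ->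
  (forall t, 0 <= F t) -> \int[P]_w F (sample n w) = \int[power_prob Q n]_t F t.
Proof.
move=> mF F0; pose W : {mfun Omega >-> n.-tuple T} := mfun_Sub (mem_set (@measurable_sample n)).
have := @ge0_integral_distribution _ _ _ _ _ P W F mF F0.
rewrite (_ : F \o W = (fun w => F (sample n w)))// => <-.
by apply: eq_measure_integral => A mA _; first [exact: sample_lawE|exact/esym/sample_lawE].
Qed.

End sample_law.

(** * Markov inequality and second moments of sums *)

Section second_moment.
Context {R : realType} {d2 : measure_display} {T : measurableType d2}.
Variable Q : probability T R.
Local Open Scope ereal_scope.

Lemma markov_ineq (g : T -> R) (a : R) : (0 <= a)%R -> measurable_fun setT g -> (forall x, 0 <= g x)%R ->
  a%:E * Q [set x | a <= g x]%R <= \int[Q]_x (g x)%:E.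
Proof.
move=> a0 mg g0; have mA : measurable [set x | a <= g x]%R.
  rewrite (_ : [set x | _] = setT `&` g @^-1` `[a, +oo[%classic); first exact: mg.
  by apply/seteqP; split => [x /= h|x [_ /=]]; rewrite in_itv /= andbT.
rewrite -integral_cst//; apply: (@le_trans _ _ (\int[Q]_(x in [set x | a <= g x]%R) (g x)%:E)).
  apply: ge0_le_integral => //.
  by apply/measurable_EFinP; exact: measurable_funTS.
apply: ge0_subset_integral => //; first exact/measurable_EFinP.
by move=> x _; rewrite lee_fin.
Qed.

Variable f : T -> R.
Hypothesis mf : measurable_fun setT f.
Hypothesis f2 : \int[Q]_x ((f x) ^+ 2)%:E < +oo.

Lemma integrable_of_square : Q.-integrable setT (EFin \o f).
Proof.
apply/integrableP; split; first exact/measurable_EFinP.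
apply: (@le_lt_trans _ _ (\int[Q]_x (1 + ((f x) ^+ 2)%:E))).
  apply: ge0_le_integral => //.
  - by apply: measurableT_comp => //; exact/measurable_EFinP.
  - by apply: emeasurable_funD => //; apply/measurable_EFinP; exact: measurable_funX.
  - move=> x _; rewrite /= -EFinD lee_fin; have := sqr_ge0 (`|f x| - 1)%R.
    by rewrite sqrrB1 real_normK ?num_real//; have := normr_ge0 (f x); nra.
rewrite ge0_integralD//; last 2 first.
  - by move=> x _; rewrite lee_fin sqr_ge0.
  - by apply/measurable_EFinP; exact: measurable_funX.
by rewrite integral_prob_cst lte_add_pinfty// ltry.
Qed.

Hypothesis f1 : \int[Q]_x (f x)%:E = 0.

Definition variance_of : R := fine (\int[Q]_x ((f x) ^+ 2)%:E).

Lemma variance_ofE : \int[Q]_x ((f x) ^+ 2)%:E = variance_of%:E.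
Proof.
rewrite fineK// ge0_fin_numE//; apply: integral_ge0 => x _; by rewrite lee_fin sqr_ge0.
Qed.

Lemma integrable_square : Q.-integrable setT (fun x => ((f x) ^+ 2)%:E).
Proof.
apply/integrableP; split; first by apply/measurable_EFinP; exact: measurable_funX.
rewrite (_ : (fun x => `|_|) = fun x => ((f x) ^+ 2)%:E)//.
by apply/funext => x; rewrite /= ger0_norm// sqr_ge0.
Qed.

Lemma shifted_second_moment (b c : R) :
  \int[Q]_x ((c + f x) ^+ 2 + b)%:E = (c ^+ 2 + b + variance_of)%:E.
Proof.
have i1 := integrable_of_square; have i2 := integrable_square.
have iz : Q.-integrable setT (fun x => (2 * c)%:E * (f x)%:E) by exact: (integrableZl measurableT (2 * c) i1).
have ic : Q.-integrable setT (fun x => (c ^+ 2 + b)%:E) by exact: finite_measure_integrable_cst.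
have id := integrableD measurableT iz i2.
have := @integralD _ _ R Q setT measurableT _ _ ic id.
have -> : \int[Q]_x ((c ^+ 2 + b)%:E + ((fun x => (2 * c)%:E * (f x)%:E) \+ (fun x => ((f x) ^+ 2)%:E)) x) =
    \int[Q]_x ((c + f x) ^+ 2 + b)%:E.
  by apply: eq_integral => x _; rewrite /= -EFinM -!EFinD; congr EFin; ring.
move=> ->; rewrite (@integralD _ _ R Q setT measurableT _ _ iz i2).
rewrite variance_ofE (@integralZl _ _ R Q setT measurableT _ i1 (2 * c)) f1 mule0 add0e.
by rewrite integral_prob_cst.
Qed.

(** The shift c is generalised in the induction: fixing the first observation x replaces c by c + f
    x. *)
Lemma sum_second_moment n (c : R) :
  \int[power_prob Q n]_t ((c + \sum_(i < n) f (tnth t i)) ^+ 2)%:E = (c ^+ 2 + n%:R * variance_of)%:E.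
Proof.
elim: n => [|n IH] in c *.
  rewrite -[RHS](@integral_prob_cst R _ _ (power_prob Q 0) (c ^+ 2 + 0 * variance_of)).
  by apply: eq_integral => t _; rewrite big_ord0 mul0r !addr0.
rewrite ge0_integral_power_prob; last 2 first.
- apply/measurable_EFinP; apply: measurable_funX; apply: measurable_funD => //.
  apply: measurable_sum => i; exact: (measurableT_comp mf (measurable_tnth i)).
- by move=> t; rewrite lee_fin sqr_ge0.
transitivity (\int[Q]_x ((c + f x) ^+ 2 + n%:R * variance_of)%:E).
  apply: eq_integral => x _; rewrite -IH; apply: eq_integral => t _; congr (_ ^+ 2)%:E.
  rewrite big_ord_recl addrA /cons_pair tnth0; congr (_ + _)%R.
  by apply: eq_bigr => i _; rewrite tnthS.
rewrite shifted_second_moment; congr EFin; rewrite -natr1; ring.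
Qed.

End second_moment.

(** * The density of the wrapped normal law *)

Section linear_substitution.
Context {R : realType}.
Local Open Scope ereal_scope.

Lemma substitution_affine (a b : R) : (0 < a)%R -> substitution (fun s => a * s + b)%R (fun=> a).
Proof.
move=> a0; apply: substitution_increasing => //.
- move=> x.
  have h1 := is_derive_mull a x.
  have h : is_derive x 1%R (((fun s => a * s) : R -> R^o) + cst b)%R (a + 0)%R by apply: is_deriveD.
  by rewrite addr0 in h.
- by move=> x; exact: cvg_cst.
- move=> y; exists (a^-1 * (y - b))%R; rewrite mulrA divff ?gt_eqF// mul1r subrK.
  by [].
Qed.

Lemma measurable_mulmx_cst n m (A : 'M[R]_(n, m)) :
  measurable_fun setT ((fun v => v *m A) : borel R 1 n -> borel R 1 m).
Proof. by apply: measurable_mulmx; [exact: measurable_idrow|exact: measurable_cstmx]. Qed.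

(** The matrix is a product of commuting stretches along single eigenvectors, and each stretch is a
    displacement in one direction, covered by [lebesgueI_directional]. *)
Lemma lebesgueI_specmx n (U : 'M[R]_n) (d : 'rV[R]_n) : U *m U^T = 1%:M ->
  (forall i, 0 < d ord0 i)%R ->
  forall F : borel R 1 n -> \bar R, measurable_fun setT F -> (forall v, 0 <= F v) ->
  lebesgueI (fun v => F (v *m specmx U d)) * (\prod_i d ord0 i)%:E = lebesgueI F.
Proof.
move=> UU d0.
(* Only the stretches listed in s are switched on; the induction adds them one at a time. *)
pose e (s : seq 'I_n) : 'rV[R]_n := (\row_j if j \in s then d ord0 j else 1)%R.
suff main (s : seq 'I_n) : uniq s -> forall F : borel R 1 n -> \bar R, measurable_fun setT F ->
    (forall v, 0 <= F v) ->
    lebesgueI (fun v => F (v *m specmx U (e s))) * (\prod_(i <- s) d ord0 i)%:E = lebesgueI F.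
  move=> F mF F0; have := main (index_enum 'I_n) (index_enum_uniq _) F mF F0.
  rewrite (_ : e _ = d)//; apply/rowP => j; by rewrite mxE mem_index_enum.
elim: s => [_ F mF F0|i s IH /= /andP[ins us] F mF F0].
  rewrite big_nil mule1; apply: eq_lebesgueI => v.
  rewrite (_ : e [::] = const_mx 1%R) ?specmx1 ?mulmx1//.
  by apply/rowP => j; rewrite !mxE.
pose u : 'rV[R]_n := (delta_mx ord0 i *m U)%R.
have u1 : dot u u = 1%R by exact: dot_eigen.
have un0 : u != 0%R by rewrite -dot_eq0 u1 oner_eq0.
have eE : specmx U (e (i :: s)) = specmx U (e [:: i]) *m specmx U (e s).
  rewrite specmxM//; congr specmx; apply/rowP => j; rewrite !mxE !inE.
  by case: eqP => [->|_] /=; rewrite ?(negPf ins) ?mulr1 ?mul1r.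
have e1 v : v *m specmx U (e [:: i]) = (v + ((d ord0 i - 1) * dot v u) *: u)%R.
  have vu : dot v u = (v *m U^T) ord0 i.
    by rewrite dotC dot_mulmxl dotE (bigD1 i)//= big1 ?addr0 ?mxE ?eqxx ?mul1r// => j ji; rewrite mxE (negPf ji) andbF mul0r.
  have -> : e [:: i] = (const_mx 1 + (d ord0 i - 1) *: delta_mx ord0 i)%R.
    apply/rowP => j; rewrite !mxE inE eqxx /=; case: eqP => [->|_]; rewrite ?mulr1 ?mulr0 ?addr0//.
    by rewrite addrC subrK.
  rewrite /specmx raddfD /= mulmxDr mulmxDl mulmxDr diag_const_mx mulmx1 (mulmx1C UU) mulmx1.
  congr (_ + _)%R; rewrite !mulmxA vu; set w := (v *m U^T)%R.
  have -> : w *m diag_mx ((d ord0 i - 1) *: delta_mx ord0 i)%R =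
      (((d ord0 i - 1) * w ord0 i) *: delta_mx ord0 i)%R.
    apply/rowP => j; rewrite mul_mx_diag !mxE eqxx /=.
    by case: eqP => [->|_]; rewrite ?mulr0// !mulr1 mulrC.
  by rewrite -scalemxAl.
have mFs : measurable_fun setT ((fun v => F (v *m specmx U (e s))) : borel R 1 n -> \bar R).
  by apply: measurable_comp_borel => //; exact: measurable_mulmx_cst.
rewrite big_cons mulrC EFinM muleA -(IH us F mF F0) muleAC; congr (_ * _).
have mdot : measurable_fun setT ((fun v => (d ord0 i - 1) * dot v u)%R : borel R 1 n -> R).
  apply: measurable_funM; first exact: measurable_cst.
  have ee : (fun v : 'rV[R]_n => dot v u) = dot u by apply/funext => v; rewrite dotC.
  by rewrite ee; exact: measurable_dotl.
have hsub x : substitution (fun s => s + (d ord0 i - 1) * dot (x + s *: u) u)%R (fun=> d ord0 i).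
  have := substitution_affine ((d ord0 i - 1) * dot x u)%R (d0 i); congr substitution.
  by apply/funext => r; rewrite dotDl dotZl u1; ring.
rewrite -(lebesgueI_directional un0 mdot (measurable_cst _) (fun=> ltW (d0 i)) hsub mFs)//.
rewrite /lebesgueI -ge0_integralZr; last first.
- by rewrite lee_fin ltW.
- move=> t _; rewrite mule_ge0// lee_fin gauss_weight_ge0.
  by [].
- apply: emeasurable_funM.
    apply: (measurableT_comp mF); apply: measurable_mulmx; first exact: measurable_tuple_row.
    exact: measurable_cstmx.
  by apply/measurable_EFinP; apply: measurableT_comp (@measurable_gauss_weight R n) (@measurable_tuple_row R n).
- exact: measurableT.
by apply: eq_integral => t _; rewrite eE mulmxA e1 muleAC.
Qed.

Lemma lebesgueI_posdef n (A : 'M[R]_n) : posdef A ->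
  forall F : borel R 1 n -> \bar R, measurable_fun setT F -> (forall v, 0 <= F v) ->
  lebesgueI (fun v => F (v *m A)) * (\det A)%:E = lebesgueI F.
Proof.
move=> /specP[U [d [UU -> d0]]] F mF F0; rewrite det_specmx//.
exact: lebesgueI_specmx.
Qed.

Lemma lebesgueI_gauss n (F : 'rV[R]_n -> \bar R) :
  \int[gauss n]_t F (tuple_row t) =
  lebesgueI (fun v => F v * (normal_peak 1 ^+ n * expR (- 2^-1 * dot v v))%:E).
Proof.
rewrite /lebesgueI; apply: eq_integral => t _; rewrite -muleA -EFinM.
set v := tuple_row t.
have -> : (normal_peak 1 ^+ n * expR (- 2^-1 * dot v v) = \prod_i normal_pdf 0 1 (v ord0 i))%R.
  under [RHS]eq_bigr do rewrite normal_pdfE ?oner_eq0//.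
  rewrite big_split /= prodr_const card_ord; congr (_ * _)%R.
  rewrite /normal_fun -expR_sum; congr expR; rewrite dotE mulr_sumr; apply: eq_bigr => i _.
  by rewrite subr0 expr1n; field.
rewrite /gauss_weight -big_split /= big1 ?mule1// => i _.
by rewrite divff// gt_eqF// normal_pdf01_gt0.
Qed.

End linear_substitution.

Section boosts.
Context {R : realType}.

Lemma boost0N n (m x : 'rV[R]_n) : boost0 (- m) (boost m x) = hyp0 x.
Proof.
rewrite /boost0 hyp0_boost /boost /boost0 (_ : hyp0 (- m) = hyp0 m); last first.
  by rewrite /hyp0 dotNl dotNr opprK.
have hm1 : 1 + hyp0 m != 0 by rewrite gt_eqF// addr_gt0// hyp0_gt0.
rewrite dotNl dotDr dotNr dotZr; have -> : dot m m = hyp0 m ^+ 2 - 1 by rewrite hyp0_sqr addrC addKr.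
by field.
Qed.

Lemma boostK n (m : 'rV[R]_n) : cancel (boost m) (boost (- m)).
Proof.
move=> x; rewrite {1}/boost boost0N hyp0_boost (_ : hyp0 (- m) = hyp0 m); last first.
  by rewrite /hyp0 dotNl dotNr opprK.
by rewrite {1}/boost scalerN opprK (addrC (boost0 m x)) subrK.
Qed.

Lemma measurable_lift d : measurable_fun setT (@lift_point R d : borel R 1 d -> borel R 1 d.+1).
Proof. by apply: measurable_cons_row; [exact: measurable_hyp0|exact: measurable_idrow]. Qed.

Lemma measurable_spatial d : measurable_fun setT (@spatial R d : borel R 1 d.+1 -> borel R 1 d).
Proof. by apply: measurable_mxP => i j; under eq_fun do rewrite mxE; exact: measurable_coord. Qed.

End boosts.

(** * The wrapped law has the stated density *)

Section hyperbolic_measure.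
Context {R : realType} {n : nat}.
Notation d := n.+1.
Implicit Types (mu x : 'rV[R]_d.+1) (S : 'M[R]_d).

Definition wrap_normal mu S (t : d.-tuple (measurableTypeR R)) : 'rV[R]_d.+1 :=
  Exp mu (frame mu (tuple_row t *m msqrt S)).

Lemma measurable_acosh : measurable_fun setT (@acosh R).
Proof.
have m1 : measurable_fun setT (fun k : R => k ^+ 2 - 1).
  by apply: measurable_funB; [exact: measurable_funX|exact: measurable_cst].
apply: (measurableT_comp (@measurable_ln R)); apply: measurable_funD => //.
by apply: measurableT_comp m1; exact: (continuous_measurable_fun (@sqrt_continuous R)).
Qed.

Lemma measurable_Gfun : measurable_fun setT (@Gfun R).
Proof. by apply: measurable_funV; exact: (measurableT_comp (@measurable_sinhc R) measurable_acosh). Qed.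

Lemma measurable_quad m (S : 'M[R]_m) : measurable_fun setT (quad S : borel R 1 m -> R).
Proof. by apply: measurable_continuousR; exact: continuous_quad. Qed.

(** The log-density as an explicit function of the spatial part. Measurability and continuity are
    proved for it, since [logdens] itself is built from [xget] and is explicit only on the
    hyperboloid. *)
Definition logdensG mu S (x : 'rV[R]_d) : R := - 2^-1 * ln (\det S)
    - 2^-1 * Gfun (boost0 (spatial mu) x) ^+ 2 * quad (invmx S) (boost (spatial mu) x)
    + d.-1%:R * ln (Gfun (boost0 (spatial mu) x)).

Lemma measurable_logdensG mu S : measurable_fun setT (logdensG mu S : borel R 1 d -> R).
Proof.
have mG := measurableT_comp measurable_Gfun (measurable_boost0 (spatial mu)).
apply: measurable_funD.
  apply: measurable_funB; first exact: measurable_cst.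
  apply: measurable_funM.
    by apply: measurable_funM; [exact: measurable_cst|exact: measurable_funX].
  exact: (measurableT_comp (measurable_quad (invmx S)) (measurable_boost (spatial mu))).
apply: measurable_funM; first exact: measurable_cst.
exact: (measurableT_comp (@measurable_ln R) mG).
Qed.

Lemma logdens_lift mu S (x : 'rV[R]_d) : hyperboloid mu -> logdens mu S (lift_point x) = logdensG mu S x.
Proof. by move=> hmu; rewrite logdensE//; [rewrite spatial_cons|exact: hyperboloid_lift]. Qed.

Lemma Exp_frame_lift mu z : hyperboloid mu ->
  Exp mu (frame mu z) = lift_point (boost (- spatial mu) (sinhc (enorm z) *: z)).
Proof.
move=> hmu; have hx := hyperboloid_Exp hmu (tangent_frame z hmu).
rewrite [LHS]hyperboloid_eta//; congr lift_point.
have := Tmap_wrap z hmu; rewrite TmapE// /Tcoord => e.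
have k : boost0 (spatial mu) (spatial (Exp mu (frame mu z))) = cosh (enorm z).
  have := lorentz_Exp hmu (tangent_frame z hmu); rewrite lorentz_frame// -enormE lorentz_hyp// opprK.
  by [].
rewrite k /Gfun acosh_cosh ?enorm_ge0// in e.
have e' : sinhc (enorm z) *: z = boost (spatial mu) (spatial (Exp mu (frame mu z))).
  by rewrite -{2}e scalerA divff ?gt_eqF ?sinhc_gt0// scale1r.
by rewrite e' boostK.
Qed.

(** The power of [sinhc] in the density cancels the Jacobian of the exponential map, leaving the
    Gaussian density in z. *)
Lemma expR_logdens_wrap mu S z : hyperboloid mu -> posdef S ->
  expR (logdens mu S (Exp mu (frame mu z))) * sinhc (enorm z) ^+ n =
  (\det (msqrt S))^-1 * expR (- 2^-1 * quad (invmx S) z).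
Proof.
move=> hmu pS; rewrite /logdens Tmap_wrap// phiE !expRD.
have [pA AA] := msqrtP pS; have A0 := posdef_det pA.
have -> : \det S = \det (msqrt S) ^+ 2 by rewrite -{1}AA det_mulmx expr2.
rewrite lnXn//.
have -> : expR (- 2^-1 * (ln (\det (msqrt S)) *+ 2)) = (\det (msqrt S))^-1.
  rewrite (_ : - 2^-1 * _ = - ln (\det (msqrt S))); last by field.
  by rewrite expRN lnK.
have -> : expR (- (d.-1%:R * ln (sinhc (enorm z)))) = (sinhc (enorm z) ^+ n)^-1.
  by rewrite expRN mulrC expRM_natr lnK// posrE sinhc_gt0.
rewrite -mulrA mulVf ?mulr1; last by rewrite expf_neq0// gt_eqF// sinhc_gt0.
by rewrite mulNr.
Qed.

Local Open Scope ereal_scope.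

Lemma measurable_wrap mu S : hyperboloid mu ->
  measurable_fun setT (wrap_normal mu S : _ -> borel R 1 d.+1).
Proof.
move=> hmu.
rewrite (_ : wrap_normal mu S = fun t => lift_point (boost (- spatial mu)
   (sinhc (enorm (tuple_row t *m msqrt S)) *: (tuple_row t *m msqrt S)))); last first.
  by apply/funext => t; rewrite /wrap_normal Exp_frame_lift.
have mz : measurable_fun setT ((fun t => tuple_row t *m msqrt S) : _ -> borel R 1 d).
  exact: (measurableT_comp (measurable_mulmx_cst (msqrt S)) (@measurable_tuple_row R d)).
apply: (measurableT_comp (@measurable_lift R d)); apply: (measurableT_comp (measurable_boost (- spatial mu))).
apply: measurable_scalemx => //.
exact: (measurableT_comp (measurableT_comp (@measurable_sinhc R) (@measurable_enorm R d)) mz).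
Qed.

Lemma eq_hypI m (F G : 'rV[R]_m -> \bar R) : F =1 G -> hypI F = hypI G.
Proof. by move=> /funext ->. Qed.

(** A boost moves mu to the origin, the exponential map turns hyperbolic volume into a density on
    R^d, and the square root of S turns the Gaussian into the standard one. Thus exp(logdens) is, up
    to a constant depending only on d, the density with respect to volume. *)
Lemma wrapped_integral mu S (F : borel R 1 d.+1 -> \bar R) (G : 'rV[R]_d -> \bar R) :
  hyperboloid mu -> posdef S -> measurable_fun setT F -> (forall x, 0 <= F x) ->
  (forall x : 'rV[R]_d, F (lift_point x) * (expR (logdens mu S (lift_point x)))%:E = G x) ->
  \int[gauss d]_t F (wrap_normal mu S t) =
  hypI G * (normal_peak 1 ^+ d)%:E.
Proof.
move=> hmu pS mF F0 FG; rewrite -(eq_hypI FG) {G FG}.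
pose H (x : 'rV[R]_d) := F (lift_point x) * (expR (logdens mu S (lift_point x)))%:E.
have mH : measurable_fun setT (H : borel R 1 d -> \bar R).
  apply: emeasurable_funM; first exact: (measurableT_comp mF (@measurable_lift R d)).
  apply/measurable_EFinP; apply: measurableT_comp => //.
  have e : (fun x : 'rV[R]_d => logdens mu S (lift_point x)) = logdensG mu S.
    by apply/funext => x; rewrite logdens_lift.
  by rewrite e; exact: measurable_logdensG.
have H0 (x : 'rV[R]_d) : 0 <= H x by rewrite mule_ge0// lee_fin expR_ge0.
rewrite -/(H) -(hypI_boost (- spatial mu) mH H0).
have mHb : measurable_fun setT ((fun x : 'rV[R]_d => H (boost (- spatial mu) x)) : borel R 1 d -> \bar R).
  exact: (measurableT_comp mH (measurable_boost _)).
rewrite (hypI_exp mHb (fun x : borel R 1 d => H0 (boost (- spatial mu) x))).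
pose K (z : 'rV[R]_d) := F (Exp mu (frame mu z)) *
  ((\det (msqrt S))^-1 * expR (- 2^-1 * quad (invmx S) z))%:E.
have -> : lebesgueI (fun z : 'rV[R]_d => H (boost (- spatial mu) (sinhc (enorm z) *: z)) * (sinhc (enorm z) ^+ n)%:E)
   = lebesgueI K.
  apply: eq_lebesgueI => z; rewrite /H -Exp_frame_lift// -muleA -EFinM.
  by rewrite expR_logdens_wrap.
have [pA AA] := msqrtP pS; have A0 := posdef_det pA.
have mK : measurable_fun setT (K : borel R 1 d -> \bar R).
  apply: emeasurable_funM.
    rewrite (_ : (fun z => _) = fun z => F (lift_point (boost (- spatial mu) (sinhc (enorm z) *: z)))); last first.
      by apply/funext => z; rewrite Exp_frame_lift.
    apply: (measurableT_comp mF); apply: (measurableT_comp (@measurable_lift R d)).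
    apply: (measurableT_comp (measurable_boost (- spatial mu))).
    apply: measurable_scalemx; last exact: measurable_idrow.
    exact: (measurableT_comp (@measurable_sinhc R) (@measurable_enorm R d)).
  apply/measurable_EFinP; apply: measurable_funM; first exact: measurable_cst.
  apply: measurableT_comp => //; apply: measurable_funM; first exact: measurable_cst.
  exact: measurable_quad.
have K0 z : 0 <= K z by rewrite mule_ge0// lee_fin mulr_ge0 ?expR_ge0// invr_ge0 ltW.
rewrite -(lebesgueI_posdef pA mK K0).
rewrite (lebesgueI_gauss (fun v => F (Exp mu (frame mu (v *m msqrt S))))).
rewrite -muleA -EFinM.
pose G (v : 'rV[R]_d) := F (Exp mu (frame mu (v *m msqrt S))) * (expR (- 2^-1 * dot v v))%:E.
have mG : measurable_fun setT (fun t => G (tuple_row t) * (gauss_weight (tuple_row t))%:E).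
  apply: emeasurable_funM; last first.
    by apply/measurable_EFinP; exact: measurableT_comp (@measurable_gauss_weight R d) (@measurable_tuple_row R d).
  apply: emeasurable_funM; first exact: (measurableT_comp mF (measurable_wrap S hmu)).
  apply/measurable_EFinP; apply: measurableT_comp => //; apply: measurable_funM; first exact: measurable_cst.
  apply: (measurableT_comp (measurable_continuousR (@continuous_dot R d)) (@measurable_tuple_row R d)).
have G0 v : 0 <= G v by rewrite mule_ge0// lee_fin expR_ge0.
have quadA v : quad (invmx S) (v *m msqrt S) = dot v v.
  have Su := posdef_unit pA; have [sA _] := pA.
  have h : msqrt S *m invmx S = invmx (msqrt S).
    by rewrite -[LHS](mulKmx Su) (mulmxA (msqrt S) (msqrt S)) AA mulmxV ?mulmx1// (posdef_unit pS).
  by rewrite quadE -mulmxA h dot_mulmxl trmx_inv sA mulmxK.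
have mGt : measurable_fun setT (fun t => G (tuple_row t) * (gauss_weight (tuple_row t))%:E) by [].
have nnt t : 0 <= G (tuple_row t) * (gauss_weight (tuple_row t))%:E.
  by rewrite mule_ge0// lee_fin gauss_weight_ge0.
have kp : (0 <= normal_peak 1 ^+ d :> R)%R by rewrite exprn_ge0// normal_peak_ge0.
transitivity (\int[gauss d]_t (G (tuple_row t) * (gauss_weight (tuple_row t))%:E * (normal_peak 1 ^+ d)%:E)).
  apply: eq_integral => t _; rewrite /G mulrC EFinM !muleA.
  by rewrite [in RHS]muleAC.
rewrite (ge0_integralZr (gauss d) measurableT mGt (fun t _ => nnt t)); last by rewrite lee_fin.
have Ai : (0 <= (\det (msqrt S))^-1)%R by rewrite invr_ge0 ltW.
have -> : lebesgueI (fun v => K (v *m msqrt S)) = \int[gauss d]_t (G (tuple_row t) * (gauss_weight (tuple_row t))%:E * ((\det (msqrt S))^-1)%:E).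
  apply: eq_integral => t _; rewrite /K quadA /G mulrC EFinM !muleA.
  exact: muleAC.
rewrite (ge0_integralZr (gauss d) measurableT mGt (fun t _ => nnt t)); last by rewrite lee_fin.
rewrite -muleA -EFinM mulrA mulVf ?mul1r// gt_eqF//.
Qed.

(** [wrapped_integral] is used twice: at (mu0, S0) the ratio turns into the volume integral of the
    density at (mu, S), and at (mu, S) that integral is the total mass of a probability. *)
Lemma likelihood_ratio mu0 S0 mu S : hyperboloid mu0 -> posdef S0 -> hyperboloid mu -> posdef S ->
  \int[gauss d]_t (expR (logdens mu S (wrap_normal mu0 S0 t) - logdens mu0 S0 (wrap_normal mu0 S0 t)))%:E = 1.
Proof.
move=> hmu0 pS0 hmu pS.
pose F (x : 'rV[R]_d.+1) := (expR (logdensG mu S (spatial x) - logdensG mu0 S0 (spatial x)))%:E.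
have mF : measurable_fun setT (F : borel R 1 d.+1 -> \bar R).
  apply/measurable_EFinP; apply: measurableT_comp => //; apply: measurable_funB.
    exact: (measurableT_comp (measurable_logdensG mu S) (@measurable_spatial R d)).
  exact: (measurableT_comp (measurable_logdensG mu0 S0) (@measurable_spatial R d)).
have F0 x : 0 <= F x by rewrite lee_fin expR_ge0.
have FE x : F x = (expR (logdensG mu S (spatial x) - logdensG mu0 S0 (spatial x)))%:E by [].
clearbody F.
have hw t : hyperboloid (wrap_normal mu0 S0 t) by exact: (hyperboloid_Exp hmu0 (tangent_frame _ hmu0)).
rewrite (_ : \int[gauss d]_t _ = \int[gauss d]_t F (wrap_normal mu0 S0 t)); last first.
  by apply: eq_integral => t _; rewrite FE [in LHS](hyperboloid_eta (hw t)) !logdens_lift.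
pose G (x : 'rV[R]_d) := (expR (logdens mu S (lift_point x)))%:E.
have GF (x : 'rV[R]_d) : F (lift_point x) * (expR (logdens mu0 S0 (lift_point x)))%:E = G x.
  by rewrite FE spatial_cons (logdens_lift _ _ hmu0) /G (logdens_lift _ _ hmu) -EFinM -expRD subrK.
have G1 (x : 'rV[R]_d) : cst 1 (lift_point x) * (expR (logdens mu S (lift_point x)))%:E = G x by rewrite mul1e.
clearbody G.
rewrite (wrapped_integral hmu0 pS0 mF F0 GF).
rewrite -(@wrapped_integral mu S (cst 1) G hmu pS (measurable_cst _) (fun=> lee01) G1).
have := @integral_cst _ _ R (gauss d) setT measurableT 1.
by rewrite [X in 1 * X]probability_setT mul1e; exact.
Qed.

End hyperbolic_measure.

(** * Expansion of the log-density *)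

Section arccosh_kernel.
Context {R : realType}.
Notation lebesgue := (@lebesgue_measure R).

Lemma FTC01 (F f : R -> R) : (forall s : R, 0 <= s <= 1 -> is_derive s 1 F (f s)) ->
  (forall s : R, 0 <= s <= 1 -> {for s, continuous f}) ->
  \int[lebesgue]_(s in `[0, 1]) f s = F 1 - F 0.
Proof.
move=> dF cf; have cF s : 0 <= s <= 1 -> {for s, continuous F}.
  by move=> /dF h; apply/differentiable_continuous/derivable1_diffP; case: h.
rewrite /Rintegral (@continuous_FTC2 _ f F 0 1)//.
- by apply: continuous_in_subspaceT => x; rewrite inE /= in_itv => /cf.
- split.
  + move=> x; rewrite in_itv /= => /andP[x0 x1].
    by case: (dF x) => //; rewrite !ltW.
  + by apply: cvg_at_right_filter; apply: cF; rewrite lexx ler01.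
  + by apply: cvg_at_left_filter; apply: cF; rewrite lexx ler01.
- move=> x; rewrite in_itv /= => /andP[x0 x1]; rewrite derive1E.
  by have [] := dF x _; rewrite ?ltW.
Qed.

(* Gfun (cosh r) = r / sinh r is the integral over [0, 1] of 2 / (s^2 + 2 s cosh r + 1); *)
(* this makes its Taylor expansion uniform in c = cosh r >= 1.                           *)
Definition kernq (c s : R) : R := s ^+ 2 + 2 * c * s + 1.

Definition kern j (c s : R) : R := 2 / kernq c s * (2 * c * s / kernq c s) ^+ j.

(** Replacing c by c (1 + e) multiplies [kernq] by 1 + rho e with rho = 2 c s / kernq in [0, 1], so
    up to sign these are the coefficients of the expansion in e. The absolute value changes nothing
    for c > 0 and gives nonnegativity for all c. *)
Definition Gmom j (c : R) : R := \int[lebesgue]_(s in `[0, 1]) `|kern j c s|.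

Lemma kernq_gt0 c s : 0 < c -> 0 <= s -> 0 < kernq c s.
Proof. by move=> c0 s0; rewrite /kernq; nra. Qed.

Lemma kern_ge0 j c s : 0 < c -> 0 <= s -> 0 <= kern j c s.
Proof.
move=> c0 s0; have q0 := kernq_gt0 c0 s0.
by rewrite /kern mulr_ge0 ?divr_ge0 ?exprn_ge0 ?divr_ge0 ?mulr_ge0// ?ltW.
Qed.

Lemma continuous_kern j c s : 0 < c -> 0 <= s -> {for s, continuous (kern j c)}.
Proof.
move=> c0 s0; have q0 := kernq_gt0 c0 s0.
have cl : {for s, continuous (fun s : R => 2 * c * s)}.
  by apply: continuousM; [exact: cst_continuous|exact: cvg_id].
have cq : {for s, continuous (kernq c)}.
  apply: continuousD; last exact: cst_continuous.
  by apply: continuousD => //; exact: exprn_continuous.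
have cqi : {for s, continuous (fun s => (kernq c s)^-1)}.
  by apply: continuousV => //; rewrite gt_eqF.
have cr : {for s, continuous (fun s => 2 * c * s / kernq c s)} by exact: continuousM.
apply: continuousM; first by apply: continuousM => //; exact: cst_continuous.
exact: (@continuous_comp _ _ _ (fun s => 2 * c * s / kernq c s) (fun y => y ^+ j) s cr (@exprn_continuous _ j _)).
Qed.

Lemma GmomE j c : 0 < c -> Gmom j c = \int[lebesgue]_(s in `[0, 1]) kern j c s.
Proof.
move=> c0; apply: eq_Rintegral => s; rewrite inE /= in_itv /= => /andP[s0 _].
by rewrite ger0_norm// kern_ge0.
Qed.

Lemma integrable_kern j c : 0 < c -> lebesgue.-integrable `[0, 1] (EFin \o kern j c).
Proof.
move=> c0; apply: continuous_compact_integrable; first exact: segment_compact.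
by apply: continuous_in_subspaceT => s; rewrite inE /= in_itv /= => /andP[s0 _]; exact: continuous_kern.
Qed.

Lemma Gmom_ge0 j c : 0 <= Gmom j c.
Proof. by apply: Rintegral_ge0. Qed.

Lemma kern_ratio c s : 0 < c -> 0 <= s -> 0 <= 2 * c * s / kernq c s <= 1.
Proof.
move=> c0 s0; have q0 := kernq_gt0 c0 s0; rewrite divr_ge0 ?mulr_ge0 ?(ltW c0)// ?(ltW q0)//=.
by rewrite ler_pdivrMr// mul1r /kernq; nra.
Qed.

Lemma Gmom_le j c : 0 < c -> Gmom j c <= Gmom 0 c.
Proof.
move=> c0; rewrite !GmomE//; apply: le_Rintegral.
- exact: measurable_itv.
- exact: integrable_kern.
- exact: integrable_kern.
move=> s; rewrite /= in_itv /= => /andP[s0 _]; have q0 := kernq_gt0 c0 s0.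
have /andP[r0 r1] := kern_ratio c0 s0.
rewrite /kern expr0 mulr1 ler_piMr//; first by rewrite divr_ge0// ltW.
by rewrite exprn_ile1.
Qed.

(** The geometric series in rho e cut after the square; rho <= 1 and 1 + rho e >= 1/2 give a bound
    relative to the kernel, uniform in c and s. *)
Lemma kern_expansion c s e : 0 < c -> 0 <= s -> `|e| <= 2^-1 ->
  `|kern 0 (c * (1 + e)) s - (kern 0 c s - e * kern 1 c s + e ^+ 2 * kern 2 c s)|
   <= 2 * `|e| ^+ 3 * kern 0 c s.
Proof.
move=> c0 s0 he; have q0 := kernq_gt0 c0 s0.
have /andP[r0 r1] := kern_ratio c0 s0.
have [e1 e2] : - 2^-1 <= e /\ e <= 2^-1 by apply/andP; rewrite -ler_norml.
have ce : 0 < c * (1 + e) by rewrite mulr_gt0//; lra.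
have q0' := kernq_gt0 ce s0.
rewrite /kern !expr0 !mulr1 expr1.
have qE : kernq (c * (1 + e)) s = kernq c s * (1 + 2 * c * s / kernq c s * e).
  have -> : kernq (c * (1 + e)) s = kernq c s + 2 * c * s * e by rewrite /kernq; ring.
  by set q := kernq c s in q0 *; field; rewrite gt_eqF.
rewrite qE; set q := kernq c s in q0 r0 r1 *; set rho := 2 * c * s / q in r0 r1 *.
have d0 : 2^-1 <= 1 + rho * e by nra.
have dp : 0 < 1 + rho * e by lra.
have -> : 2 / (q * (1 + rho * e)) - (2 / q - e * (2 / q * rho) + e ^+ 2 * (2 / q * rho ^+ 2)) =
   2 / q * (- (rho * e) ^+ 3 / (1 + rho * e)).
  by field; rewrite !gt_eqF.
have q2 : 0 <= 2 / q by rewrite divr_ge0// ltW.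
rewrite normrM mulrC (ger0_norm q2) ler_wpM2r//.
rewrite normrM normrN normfV (gtr0_norm dp) ler_pdivrMr// normrX normrM exprMn (ger0_norm r0).
have r3 : rho ^+ 3 <= 1 by rewrite exprn_ile1.
have e3 : 0 <= `|e| ^+ 3 by rewrite exprn_ge0.
have h1 : rho ^+ 3 * `|e| ^+ 3 <= `|e| ^+ 3 by rewrite ler_piMl.
by nra.
Qed.

Lemma Gmom_expansion c e : 0 < c -> `|e| <= 2^-1 ->
  `|Gmom 0 (c * (1 + e)) - (Gmom 0 c - e * Gmom 1 c + e ^+ 2 * Gmom 2 c)|
   <= 2 * `|e| ^+ 3 * Gmom 0 c.
Proof.
move=> c0 he.
have [e1 e2] : - 2^-1 <= e /\ e <= 2^-1 by apply/andP; rewrite -ler_norml.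
have ce : 0 < c * (1 + e) by rewrite mulr_gt0//; lra.
have m01 : measurable (`[0%R, 1%R]%classic : set (measurableTypeR R)) by exact: measurable_itv.
have iZ (a : R) j b : 0 < b -> lebesgue.-integrable `[0, 1] (EFin \o (fun s => a * kern j b s)).
  by move=> b0; have := integrableZl m01 a (integrable_kern j b0).
have iD (f g : R -> R) : lebesgue.-integrable `[0, 1] (EFin \o f) ->
    lebesgue.-integrable `[0, 1] (EFin \o g) -> lebesgue.-integrable `[0, 1] (EFin \o (fun s => f s + g s)).
  by move=> hf hg; have := integrableD m01 hf hg.
have Z (a : R) j b : 0 < b -> a * Gmom j b = \int[lebesgue]_(s in `[0, 1]) (a * kern j b s).
  by move=> b0; rewrite GmomE// RintegralZl//; exact: integrable_kern.
have e0 := Z 1 0%N _ ce; have eA := Z (-1) 0%N _ c0; have eB := Z e 1%N _ c0; have eC := Z (- e ^+ 2) 2%N _ c0.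
have -> : Gmom 0 (c * (1 + e)) - (Gmom 0 c - e * Gmom 1 c + e ^+ 2 * Gmom 2 c) =
  1 * Gmom 0 (c * (1 + e)) + (-1 * Gmom 0 c + (e * Gmom 1 c + (- e ^+ 2) * Gmom 2 c)) by ring.
have i1 := iD _ _ (iZ e 1%N c c0) (iZ (- e ^+ 2) 2%N c c0).
have i2 := iD _ _ (iZ (-1) 0%N c c0) i1.
have i3 := iD _ _ (iZ 1 0%N _ ce) i2.
rewrite e0 eA eB eC.
rewrite -(RintegralD m01 (iZ e 1%N c c0) (iZ (- e ^+ 2) 2%N c c0)).
rewrite -(RintegralD m01 (iZ (-1) 0%N c c0) i1).
rewrite -(RintegralD m01 (iZ 1 0%N _ ce) i2).
rewrite (le_trans (le_normr_Rintegral m01 i3))// (Z _ 0%N _ c0).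
apply: le_Rintegral => //.
- exact: (integrable_norm i3).
- exact: iZ.
move=> s; rewrite /= in_itv /= => /andP[s0 _].
have := kern_expansion c0 s0 he; rewrite (_ : _ - (_ - _ + _) = 1 * kern 0 (c * (1 + e)) s +
  (-1 * kern 0 c s + (e * kern 1 c s + - e ^+ 2 * kern 2 c s))) //; ring.
Qed.

(** With c = cosh r the denominator is (s + exp r) (s + exp(- r)); partial fractions integrate to
    logarithms whose difference over [0, 1] is r. *)
Lemma Gfun_Gmom c : 1 <= c -> Gfun c = Gmom 0 c.
Proof.
move=> c1; have c0 : 0 < c by lra.
rewrite GmomE//; have cc s : 0 <= s <= 1 -> {for s, continuous (kern 0 c)}.
  by move=> /andP[s0 _]; exact: continuous_kern.
set r := acosh c; have r0 : 0 <= r by exact: acosh_ge0.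
have cr : cosh r = c by exact: cosh_acosh.
(* At c = 1 the two roots coincide and the antiderivative is - 2 / (s + 1). *)
have [r00|rn0] := eqVneq r 0.
  have c11 : c = 1 by rewrite -cr r00 cosh0.
  pose F (s : R) := (-2) * (s + 1)^-1 : R.
  suff dF (s : R) : 0 <= s <= 1 -> is_derive s 1 F (kern 0 c s).
    by rewrite (@FTC01 F _ dF cc) /Gfun -/r r00 /sinhc eqxx /F; field.
  move=> /andP[s0 s1]; have h1 := is_derive_addr 1 s.
  have sn : s + 1 != 0 by rewrite gt_eqF// ltr_pwDr.
  have h2 := @is_deriveV R (fun s => s + 1) s 1 1 sn h1.
  have h : is_derive s 1 ((-2) \*: ((fun s => (s + 1)^-1) : R -> R^o)) ((-2) *: (- ((s + 1) ^- 2) *: 1)).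
    by apply: is_deriveZ.
  have e : (-2) *: (- ((s + 1) ^- 2) *: 1) = kern 0 c s :> R.
    by rewrite /kern /kernq c11 /GRing.scale /= expr0; field; rewrite sn /= (_ : s ^+ 2 + 2 * s + 1 = (s + 1) ^+ 2) ?expf_neq0//; ring.
  by rewrite -e; exact: h.
have rp : 0 < r by rewrite lt_def rn0.
set A := expR r; have A1 : 1 < A by rewrite /A -expR0 ltr_expR.
set B := expR (- r); have B0 : 0 < B by exact: expR_gt0.
have AB : A * B = 1 by rewrite /A /B -expRD subrr expR0.
have cE : 2 * c = A + B by rewrite -cr /cosh -/A -/B; field.
have BA : B < A by rewrite /A /B ltr_expR; lra.
pose k : R := 2 / (A - B).
pose F (s : R) := k * (ln (s + B) - ln (s + A)).
have sE : sinh r = (A - B) / 2 by [].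
suff dF (s : R) : 0 <= s <= 1 -> is_derive s 1 F (kern 0 c s).
  rewrite (@FTC01 F _ dF cc) /Gfun -/r /sinhc (negPf rn0) sE /F /k !add0r /A /B !expRK -/A -/B.
  have -> : ln (1 + A) = r + ln (1 + B).
    have -> : 1 + A = A * (1 + B) by rewrite mulrDr AB mulr1 addrC.
    by rewrite lnM ?posrE ?expR_gt0 ?addr_gt0// /A expRK.
  by field; rewrite rn0 subr_eq0 gt_eqF.
move=> /andP[s0 s1].
have hln (a : R) : 0 < a -> is_derive s 1 (fun s => ln (s + a)) (s + a)^-1.
  move=> a0; have sa : 0 < s + a by rewrite ltr_wpDl.
  have h1 := is_derive_addr a s; have h2 := is_derive1_ln sa.
  have := @is_derive1_comp R (@ln R) (fun s => s + a) s _ _ h2 h1.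
  by rewrite mulr1.
have A0 : 0 < A by lra.
have hA := hln A A0; have hB := hln B B0.
have h : is_derive s 1 (k \*: (((fun s => ln (s + B)) : R -> R^o) - (fun s => ln (s + A)))) (k *: ((s + B)^-1 - (s + A)^-1)).
  by apply: is_deriveZ; apply: is_deriveB.
have e : k *: ((s + B)^-1 - (s + A)^-1) = kern 0 c s :> R.
  have qE : kernq c s = (s + A) * (s + B) by rewrite /kernq cE -AB; ring.
  rewrite /kern qE /k /GRing.scale /= expr0; field.
  by rewrite !gt_eqF ?subr_gt0 ?ltr_wpDl.
by rewrite -e; exact: h.
Qed.

Lemma measurable_Gmom j : measurable_fun setT (Gmom j).
Proof.
pose K (z : (measurableTypeR R * measurableTypeR R)%type) : R := `|kern j z.1 z.2| * \1_(`[0%R, 1%R]%classic : set R) z.2.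
have m1 : measurable_fun setT (fun z : (measurableTypeR R * measurableTypeR R)%type => z.1) by exact: measurable_fst.
have m2 : measurable_fun setT (fun z : (measurableTypeR R * measurableTypeR R)%type => z.2) by exact: measurable_snd.
have mcs : measurable_fun setT (fun z : (measurableTypeR R * measurableTypeR R)%type => 2 * z.1 * z.2).
  by apply: measurable_funM => //; apply: measurable_funM => //; exact: measurable_cst.
have mq : measurable_fun setT (fun z : (measurableTypeR R * measurableTypeR R)%type => kernq z.1 z.2).
  apply: measurable_funD; last exact: measurable_cst.
  by apply: measurable_funD => //; exact: measurable_funX.
have mqi := measurable_funV mq.
have mK : measurable_fun setT K.
  apply: measurable_funM.
    apply: measurableT_comp => //; apply: measurable_funM.
      by apply: measurable_funM => //; exact: measurable_cst.
    by apply: measurable_funX; exact: measurable_funM.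
  have m01 : measurable (`[0%R, 1%R]%classic : set (measurableTypeR R)) by exact: measurable_itv.
  exact: (measurableT_comp (measurable_indic m01) m2).
have mKE : measurable_fun setT (EFin \o K) by exact/measurable_EFinP.
have K0 z : (0 <= (EFin \o K) z)%E by rewrite /= lee_fin mulr_ge0.
have h := @measurable_fun_fubini_tonelli_F _ _ _ _ R lebesgue (EFin \o K) mKE K0.
rewrite (_ : Gmom j = fun c => fine (fubini_F lebesgue (EFin \o K) c)); last first.
  apply/funext => c; rewrite /Gmom /Rintegral integral_mkcond /fubini_F; congr fine.
  apply: eq_integral => s _; rewrite /K /= patchE indicE.
  by case: ifP => _; rewrite ?mulr1 ?mulr0.
exact: (measurableT_comp (fine_measurable measurableT) h).
Qed.

End arccosh_kernel.

Section scalar_expansions.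
Context {R : realType}.

Lemma ln1D_expansion (e : R) : `|e| <= 2^-1 ->
  `|ln (1 + e) - (e - e ^+ 2 / 2)| <= (3 + 14 * expR 1) * `|e| ^+ 3.
Proof.
move=> he; have [e1 e2] : - 2^-1 <= e /\ e <= 2^-1 by apply/andP; rewrite -ler_norml.
have p0 : 0 < 1 + e by lra.
set u := ln (1 + e); have eu : expR u = 1 + e by rewrite lnK.
have u1 : u <= e by apply: le_ln1Dx; lra.
have u2 : - u <= - e / (1 + e).
  have -> : - u = ln (1 + (- e / (1 + e))).
    by rewrite -lnV ?posrE//; congr ln; field; rewrite gt_eqF.
  by apply: le_ln1Dx; rewrite ltr_pdivlMr//; lra.
have e0 := normr_ge0 e; have u0 := normr_ge0 u.
have hu : `|u| <= 2 * `|e|.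
  have u3 : - e / (1 + e) <= 2 * `|e|.
    by rewrite ler_pdivrMr//; have := ler_norm (- e); rewrite normrN; nra.
  rewrite ler_norml; apply/andP; split; first by lra.
  by have := ler_norm e; lra.
have t := expR_taylor2 u; rewrite eu in t.
have [r rE] : exists r, r = 1 + e - (1 + u + u ^+ 2 / 2) by eexists.
rewrite -rE in t.
have r3 : `|r| <= 8 * expR 1 * `|e| ^+ 3.
  have a1 : `|u| ^+ 3 <= (2 * `|e|) ^+ 3 by rewrite lerXn2r ?nnegrE// mulr_ge0.
  have a2 : `|u| ^+ 3 * expR `|u| <= (2 * `|e|) ^+ 3 * expR 1.
    by apply: ler_pM; rewrite ?exprn_ge0 ?expR_ge0// ler_expR; lra.
  by rewrite (le_trans t)// (le_trans a2)// exprMn; lra.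
(* Here e - u = u^2 / 2 + r, with r the remainder of the exponential at u = ln (1 + e), so e^2 - u^2
   is already of third order. *)
have -> : u - (e - e ^+ 2 / 2) = (u ^+ 2 / 2 + r) * ((e + u) / 2) - r by rewrite rE; field.
have E0 := expR_gt0 (1 : R).
have e2e : `|e| ^+ 3 <= 2^-1 * `|e| ^+ 2 by rewrite exprS ler_wpM2r// exprn_ge0.
have b1 : `|u ^+ 2 / 2 + r| <= (2 + 4 * expR 1) * `|e| ^+ 2.
  rewrite (le_trans (ler_normD _ _))// normrM normrX (@ger0_norm _ 2^-1)//.
  have a1 : `|u| ^+ 2 <= (2 * `|e|) ^+ 2 by rewrite lerXn2r ?nnegrE// mulr_ge0.
  rewrite exprMn in a1; have := ler_wpM2l (ltW E0) e2e; nra.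
have b2 : `|(e + u) / 2| <= 3 / 2 * `|e|.
  rewrite normrM (@ger0_norm _ 2^-1)//; have := ler_normD e u; lra.
rewrite (le_trans (ler_normB _ _))//.
have := normM_le b1 b2.
have -> : (2 + 4 * expR 1) * `|e| ^+ 2 * (3 / 2 * `|e|) = (3 + 6 * expR 1) * `|e| ^+ 3 by field.
by lra.
Qed.

Lemma inv_expansion (c e : R) : 0 < c -> `|e| <= c / 2 ->
  `|(c + e)^-1 - (c^-1 - e / c ^+ 2 + e ^+ 2 / c ^+ 3)| <= 2 / c ^+ 4 * `|e| ^+ 3.
Proof.
move=> c0 he; have [e1 e2] : - (c / 2) <= e /\ e <= c / 2 by apply/andP; rewrite -ler_norml.
have p0 : c / 2 <= c + e by lra.
have p1 : 0 < c + e by lra.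
have -> : (c + e)^-1 - (c^-1 - e / c ^+ 2 + e ^+ 2 / c ^+ 3) = - e ^+ 3 / (c ^+ 3 * (c + e)).
  by field; rewrite !gt_eqF.
rewrite normrM normrN normrX normfV mulrC ler_wpM2r ?exprn_ge0//.
rewrite gtr0_norm; last by rewrite mulr_gt0// exprn_gt0.
rewrite -[leRHS]invrK lef_pV2 ?posrE ?mulr_gt0 ?exprn_gt0 ?invr_gt0 ?divr_gt0 ?exprn_gt0//.
rewrite invf_div (_ : c ^+ 4 / 2 = c ^+ 3 * (c / 2)); last by field.
by rewrite ler_wpM2l// exprn_ge0// ltW.
Qed.

(** The bound r coth r <= 1 + r without division; it amounts to exp(2 r) >= 1 + 2 r. *)
Lemma mul_cosh_le (r : R) : 0 <= r -> r * cosh r <= (1 + r) * sinh r.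
Proof.
move=> r0; rewrite /cosh /sinh; set A := expR r; set B := expR (- r).
have B0 : 0 < B by exact: expR_gt0.
have AB : A * B = 1 by rewrite /A /B -expRD subrr expR0.
have h := expR_ge1Dx (2 * r); have A2 : expR (2 * r) = A ^+ 2 by rewrite mulrC expRM_natr.
rewrite A2 in h; have h2 := ler_wpM2l (ltW B0) h.
have e : B * A ^+ 2 = A by rewrite expr2 mulrA (mulrC B) AB mul1r.
rewrite e in h2; nra.
Qed.

Lemma sinhc_bounds (r : R) : 0 <= r -> expR (- r) <= sinhc r <= expR r.
Proof.
move=> r0; rewrite /sinhc; case: eqVneq => [->|rn0]; first by rewrite oppr0 expR0 lexx.
have rp : 0 < r by rewrite lt_def rn0.
rewrite ler_pdivlMr// ler_pdivrMr// /sinh; set A := expR r; set B := expR (- r).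
have B0 : 0 < B by exact: expR_gt0.
have A0 : 0 < A by exact: expR_gt0.
have AB : A * B = 1 by rewrite /A /B -expRD subrr expR0.
have h := expR_ge1Dx (2 * r); have A2 : expR (2 * r) = A ^+ 2 by rewrite mulrC expRM_natr.
have h' := expR_ge1Dx (2 * - r); have B2 : expR (2 * - r) = B ^+ 2 by rewrite mulrC expRM_natr.
rewrite A2 in h; rewrite B2 in h'.
have h2 := ler_wpM2l (ltW B0) h; have h2' := ler_wpM2l (ltW A0) h'.
have e : B * A ^+ 2 = A by rewrite expr2 mulrA (mulrC B) AB mul1r.
have e' : A * B ^+ 2 = B by rewrite expr2 mulrA AB mul1r.
rewrite e in h2; rewrite e' in h2'; apply/andP; split; nra.
Qed.

End scalar_expansions.

Section linear_functionals.
Context {R : realType}.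

Lemma linear_functionalE p (F : 'rV[R]_p -> R) : (forall a h k, F (a *: h + k) = a * F h + F k) ->
  forall h, F h = dot (\row_k F (delta_mx ord0 k)) h.
Proof.
move=> lF h; have F0 : F 0 = 0.
  by have := lF (-1) 0 0; rewrite scaler0 addr0; lra.
have FD a b : F (a + b) = F a + F b by rewrite -[a]scale1r lF mul1r scale1r.
have FZ c a : F (c *: a) = c * F a by rewrite -[c *: a]addr0 lF F0 addr0.
rewrite {1}[h]row_sum_delta (big_morph F FD F0) dotE; apply: eq_bigr => i _.
by rewrite FZ mxE mulrC.
Qed.

Lemma quadratic_formE p (Q : 'rV[R]_p -> 'rV[R]_p -> R) :
  (forall a h k m, Q (a *: h + k) m = a * Q h m + Q k m) ->
  (forall a h k m, Q m (a *: h + k) = a * Q m h + Q m k) ->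
  forall h, Q h h = quad (\matrix_(i, j) Q (delta_mx ord0 i) (delta_mx ord0 j)) h.
Proof.
move=> ql qr h; rewrite (linear_functionalE (F := Q h)); last by move=> *; exact: qr.
rewrite quadE; congr dot; apply/rowP => j; rewrite mxE.
rewrite (linear_functionalE (F := fun h => Q h (delta_mx ord0 j))); last by move=> *; exact: ql.
by rewrite dotC dotE mxE; apply: eq_bigr => i _; rewrite !mxE.
Qed.

Lemma mat_linear d a (b c : 'rV[R]_(vech_dim d)) : mat (a *: b + c) = a *: mat b + mat c.
Proof.
apply/matrixP => i j; rewrite !mxE mulr_sumr -big_split; apply: eq_bigr => k _.
by rewrite !mxE.
Qed.

Lemma mnorm_linear p d (H : 'rV[R]_p -> 'M[R]_d) : (forall a h k, H (a *: h + k) = a *: H h + H k) ->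
  exists C, 0 < C /\ forall h, mnorm (H h) <= C * enorm h.
Proof.
move=> lH; have lHij i j : forall a h k, H (a *: h + k) i j = a * H h i j + H k i j.
  by move=> a h k; rewrite lH !mxE.
exists (1 + \sum_i \sum_j enorm (\row_k H (delta_mx ord0 k) i j)); split.
  rewrite ltr_pwDl// sumr_ge0// => i _; rewrite sumr_ge0// => j _; exact: enorm_ge0.
move=> h; apply: (@le_trans _ _ ((\sum_i \sum_j enorm (\row_k H (delta_mx ord0 k) i j)) * enorm h)).
  rewrite /mnorm mulr_suml; apply: ler_sum => i _; rewrite mulr_suml; apply: ler_sum => j _.
  by rewrite (linear_functionalE (lHij i j)) ler_dot.
by rewrite ler_wpM2r ?enorm_ge0// lerDr.
Qed.

End linear_functionals.

Section basic_jets.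
Context {R : realType} {disp : measure_display} {T : measurableType disp}.
Variable D : set T.

Lemma has_jet_linear p (F : 'rV[R]_p -> R) : (forall a h k, F (a *: h + k) = a * F h + F k) ->
  has_jet D (fun=> 1) (fun h _ => F h).
Proof.
move=> lF; apply: (@has_jet_ext _ _ _ _ D _ (fun h _ => dot (\row_k F (delta_mx ord0 k)) h) _ 1) => //.
  by move=> h x _ _; rewrite -linear_functionalE.
exact: has_jet_lin.
Qed.

Lemma has_jet_mexp p d (B : 'M[R]_d) (H : 'rV[R]_p -> 'M[R]_d) i j :
  (forall a h k, H (a *: h + k) = a *: H h + H k) ->
  has_jet D (fun=> 1) (fun h _ => mexp (B + H h) i j).
Proof.
move=> lH; have [C [C0 hC]] := mnorm_linear lH.
have [L [Q [K [lL lQ rQ hK]]]] := mexp_expansion B i j.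
have lLH a h k : L (H (a *: h + k)) = a * L (H h) + L (H k) by rewrite lH lL.
have lQH a h k m : Q (H (a *: h + k)) (H m) = a * Q (H h) (H m) + Q (H k) (H m) by rewrite lH lQ.
have rQH a h k m : Q (H m) (H (a *: h + k)) = a * Q (H m) (H h) + Q (H m) (H k) by rewrite lH rQ.
pose u : 'rV[R]_p := \row_k L (H (delta_mx ord0 k)).
pose M : 'M[R]_p := \matrix_(k, l) Q (H (delta_mx ord0 k)) (H (delta_mx ord0 l)).
apply: (@has_jet_poly _ _ _ _ D (mexp B i j) u M _ (`|K| * C ^+ 3) C^-1); rewrite ?invr_gt0//.
  by rewrite mulr_ge0// exprn_ge0// ltW.
move=> h hh; have Hh : mnorm (H h) <= 1.
  by rewrite (le_trans (hC h))// mulrC -ler_pdivlMr// div1r.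
have := hK _ Hh.
rewrite (linear_functionalE (F := fun h => L (H h)) lLH) -/u.
rewrite (quadratic_formE (Q := fun h m => Q (H h) (H m)) lQH rQH) -/M.
rewrite opprD addrA opprD addrA => /le_trans; apply.
rewrite -mulrA -exprMn; apply: (@le_trans _ _ (`|K| * mnorm (H h) ^+ 3)).
  by rewrite ler_wpM2r ?ler_norm// exprn_ge0// mnorm_ge0.
by rewrite ler_wpM2l// lerXn2r ?nnegrE ?mnorm_ge0// mulr_ge0 ?enorm_ge0// ltW.
Qed.

Lemma has_gjet_ln : has_gjet D (fun=> 1) (fun=> fun e : R => ln (1 + e)).
Proof.
have E0 := expR_gt0 (1 : R).
exists (fun=> 0), (fun=> 1), (fun=> - 2^-1); split; try exact: measurable_cst.
have K0 : 0 < 3 + 14 * expR (1 : R) by lra.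
exists (3 + 14 * expR (1 : R)), 2^-1; split => //.
move=> x _; rewrite normr0 normr1 normrN ger0_norm// mulr1; split => //; try lra.
move=> e he; have := ln1D_expansion he; rewrite (_ : e - e ^+ 2 / 2 = 0 + 1 * e + - 2^-1 * e ^+ 2) //.
by field.
Qed.

Lemma has_gjet_inv (c : R) : 0 < c -> has_gjet D (fun=> 1) (fun=> fun e => (c + e)^-1).
Proof.
move=> c0; have i0 : 0 < c^-1 by rewrite invr_gt0.
exists (fun=> c^-1), (fun=> - (c^-1 ^+ 2)), (fun=> c^-1 ^+ 3); split; try exact: measurable_cst.
exists (c^-1 + c^-1 ^+ 2 + c^-1 ^+ 3 + 2 / c ^+ 4), (c / 2); split => //; last first.
- move=> x _; have p1 : 0 < c^-1 ^+ 2 by rewrite exprn_gt0.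
  have p2 : 0 < c^-1 ^+ 3 by rewrite exprn_gt0.
  have p3 : 0 < 2 / c ^+ 4 by rewrite divr_gt0// exprn_gt0.
  rewrite normrN !gtr0_norm// !mulr1; split => //; try lra.
  move=> e he; have := inv_expansion c0 he.
  rewrite (_ : c^-1 - e / c ^+ 2 + e ^+ 2 / c ^+ 3 = c^-1 + - c^-1 ^+ 2 * e + c^-1 ^+ 3 * e ^+ 2); last first.
    by field; rewrite gt_eqF.
  by move=> /le_trans; apply; rewrite ler_wpM2r ?exprn_ge0//; lra.
- by rewrite divr_gt0.
- by rewrite !addr_gt0 ?exprn_gt0 ?divr_gt0 ?exprn_gt0.
Qed.

(** Dividing by [Gmom] 0 bounds all coefficients by 1, whatever the size of k x. *)
Lemma has_gjet_Gmom (k : T -> R) : measurable_fun setT k -> (forall x, D x -> 1 <= k x) ->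
  has_gjet D (fun=> 1) (fun x e => Gmom 0 (k x * (1 + e)) / Gmom 0 (k x)).
Proof.
move=> mk k1; have mG j := measurableT_comp (measurable_Gmom j) mk.
have mGi := measurable_funV (mG 0%N).
exists (fun x => Gmom 0 (k x) / Gmom 0 (k x)), (fun x => - (Gmom 1 (k x) / Gmom 0 (k x))), (fun x => Gmom 2 (k x) / Gmom 0 (k x)); split.
- exact: (measurable_funM (mG 0%N) mGi).
- by apply: measurableT_comp => //; exact: (measurable_funM (mG 1%N) mGi).
- exact: (measurable_funM (mG 2%N) mGi).
exists 2, 2^-1; split => // x /k1 kx1; have k0 : 0 < k x by lra.
have G0 : 0 < Gmom 0 (k x) by rewrite -Gfun_Gmom// Gfun_gt0.
have rat j : 0 <= Gmom j (k x) / Gmom 0 (k x) <= 1.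
  by rewrite divr_ge0 ?Gmom_ge0//= ler_pdivrMr// mul1r Gmom_le.
have /andP[a0 a1] := rat 0%N; have /andP[b0 b1] := rat 1%N; have /andP[c0 c1] := rat 2%N.
rewrite normrN !ger0_norm// !mulr1; split => //; try lra.
move=> e he; have := Gmom_expansion k0 he.
have G0n : Gmom 0 (k x) != 0 by rewrite gt_eqF.
have -> : Gmom 0 (k x * (1 + e)) / Gmom 0 (k x) -
   (Gmom 0 (k x) / Gmom 0 (k x) + - (Gmom 1 (k x) / Gmom 0 (k x)) * e +
    Gmom 2 (k x) / Gmom 0 (k x) * e ^+ 2) =
   (Gmom 0 (k x * (1 + e)) - (Gmom 0 (k x) - e * Gmom 1 (k x) + e ^+ 2 * Gmom 2 (k x))) / Gmom 0 (k x).
  by field.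
by move=> h; rewrite normrM normfV (gtr0_norm G0) ler_pdivrMr.
Qed.

End basic_jets.

(** * The log-density as a combination of uniformly bounded jets *)

Section wrapped_jets.
Context {R : realType} {d : nat}.
Variables (m : 'rV[R]_d.+1) (iota : {linear 'rV[R]_d -> 'rV[R]_d.+1}) (B0 : 'M[R]_d).
Hypothesis hm : hyperboloid m.
Hypothesis iso : linear_isometry_onto_tangent m iota.
Hypothesis symB : B0^T = B0.
Implicit Types (x : 'rV[R]_d.+1) (h : 'rV[R]_(d + vech_dim d)).

(** On the hyperboloid [kbase] is the cosh of the distance to m, and [rbase] is that distance. *)
Definition kbase x : R := boost0 (spatial m) (spatial x).

Definition rbase x : R := acosh (kbase x).

Definition jet_weight x : R := (1 + rbase x) ^+ 2.

Local Notation has_jet := (@has_jet R _ (borel R 1 d.+1) (d + vech_dim d) hyperboloid).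
Local Notation one := (fun=> 1 : R).

Lemma kbase_ge1 x : 1 <= kbase x. Proof. exact: boost0_ge1. Qed.

Lemma kbase_gt0 x : 0 < kbase x. Proof. exact: lt_le_trans (kbase_ge1 x). Qed.

Lemma kbaseE x : hyperboloid x -> kbase x = - lorentz m x.
Proof. by move=> hx; rewrite lorentz_hyp// opprK. Qed.

Lemma rbase_ge0 x : 0 <= rbase x. Proof. by rewrite acosh_ge0// kbase_ge1. Qed.

Lemma jet_weight_ge1 x : 1 <= jet_weight x.
Proof. by have r0 := rbase_ge0 x; rewrite /jet_weight; nra. Qed.

Lemma measurable_kbase : measurable_fun setT (kbase : borel R 1 d.+1 -> R).
Proof. exact: (measurableT_comp (measurable_boost0 (spatial m)) (@measurable_spatial R d)). Qed.

Lemma measurable_lorentz v : measurable_fun setT (lorentz v : borel R 1 d.+1 -> R).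
Proof.
apply: measurable_funD.
  apply: measurableT_comp => //; apply: measurable_funM; first exact: measurable_cst.
  exact: measurable_coord.
apply: measurable_sum => j; apply: measurable_funM; first exact: measurable_cst.
exact: measurable_coord.
Qed.

Lemma enorm_lsubmx n1 n2 (h : 'rV[R]_(n1 + n2)) : enorm (lsubmx h) <= enorm h.
Proof.
rewrite !enormE ler_sqrt ?dot_ge0// -[in leRHS](hsubmxK h) /dot tr_row_mx mul_row_col [leRHS]mxE.
by rewrite lerDl -/(dot _ _) dot_ge0.
Qed.

Definition csh h : R := cosh (enorm (lsubmx h)).

Definition snh i h : R := sinhc (enorm (lsubmx h)) * lsubmx h ord0 i.

Lemma cube_exp_le h : enorm h <= 1 ->
  enorm (lsubmx h) ^+ 3 * expR (enorm (lsubmx h)) <= expR 1 * enorm h ^+ 3.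
Proof.
move=> h1; have l := enorm_lsubmx h; rewrite mulrC; apply: ler_pM.
- exact: expR_ge0.
- by rewrite exprn_ge0// enorm_ge0.
- by rewrite ler_expR (le_trans l).
- by rewrite lerXn2r ?nnegrE ?enorm_ge0.
Qed.

Lemma jet_csh : has_jet one (fun h _ => csh h).
Proof.
pose Q (h k : 'rV[R]_(d + vech_dim d)) : R := 2^-1 * dot (lsubmx h) (lsubmx k).
have lQ a h k l : Q (a *: h + k) l = a * Q h l + Q k l.
  by rewrite /Q linearP dotDl dotZl; ring.
have rQ a h k l : Q l (a *: h + k) = a * Q l h + Q l k.
  by rewrite /Q linearP dotDr dotZr; ring.
apply: (@has_jet_poly R _ (borel R 1 d.+1) _ hyperboloid 1 0 (\matrix_(i, j) Q (delta_mx ord0 i) (delta_mx ord0 j)) csh (expR 1) 1) => //.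
move=> h h1; rewrite dot0l addr0 -(quadratic_formE lQ rQ) (le_trans _ (cube_exp_le h1))//.
have := cosh_taylor (enorm_ge0 (lsubmx h)); rewrite enorm_sqr -/(cosh _) -/(csh h) /Q.
by rewrite opprD addrA mulrC.
Qed.

Lemma jet_snh i : has_jet one (fun h _ => snh i h).
Proof.
apply: (@has_jet_poly R _ (borel R 1 d.+1) _ hyperboloid 0 (delta_mx ord0 (lshift _ i)) 0 (snh i) (expR 1) 1) => //.
move=> h h1; rewrite quadE mulmx0 dot0l addr0 add0r (le_trans _ (cube_exp_le h1))//.
have -> : dot (delta_mx ord0 (lshift _ i)) h = lsubmx h ord0 i.
  rewrite dotE (bigD1 (lshift _ i))//= big1 ?addr0; first by rewrite !mxE !eqxx mul1r.
  by move=> j ji; rewrite mxE (negPf ji) andbF mul0r.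
set r := enorm _; have r0 : 0 <= r by exact: enorm_ge0.
have -> : snh i h - lsubmx h ord0 i = (sinhc r - 1) * lsubmx h ord0 i by rewrite /snh -/r; ring.
have e : sinh r - r = (sinhc r - 1) * r by rewrite -mul_sinhc; ring.
have := sinh_taylor r0; rewrite e; apply: le_trans.
by rewrite !normrM ler_wpM2l// (ger0_norm r0) enorm_coord.
Qed.

Definition muh h : 'rV[R]_d.+1 := Exp m (iota (lsubmx h)).

Lemma hyperboloid_muh h : hyperboloid (muh h).
Proof. by apply: hyperboloid_Exp => //; exact: tangent_iota. Qed.

Lemma muhE h : muh h = csh h *: m + \sum_i snh i h *: iota (delta_mx ord0 i).
Proof.
rewrite /muh ExpE//; last exact: tangent_iota.
rewrite (lorentz_iota iso) -enormE; congr (_ + _).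
rewrite {2}[lsubmx h]row_sum_delta linear_sum scaler_sumr; apply: eq_bigr => i _.
by rewrite linearZ /= scalerA.
Qed.

Lemma csh0 : csh 0 = 1. Proof. by rewrite /csh linear0 enorm0 cosh0. Qed.

Lemma snh0 i : snh i 0 = 0. Proof. by rewrite /snh linear0 mxE mulr0. Qed.

Lemma muh0 : muh 0 = m.
Proof. by rewrite muhE csh0 scale1r big1 ?addr0// => i _; rewrite snh0 scale0r. Qed.

Lemma jet_muh j : has_jet one (fun h _ => muh h ord0 j).
Proof.
apply: (@has_jet_ext _ _ _ _ _ _ (fun h _ => csh h * m ord0 j + \sum_i snh i h * iota (delta_mx ord0 i) ord0 j) _ 1) => //.
  by move=> h x _ _; rewrite muhE !mxE summxE; congr (_ + _); apply: eq_bigr => i _; rewrite mxE.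
apply: has_jet_D; first by apply: has_jet_Ml; [exact: jet_csh|exact: has_jet_cst].
apply: has_jet_sum => // i.
by apply: has_jet_Ml; [exact: jet_snh|exact: has_jet_cst].
Qed.

(** Derivative of - <mu, x> in the i-th chart direction at m, relative to its value; it is at most 1
    in absolute value by [lorentz_tangent_bound]. *)
Definition xi i x : R := - lorentz (iota (delta_mx ord0 i)) x / kbase x.

(** Split x = k m + u with u tangent at m: only u pairs with v, and its squared norm is k^2 - 1. *)
Lemma lorentz_tangent_bound v x : tangent m v -> hyperboloid x ->
  `|lorentz v x| <= Num.sqrt (lorentz v v) * kbase x.
Proof.
move=> tv hx; have k1 := kbase_ge1 x.
have tm : lorentz v m = 0 by rewrite lorentzC; exact: tv.
pose u := x - kbase x *: m.
have tu : tangent m u.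
  by rewrite /tangent /= lorentzBr lorentzZr kbaseE//; have [-> _] := hm; ring.
have e : lorentz v x = dot (unframe m v) (unframe m u).
  by rewrite -(lorentz_frame _ _ hm) !frameK// /u lorentzBr lorentzZr tm mulr0 subr0.
have ev : lorentz v v = dot (unframe m v) (unframe m v) by rewrite -(lorentz_frame _ _ hm) !frameK.
have eu : dot (unframe m u) (unframe m u) = kbase x ^+ 2 - 1.
  rewrite -(lorentz_frame _ _ hm) !frameK// /u lorentzBl !lorentzBr !lorentzZl !lorentzZr.
  rewrite (lorentzC x m) (_ : lorentz m x = - kbase x); last by rewrite kbaseE// opprK.
  by have [-> _] := hm; have [-> _] := hx; ring.
rewrite e ev (le_trans (ler_dot _ _))// -enormE ler_wpM2l ?enorm_ge0//.
by rewrite -ler_sqr ?nnegrE ?enorm_ge0 ?(ltW (kbase_gt0 x))// enorm_sqr eu; lra.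
Qed.

Lemma jet_xi i : has_jet one (fun _ x => xi i x).
Proof.
apply: (@has_jet_fun R _ (borel R 1 d.+1) _ hyperboloid one (xi i) 1) => //.
  apply: measurable_funM; first by apply: measurableT_comp => //; exact: measurable_lorentz.
  by apply: measurable_funV; exact: measurable_kbase.
move=> x hx; split => //; rewrite /xi normrM normrN normfV (gtr0_norm (kbase_gt0 x)).
rewrite mul1r ler_pdivrMr ?kbase_gt0//.
have := lorentz_tangent_bound (tangent_iota iso (delta_mx ord0 i)) hx.
rewrite (lorentz_iota iso) dotE (bigD1 i)//= big1 ?addr0 ?mxE ?eqxx ?mulr1 ?sqrtr1//.
by move=> j ji; rewrite mxE (negPf ji) andbF mul0r.
Qed.

(** The relative change of - <mu, x> when mu moves from m to [muh] h: small with h uniformly in x,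
    which is the form of perturbation [Gmom_expansion] accepts. *)
Definition etah h x : R := csh h - 1 + \sum_i snh i h * xi i x.

Lemma jet_etah : has_jet one etah.
Proof.
apply: has_jet_D.
  by apply: has_jet_D; [exact: jet_csh|exact: has_jet_cst].
apply: has_jet_sum => // i.
by apply: has_jet_Ml; [exact: jet_snh|exact: jet_xi].
Qed.

Lemma etah0 x : etah 0 x = 0.
Proof. by rewrite /etah csh0 subrr add0r big1// => i _; rewrite snh0 mul0r. Qed.

Lemma boost0_muh h x : hyperboloid x ->
  boost0 (spatial (muh h)) (spatial x) = kbase x * (1 + etah h x).
Proof.
move=> hx; have k0 := kbase_gt0 x.
have := lorentz_hyp (hyperboloid_muh h) hx => /(congr1 -%R); rewrite opprK => <-.
rewrite muhE lorentzDl lorentzZl (_ : lorentz m x = - kbase x); last by rewrite kbaseE// opprK.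
have -> : 1 + etah h x = csh h + \sum_i snh i h * xi i x by rewrite /etah; ring.
rewrite mulrDr mulr_sumr opprD mulrN opprK mulrC; congr (_ + _).
have lsum (I : Type) (s : seq I) (F : I -> 'rV[R]_d.+1) :
    lorentz (\sum_(i <- s) F i) x = \sum_(i <- s) lorentz (F i) x.
  by apply: (big_morph (lorentz^~ x) (fun a b => lorentzDl a b x) (lorentz0l x)).
rewrite lsum -sumrN; apply: eq_bigr => i _; rewrite lorentzZl /xi.
by field; rewrite gt_eqF.
Qed.

Definition Gratio h x : R := Gmom 0 (kbase x * (1 + etah h x)) / Gmom 0 (kbase x).

Lemma jet_Gratio : has_jet one Gratio.
Proof.
apply: (has_jet_comp (has_gjet_Gmom measurable_kbase (fun x _ => kbase_ge1 x)) jet_etah).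
by move=> x _; exact: etah0.
Qed.

Lemma Gfun_muh h x : hyperboloid x ->
  Gfun (boost0 (spatial (muh h)) (spatial x)) = Gfun (kbase x) * Gratio h x.
Proof.
move=> hx; rewrite Gfun_Gmom ?boost0_ge1// boost0_muh// (Gfun_Gmom (kbase_ge1 x)) /Gratio.
by rewrite mulrCA divff ?mulr1// -(Gfun_Gmom (kbase_ge1 x)) gt_eqF// Gfun_gt0.
Qed.

Lemma jet_coord_ratio i : has_jet one (fun _ x => x ord0 i / kbase x).
Proof.
(* Coordinates of x are at most hyp0 of its spatial part, and by [boost0_slope] s times that is at
   most [kbase] x. *)
pose s := hyp0 (spatial m) - enorm (spatial m).
have s0 : 0 < s by rewrite subr_gt0 enorm_lt_hyp0.
apply: (@has_jet_fun R _ (borel R 1 d.+1) _ hyperboloid one (fun x => x ord0 i / kbase x) s^-1); rewrite ?invr_gt0//.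
  by apply: measurable_funM; [exact: measurable_coord|apply: measurable_funV; exact: measurable_kbase].
move=> x hx; split => //; rewrite mulr1 normrM normfV (gtr0_norm (kbase_gt0 x)) ler_pdivrMr ?kbase_gt0//.
have x0 := (hyperboloidP x).1 hx.
have bx : `|x ord0 i| <= hyp0 (spatial x).
  have [j ->|->] := unliftP ord0 i; last by rewrite x0 gtr0_norm ?hyp0_gt0.
  rewrite (_ : x ord0 (lift ord0 j) = spatial x ord0 j); last by rewrite mxE.
  by rewrite (le_trans (enorm_coord _ _))// ltW// enorm_lt_hyp0.
rewrite (le_trans bx)// ler_pdivlMl// mulrC.
by have := boost0_slope (spatial m) (spatial x); rewrite ler_pdivlMr ?hyp0_gt0// mulrC.
Qed.

Definition Vh j h x : R := x ord0 (lift ord0 j) / kbase x -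
  (x ord0 ord0 / kbase x + (1 + etah h x)) * ((1 + muh h ord0 ord0)^-1 * muh h ord0 (lift ord0 j)).

Lemma jet_Vh j : has_jet one (Vh j).
Proof.
apply: has_jet_D; first exact: jet_coord_ratio.
apply: has_jet_N; apply: has_jet_Ml.
  apply: has_jet_D; first exact: jet_coord_ratio.
  by apply: has_jet_D; [exact: has_jet_cst|exact: jet_etah].
apply: has_jet_Ml; last exact: jet_muh.
have m1 : 0 < 1 + m ord0 ord0 by have [_ m0] := hm; rewrite addr_gt0.
have hd : has_jet one (fun h _ => muh h ord0 ord0 + - m ord0 ord0).
  by apply: has_jet_D; [exact: jet_muh|exact: has_jet_cst].
have := has_jet_comp (has_gjet_inv (T := borel R 1 d.+1) hyperboloid m1) hd.
move=> H; apply: (@has_jet_ext _ _ _ _ _ _ _ _ 1 _ _ (H _)) => //.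
  by move=> h x _ _; congr (_^-1); ring.
by move=> x _; rewrite muh0 subrr.
Qed.

Lemma boost_muh j h x : hyperboloid x ->
  boost (spatial (muh h)) (spatial x) ord0 j = kbase x * Vh j h x.
Proof.
move=> hx; have k0 := kbase_gt0 x; have hmu := hyperboloid_muh h.
have m1 : 1 + muh h ord0 ord0 != 0 by have [_ m0] := hmu; rewrite gt_eqF// addr_gt0.
rewrite /boost !mxE boost0_muh// -(hyperboloidP x).1// -(hyperboloidP _).1// /Vh.
by field; rewrite m1 gt_eqF.
Qed.

Definition Eh i j h : R := mexp (- B0 - mat (rsubmx h)) i j.

Lemma jet_Eh i j : has_jet one (fun h _ => Eh i j h).
Proof.
apply: (@has_jet_mexp R _ (borel R 1 d.+1) hyperboloid _ _ (- B0) (fun h => - mat (rsubmx h))).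
by move=> a h k; rewrite linearP mat_linear opprD scalerN.
Qed.

Definition Uh j h x : R := Gratio h x * Vh j h x.

Lemma jet_Uh j : has_jet one (Uh j).
Proof. by apply: has_jet_Ml; [exact: jet_Gratio|exact: jet_Vh]. Qed.

(** The product is r coth r; its square is the only factor of the quadratic term of the log-density
    that grows with x, and it fixes the weight (1 + r)^2. *)
Lemma sqrt_weight_bound x : 0 <= kbase x * Gfun (kbase x) <= 1 + rbase x.
Proof.
have k0 := kbase_gt0 x; have G0 := Gfun_gt0 (kbase x); have r0 := rbase_ge0 x.
apply/andP; split; first by rewrite mulr_ge0// ltW.
rewrite /Gfun -/(rbase x) ler_pdivrMr ?sinhc_gt0//.
have [r00|rn0] := eqVneq (rbase x) 0.
  rewrite r00 /sinhc eqxx -[kbase x](cosh_acosh (kbase_ge1 x)) -/(rbase x) r00 cosh0; lra.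
have rp : 0 < rbase x by rewrite lt_def rn0.
rewrite -(ler_pM2l rp) -[in leLHS](cosh_acosh (kbase_ge1 x)) -/(rbase x).
rewrite (le_trans (mul_cosh_le r0))// -mul_sinhc; lra.
Qed.

Lemma measurable_Gfun_kbase : measurable_fun setT ((fun x => Gfun (kbase x)) : borel R 1 d.+1 -> R).
Proof. exact: (measurableT_comp (@measurable_Gfun R) measurable_kbase). Qed.

Definition logdens_jet h x : R :=
  - 2^-1 * (\tr B0 + \tr (mat (rsubmx h)))
  + (\sum_j (\sum_i Uh i h x * Eh i j h) * Uh j h x) * (- 2^-1 * (kbase x * Gfun (kbase x)) ^+ 2)
  + (d.-1%:R * ln (Gfun (kbase x)) + d.-1%:R * ln (1 + (Gratio h x - 1))).

(** Factoring [kbase] out of the boost and [Gfun] ([kbase]) out of r / sinh r leaves jets with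
    weight 1; the factors taken out do not depend on h and are bounded by the weight. *)
Lemma has_jet_logdens :
  has_jet jet_weight (fun h x => logdens (muh h) (mexp (B0 + mat (rsubmx h))) x).
Proof.
have one_weight f : has_jet one f -> has_jet jet_weight f.
  by apply: (@has_jet_weaken R _ (borel R 1 d.+1) _ hyperboloid one jet_weight f 1) => // x _; rewrite mul1r jet_weight_ge1.
have w0 x : 0 <= jet_weight x by rewrite (le_trans _ (jet_weight_ge1 x)).
suff H : has_jet jet_weight logdens_jet.
  apply: (@has_jet_ext _ _ _ _ _ _ _ _ 1 _ _ H) => // h x hx _.
  have sh : (mat (rsubmx h))^T = mat (rsubmx h) by exact: mat_sym.
  have sS : (B0 + mat (rsubmx h))^T = B0 + mat (rsubmx h) by rewrite linearD /= symB sh.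
  rewrite logdensE//; last exact: hyperboloid_muh.
  rewrite det_mexp// expRK invmx_mexp// Gfun_muh// lnM ?posrE ?Gfun_gt0//; last first.
    rewrite /Gratio -boost0_muh// -!Gfun_Gmom ?boost0_ge1 ?kbase_ge1//.
    by rewrite divr_gt0 ?Gfun_gt0.
  have -> : logdens_jet h x = - 2^-1 * (\tr B0 + \tr (mat (rsubmx h)))
    + (\sum_j (\sum_i Uh i h x * Eh i j h) * Uh j h x) * (- 2^-1 * (kbase x * Gfun (kbase x)) ^+ 2)
    + d.-1%:R * (ln (Gfun (kbase x)) + ln (Gratio h x)).
    by rewrite /logdens_jet mulrDr (_ : 1 + (Gratio h x - 1) = Gratio h x)//; ring.
  rewrite mxtraceD; congr (_ + _ + _); apply: esym.
  rewrite quadE dotE mulr_sumr mulr_suml -sumrN; apply: eq_bigr => j _.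
  rewrite mxE boost_muh// !mulr_suml mulr_sumr -sumrN; apply: eq_bigr => i _.
  by rewrite boost_muh// /Eh /Uh opprD; ring.
apply: has_jet_D; first apply: has_jet_D.
- apply: one_weight; apply: has_jet_Ml; first exact: has_jet_cst.
  apply: has_jet_D; first exact: has_jet_cst.
  apply: has_jet_linear => a h k; by rewrite linearP mat_linear linearP.
- apply: has_jet_Ml.
    apply: has_jet_sum => // j; apply: has_jet_Ml; last exact: jet_Uh.
    by apply: has_jet_sum => // i; apply: has_jet_Ml; [exact: jet_Uh|exact: jet_Eh].
  apply: (@has_jet_fun R _ (borel R 1 d.+1) _ hyperboloid _ _ 1) => //.
    apply: measurable_funM; first exact: measurable_cst.
    by apply: measurable_funX; apply: measurable_funM; [exact: measurable_kbase|exact: measurable_Gfun_kbase].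
  move=> x _; split => //; have /andP[a0 a1] := sqrt_weight_bound x.
  rewrite normrM normrN !ger0_norm ?exprn_ge0// mul1r /jet_weight.
  have r0 := rbase_ge0 x.
  by have : (kbase x * Gfun (kbase x)) ^+ 2 <= (1 + rbase x) ^+ 2 by [rewrite lerXn2r ?nnegrE//; lra]; have := exprn_ge0 2 a0; lra.
apply: has_jet_D; last first.
  apply: one_weight; apply: has_jet_Ml; first exact: has_jet_cst.
  have hd : has_jet one (fun h x => Gratio h x + - 1) by apply: has_jet_D; [exact: jet_Gratio|exact: has_jet_cst].
  apply: (has_jet_comp (has_gjet_ln (T := borel R 1 d.+1) hyperboloid) hd).
  move=> x _; rewrite /Gratio etah0 addr0 mulr1 divff ?subrr//.
  by rewrite -(Gfun_Gmom (kbase_ge1 x)) gt_eqF// Gfun_gt0.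
apply: (@has_jet_fun R _ (borel R 1 d.+1) _ hyperboloid _ _ (d.-1%:R + 1)).
- by rewrite ltr_wpDl.
- apply: measurable_funM; first exact: measurable_cst.
  exact: (measurableT_comp (@measurable_ln R) measurable_Gfun_kbase).
move=> x _; split => //; have r0 := rbase_ge0 x.
have /andP[s1 s2] := sinhc_bounds r0.
have lb : `|ln (Gfun (kbase x))| <= rbase x.
  rewrite /Gfun -/(rbase x) lnV ?posrE ?sinhc_gt0// normrN ler_norml.
  apply/andP; split.
    by rewrite -[leLHS]expRK ler_ln ?posrE ?sinhc_gt0 ?expR_gt0.
  by rewrite -[leRHS]expRK ler_ln ?posrE ?sinhc_gt0 ?expR_gt0.
rewrite normrM ger0_norm//; apply: ler_pM => //; first by rewrite lerDl.
by rewrite (le_trans lb)// /jet_weight; nra.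
Qed.

End wrapped_jets.

(** * Gaussian integrals and the score identities *)

Section gaussian_integrals.
Context {R : realType}.
Local Open Scope ereal_scope.

Lemma measurable_dot_expr n (c : R) (a : 'rV[R]_n) (b : R) :
  measurable_fun setT ((fun v => expR (c * dot (v + a) (v + a) + b)%R) : borel R 1 n -> R).
Proof.
apply: measurableT_comp => //; apply: measurable_funD; last exact: measurable_cst.
apply: measurable_funM; first exact: measurable_cst.
have mshift : measurable_fun setT ((fun v => v + a)%R : borel R 1 n -> borel R 1 n).
  by apply: measurable_addmx; [exact: measurable_idrow|exact: measurable_cstmx].
exact: (measurableT_comp (measurable_continuousR (@continuous_dot R n)) mshift).
Qed.

Lemma lebesgueIZr n (F : borel R 1 n -> \bar R) (c : R) : measurable_fun setT F ->
  (forall v, 0 <= F v) -> (0 <= c)%R -> lebesgueI (fun v => F v * c%:E) = lebesgueI F * c%:E.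
Proof.
move=> mF F0 c0.
have mG : measurable_fun setT (fun t => F (tuple_row t) * (gauss_weight (tuple_row t))%:E).
  apply: emeasurable_funM; first exact: (measurableT_comp mF (@measurable_tuple_row R n)).
  by apply/measurable_EFinP; exact: measurableT_comp (@measurable_gauss_weight R n) (@measurable_tuple_row R n).
have G0 t : 0 <= F (tuple_row t) * (gauss_weight (tuple_row t))%:E.
  by rewrite mule_ge0// lee_fin gauss_weight_ge0.
rewrite /lebesgueI -(ge0_integralZr (gauss n) measurableT mG (fun t _ => G0 t)); last by rewrite lee_fin.
by apply: eq_integral => t _; exact: muleAC.
Qed.

Local Notation kappa n := ((normal_peak 1 : R) ^+ n)%R.

Lemma kappa_ge0 n : (0 <= kappa n)%R. Proof. by rewrite exprn_ge0// normal_peak_ge0. Qed.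

Lemma gaussian_mass n (b : R) (c : 'rV[R]_n) : (0 < b)%R ->
  lebesgueI (fun v : 'rV[R]_n => (kappa n * expR (- (2^-1 / b ^+ 2) * dot (v - c) (v - c)))%R%:E) = (b ^+ n)%:E.
Proof.
move=> b0; pose F (v : 'rV[R]_n) : \bar R := (kappa n * expR (- (2^-1 / b ^+ 2) * dot v v))%:E.
have mF : measurable_fun setT (F : borel R 1 n -> \bar R).
  apply/measurable_EFinP; apply: measurable_funM; first exact: measurable_cst.
  have := @measurable_dot_expr n (- (2^-1 / b ^+ 2)) 0 0; rewrite (_ : (fun v => _) = fun v : 'rV[R]_n => expR (- (2^-1 / b ^+ 2) * dot v v)%R)//.
  by apply/funext => v; rewrite !addr0.
have F0 v : 0 <= F v by rewrite lee_fin mulr_ge0 ?kappa_ge0 ?expR_ge0.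
rewrite (lebesgueI_shift (- c) mF F0) -(lebesgueI_scale (lt0r_neq0 b0) mF F0) (gtr0_norm b0).
rewrite -[RHS]mul1e; congr (_ * _); rewrite -[RHS](integral_prob_cst (gauss n)).
rewrite (@lebesgueI_gauss R n (fun=> 1%:E)); apply: eq_lebesgueI => v.
rewrite /F mul1e; congr (_ * expR _)%:E; rewrite dotZl dotZr.
by field; rewrite gt_eqF.
Qed.

(** 3/8 - 1/2 = - 1/8 is the exponent of a Gaussian of standard deviation 2, which has mass 2^n
    against the normalised density. *)
Lemma gauss_exp_moment n :
  \int[gauss n]_t (expR (3 / 8 * dot (tuple_row t) (tuple_row t)))%:E = (2 ^+ n : R)%:E.
Proof.
have b0 : (0 < 2 :> R)%R by [].
rewrite -(gaussian_mass 0 b0) (lebesgueI_gauss (fun v => (expR (3 / 8 * dot v v))%:E)).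
apply: eq_lebesgueI => v; rewrite subr0 -EFinM mulrCA -expRD; congr (_ * expR _)%:E.
by field.
Qed.

Lemma cameron_martin n (F : borel R 1 n -> \bar R) (h : 'rV[R]_n) : measurable_fun setT F ->
  (forall v, 0 <= F v) ->
  \int[gauss n]_t F (tuple_row t + h)%R =
  \int[gauss n]_t (F (tuple_row t) * (expR (dot (tuple_row t) h - 2^-1 * dot h h))%:E).
Proof.
move=> mF F0; rewrite (lebesgueI_gauss (fun v => F (v + h)%R)).
rewrite (lebesgueI_gauss (fun v => F v * (expR (dot v h - 2^-1 * dot h h))%:E)).
pose H (v : 'rV[R]_n) := F v * (kappa n * expR (- 2^-1 * dot (v - h) (v - h)))%:E.
have mH : measurable_fun setT (H : borel R 1 n -> \bar R).
  apply: emeasurable_funM => //; apply/measurable_EFinP; apply: measurable_funM; first exact: measurable_cst.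
  have := @measurable_dot_expr n (- 2^-1) (- h) 0.
  rewrite (_ : (fun v => _) = fun v : 'rV[R]_n => expR (- 2^-1 * dot (v - h) (v - h))%R)//.
  by apply/funext => v; rewrite !addr0.
have H0 v : 0 <= H v by rewrite mule_ge0// lee_fin mulr_ge0 ?kappa_ge0 ?expR_ge0.
rewrite (eq_lebesgueI (G := fun v => H (v + h)%R)); last by move=> v; rewrite /H addrK.
rewrite (lebesgueI_shift h mH H0); apply: eq_lebesgueI => v.
rewrite /H -muleA -EFinM mulrCA -expRD; congr (_ * (_ * expR _)%:E).
by rewrite !(dotDl, dotDr, dotNl, dotNr) (dotC h v); field.
Qed.

(** The inner integral is rewritten over the sum u with a Gaussian kernel; after Tonelli, completing
    the square in s leaves the standard Gaussian density of u. *)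
Lemma gauss_stability n (F : borel R 1 n -> \bar R) (a b : R) : (0 < b)%R -> (a ^+ 2 + b ^+ 2 = 1)%R ->
  measurable_fun setT F -> (forall v, 0 <= F v) ->
  \int[gauss n]_s \int[gauss n]_t F (a *: tuple_row s + b *: tuple_row t)%R =
  \int[gauss n]_t F (tuple_row t).
Proof.
move=> b0 ab mF F0; have bn0 : b != 0%R by rewrite gt_eqF.
have bp : (0 < b ^+ n)%R by rewrite exprn_gt0.
pose H (s u : 'rV[R]_n) := F u * (kappa n * expR (- (2^-1 / b ^+ 2) * dot (u - a *: s) (u - a *: s)))%:E.
have mE s : measurable_fun setT ((fun u => kappa n * expR (- (2^-1 / b ^+ 2) * dot (u - a *: s) (u - a *: s)))%R : borel R 1 n -> R).
  apply: measurable_funM; first exact: measurable_cst.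
  have := @measurable_dot_expr n (- (2^-1 / b ^+ 2)) (- (a *: s)) 0.
  rewrite (_ : (fun v => _) = fun u : 'rV[R]_n => expR (- (2^-1 / b ^+ 2) * dot (u - a *: s) (u - a *: s))%R)//.
  by apply/funext => v; rewrite !addr0.
have mH s : measurable_fun setT (H s : borel R 1 n -> \bar R).
  by apply: emeasurable_funM => //; apply/measurable_EFinP; exact: mE.
have H0 s u : 0 <= H s u by rewrite mule_ge0// lee_fin mulr_ge0 ?kappa_ge0 ?expR_ge0.
have inner (s : 'rV[R]_n) : \int[gauss n]_t F (a *: s + b *: tuple_row t)%R = lebesgueI (H s) * ((b ^+ n)^-1)%:E.
  rewrite (lebesgueI_gauss (fun v => F (a *: s + b *: v)%R)).
  rewrite -(lebesgueI_shift (a *: s) (mH s) (H0 s)).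
  have mHs : measurable_fun setT ((fun v => H s (v + a *: s)%R) : borel R 1 n -> \bar R).
    apply: measurable_comp_borel => //; apply: measurable_addmx; [exact: measurable_idrow|exact: measurable_cstmx].
  rewrite -(lebesgueI_scale bn0 mHs (fun v => H0 s _)) (gtr0_norm b0) -muleA -EFinM divff ?gt_eqF// mule1.
  apply: eq_lebesgueI => v; rewrite /H addrK addrC; congr (_ * (_ * expR _)%:E).
  by rewrite dotZl dotZr; field.
pose L (z : (n.-tuple (measurableTypeR R) * n.-tuple (measurableTypeR R))%type) : \bar R :=
  H (tuple_row z.1) (tuple_row z.2) * (gauss_weight (tuple_row z.2))%:E * ((b ^+ n)^-1)%:E.
have m1 : measurable_fun setT ((fun z : (n.-tuple (measurableTypeR R) * n.-tuple (measurableTypeR R))%type => tuple_row z.1) : _ -> borel R 1 n).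
  exact: (measurableT_comp (@measurable_tuple_row R n) measurable_fst).
have m2 : measurable_fun setT ((fun z : (n.-tuple (measurableTypeR R) * n.-tuple (measurableTypeR R))%type => tuple_row z.2) : _ -> borel R 1 n).
  exact: (measurableT_comp (@measurable_tuple_row R n) measurable_snd).
have mL : measurable_fun setT L.
  apply: emeasurable_funM; last exact: measurable_cst.
  apply: emeasurable_funM; last first.
    by apply/measurable_EFinP; exact: (measurableT_comp (@measurable_gauss_weight R n) m2).
  apply: emeasurable_funM; first exact: (measurableT_comp mF m2).
  apply/measurable_EFinP; apply: measurable_funM; first exact: measurable_cst.
  apply: measurableT_comp => //; apply: measurable_funM; first exact: measurable_cst.
  have mD : measurable_fun setT ((fun z : (n.-tuple (measurableTypeR R) * n.-tuple (measurableTypeR R))%type => tuple_row z.2 + (- a) *: tuple_row z.1)%R : _ -> borel R 1 n).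
    by apply: measurable_addmx => //; apply: measurable_scalemx => //; exact: measurable_cst.
  have := measurableT_comp (measurable_continuousR (@continuous_dot R n)) mD.
  congr measurable_fun; apply/funext => z; by rewrite /= scaleNr.
have L0 z : 0 <= L z.
  by rewrite mule_ge0 ?lee_fin ?invr_ge0 ?(ltW bp)// mule_ge0// lee_fin gauss_weight_ge0.
transitivity (\int[gauss n]_s \int[gauss n]_t L (s, t)).
  apply: eq_integral => s _; rewrite inner /L /=.
  rewrite -lebesgueIZr ?invr_ge0 ?(ltW bp)//.
  by apply: eq_integral => t _; exact: muleAC.
rewrite (@fubini_tonelli _ _ _ _ _ (gauss n) (gauss n) L mL L0).
apply: eq_integral => t _; set u := tuple_row t.
pose K (s : 'rV[R]_n) := (kappa n * expR (- (2^-1 / b ^+ 2) * dot (u - a *: s) (u - a *: s)))%:E.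
have mK : measurable_fun setT (fun s => K (tuple_row s)).
  apply/measurable_EFinP; apply: measurable_funM; first exact: measurable_cst.
  apply: measurableT_comp => //; apply: measurable_funM; first exact: measurable_cst.
  have mD : measurable_fun setT ((fun s : n.-tuple (measurableTypeR R) => u + (- a) *: tuple_row s)%R : _ -> borel R 1 n).
    apply: measurable_addmx; first exact: measurable_cstmx.
    by apply: measurable_scalemx; [exact: measurable_cst|exact: measurable_tuple_row].
  have := measurableT_comp (measurable_continuousR (@continuous_dot R n)) mD.
  congr measurable_fun; apply/funext => z; by rewrite /= scaleNr.
have K0 s : 0 <= K s by rewrite lee_fin mulr_ge0 ?kappa_ge0 ?expR_ge0.
have w0 := gauss_weight_ge0 u.
transitivity (\int[gauss n]_s (K (tuple_row s) * (F u * (gauss_weight u)%:E * ((b ^+ n)^-1)%:E))).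
  apply: eq_integral => s _; rewrite /L /H /= -/u -/(K (tuple_row s)).
  by rewrite (muleC (F u)) -!muleA.
rewrite (ge0_integralZr (gauss n) measurableT mK (fun s _ => K0 _)); last first.
  by rewrite mule_ge0 ?lee_fin ?invr_ge0 ?(ltW bp)// mule_ge0.
have -> : \int[gauss n]_s K (tuple_row s) = (b ^+ n * (kappa n * expR (- 2^-1 * dot u u)))%:E.
  rewrite (lebesgueI_gauss K) EFinM -(gaussian_mass (a *: u) b0) -lebesgueIZr.
  - apply: eq_lebesgueI => s; rewrite /K -!EFinM; congr EFin.
    rewrite mulrACA [in RHS]mulrACA -!expRD; congr (_ * expR _)%R.
    rewrite !(dotDl, dotDr, dotNl, dotNr, dotZl, dotZr) (dotC s u).
    have a2 : (a ^+ 2 = 1 - b ^+ 2)%R by lra.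
    by field: a2.
  - apply/measurable_EFinP; apply: measurable_funM; first exact: measurable_cst.
    have := @measurable_dot_expr n (- (2^-1 / b ^+ 2)) (- (a *: u)) 0.
    by congr measurable_fun; apply/funext => v; rewrite !addr0.
  - by move=> v; rewrite lee_fin mulr_ge0 ?kappa_ge0 ?expR_ge0.
  - by rewrite mulr_ge0 ?kappa_ge0 ?expR_ge0.
have wE : (gauss_weight u * (kappa n * expR (- 2^-1 * dot u u)) = 1)%R.
  have -> : (kappa n * expR (- 2^-1 * dot u u) = \prod_i normal_pdf 0 1 (u ord0 i))%R.
    under [RHS]eq_bigr do rewrite normal_pdfE ?oner_eq0//.
    rewrite big_split /= prodr_const card_ord; congr (_ * _)%R.
    rewrite /normal_fun -expR_sum; congr expR; rewrite dotE mulr_sumr; apply: eq_bigr => i _.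
    by rewrite subr0 expr1n; field.
  rewrite /gauss_weight -big_split /= big1// => i _.
  by rewrite mulVf// gt_eqF// normal_pdf01_gt0.
rewrite muleC -!muleA -!EFinM.
rewrite (_ : (gauss_weight u * ((b ^+ n)^-1 * (b ^+ n * (kappa n * expR (- 2^-1 * dot u u)))))%R = 1%R) ?mule1//.
by rewrite mulKf ?gt_eqF.
Qed.

End gaussian_integrals.

Section integrals_over_probability.
Context {R : realType} {disp : measure_display} {T : measurableType disp}.
Variable mu : probability T R.

Lemma integrable_dominated (f g : T -> R) : measurable_fun setT f ->
  mu.-integrable setT (EFin \o g) -> (forall x, `|f x| <= g x) -> mu.-integrable setT (EFin \o f).
Proof.
move=> mf ig fg; apply: (le_integrable measurableT _ _ ig); first exact/measurable_EFinP.
by move=> x _; rewrite /= lee_fin (le_trans (fg x))// ler_norm.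
Qed.

Lemma integrableD_fin (f g : T -> R) : mu.-integrable setT (EFin \o f) ->
  mu.-integrable setT (EFin \o g) -> mu.-integrable setT (EFin \o (fun x => f x + g x)).
Proof. by move=> hf hg; have := integrableD measurableT hf hg. Qed.

Lemma integrableZ_fin (f : T -> R) c : mu.-integrable setT (EFin \o f) ->
  mu.-integrable setT (EFin \o (fun x => c * f x)).
Proof. by move=> hf; have := integrableZl measurableT c hf. Qed.

Lemma integrable_cst_fin (c : R) : mu.-integrable setT (EFin \o (fun=> c)).
Proof. exact: finite_measure_integrable_cst. Qed.

Lemma integrable_sum_fin (I : Type) (s : seq I) (F : I -> T -> R) :
  (forall i, mu.-integrable setT (EFin \o F i)) ->
  mu.-integrable setT (EFin \o (fun x => \sum_(i <- s) F i x)).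
Proof.
move=> hF; elim: s => [|i s IH].
  rewrite (_ : EFin \o _ = EFin \o (fun=> 0)); first exact: integrable_cst_fin.
  by apply/funext => x /=; rewrite big_nil.
rewrite (_ : EFin \o _ = EFin \o (fun x => F i x + \sum_(j <- s) F j x)).
  exact: integrableD_fin.
by apply/funext => x /=; rewrite big_cons.
Qed.

Lemma Rintegral_cst_prob (c : R) : \int[mu]_x c = c.
Proof.
rewrite /Rintegral; have := @integral_cst _ _ R mu setT measurableT c%:E; rewrite /cst => ->.
by rewrite [X in (_ * X)%E]probability_setT mule1.
Qed.

Lemma Rintegral_sum_fin (I : Type) (s : seq I) (F : I -> T -> R) :
  (forall i, mu.-integrable setT (EFin \o F i)) ->
  \int[mu]_x (\sum_(i <- s) F i x) = \sum_(i <- s) \int[mu]_x F i x.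
Proof.
move=> hF; elim: s => [|i s IH].
  rewrite big_nil -[RHS](Rintegral_cst_prob 0); apply: eq_Rintegral => x _.
  by rewrite big_nil.
rewrite big_cons -IH -(RintegralD measurableT (hF i) (integrable_sum_fin s hF)).
by apply: eq_Rintegral => x _; rewrite big_cons.
Qed.

Lemma RintegralZl_fin (f : T -> R) c : mu.-integrable setT (EFin \o f) ->
  \int[mu]_x (c * f x) = c * \int[mu]_x f x.
Proof. exact: RintegralZl. Qed.

Lemma RintegralD_fin (f g : T -> R) : mu.-integrable setT (EFin \o f) ->
  mu.-integrable setT (EFin \o g) ->
  \int[mu]_x (f x + g x) = \int[mu]_x f x + \int[mu]_x g x.
Proof. exact: RintegralD. Qed.

Lemma Rintegral_norm_le (f g : T -> R) : measurable_fun setT f ->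
  mu.-integrable setT (EFin \o g) -> (forall x, `|f x| <= g x) -> `|\int[mu]_x f x| <= \int[mu]_x g x.
Proof.
move=> mf ig fg; have i_f := integrable_dominated mf ig fg.
rewrite (le_trans (le_normr_Rintegral measurableT i_f))//; apply: le_Rintegral => //.
exact: (integrable_norm i_f).
Qed.

End integrals_over_probability.

(** A polynomial without constant term and of degree at most 2 that is O(l^3) at 0 vanishes. *)
Lemma quadratic_expansion_eq0 {R : realType} (a b K l0 : R) : 0 < l0 ->
  (forall l, `|l| <= l0 -> `|a * l + b * l ^+ 2| <= K * `|l| ^+ 3) -> a = 0 /\ b = 0.
Proof.
move=> l00 H.
have K0 : 0 <= K.
  have := H l0; rewrite gtr0_norm// => /(_ (lexx _)) h.
  by rewrite -(pmulr_lge0 _ (exprn_gt0 3 l00)) (le_trans _ h).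
have a0 : a = 0.
  apply/eqP; apply/negPn/negP => an0; have ap : 0 < `|a| by rewrite normr_gt0.
  have D0 : 0 < `|b| + K * l0 + 1 by rewrite ltr_wpDl// addr_ge0// mulr_ge0// ltW.
  (* So small that the higher-order terms use up at most half of |a| l. *)
  pose l := Num.min l0 (`|a| / (2 * (`|b| + K * l0 + 1))).
  have lp : 0 < l by rewrite lt_min l00 divr_gt0// mulr_gt0.
  have ll0 : l <= l0 by rewrite /l ge_min lexx.
  have la : l * (2 * (`|b| + K * l0 + 1)) <= `|a|.
    by rewrite -ler_pdivlMr ?mulr_gt0// /l ge_min lexx orbT.
  have := H l; rewrite gtr0_norm// => /(_ ll0) h.
  have h1 : `|a| * l - `|b| * l ^+ 2 <= `|a * l + b * l ^+ 2|.
    have := ler_normD (a * l + b * l ^+ 2) (- (b * l ^+ 2)); rewrite addrK normrN (normrM a) (normrM b) normrX (gtr0_norm lp).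
    by lra.
  have h2 : `|a| * l <= (`|b| + K * l) * l ^+ 2 by rewrite exprS in h; lra.
  have h3 : `|a| <= (`|b| + K * l) * l.
    by rewrite -(ler_pM2r lp) (le_trans h2)// expr2 mulrA.
  have h4 : K * l <= K * l0 by rewrite ler_wpM2l.
  have := normr_ge0 b; nra.
split=> //; apply/eqP; apply/negPn/negP => bn0; have bp : 0 < `|b| by rewrite normr_gt0.
pose l := Num.min l0 (`|b| / (2 * (K + 1))).
have K1 : 0 < K + 1 by lra.
have lp : 0 < l by rewrite lt_min l00 divr_gt0// mulr_gt0.
have ll0 : l <= l0 by rewrite /l ge_min lexx.
have la : l * (2 * (K + 1)) <= `|b| by rewrite -ler_pdivlMr ?mulr_gt0// /l ge_min lexx orbT.
have := H l; rewrite gtr0_norm// a0 mul0r add0r => /(_ ll0).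
rewrite normrM normrX (gtr0_norm lp) (exprS l 2) (mulrA K) ler_pM2r ?exprn_gt0// => h.
nra.
Qed.

(** * Mean and variance identities of a smooth likelihood ratio *)

Section score_identities.
Context {R : realType} {disp : measure_display} {T : measurableType disp} {p : nat}.
Variables (mu : probability T R) (w : T -> R) (kappa : R).
Hypothesis mw : measurable_fun setT w.
Hypothesis w1 : forall x, 1 <= w x.
Hypothesis kappa0 : 0 < kappa.
Hypothesis expw : mu.-integrable setT (EFin \o (fun x => expR (kappa * w x))).

(** Spends only half of the exponential moment; the other half remains to dominate exp of the
    log-ratio. *)
Lemma weight_cube x : w x ^+ 3 <= (6 / kappa) ^+ 3 * expR (kappa / 2 * w x).
Proof.
have h : w x <= 6 / kappa * expR (kappa / 6 * w x).
  have := expR_ge1Dx (kappa / 6 * w x); have c : 0 < 6 / kappa by rewrite divr_gt0.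
  move=> /(ler_wpM2l (ltW c)); apply: le_trans.
  by rewrite mulrDr mulr1 mulrA (_ : 6 / kappa * (kappa / 6) = 1) ?mul1r; [lra|field; rewrite gt_eqF].
have w0 := w1 x; have c0 : 0 <= 6 / kappa * expR (kappa / 6 * w x).
  by rewrite mulr_ge0 ?expR_ge0// divr_ge0// ltW.
have : w x ^+ 3 <= (6 / kappa * expR (kappa / 6 * w x)) ^+ 3 by rewrite lerXn2r ?nnegrE//; lra.
rewrite exprMn -expRM_natr; congr (_ <= _ * expR _); by field.
Qed.

Lemma integrable_weight_cube : mu.-integrable setT (EFin \o (fun x => w x ^+ 3)).
Proof.
apply: (@integrable_dominated _ _ _ mu _ (fun x => (6 / kappa) ^+ 3 * expR (kappa * w x))).
- exact: measurable_funX.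
- exact: integrableZ_fin.
move=> x; have w0 := w1 x; rewrite ger0_norm ?exprn_ge0//; last by lra.
rewrite (le_trans (weight_cube x))// ler_wpM2l ?exprn_ge0 ?divr_ge0 ?(ltW kappa0)// ler_expR.
have : 0 <= kappa * w x by rewrite mulr_ge0 ?(ltW kappa0) ?(le_trans ler01 (w1 x)).
by lra.
Qed.

Variables (f : 'rV[R]_p -> T -> R) (s : T -> 'rV[R]_p) (q : T -> 'M[R]_p).
Hypothesis jf : jet setT w f (fun=> 0) s q.
Hypothesis mf : forall h, measurable_fun setT (f h).
Hypothesis ef : forall h, (\int[mu]_x (expR (f h x))%:E = 1)%E.

Lemma measurable_dot_score h : measurable_fun setT (fun x => dot (s x) h).
Proof.
case: jf => _ ms _ _; under eq_fun do rewrite dotE.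
by apply: measurable_sum => i; apply: measurable_funM; [exact: measurable_entry|exact: measurable_cst].
Qed.

Lemma measurable_quad_score h : measurable_fun setT (fun x => quad (q x) h).
Proof.
case: jf => _ _ mq _; under eq_fun do rewrite quadE dotE.
apply: measurable_sum => i; apply: measurable_funM; last exact: measurable_cst.
under eq_fun do rewrite mxE; apply: measurable_sum => j.
by apply: measurable_funM; [exact: measurable_cst|exact: measurable_entry].
Qed.

Lemma weight_le_cube x : w x <= w x ^+ 3 /\ w x ^+ 2 <= w x ^+ 3.
Proof.
have w0 := w1 x; have e : 0 <= w x by lra.
by split; [rewrite -{1}[w x]expr1 ler_weXn2l|rewrite ler_weXn2l].
Qed.

Lemma integrable_dot_score h : mu.-integrable setT (EFin \o (fun x => dot (s x) h)).
Proof.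
have [_ _ _ [C [rho [C0 rho0 H]]]] := jf.
apply: (@integrable_dominated _ _ _ mu _ (fun x => (C * enorm h) * w x ^+ 3)).
- exact: measurable_dot_score.
- by apply: integrableZ_fin; exact: integrable_weight_cube.
move=> x; have [_ _ b1 _ _] := H x I; rewrite (le_trans (ler_dot _ _))//.
rewrite mulrAC ler_wpM2r ?enorm_ge0// (le_trans b1)// ler_wpM2l ?(ltW C0)//.
by case: (weight_le_cube x).
Qed.

Lemma integrable_dot_score_sqr h : mu.-integrable setT (EFin \o (fun x => dot (s x) h ^+ 2)).
Proof.
have [_ _ _ [C [rho [C0 rho0 H]]]] := jf.
apply: (@integrable_dominated _ _ _ mu _ (fun x => (C * enorm h) ^+ 2 * w x ^+ 3)).
- by apply: measurable_funX; exact: measurable_dot_score.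
- by apply: integrableZ_fin; exact: integrable_weight_cube.
move=> x; have [w0 _ b1 _ _] := H x I; have e0 := enorm_ge0 h.
have d : `|dot (s x) h| <= C * enorm h * w x.
  by rewrite (le_trans (ler_dot _ _))// mulrAC ler_wpM2r.
rewrite normrX (@le_trans _ _ ((C * enorm h * w x) ^+ 2))//.
  by rewrite lerXn2r ?nnegrE ?mulr_ge0// ltW.
rewrite exprMn ler_wpM2l ?exprn_ge0 ?mulr_ge0 ?(ltW C0)//.
by case: (weight_le_cube x).
Qed.

Lemma integrable_quad_score h : mu.-integrable setT (EFin \o (fun x => quad (q x) h)).
Proof.
have [_ _ _ [C [rho [C0 rho0 H]]]] := jf.
apply: (@integrable_dominated _ _ _ mu _ (fun x => (C * enorm h ^+ 2) * w x ^+ 3)).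
- exact: measurable_quad_score.
- by apply: integrableZ_fin; exact: integrable_weight_cube.
move=> x; have [_ _ _ b2 _] := H x I; rewrite (le_trans (quad_bound _ _))//.
rewrite mulrAC ler_wpM2r ?sqr_ge0// (le_trans b2)// ler_wpM2l ?(ltW C0)//.
by case: (weight_le_cube x).
Qed.

Lemma expansion_remainder : exists K r, [/\ 0 <= K, 0 < r & forall h x, enorm h <= r ->
  `|expR (f h x) - (1 + dot (s x) h + quad (q x) h + dot (s x) h ^+ 2 / 2)|
    <= enorm h ^+ 3 * (K * expR (kappa * w x))].
Proof.
have [_ _ _ [C [rho [C0 rho0 H]]]] := jf.
(* The three terms bound the cubic remainder of exp, the remainder of the jet, and half the
   difference between f^2 and the square of its linear part. The radius kappa / (6 C) gives |f| <=
   kappa w / 2. *)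
exists ((27 * C ^+ 3 + C + 4 * C ^+ 2) * (6 / kappa) ^+ 3), (Num.min (Num.min 1 rho) (kappa / (6 * C))).
split.
- by rewrite mulr_ge0 ?exprn_ge0 ?divr_ge0 ?(ltW kappa0)// !addr_ge0 ?mulr_ge0 ?exprn_ge0 ?(ltW C0).
- by rewrite !lt_min ltr01 rho0 divr_gt0// mulr_gt0.
move=> h x; rewrite !le_min => /andP[/andP[h1 hr] hk].
have [w0 _ b1 b2 b3] := H x I; have {}b3 := b3 h hr.
have z0 : `|0 : R| <= C * w x by rewrite normr0 mulr_ge0// ltW.
have [d1 d2] := jet_bounds h z0 b1 b2.
set e := enorm h in h1 hr hk b3 d1 d2 *; have e0 : 0 <= e := enorm_ge0 h.
set A := dot (s x) h in b3 d1 *; set B := quad (q x) h in b3 d2 *; set D := f h x in b3 *.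
rewrite add0r in b3; set W := w x in w0 b3 d1 d2 b1 b2 *; have W1 : 1 <= W := w1 x.
have CW : 0 <= C * W by rewrite mulr_ge0// ltW.
have e2 : e ^+ 2 <= e by rewrite expr2 ler_piMl.
have e3 : e ^+ 3 <= e ^+ 2 by rewrite exprS ler_piMl// exprn_ge0.
have u2 := ler_wpM2l CW e2; have u3 := ler_wpM2l CW e3.
have DA : `|D - A| <= 2 * (C * W) * e ^+ 2.
  rewrite (_ : D - A = B + (D - (A + B))); last by ring.
  by have := normD_le d2 b3; lra.
have DD : `|D| <= 3 * (C * W * e).
  by rewrite (_ : D = A + (D - A)); [have := normD_le d1 DA; lra|ring].
have DpA : `|D + A| <= 4 * (C * W * e) by have := normD_le DD d1; lra.
have sq : `|(D - A) * (D + A) / 2| <= 4 * (C * W) ^+ 2 * e ^+ 3.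
  rewrite normrM (@ger0_norm _ 2^-1)//; have := normM_le DA DpA.
  rewrite (_ : 2 * (C * W) * e ^+ 2 * (4 * (C * W * e)) = 8 * (C * W) ^+ 2 * e ^+ 3); last by ring.
  lra.
have t := expR_taylor2 D.
have t' : `|D| ^+ 3 * expR `|D| <= 27 * (C * W) ^+ 3 * e ^+ 3 * expR (kappa / 2 * W).
  rewrite (_ : 27 * (C * W) ^+ 3 * e ^+ 3 = (3 * (C * W * e)) ^+ 3); last by ring.
  apply: ler_pM; rewrite ?exprn_ge0 ?expR_ge0//.
    by rewrite lerXn2r ?nnegrE// (le_trans _ DD).
  rewrite ler_expR (le_trans DD)// (_ : 3 * (C * W * e) = (3 * C * e) * W); last by ring.
  rewrite ler_wpM2r//; move: hk; rewrite ler_pdivlMr ?mulr_gt0//; lra.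
have -> : expR D - (1 + A + B + A ^+ 2 / 2) =
   (expR D - (1 + D + D ^+ 2 / 2)) + ((D - (A + B)) + (D - A) * (D + A) / 2) by field.
have h3 : `|expR D - (1 + D + D ^+ 2 / 2)| <= 27 * (C * W) ^+ 3 * e ^+ 3 * expR (kappa / 2 * W).
  exact: le_trans t t'.
have tot := normD_le h3 (normD_le b3 sq); rewrite (le_trans tot)//.
have E1 : 1 <= expR (kappa / 2 * W).
  by rewrite -expR0 ler_expR mulr_ge0// divr_ge0// ltW.
have [l1 l2] := weight_le_cube x; rewrite -/W in l1 l2.
have e30 : 0 <= e ^+ 3 by rewrite exprn_ge0.
have W3 : 0 <= W ^+ 3 by rewrite exprn_ge0.
set E := expR (kappa / 2 * W) in E1 *.
have E0 : 0 <= E by lra.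
have c1 : C * W * e ^+ 3 <= C * W ^+ 3 * e ^+ 3 * E.
  rewrite -[leLHS]mulr1; apply: ler_pM => //; first by rewrite !mulr_ge0// ltW.
  by rewrite ler_wpM2r// ler_wpM2l// ltW.
have c2 : 4 * (C * W) ^+ 2 * e ^+ 3 <= 4 * C ^+ 2 * W ^+ 3 * e ^+ 3 * E.
  rewrite -[leLHS]mulr1; apply: ler_pM => //; first by rewrite mulr_ge0// mulr_ge0// exprn_ge0.
  by rewrite ler_wpM2r// exprMn mulrA ler_wpM2l// mulr_ge0// exprn_ge0// ltW.
apply: (@le_trans _ _ (e ^+ 3 * ((27 * C ^+ 3 + C + 4 * C ^+ 2) * (W ^+ 3 * E)))).
  by rewrite exprMn; lra.
rewrite ler_wpM2l// -mulrA ler_wpM2l//.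
  by rewrite !addr_ge0 ?mulr_ge0 ?exprn_ge0 ?(ltW C0).
have := weight_cube x; rewrite -/W -/E => /(ler_wpM2r E0) /le_trans; apply.
by rewrite -mulrA /E -expRD ler_wpM2l ?exprn_ge0 ?divr_ge0 ?(ltW kappa0)// ler_expR; lra.
Qed.

(** Integrating the expansion of exp f, whose integral is 1 for every h, leaves first- and
    second-order terms that are O(|h|^3); along the ray l h both must vanish. *)
Theorem score_identity h : \int[mu]_x dot (s x) h = 0 /\
  \int[mu]_x quad (q x) h = - 2^-1 * \int[mu]_x (dot (s x) h ^+ 2).
Proof.
have [K [r [K0 r0 HK]]] := expansion_remainder.
have i1 := integrable_dot_score; have i2 := integrable_dot_score_sqr; have i3 := integrable_quad_score.
have mE k : measurable_fun setT (fun x => expR (f k x)) by apply: measurableT_comp => //; exact: mf.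
have iE k : mu.-integrable setT (EFin \o (fun x => expR (f k x))).
  apply/integrableP; split; first exact/measurable_EFinP.
  rewrite (_ : (fun x => `|_|%E) = fun x => (expR (f k x))%:E); first by rewrite ef ltry.
  by apply/funext => x; rewrite /= ger0_norm// expR_ge0.
have IE k : \int[mu]_x expR (f k x) = 1 by rewrite /Rintegral ef.
pose M := K * \int[mu]_x expR (kappa * w x).
have bound k : enorm k <= r ->
    `|\int[mu]_x dot (s x) k + \int[mu]_x quad (q x) k + 2^-1 * \int[mu]_x (dot (s x) k ^+ 2)| <= M * enorm k ^+ 3.
  move=> hk; pose g x := expR (f k x) - (1 + dot (s x) k + quad (q x) k + dot (s x) k ^+ 2 / 2).
  have gE x : g x = expR (f k x) + ((- 1) + (-1 * dot (s x) k + (-1 * quad (q x) k + - 2^-1 * dot (s x) k ^+ 2))).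
    by rewrite /g; field.
  have j3 := integrableZ_fin (- 2^-1) (i2 k); have j2 := integrableZ_fin (-1) (i3 k).
  have j1 := integrableZ_fin (-1) (i1 k).
  have k1 := integrableD_fin j2 j3; have k2 := integrableD_fin j1 k1.
  have k3 := integrableD_fin (integrable_cst_fin mu (-1)) k2.
  have Ig : \int[mu]_x g x = - (\int[mu]_x dot (s x) k + \int[mu]_x quad (q x) k + 2^-1 * \int[mu]_x (dot (s x) k ^+ 2)).
    have -> : \int[mu]_x g x = \int[mu]_x (expR (f k x) + ((- 1) + (-1 * dot (s x) k + (-1 * quad (q x) k + - 2^-1 * dot (s x) k ^+ 2)))).
      by apply: eq_Rintegral => x _; exact: gE.
    rewrite (RintegralD_fin (iE k) k3) (RintegralD_fin (integrable_cst_fin mu (-1)) k2).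
    rewrite (RintegralD_fin j1 k1) (RintegralD_fin j2 j3).
    by rewrite !RintegralZl_fin// IE Rintegral_cst_prob; ring.
  rewrite -normrN -Ig.
  have mg : measurable_fun setT g.
    rewrite (_ : g = fun x => expR (f k x) + ((- 1) + (-1 * dot (s x) k + (-1 * quad (q x) k + - 2^-1 * dot (s x) k ^+ 2)))); last exact/funext.
    by have /integrableP[/measurable_EFinP] := integrableD_fin (iE k) k3.
  have iK : mu.-integrable setT (EFin \o (fun x => (enorm k ^+ 3 * K) * expR (kappa * w x))) by exact: integrableZ_fin.
  have := Rintegral_norm_le mg iK; rewrite RintegralZl_fin// => H.
  rewrite /M mulrC mulrA; apply: H => x.
  by rewrite -mulrA; exact: HK.
have [e1 e2] : \int[mu]_x dot (s x) h = 0 /\ \int[mu]_x quad (q x) h + 2^-1 * \int[mu]_x (dot (s x) h ^+ 2) = 0.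
  have hp : 0 < enorm h + 1 by rewrite ltr_wpDl// enorm_ge0.
  apply: (@quadratic_expansion_eq0 _ _ _ (M * enorm h ^+ 3) (r / (enorm h + 1))); first exact: divr_gt0.
  move=> l hl; have lh : enorm (l *: h) <= r.
    rewrite enormZ; have := enorm_ge0 h; have l0 := normr_ge0 l.
    by move: hl; rewrite ler_pdivlMr//; nra.
  have := bound _ lh; rewrite enormZ exprMn.
  have -> : \int[mu]_x dot (s x) (l *: h) = l * \int[mu]_x dot (s x) h.
    by rewrite -RintegralZl_fin//; apply: eq_Rintegral => x _; rewrite dotZr.
  have -> : \int[mu]_x quad (q x) (l *: h) = l ^+ 2 * \int[mu]_x quad (q x) h.
    by rewrite -RintegralZl_fin//; apply: eq_Rintegral => x _; rewrite !quadE -scalemxAl dotZl dotZr mulrA.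
  have -> : \int[mu]_x (dot (s x) (l *: h) ^+ 2) = l ^+ 2 * \int[mu]_x (dot (s x) h ^+ 2).
    by rewrite -RintegralZl_fin//; apply: eq_Rintegral => x _; rewrite dotZr exprMn.
  rewrite (mulrC (`|l| ^+ 3)) mulrA; congr (`|_| <= _); ring.
by split => //; lra.
Qed.

End score_identities.

(** * The central limit theorem *)

Section averaging.
Context {R : realType} {p : nat}.
Implicit Types F G : borel R 1 p -> \bar R.
Local Open Scope ereal_scope.

(** Adding an independent copy of psi, as an operator on test functions; such operators commute, and
    iterating k times adds k independent copies. *)
Definition avg d (T : measurableType d) (mu : probability T R) (psi : T -> 'rV[R]_p) F
  : borel R 1 p -> \bar R := fun x => \int[mu]_t F (x + psi t)%R.

(* F and G need not be finite, hence the two one-sided bounds. *)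
Definition unif_close (e : R) F G := forall x, F x <= G x + e%:E /\ G x <= F x + e%:E.

Lemma measurable_shifted d (T : measurableType d) (psi : T -> 'rV[R]_p) F (x : 'rV[R]_p) :
  measurable_fun setT (psi : T -> borel R 1 p) -> measurable_fun setT F ->
  measurable_fun setT (fun t => F (x + psi t)%R).
Proof.
move=> mpsi mF; have mg : measurable_fun setT ((fun t => x + psi t)%R : T -> borel R 1 p).
  by apply: measurable_addmx => //; exact: measurable_cstmx.
exact: (measurableT_comp mF mg).
Qed.

Lemma avg_ge0 d (T : measurableType d) (mu : probability T R) psi F :
  (forall x, 0 <= F x) -> forall x, 0 <= avg mu psi F x.
Proof. by move=> F0 x; apply: integral_ge0. Qed.

Lemma measurable_avg d (T : measurableType d) (mu : probability T R) (psi : T -> 'rV[R]_p) F :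
  measurable_fun setT (psi : T -> borel R 1 p) -> measurable_fun setT F -> (forall x, 0 <= F x) ->
  measurable_fun setT (avg mu psi F).
Proof.
move=> mpsi mF F0.
pose L (z : (borel R 1 p * T)%type) := F ((z.1 : 'rV[R]_p) + psi z.2)%R.
have mL : measurable_fun setT L.
  have mg : measurable_fun setT ((fun z => (z.1 : 'rV[R]_p) + psi z.2)%R : (borel R 1 p * T)%type -> borel R 1 p).
    apply: measurable_addmx; first exact: measurable_fst.
    exact: (measurableT_comp mpsi measurable_snd).
  exact: (measurableT_comp mF mg).
exact: (@measurable_fun_fubini_tonelli_F _ _ _ _ R mu L mL (fun z => F0 _)).
Qed.

Lemma avgC d1 (T1 : measurableType d1) (mu : probability T1 R) (psi : T1 -> 'rV[R]_p)
    d2 (T2 : measurableType d2) (nu : probability T2 R) (chi : T2 -> 'rV[R]_p) F :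
  measurable_fun setT (psi : T1 -> borel R 1 p) -> measurable_fun setT (chi : T2 -> borel R 1 p) ->
  measurable_fun setT F -> (forall x, 0 <= F x) ->
  avg mu psi (avg nu chi F) = avg nu chi (avg mu psi F).
Proof.
move=> mpsi mchi mF F0; apply/funext => x; rewrite /avg.
pose L (z : (T1 * T2)%type) := F (x + psi z.1 + chi z.2)%R.
have mL : measurable_fun setT L.
  have mg : measurable_fun setT ((fun z => x + psi z.1 + chi z.2)%R : (T1 * T2)%type -> borel R 1 p).
    apply: measurable_addmx; last exact: (measurableT_comp mchi measurable_snd).
    apply: measurable_addmx; first exact: measurable_cstmx.
    exact: (measurableT_comp mpsi measurable_fst).
  exact: (measurableT_comp mF mg).
have := @fubini_tonelli _ _ _ _ R mu nu L mL (fun z => F0 _).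
rewrite /L /= => ->; apply: eq_integral => t _; apply: eq_integral => s _.
by rewrite addrAC.
Qed.

Lemma unif_close_trans e e' F G H : unif_close e F G -> unif_close e' G H -> unif_close (e + e') F H.
Proof.
move=> h h' x; have [a b] := h x; have [a' b'] := h' x; split.
  by rewrite (le_trans a)// (addrC e e') EFinD addeA leeD2r.
by rewrite (le_trans b')// EFinD addeA leeD2r.
Qed.

Lemma avg_close d (T : measurableType d) (mu : probability T R) (psi : T -> 'rV[R]_p) F G (e : R) :
  measurable_fun setT (psi : T -> borel R 1 p) -> measurable_fun setT F -> measurable_fun setT G ->
  (forall x, 0 <= F x) -> (forall x, 0 <= G x) -> (0 <= e)%R ->
  unif_close e F G -> unif_close e (avg mu psi F) (avg mu psi G).
Proof.
move=> mpsi mF mG F0 G0 e0.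
have main F' G' : measurable_fun setT F' -> measurable_fun setT G' -> (forall x, 0 <= F' x) ->
    (forall x, 0 <= G' x) -> (forall x, F' x <= G' x + e%:E) ->
    forall x, avg mu psi F' x <= avg mu psi G' x + e%:E.
  move=> mF' mG' F'0 G'0 h x.
  have mFx := measurable_shifted x mpsi mF'; have mGx := measurable_shifted x mpsi mG'.
  have -> : avg mu psi G' x + e%:E = \int[mu]_t (G' (x + psi t)%R + e%:E).
    rewrite (ge0_integralD mu measurableT (fun t _ => G'0 _) mGx) ?integral_prob_cst//.
  apply: ge0_le_integral => //.
  by apply: emeasurable_funD.
move=> h x; split; apply: main => // y; by have [] := h y.
Qed.

Section iterated.
Context d1 (T1 : measurableType d1) (mu : probability T1 R) (psi : T1 -> 'rV[R]_p).
Context d2 (T2 : measurableType d2) (nu : probability T2 R) (chi : T2 -> 'rV[R]_p).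
Hypothesis mpsi : measurable_fun setT (psi : T1 -> borel R 1 p).
Hypothesis mchi : measurable_fun setT (chi : T2 -> borel R 1 p).

Lemma iter_avg_nice F k : measurable_fun setT F -> (forall x, 0 <= F x) ->
  measurable_fun setT (iter k (avg mu psi) F) /\ (forall x, 0 <= iter k (avg mu psi) F x).
Proof.
move=> mF F0; elim: k => [//|k [m i]]; split; first exact: measurable_avg.
exact: avg_ge0.
Qed.

Lemma iter_avg_power F k x : measurable_fun setT F -> (forall x, 0 <= F x) ->
  iter k (avg mu psi) F x = \int[power_prob mu k]_t F (x + \sum_(i < k) psi (tnth t i))%R.
Proof.
move=> mF F0; elim: k => [|k IH] in x *.
  rewrite /= -[LHS]mul1e.
  have <- : \int[power_prob mu 0]_t (F x) = 1 * F x.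
    by have := @integral_cst _ _ R (power_prob mu 0) setT measurableT (F x); rewrite /cst [X in _ * X]probability_setT mule1 mul1e.
  by apply: eq_integral => t _; rewrite big_ord0 addr0.
rewrite ge0_integral_power_prob; last 2 first.
- apply: (measurable_shifted (psi := fun t : k.+1.-tuple T1 => (\sum_(i < k.+1) psi (tnth t i))%R)) => //.
  apply: measurable_mxP => i j; under eq_fun do rewrite summxE.
  apply: measurable_sum => l; apply: measurable_entry.
  exact: (measurableT_comp mpsi (measurable_tnth l)).
- by move=> t.
rewrite iterS /avg; apply: eq_integral => y _; rewrite IH; apply: eq_integral => t _.
rewrite big_ord_recl addrA {1}/cons_pair tnth0; congr (F (_ + _)%R).
by apply: eq_bigr => i _; rewrite /cons_pair tnthS.
Qed.

End iterated.

(** Replacement one summand at a time: commutation brings the exchanged operators next to F, and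
    averaging does not increase the distance, so each of the k exchanges costs e. *)
Lemma lindeberg d1 (T1 : measurableType d1) (mu : probability T1 R) (psi : T1 -> 'rV[R]_p)
    d2 (T2 : measurableType d2) (nu : probability T2 R) (chi : T2 -> 'rV[R]_p) F (e : R) k :
  measurable_fun setT (psi : T1 -> borel R 1 p) -> measurable_fun setT (chi : T2 -> borel R 1 p) ->
  measurable_fun setT F -> (forall x, 0 <= F x) -> (0 <= e)%R ->
  unif_close e (avg mu psi F) (avg nu chi F) ->
  unif_close (k%:R * e) (iter k (avg mu psi) F) (iter k (avg nu chi) F).
Proof.
move=> mpsi mchi mF F0 e0 h.
have swap j : avg mu psi (iter j (avg nu chi) F) = iter j (avg nu chi) (avg mu psi F).
  elim: j => [//|j IH]; have [m0 i0] := iter_avg_nice nu mchi j mF F0.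
  by rewrite !iterS avgC// IH.
have mA := measurable_avg mu mpsi mF F0; have mB := measurable_avg nu mchi mF F0.
have A0 := avg_ge0 mu psi F0; have B0 := avg_ge0 nu chi F0.
have step j : unif_close e (avg mu psi (iter j (avg nu chi) F)) (avg nu chi (iter j (avg nu chi) F)).
  rewrite swap -iterS iterSr; elim: j => [//|j IH].
  have [m1 i1] := iter_avg_nice nu mchi j mA A0; have [m2 i2] := iter_avg_nice nu mchi j mB B0.
  by rewrite !iterS; apply: avg_close.
elim: k => [|k IH].
  by move=> x; rewrite mul0r !adde0.
have [m1 i1] := iter_avg_nice mu mpsi k mF F0; have [m2 i2] := iter_avg_nice nu mchi k mF F0.
rewrite -natr1 mulrDl mul1r !iterS; apply: unif_close_trans (step k).
by apply: avg_close => //; rewrite mulr_ge0.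
Qed.

Lemma iter_avg_gauss q (A : 'M[R]_(q, p)) (c : R) F k x : measurable_fun setT F -> (forall x, 0 <= F x) ->
  iter k (avg (gauss q) (fun t => c *: (tuple_row t *m A))%R) F x =
  \int[gauss q]_t F (x + (c * Num.sqrt k%:R) *: (tuple_row t *m A))%R.
Proof.
have mt : measurable_fun setT ((fun t => c *: (tuple_row t *m A))%R : q.-tuple (measurableTypeR R) -> borel R 1 p).
  apply: measurable_scalemx; first exact: measurable_cst.
  exact: (measurableT_comp (measurable_mulmx_cst A) (@measurable_tuple_row R q)).
elim: k F x => [|k IH] F x mF F0.
  rewrite sqrtr0 mulr0; under eq_integral do rewrite scale0r addr0.
  have := @integral_cst _ _ R (gauss q) setT measurableT (F x); rewrite /cst => ->.
  by rewrite [X in _ * X]probability_setT mule1.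
rewrite iterSr IH; [|exact: measurable_avg|exact: avg_ge0].
have k1 : (0 < k.+1%:R :> R)%R by rewrite ltr0n.
pose r : R := Num.sqrt k.+1%:R; have r0 : (0 < r)%R by rewrite sqrtr_gt0.
have r2 : (r ^+ 2 = k.+1%:R)%R by rewrite sqr_sqrtr// ltW.
have s2 : (Num.sqrt k%:R ^+ 2 = k%:R :> R)%R by rewrite sqr_sqrtr.
pose G (v : 'rV[R]_q) := F (x + (c * r) *: (v *m A))%R.
have mG : measurable_fun setT (G : borel R 1 q -> \bar R).
  apply: (measurable_shifted (T := borel R 1 q) (psi := fun v : 'rV[R]_q => ((c * r) *: (v *m A))%R)) => //.
  apply: measurable_scalemx; [exact: measurable_cst|exact: measurable_mulmx_cst].
have b0 : (0 < r^-1)%R by rewrite invr_gt0.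
have ab : ((Num.sqrt k%:R / r) ^+ 2 + r^-1 ^+ 2 = 1)%R.
  rewrite exprMn s2 exprVn r2 -natr1; field; by rewrite natr1 gt_eqF.
rewrite -[RHS](gauss_stability b0 ab mG (fun v => F0 _)).
apply: eq_integral => t _; apply: eq_integral => s _; rewrite /G; congr F.
rewrite mulmxDl -!scalemxAl scalerDr !scalerA addrA.
rewrite (_ : (c * r * (Num.sqrt k%:R / r) = c * Num.sqrt k%:R)%R); last by field; rewrite gt_eqF.
by rewrite (_ : (c * r * r^-1 = c)%R)// mulfK// gt_eqF.
Qed.

End averaging.

(** * Moments of the standard Gaussian *)

Section gaussian_moments.
Context {R : realType} {p : nat}.

Definition gw (t : p.-tuple (measurableTypeR R)) : R := 1 + dot (tuple_row t) (tuple_row t).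

Lemma measurable_gw : measurable_fun setT gw.
Proof.
apply: measurable_funD; first exact: measurable_cst.
exact: (measurableT_comp (measurable_continuousR (@continuous_dot R p)) (@measurable_tuple_row R p)).
Qed.

Lemma gw_ge1 t : 1 <= gw t. Proof. by rewrite /gw lerDl dot_ge0. Qed.

Lemma gw_exp : (gauss p).-integrable setT (EFin \o (fun t => expR (3 / 8 * gw t))).
Proof.
have h : (gauss p).-integrable setT (EFin \o (fun t : p.-tuple (measurableTypeR R) => expR (3 / 8 * dot (tuple_row t) (tuple_row t)))).
  apply/integrableP; split.
    apply/measurable_EFinP; apply: measurableT_comp => //; apply: measurable_funM; first exact: measurable_cst.
    exact: (measurableT_comp (measurable_continuousR (@continuous_dot R p)) (@measurable_tuple_row R p)).
  under eq_integral do rewrite /= ger0_norm ?expR_ge0//.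
  by rewrite gauss_exp_moment ltry.
have := integrableZ_fin (expR (3 / 8)) h; congr (_.-integrable _ _).
by apply/funext => t /=; rewrite /gw mulrDr mulr1 expRD.
Qed.

(** The log-likelihood ratio of the shift by h is an exact quadratic in h, so [score_identity]
    yields mean 0 and identity covariance. *)
Lemma gauss_jet : jet setT gw (fun h t => dot (tuple_row t) h - 2^-1 * dot h h) (fun=> 0)
  (@tuple_row R p) (fun=> - 2^-1 *: 1%:M).
Proof.
split; [exact: measurable_cst|exact: measurable_tuple_row|exact: measurable_cstmx|].
exists (1 + mnorm (- 2^-1 *: 1%:M : 'M[R]_p)), 1; have m0 := mnorm_ge0 (- 2^-1 *: 1%:M : 'M[R]_p).
split => //; first by rewrite ltr_wpDr.
move=> t _; have g1 := gw_ge1 t; have g0 : 0 <= gw t by lra.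
split => //.
- by rewrite normr0 mulr_ge0// addr_ge0.
- have e0 := enorm_ge0 (tuple_row t); have := enorm_sqr (tuple_row t).
  rewrite /gw => <-; have := sqr_ge0 (enorm (tuple_row t) - 2^-1); nra.
- by rewrite -[leLHS]mulr1; apply: ler_pM => //; lra.
move=> h h1; rewrite add0r quadE -scalemxAr mulmx1 dotZl mulNr subrr normr0.
by rewrite mulr_ge0 ?exprn_ge0 ?enorm_ge0// mulr_ge0// addr_ge0.
Qed.

Lemma gauss_jet_exp (h : 'rV[R]_p) :
  (\int[gauss p]_t (expR (dot (tuple_row t) h - 2^-1 * dot h h))%:E = 1)%E.
Proof.
have := @cameron_martin R p (fun=> 1%:E) h (measurable_cst _) (fun=> lee01).
rewrite integral_prob_cst => /esym; under eq_integral do rewrite mul1e.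
exact.
Qed.

Lemma measurable_gauss_dot h : measurable_fun setT (fun t : p.-tuple (measurableTypeR R) => dot (tuple_row t) h).
Proof.
have := measurableT_comp (measurable_dotl h) (@measurable_tuple_row R p).
by congr measurable_fun; apply/funext => t; rewrite /= dotC.
Qed.

Lemma gauss_jet_measurable h : measurable_fun setT
  (fun t : p.-tuple (measurableTypeR R) => dot (tuple_row t) h - 2^-1 * dot h h).
Proof. by apply: measurable_funB; [exact: measurable_gauss_dot|exact: measurable_cst]. Qed.

Lemma kappa38 : 0 < 3 / 8 :> R. Proof. lra. Qed.

Lemma gauss_mean (h : 'rV[R]_p) : \int[gauss p]_t dot (tuple_row t) h = 0.
Proof.
by have [] := score_identity measurable_gw gw_ge1 kappa38 gw_exp gauss_jet gauss_jet_measurable gauss_jet_exp h.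
Qed.

Lemma gauss_covariance (h : 'rV[R]_p) : \int[gauss p]_t (dot (tuple_row t) h ^+ 2) = dot h h.
Proof.
have [_] := score_identity measurable_gw gw_ge1 kappa38 gw_exp gauss_jet gauss_jet_measurable gauss_jet_exp h.
rewrite Rintegral_cst_prob quadE -scalemxAr mulmx1 dotZl => h1; lra.
Qed.

Lemma gauss_integrable_cube : (gauss p).-integrable setT (EFin \o (fun t => gw t ^+ 3)).
Proof. exact: (integrable_weight_cube measurable_gw gw_ge1 kappa38 gw_exp). Qed.

End gaussian_moments.

Section moment_structure.
Context {R : realType} {p : nat} {disp : measure_display} {T : measurableType disp}.
Variables (mu : probability T R) (psi : T -> 'rV[R]_p) (V : 'M[R]_p).

Definition moments : Prop :=
  [/\ measurable_fun setT (psi : T -> borel R 1 p),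
      mu.-integrable setT (EFin \o (fun t => enorm (psi t) ^+ 3)),
      forall h, \int[mu]_t dot (psi t) h = 0 &
      forall h, \int[mu]_t (dot (psi t) h ^+ 2) = quad V h].

Hypothesis hm : moments.

Lemma measurable_moment_dot h : measurable_fun setT (fun t => dot (psi t) h).
Proof.
case: hm => m _ _ _; have := measurableT_comp (measurable_dotl h) m.
by congr measurable_fun; apply/funext => t; rewrite /= dotC.
Qed.

Lemma integrable_enorm_pow k : (k <= 3)%N -> mu.-integrable setT (EFin \o (fun t => enorm (psi t) ^+ k)).
Proof.
move=> k3; case: hm => m i3 _ _.
have me : measurable_fun setT (fun t => enorm (psi t)) by exact: (measurableT_comp (@measurable_enorm R p) m).
apply: (@integrable_dominated _ _ _ mu _ (fun t => 1 + enorm (psi t) ^+ 3)).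
- exact: measurable_funX.
- by apply: integrableD_fin => //; exact: integrable_cst_fin.
move=> t; have e0 := enorm_ge0 (psi t); rewrite ger0_norm ?exprn_ge0//.
have [e1|e1] := leP (enorm (psi t)) 1.
  by rewrite (@le_trans _ _ 1)// ?exprn_ile1// lerDl exprn_ge0.
by apply: (@le_trans _ _ (enorm (psi t) ^+ 3)); [rewrite ler_weXn2l// ltW|rewrite lerDr].
Qed.

Lemma integrable_moment_dot h : mu.-integrable setT (EFin \o (fun t => dot (psi t) h)).
Proof.
apply: (@integrable_dominated _ _ _ mu _ (fun t => enorm h * enorm (psi t) ^+ 1)).
- exact: measurable_moment_dot.
- by apply: integrableZ_fin; exact: integrable_enorm_pow.
- by move=> t; rewrite expr1 mulrC ler_dot.
Qed.

Lemma measurable_moment_quad M : measurable_fun setT (fun t => quad M (psi t)).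
Proof. by case: hm => m _ _ _; exact: (measurableT_comp (@measurable_quad R p M) m). Qed.

Lemma integrable_moment_quad M : mu.-integrable setT (EFin \o (fun t => quad M (psi t))).
Proof.
apply: (@integrable_dominated _ _ _ mu _ (fun t => mnorm M * enorm (psi t) ^+ 2)).
- exact: measurable_moment_quad.
- by apply: integrableZ_fin; exact: integrable_enorm_pow.
- by move=> t; exact: quad_bound.
Qed.

(** Polarisation of the variance form, so that two laws with the same V have the same mixed second
    moments. *)
Lemma Rintegral_product i j : mu.-integrable setT (EFin \o (fun t => psi t ord0 i * psi t ord0 j)) /\
  \int[mu]_t (psi t ord0 i * psi t ord0 j) = 2^-1 * (quad V (delta_mx ord0 i + delta_mx ord0 j) - quad V (delta_mx ord0 i) - quad V (delta_mx ord0 j)).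
Proof.
have coordE k t : dot (psi t) (delta_mx ord0 k) = psi t ord0 k.
  by rewrite dotE (bigD1 k)//= big1 ?addr0 ?mxE ?eqxx ?mulr1// => l lk; rewrite mxE (negPf lk) andbF mulr0.
have i2 h : mu.-integrable setT (EFin \o (fun t => dot (psi t) h ^+ 2)).
  apply: (@integrable_dominated _ _ _ mu _ (fun t => enorm h ^+ 2 * enorm (psi t) ^+ 2)).
  - by apply: measurable_funX; exact: measurable_moment_dot.
  - by apply: integrableZ_fin; exact: integrable_enorm_pow.
  move=> t; rewrite normrX -exprMn lerXn2r ?nnegrE ?mulr_ge0 ?enorm_ge0//.
  by rewrite mulrC ler_dot.
set a : 'rV[R]_p := delta_mx ord0 i; set b : 'rV[R]_p := delta_mx ord0 j.
have e t : psi t ord0 i * psi t ord0 j =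
    2^-1 * dot (psi t) (a + b) ^+ 2 + (- 2^-1 * dot (psi t) a ^+ 2 + - 2^-1 * dot (psi t) b ^+ 2).
  by rewrite dotDr !coordE; field.
have j1 := integrableZ_fin 2^-1 (i2 (a + b)); have j2 := integrableZ_fin (- 2^-1) (i2 a).
have j3 := integrableZ_fin (- 2^-1) (i2 b); have j4 := integrableD_fin j2 j3.
rewrite (_ : (fun t => _) = fun t => 2^-1 * dot (psi t) (a + b) ^+ 2 + (- 2^-1 * dot (psi t) a ^+ 2 + - 2^-1 * dot (psi t) b ^+ 2)); last exact/funext.
split; first exact: integrableD_fin.
rewrite (RintegralD_fin j1 j4) (RintegralD_fin j2 j3) !RintegralZl_fin//.
by case: hm => _ _ _ hV; rewrite !hV; ring.
Qed.

End moment_structure.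

Lemma moment_quad_eq {R : realType} p d1 (T1 : measurableType d1) (mu : probability T1 R) psi
    d2 (T2 : measurableType d2) (nu : probability T2 R) chi (V M : 'M[R]_p) :
  moments mu psi V -> moments nu chi V -> \int[mu]_t quad M (psi t) = \int[nu]_t quad M (chi t).
Proof.
have main d (T : measurableType d) (m : probability T R) f : moments m f V ->
    \int[m]_t quad M (f t) = \sum_j \sum_i M i j * (2^-1 * (quad V (delta_mx ord0 i + delta_mx ord0 j) - quad V (delta_mx ord0 i) - quad V (delta_mx ord0 j))).
  move=> hm; have qE t : quad M (f t) = \sum_j \sum_i M i j * (f t ord0 i * f t ord0 j).
    rewrite quadE dotE; apply: eq_bigr => j _; rewrite mxE mulr_suml; apply: eq_bigr => i _; ring.
  have -> : \int[m]_t quad M (f t) = \int[m]_t (\sum_j \sum_i M i j * (f t ord0 i * f t ord0 j)).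
    by apply: eq_Rintegral => t _; exact: qE.
  have ip i j : m.-integrable setT (EFin \o (fun t => M i j * (f t ord0 i * f t ord0 j))).
    by apply: integrableZ_fin; have [] := Rintegral_product hm i j.
  rewrite Rintegral_sum_fin; last by move=> j; exact: integrable_sum_fin.
  apply: eq_bigr => j _; rewrite Rintegral_sum_fin//; apply: eq_bigr => i _.
  have [ii <-] := Rintegral_product hm i j; exact: RintegralZl_fin.
by move=> h1 h2; rewrite (main _ _ _ _ h1) (main _ _ _ _ h2).
Qed.

Lemma gauss_moments {R : realType} q p (A : 'M[R]_(q, p)) :
  moments (gauss q) (fun t => tuple_row t *m A) (A^T *m A).
Proof.
have mt : measurable_fun setT ((fun t => tuple_row t *m A) : q.-tuple (measurableTypeR R) -> borel R 1 p).
  exact: (measurableT_comp (measurable_mulmx_cst A) (@measurable_tuple_row R q)).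
have dE (t : q.-tuple (measurableTypeR R)) h : dot (tuple_row t *m A) h = dot (tuple_row t) (h *m A^T) by exact: dot_mulmxl.
split => //.
- pose C := \sum_i enorm (row i A^T).
  have C0 : 0 <= C by apply: sumr_ge0 => i _; exact: enorm_ge0.
  apply: (@integrable_dominated _ _ _ (gauss q) _ (fun t => C ^+ 3 * gw t ^+ 3)).
  + by apply: measurable_funX; exact: (measurableT_comp (@measurable_enorm R p) mt).
  + by apply: integrableZ_fin; exact: gauss_integrable_cube.
  move=> t; rewrite ger0_norm ?exprn_ge0 ?enorm_ge0// -exprMn lerXn2r ?nnegrE ?enorm_ge0 ?mulr_ge0//.
    by have := gw_ge1 t; lra.
  rewrite (le_trans (enorm_le_sum _))// /C mulr_suml; apply: ler_sum => i _.
  have -> : (tuple_row t *m A) ord0 i = dot (tuple_row t) (row i A^T).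
    by rewrite dotE mxE; apply: eq_bigr => k _; rewrite !mxE.
  rewrite (le_trans (ler_dot _ _))// mulrC ler_wpM2l ?enorm_ge0// /gw -enorm_sqr.
  by have := sqr_ge0 (enorm (tuple_row t) - 2^-1); have := enorm_ge0 (tuple_row t); nra.
- move=> h; rewrite -[RHS](gauss_mean (h *m A^T)); apply: eq_Rintegral => t _; exact: dE.
- move=> h; have -> : quad (A^T *m A) h = dot (h *m A^T) (h *m A^T).
    by rewrite quadE mulmxA dot_mulmxl.
  rewrite -gauss_covariance; apply: eq_Rintegral => t _; by rewrite dE.
Qed.

(** * Smoothing of test functions by a Gaussian *)

Section smoothing.
Context {R : realType} {p : nat}.
Variables (f : 'rV[R]_p -> R) (K : R).
Hypothesis cf : continuous f.
Hypothesis f0 : forall x, 0 <= f x <= K.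

Lemma K_ge0 : 0 <= K. Proof. by have /andP[a b] := f0 0; rewrite (le_trans a). Qed.

Definition fE (x : borel R 1 p) : \bar R := (f x)%:E.

Lemma measurable_f : measurable_fun setT (f : borel R 1 p -> R).
Proof. exact: measurable_continuousR. Qed.

Lemma measurable_fE : measurable_fun setT fE.
Proof. by apply/measurable_EFinP; exact: measurable_f. Qed.

Lemma fE_ge0 x : (0 <= fE x)%E. Proof. by rewrite lee_fin; case/andP: (f0 x). Qed.

Lemma f_diff x y : `|f x - f y| <= K.
Proof. by have /andP[a b] := f0 x; have /andP[c e] := f0 y; rewrite ler_norml; apply/andP; split; lra. Qed.

Variable sigma : R.
Hypothesis sigma0 : 0 < sigma.

Definition smooth (x : 'rV[R]_p) : R := \int[gauss p]_t f (x + sigma *: tuple_row t).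

Lemma measurable_fshift x : measurable_fun setT (fun t : p.-tuple (measurableTypeR R) => f (x + sigma *: tuple_row t)).
Proof.
have mg : measurable_fun setT ((fun t => x + sigma *: tuple_row t) : p.-tuple (measurableTypeR R) -> borel R 1 p).
  apply: measurable_addmx; first exact: measurable_cstmx.
  by apply: measurable_scalemx; [exact: measurable_cst|exact: measurable_tuple_row].
exact: (measurableT_comp measurable_f mg).
Qed.

Lemma integrable_fmul x (g : p.-tuple (measurableTypeR R) -> R) : (gauss p).-integrable setT (EFin \o g) ->
  (gauss p).-integrable setT (EFin \o (fun t => f (x + sigma *: tuple_row t) * g t)).
Proof.
move=> ig; have /integrableP[/measurable_EFinP mg _] := ig.
apply: (@integrable_dominated _ _ _ (gauss p) _ (fun t => K * `|g t|)).
- by apply: measurable_funM => //; exact: measurable_fshift.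
- by apply: integrableZ_fin; exact: (integrable_norm ig).
move=> t; rewrite normrM ler_wpM2r//.
by have /andP[a b] := f0 (x + sigma *: tuple_row t); rewrite ger0_norm.
Qed.

Lemma Rintegral_fmul_le x (g G : p.-tuple (measurableTypeR R) -> R) :
  (gauss p).-integrable setT (EFin \o g) -> (gauss p).-integrable setT (EFin \o G) ->
  (forall t, `|g t| <= G t) ->
  `|\int[gauss p]_t (f (x + sigma *: tuple_row t) * g t)| <= K * \int[gauss p]_t G t.
Proof.
move=> ig iG gG; have /integrableP[/measurable_EFinP mg _] := ig.
rewrite -RintegralZl_fin//; apply: Rintegral_norm_le.
- by apply: measurable_funM => //; exact: measurable_fshift.
- exact: integrableZ_fin.
move=> t; rewrite normrM; apply: ler_pM => //.
by have /andP[a b] := f0 (x + sigma *: tuple_row t); rewrite ger0_norm.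
Qed.

Lemma integrable_fshift x : (gauss p).-integrable setT (EFin \o (fun t => f (x + sigma *: tuple_row t))).
Proof.
apply: (@integrable_dominated _ _ _ (gauss p) _ (fun=> K)); [exact: measurable_fshift|exact: integrable_cst_fin|].
by move=> t; have /andP[a b] := f0 (x + sigma *: tuple_row t); rewrite ger0_norm.
Qed.

Lemma smooth_bounds x : 0 <= smooth x <= K.
Proof.
apply/andP; split.
  by apply: Rintegral_ge0 => t _; case/andP: (f0 (x + sigma *: tuple_row t)).
rewrite -[leRHS](Rintegral_cst_prob (gauss p) K); apply: le_Rintegral => //.
- exact: integrable_fshift.
- exact: integrable_cst_fin.
- by move=> t _; case/andP: (f0 (x + sigma *: tuple_row t)).
Qed.

Lemma smoothE x : (smooth x)%:E = avg (gauss p) (fun t => sigma *: tuple_row t) fE x.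
Proof.
rewrite /smooth /Rintegral fineK//.
exact: (integrable_fin_num measurableT (integrable_fshift x)).
Qed.

(** By [cameron_martin] a shift of the argument becomes a Gaussian factor, which is expanded by
    [expansion_remainder]; f is only bounded, and the constant does not depend on x. *)
Lemma smooth_taylor : exists C, 0 <= C /\ forall x, exists l M, forall h,
  `|smooth (x + h) - (smooth x + dot l h + quad M h)| <= C * enorm h ^+ 3.
Proof.
have [Kr [r [Kr0 r0 Hr]]] := expansion_remainder (@gw_ge1 R p) (@kappa38 R) (@gauss_jet R p).
pose W (t : p.-tuple (measurableTypeR R)) : R := Kr * expR (3 / 8 * gw t).
have iW : (gauss p).-integrable setT (EFin \o W) by apply: integrableZ_fin; exact: gw_exp.
have igw := @gauss_integrable_cube R p.
pose mW : R := \int[gauss p]_t W t; pose mg : R := \int[gauss p]_t (gw t ^+ 3).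
have gwc (t : p.-tuple (measurableTypeR R)) : gw t <= gw t ^+ 3.
  have g1 := gw_ge1 t; rewrite -{1}[gw t]expr1 ler_weXn2l//.
have egw (t : p.-tuple (measurableTypeR R)) : enorm (tuple_row t) <= gw t.
  rewrite /gw -enorm_sqr; have := sqr_ge0 (enorm (tuple_row t) - 2^-1); nra.
have e2gw (t : p.-tuple (measurableTypeR R)) : enorm (tuple_row t) ^+ 2 <= gw t by rewrite /gw enorm_sqr lerDr.
have idot (k : 'rV[R]_p) : (gauss p).-integrable setT (EFin \o (fun t => dot (tuple_row t) k)).
  apply: (@integrable_dominated _ _ _ (gauss p) _ (fun t => enorm k * gw t ^+ 3)).
  - exact: measurable_gauss_dot.
  - exact: integrableZ_fin.
  move=> t; rewrite (le_trans (ler_dot _ _))// mulrC ler_wpM2l ?enorm_ge0//.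
  exact: le_trans (egw t) (gwc t).
have idot2 (h k : 'rV[R]_p) : (gauss p).-integrable setT (EFin \o (fun t => 2^-1 * (dot (tuple_row t) h * dot (tuple_row t) k - dot h k))).
  apply: integrableZ_fin; apply: integrableD_fin; last exact: integrable_cst_fin.
  apply: (@integrable_dominated _ _ _ (gauss p) _ (fun t => enorm h * enorm k * gw t ^+ 3)).
  - by apply: measurable_funM; exact: measurable_gauss_dot.
  - exact: integrableZ_fin.
  move=> t; have := normM_le (ler_dot (tuple_row t) h) (ler_dot (tuple_row t) k) => /le_trans; apply.
  rewrite (_ : _ * _ = enorm h * enorm k * enorm (tuple_row t) ^+ 2); last by ring.
  rewrite ler_wpM2l ?mulr_ge0 ?enorm_ge0//; exact: le_trans (e2gw t) (gwc t).
pose ff x (t : p.-tuple (measurableTypeR R)) : R := f (x + sigma *: tuple_row t).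
pose L (x h : 'rV[R]_p) : R := \int[gauss p]_t (ff x t * dot (tuple_row t) h).
pose Q (x h k : 'rV[R]_p) : R := \int[gauss p]_t (ff x t * (2^-1 * (dot (tuple_row t) h * dot (tuple_row t) k - dot h k))).
have LL x (a : R) h k : L x (a *: h + k) = a * L x h + L x k.
  rewrite /L -RintegralZl_fin; last exact: integrable_fmul.
  rewrite -RintegralD_fin; [|by apply: integrableZ_fin; exact: integrable_fmul|exact: integrable_fmul].
  by apply: eq_Rintegral => t _; rewrite dotDr dotZr; ring.
have QL x (a : R) h k m : Q x (a *: h + k) m = a * Q x h m + Q x k m.
  rewrite /Q -RintegralZl_fin; last exact: integrable_fmul.
  rewrite -RintegralD_fin; [|by apply: integrableZ_fin; exact: integrable_fmul|exact: integrable_fmul].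
  by apply: eq_Rintegral => t _; rewrite dotDr dotZr dotDl dotZl; ring.
have QC x h k : Q x h k = Q x k h.
  by apply: eq_Rintegral => t _; rewrite (dotC h k); ring.
have QR x (a : R) h k m : Q x m (a *: h + k) = a * Q x m h + Q x m k.
  by rewrite !(QC x m) QL.
have Lb x h : `|L x h| <= K * mg * enorm h.
  have := @Rintegral_fmul_le x _ (fun t => enorm h * gw t ^+ 3) (idot h) (integrableZ_fin _ igw).
  rewrite RintegralZl_fin// -/mg (mulrC (enorm h)) mulrA; apply => t.
  rewrite (le_trans (ler_dot _ _))// mulrC ler_wpM2l ?enorm_ge0//.
  exact: le_trans (egw t) (gwc t).
have Qb x h : `|Q x h h| <= K * mg * enorm h ^+ 2.
  have := @Rintegral_fmul_le x _ (fun t => enorm h ^+ 2 * gw t ^+ 3) (idot2 h h) (integrableZ_fin _ igw).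
  rewrite RintegralZl_fin// -/mg (mulrC (enorm h ^+ 2)) mulrA; apply => t.
  have d := ler_dot (tuple_row t) h; have g3 := gwc t; have g1 := gw_ge1 t.
  have d2 : dot (tuple_row t) h * dot (tuple_row t) h <= enorm h ^+ 2 * gw t.
    have := normM_le d d => /(le_trans (ler_norm _)) /le_trans; apply.
    rewrite (_ : _ * _ = enorm h ^+ 2 * enorm (tuple_row t) ^+ 2); last by ring.
    by rewrite ler_wpM2l ?sqr_ge0.
  have d0 : 0 <= dot (tuple_row t) h * dot (tuple_row t) h by rewrite -expr2 sqr_ge0.
  have h2 : 0 <= enorm h ^+ 2 by exact: sqr_ge0.
  have h3 : enorm h ^+ 2 * gw t <= enorm h ^+ 2 * gw t ^+ 3 by rewrite ler_wpM2l.
  have h4 : enorm h ^+ 2 <= enorm h ^+ 2 * gw t by rewrite ler_peMr.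
  rewrite -enorm_sqr ler_norml; apply/andP; split; lra.
have cm x k : smooth (x + sigma *: k) = \int[gauss p]_t (ff x t * expR (dot (tuple_row t) k - 2^-1 * dot k k)).
  pose F (v : borel R 1 p) : \bar R := (f (x + sigma *: v))%:E.
  have mF : measurable_fun setT F.
    apply/measurable_EFinP; have mg' : measurable_fun setT ((fun v => x + sigma *: v) : borel R 1 p -> borel R 1 p).
      apply: measurable_addmx; first exact: measurable_cstmx.
      by apply: measurable_scalemx; [exact: measurable_cst|exact: measurable_idrow].
    exact: (measurableT_comp measurable_f mg').
  have F0 v : (0 <= F v)%E by rewrite lee_fin; case/andP: (f0 (x + sigma *: v)).
  rewrite /smooth /Rintegral; congr fine; rewrite -(cameron_martin k mF F0).
  by apply: eq_integral => t _; rewrite /F scalerDr addrA addrAC.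
have mg0 : 0 <= mg by apply: Rintegral_ge0 => t _; rewrite exprn_ge0// (le_trans ler01 (gw_ge1 t)).
have mW0 : 0 <= mW by apply: Rintegral_ge0 => t _; rewrite mulr_ge0 ?expR_ge0.
have K0 := K_ge0.
have small x k : enorm k <= r -> `|smooth (x + sigma *: k) - (smooth x + L x k + Q x k k)| <= K * mW * enorm k ^+ 3.
  move=> kr; rewrite cm.
  pose E (t : p.-tuple (measurableTypeR R)) : R := expR (dot (tuple_row t) k - 2^-1 * dot k k).
  pose rem (t : p.-tuple (measurableTypeR R)) : R := E t - (1 + dot (tuple_row t) k + quad (- 2^-1 *: 1%:M) k + dot (tuple_row t) k ^+ 2 / 2).
  have iE : (gauss p).-integrable setT (EFin \o E).
    apply/integrableP; split.
      by apply/measurable_EFinP; apply: measurableT_comp => //; exact: gauss_jet_measurable.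
    under eq_integral do rewrite /= ger0_norm ?expR_ge0//.
    by rewrite gauss_jet_exp ltry.
  have remE t : rem t = E t + (-1 + (-1 * dot (tuple_row t) k + -1 * (2^-1 * (dot (tuple_row t) k * dot (tuple_row t) k - dot k k)))).
    by rewrite /rem quadE -scalemxAr mulmx1 dotZl; field.
  have irem : (gauss p).-integrable setT (EFin \o rem).
    rewrite (_ : rem = fun t => E t + (-1 + (-1 * dot (tuple_row t) k + -1 * (2^-1 * (dot (tuple_row t) k * dot (tuple_row t) k - dot k k))))); last exact/funext.
    apply: integrableD_fin => //; apply: integrableD_fin; first exact: integrable_cst_fin.
    by apply: integrableD_fin; apply: integrableZ_fin.
  have i1 := integrable_fmul x irem.
  have i2 : (gauss p).-integrable setT (EFin \o (fun t => ff x t * 1)).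
    by apply: integrable_fmul; exact: integrable_cst_fin.
  have i3 := integrable_fmul x (idot k); have i4 := integrable_fmul x (idot2 k k).
  have i34 := integrableD_fin i3 i4; have i234 := integrableD_fin i2 i34.
  have -> : \int[gauss p]_t (ff x t * E t) = \int[gauss p]_t (ff x t * rem t) + (smooth x + L x k + Q x k k).
    have -> : smooth x = \int[gauss p]_t (ff x t * 1) by apply: eq_Rintegral => t _; rewrite mulr1.
    rewrite -addrA -(RintegralD_fin i3 i4) -(RintegralD_fin i2 i34) -(RintegralD_fin i1 i234).
    by apply: eq_Rintegral => t _; rewrite /ff /= remE; ring.
  rewrite addrK; have := @Rintegral_fmul_le x _ (fun t => enorm k ^+ 3 * W t) irem (integrableZ_fin _ iW).
  rewrite RintegralZl_fin// -/mW (mulrC (enorm k ^+ 3)) mulrA; apply => t.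
  exact: Hr.
(* The first term serves |k| <= r. For |k| > r each term of the Taylor polynomial is bounded crudely
   and traded for |k|^3 through powers of |k| / r. *)
pose C1 := K * mW + (K + 2 * (K * mg)) * (r^-1 ^+ 3 + r^-1 ^+ 2 + r^-1 + 1).
have ri : 0 < r^-1 by rewrite invr_gt0.
have ri2 : 0 <= r^-1 ^+ 2 by rewrite exprn_ge0 ?(ltW ri).
have ri3 : 0 <= r^-1 ^+ 3 by rewrite exprn_ge0 ?(ltW ri).
have C10 : 0 <= C1.
  by rewrite /C1 addr_ge0 ?mulr_ge0 ?addr_ge0 ?mulr_ge0// ltW.
have all x k : `|smooth (x + sigma *: k) - (smooth x + L x k + Q x k k)| <= C1 * enorm k ^+ 3.
  have e0 := enorm_ge0 k; have [kr|kr] := leP (enorm k) r.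
    rewrite (le_trans (small x k kr))// ler_wpM2r ?exprn_ge0// /C1 lerDl.
    by rewrite mulr_ge0 ?addr_ge0 ?mulr_ge0// ltW.
  have lb := Lb x k; have qb := Qb x k.
  have sb : `|smooth (x + sigma *: k) - smooth x| <= K.
    have /andP[a b] := smooth_bounds (x + sigma *: k); have /andP[c e] := smooth_bounds x.
    by rewrite ler_norml; apply/andP; split; lra.
  rewrite (_ : smooth (x + sigma *: k) - (smooth x + L x k + Q x k k) =
     (smooth (x + sigma *: k) - smooth x) + (- L x k + - Q x k k)); last by ring.
  rewrite -normrN in lb; rewrite -normrN in qb.
  have tot := normD_le sb (normD_le lb qb); rewrite (le_trans tot)//.
  set e := enorm k in e0 kr *; have rr : r^-1 * e >= 1 by rewrite mulrC ler_pdivlMr// mul1r ltW.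
  have rr2 : (r^-1 * e) ^+ 2 >= 1 by rewrite exprn_ege1.
  have rr3 : (r^-1 * e) ^+ 3 >= 1 by rewrite exprn_ege1.
  have e3 : 0 <= e ^+ 3 by rewrite exprn_ge0.
  have a1 : e <= r^-1 ^+ 2 * e ^+ 3.
    by rewrite (_ : r^-1 ^+ 2 * e ^+ 3 = (r^-1 * e) ^+ 2 * e); [rewrite ler_peMl|ring].
  have a2 : e ^+ 2 <= r^-1 * e ^+ 3.
    by rewrite (_ : r^-1 * e ^+ 3 = (r^-1 * e) * e ^+ 2); [rewrite ler_peMl// exprn_ge0|ring].
  rewrite exprMn in rr3; have Km : 0 <= K * mg by rewrite mulr_ge0.
  have b1 := ler_wpM2l Km a1; have b2 := ler_wpM2l Km a2; have b3 := ler_wpM2l K0 rr3.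
  have p1 : 0 <= K * mW * e ^+ 3 by rewrite !mulr_ge0.
  have p2 : 0 <= K * (r^-1 ^+ 2 * e ^+ 3) by rewrite mulr_ge0// mulr_ge0.
  have p3 : 0 <= K * (r^-1 * e ^+ 3) by rewrite mulr_ge0// mulr_ge0// ltW.
  have p4 : 0 <= K * e ^+ 3 by rewrite mulr_ge0.
  have q1 : 0 <= (K * mg) * (r^-1 ^+ 3 * e ^+ 3) by rewrite mulr_ge0// mulr_ge0.
  have q2 : 0 <= (K * mg) * (r^-1 ^+ 2 * e ^+ 3) by rewrite mulr_ge0// mulr_ge0.
  have q3 : 0 <= (K * mg) * (r^-1 * e ^+ 3) by rewrite mulr_ge0// mulr_ge0// ltW.
  have q4 : 0 <= (K * mg) * e ^+ 3 by rewrite mulr_ge0.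
  rewrite /C1; lra.
exists (C1 * sigma^-1 ^+ 3); split.
  by rewrite mulr_ge0// exprn_ge0// invr_ge0 ltW.
move=> x; pose l : 'rV[R]_p := \row_i L x (sigma^-1 *: delta_mx ord0 i).
pose M : 'M[R]_p := \matrix_(i, j) Q x (sigma^-1 *: delta_mx ord0 i) (sigma^-1 *: delta_mx ord0 j).
exists l, M => h; have := all x (sigma^-1 *: h).
have si : 0 < sigma^-1 by rewrite invr_gt0.
rewrite scalerA divff ?gt_eqF// scale1r enormZ exprMn (gtr0_norm si) mulrA.
have lin (G : 'rV[R]_p -> R) : (forall a h k, G (a *: h + k) = a * G h + G k) ->
    forall a h k, G (sigma^-1 *: (a *: h + k)) = a * G (sigma^-1 *: h) + G (sigma^-1 *: k).
  by move=> hG a u v; rewrite scalerDr scalerA mulrC -scalerA hG.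
have -> : L x (sigma^-1 *: h) = dot l h.
  exact: (linear_functionalE (F := fun h => L x (sigma^-1 *: h)) (lin _ (LL x))).
have -> // : Q x (sigma^-1 *: h) (sigma^-1 *: h) = quad M h.
apply: (quadratic_formE (Q := fun h k => Q x (sigma^-1 *: h) (sigma^-1 *: k))).
  by move=> a u v m; apply: (lin (fun h => Q x h (sigma^-1 *: m))) => *; exact: QL.
by move=> a u v m; apply: (lin (fun h => Q x (sigma^-1 *: m) h)) => *; exact: QR.
Qed.

End smoothing.

Section uniform_continuity.
Context {R : realType} {p : nat}.

Lemma norm_le_enorm (v : 'rV[R]_p) : `|v| <= enorm v.
Proof.
rewrite [leLHS]mx_normrE; apply: bigmax_le; first exact: enorm_ge0.
by move=> -[i j] _ /=; rewrite [i]ord1 enorm_coord.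
Qed.

Lemma compact_enorm_ball (M : R) : compact [set x : 'rV[R]_p | enorm x <= M].
Proof.
apply: bounded_closed_compact.
  exists `|M|; split; first exact: num_real.
  move=> B hB x /= xM; rewrite (le_trans (norm_le_enorm x))// (le_trans xM)//.
  by rewrite (le_trans (ler_norm _))// ltW.
apply: (@preimage_closed _ _ (@enorm R p) [set y | y <= M]); last exact: closed_le.
by move=> x _; exact: continuous_enorm.
Qed.

Lemma nbhs_enorm_ball (x : 'rV[R]_p) (r : R) : 0 < r -> \forall y \near x, enorm (y - x) < r.
Proof.
move=> r0; have c : {for x, continuous (fun y : 'rV[R]_p => enorm (y - x))}.
  apply: (@continuous_comp _ _ _ (fun y : 'rV[R]_p => y - x) (@enorm R p)); last exact: continuous_enorm.
  by apply: continuousB; [exact: cvg_id|exact: cst_continuous].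
by apply: (cvgr_lt _ c); rewrite /= subrr enorm0.
Qed.

Lemma enorm_ball_nbhs (x : 'rV[R]_p) (A : set 'rV[R]_p) : nbhs x A ->
  exists r, 0 < r /\ forall y, enorm (y - x) <= r -> A y.
Proof.
move=> /nbhs_normP[e /= e0 he]; exists (e / 2); split; first exact: divr_gt0.
move=> y hy; apply: he => /=; rewrite distrC (le_lt_trans (norm_le_enorm _))// (le_lt_trans hy)//.
by rewrite ltr_pdivrMr// ltr_pMr// ltr1n.
Qed.

Lemma uniformly_continuous_ball (f : 'rV[R]_p -> R) (M eps : R) : continuous f -> 0 < eps ->
  exists delta, 0 < delta /\ forall x y, enorm x <= M -> enorm (y - x) <= delta -> `|f x - f y| <= eps.
Proof.
move=> cf e0.
have /compact_near_coveringP cover := @compact_enorm_ball M.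
have H := cover R 0^'+ (fun delta x => forall y, enorm (y - x) <= delta -> `|f x - f y| <= eps) _.
have [] := H; last first.
  move=> a /= a0 ha; pose d := a / 2; have d0 : 0 < d by exact: divr_gt0.
  exists d; split => // x y xM hy; apply: (ha d) => //=.
  by rewrite sub0r normrN gtr0_norm// /d ltr_pdivrMr// ltr_pMr// ltr1n.
move=> x _.
have nf : nbhs x [set z | `|f z - f x| <= eps / 2].
  have /cvgrPdist_le/(_ (eps / 2)) := cf x; rewrite divr_gt0// => /(_ isT); apply: filterS => z /=.
  by rewrite distrC.
have [r [r0 hr]] := enorm_ball_nbhs nf.
exists ([set y | enorm (y - x) < r / 2], [set delta | delta <= r / 2]) => /=.
  split; first by apply: nbhs_enorm_ball; exact: divr_gt0.
  by exists (r / 2) => /=; [exact: divr_gt0|move=> a /= + a0; rewrite sub0r normrN gtr0_norm// => /ltW].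
move=> [x' delta] /= [hx' hd] y hy.
have h1 : `|f x' - f x| <= eps / 2 by apply: hr; rewrite (le_trans (ltW hx'))//; lra.
have h2 : `|f y - f x| <= eps / 2.
  apply: hr; rewrite (_ : y - x = (y - x') + (x' - x)); last by rewrite addrA subrK.
  rewrite (le_trans (enormD _ _))//; lra.
rewrite (_ : f x' - f y = (f x' - f x) + (f x - f y)); last by ring.
by rewrite (le_trans (ler_normD _ _))// (distrC (f x)); lra.
Qed.

End uniform_continuity.

Section central_limit.
Context {R : realType} {p : nat} {disp : measure_display} {T : measurableType disp}.

Definition third_moment (mu : probability T R) (psi : T -> 'rV[R]_p) : R := \int[mu]_t (enorm (psi t) ^+ 3).

Lemma third_moment_ge0 mu psi : 0 <= third_moment mu psi.
Proof. by apply: Rintegral_ge0 => t _; rewrite exprn_ge0// enorm_ge0. Qed.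

(** The linear term has mean zero and the quadratic one depends on V alone, so two laws with equal V
    differ only by third moments. *)
Lemma avg_taylor (mu : probability T R) psi (V : 'M[R]_p) (g : 'rV[R]_p -> R) (K C c : R) (x l : 'rV[R]_p) (M : 'M[R]_p) :
  moments mu psi V -> measurable_fun setT (g : borel R 1 p -> R) -> (forall y, 0 <= g y <= K) -> 0 <= c ->
  (forall h, `|g (x + h) - (g x + dot l h + quad M h)| <= C * enorm h ^+ 3) ->
  mu.-integrable setT (EFin \o (fun t => g (x + c *: psi t))) /\
  `|\int[mu]_t g (x + c *: psi t) - (g x + c ^+ 2 * \int[mu]_t quad M (psi t))|
     <= C * c ^+ 3 * third_moment mu psi.
Proof.
move=> hm mg gb c0 hT; have [mpsi i3 mean _] := hm.
have mgx : measurable_fun setT (fun t => g (x + c *: psi t)).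
  have mh : measurable_fun setT ((fun t => x + c *: psi t) : T -> borel R 1 p).
    apply: measurable_addmx; first exact: measurable_cstmx.
    by apply: measurable_scalemx => //; exact: measurable_cst.
  exact: (measurableT_comp mg mh).
have ig : mu.-integrable setT (EFin \o (fun t => g (x + c *: psi t))).
  apply: (@integrable_dominated _ _ _ mu _ (fun=> K)) => //; first exact: integrable_cst_fin.
  by move=> t; have /andP[a b] := gb (x + c *: psi t); rewrite ger0_norm.
split=> //; pose rem t := g (x + c *: psi t) + (- g x + ((- c) * dot (psi t) l + - c ^+ 2 * quad M (psi t))).
have j1 := integrableZ_fin (- c) (integrable_moment_dot hm l).
have j2 := integrableZ_fin (- c ^+ 2) (integrable_moment_quad hm M).
have j12 := integrableD_fin j1 j2; have j0 := integrableD_fin (integrable_cst_fin mu (- g x)) j12.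
have irem := integrableD_fin ig j0.
have -> : \int[mu]_t g (x + c *: psi t) - (g x + c ^+ 2 * \int[mu]_t quad M (psi t)) = \int[mu]_t rem t.
  rewrite /rem (RintegralD_fin ig j0) (RintegralD_fin (integrable_cst_fin mu (- g x)) j12) (RintegralD_fin j1 j2).
  rewrite Rintegral_cst_prob (RintegralZl_fin _ (integrable_moment_dot hm l)) mean.
  by rewrite (RintegralZl_fin _ (integrable_moment_quad hm M)); ring.
have /integrableP[/measurable_EFinP mrem _] := irem.
rewrite /third_moment -RintegralZl_fin//; apply: Rintegral_norm_le => //; first exact: integrableZ_fin.
move=> t; have := hT (c *: psi t); rewrite enormZ exprMn (ger0_norm c0) mulrA.
rewrite (_ : g (x + c *: psi t) - _ = rem t)// /rem dotZr (dotC l) !quadE -scalemxAl dotZl dotZr; ring.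
Qed.

Lemma integral_enorm_sqr (mu : probability T R) psi (V : 'M[R]_p) : moments mu psi V ->
  \int[mu]_t (enorm (psi t) ^+ 2) = \sum_j quad V (delta_mx ord0 j).
Proof.
move=> hm; have [_ _ _ hV] := hm.
have coordE k t : dot (psi t) (delta_mx ord0 k) = psi t ord0 k.
  by rewrite dotE (bigD1 k)//= big1 ?addr0 ?mxE ?eqxx ?mulr1// => l lk; rewrite mxE (negPf lk) andbF mulr0.
have e t : enorm (psi t) ^+ 2 = \sum_j dot (psi t) (delta_mx ord0 j) ^+ 2.
  by rewrite enorm_sqr dotE; apply: eq_bigr => j _; rewrite coordE expr2.
have ij j : mu.-integrable setT (EFin \o (fun t => dot (psi t) (delta_mx ord0 j) ^+ 2)).
  have [+ _] := Rintegral_product hm j j; congr (_.-integrable _ _); apply/funext => t /=.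
  by rewrite coordE expr2.
have -> : \int[mu]_t (enorm (psi t) ^+ 2) = \int[mu]_t (\sum_j dot (psi t) (delta_mx ord0 j) ^+ 2).
  by apply: eq_Rintegral => t _; exact: e.
by rewrite Rintegral_sum_fin//; apply: eq_bigr => j _; exact: hV.
Qed.

End central_limit.

(** * Convergence of normalised sums *)

Section central_limit_theorem.
Context {R : realType} {p : nat} {disp : measure_display} {T : measurableType disp}.
Variables (Q : probability T R) (psi : T -> 'rV[R]_p) (V : 'M[R]_p).
Hypothesis pV : posdef V.
Hypothesis hm : moments Q psi V.

Lemma gauss_msqrt_moments : moments (gauss p) (fun t => tuple_row t *m msqrt V) V.
Proof.
have [[sA _] AA] := msqrtP pV; have := gauss_moments (msqrt V).
by rewrite sA AA.
Qed.

Lemma measurable_power_sum n : measurable_fun setT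
  ((fun t : n.-tuple T => (Num.sqrt n%:R)^-1 *: \sum_(i < n) psi (tnth t i)) : _ -> borel R 1 p).
Proof.
have [m _ _ _] := hm; apply: measurable_scalemx; first exact: measurable_cst.
apply: measurable_mxP => i j; under eq_fun do rewrite summxE.
apply: measurable_sum => l; apply: measurable_entry.
exact: (measurableT_comp m (measurable_tnth l)).
Qed.

Definition total_variance : R := \sum_j quad V (delta_mx ord0 j).

Lemma total_variance_ge0 : 0 <= total_variance.
Proof.
rewrite /total_variance -(integral_enorm_sqr hm).
by apply: Rintegral_ge0 => t _; exact: sqr_ge0.
Qed.

Lemma scaled_sum_second_moment n : (0 < n)%N ->
  (\int[power_prob Q n]_t ((enorm ((Num.sqrt n%:R)^-1 *: \sum_(i < n) psi (tnth t i)) ^+ 2))%:E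
   = total_variance%:E)%E.
Proof.
move=> n0; have [mpsi _ mean hV] := hm.
have nR : 0 < n%:R :> R by rewrite ltr0n.
have coordE k t : dot (psi t) (delta_mx ord0 k) = psi t ord0 k.
  by rewrite dotE (bigD1 k)//= big1 ?addr0 ?mxE ?eqxx ?mulr1// => l lk; rewrite mxE (negPf lk) andbF mulr0.
have mf j : measurable_fun setT (fun t => psi t ord0 j) by exact: measurable_entry.
have i2 j : Q.-integrable setT (EFin \o (fun t => psi t ord0 j ^+ 2)).
  by have [+ _] := Rintegral_product hm j j; congr (_.-integrable _ _); apply/funext => t /=; rewrite expr2.
have f2 j : (\int[Q]_t ((psi t ord0 j) ^+ 2)%:E < +oo)%E.
  have /integrableP[_] := i2 j; congr (_ < _)%E; apply: eq_integral => t _.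
  by rewrite /= ger0_norm// sqr_ge0.
have v2 j : variance_of Q (fun t => psi t ord0 j) = quad V (delta_mx ord0 j).
  rewrite -hV /variance_of; congr fine; apply: eq_integral => t _; by rewrite coordE.
have f1 j : (\int[Q]_t (psi t ord0 j)%:E = 0)%E.
  have i1 : Q.-integrable setT (EFin \o (fun t => psi t ord0 j)).
    have := integrable_moment_dot hm (delta_mx ord0 j); congr (_.-integrable _ _).
    by apply/funext => t /=; rewrite coordE.
  have := mean (delta_mx ord0 j); rewrite /Rintegral => h.
  rewrite -[LHS](fineK (integrable_fin_num measurableT i1)); congr EFin; rewrite -[RHS]h; congr fine.
  by apply: eq_integral => t _; rewrite /= coordE.
have sq t : enorm ((Num.sqrt n%:R)^-1 *: \sum_(i < n) psi (tnth t i)) ^+ 2 =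
    \sum_j n%:R^-1 * (0 + \sum_(i < n) psi (tnth t i) ord0 j) ^+ 2.
  rewrite enorm_sqr dotZl dotZr mulrA -expr2 exprVn sqr_sqrtr ?ltW// dotE mulr_sumr.
  by apply: eq_bigr => j _; rewrite summxE add0r expr2.
under eq_integral do rewrite sq -sumEFin.
have ms j : measurable_fun setT (fun t : n.-tuple T => (n%:R^-1 * (0 + \sum_(i < n) psi (tnth t i) ord0 j) ^+ 2)).
  apply: measurable_funM; first exact: measurable_cst.
  apply: measurable_funX; apply: measurable_funD; first exact: measurable_cst.
  apply: measurable_sum => i; exact: (measurableT_comp (mf j) (measurable_tnth i)).
rewrite ge0_integral_sum//; last 2 first.
- by move=> j; apply/measurable_EFinP; exact: ms.
- by move=> j t _; rewrite lee_fin mulr_ge0 ?sqr_ge0// invr_ge0 ltW.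
rewrite /total_variance -sumEFin; apply: eq_bigr => j _.
have ms0 : measurable_fun setT (fun t : n.-tuple T => ((0 + \sum_(i < n) psi (tnth t i) ord0 j) ^+ 2)%:E).
  apply/measurable_EFinP; apply: measurable_funX; apply: measurable_funD; first exact: measurable_cst.
  apply: measurable_sum => i; exact: (measurableT_comp (mf j) (measurable_tnth i)).
under eq_integral do rewrite EFinM.
rewrite (ge0_integralZl (power_prob Q n) measurableT ms0); last 2 first.
- by move=> t _; rewrite lee_fin sqr_ge0.
- by rewrite lee_fin invr_ge0 ltW.
rewrite (sum_second_moment (mf j) (f2 j) (f1 j)) -EFinM v2; congr EFin.
by rewrite expr0n add0r mulKf// gt_eqF.
Qed.

(** f is replaced by a Gaussian smoothing g, at a cost controlled by second moments common to all n;
    for g the summands are exchanged for Gaussian ones by [lindeberg] and [avg_taylor]. *)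
Lemma clt_nonneg (f : 'rV[R]_p -> R) K eps : continuous f -> (forall x, 0 <= f x <= K) -> 0 < eps ->
  exists N, forall n, (N <= n)%N ->
  `|\int[power_prob Q n]_t f ((Num.sqrt n%:R)^-1 *: \sum_(i < n) psi (tnth t i))
    - \int[gauss p]_t f (tuple_row t *m msqrt V)| <= eps.
Proof.
move=> cf fb eps0; have K0 := K_ge0 fb; have tv0 := total_variance_ge0.
(* Budget: 3 e1 for passing from f to g under each of the two laws and e1 for the exchange. *)
have hg := gauss_msqrt_moments; pose e1 := eps / 8; have e10 : 0 < e1 by exact: divr_gt0.
(* By Chebyshev the region |x| > M contributes at most e1 under either law. *)
have [M [M0 hM]] : exists M : R, 0 < M /\ K * total_variance <= e1 * M ^+ 2.
  exists (1 + K * total_variance / e1); have z : 0 <= K * total_variance / e1 by rewrite divr_ge0 ?mulr_ge0// ltW.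
  split; first by rewrite ltr_pwDl.
  have h : K * total_variance = e1 * (K * total_variance / e1) by field; rewrite gt_eqF.
  rewrite [leLHS]h ler_wpM2l ?(ltW e10)//; nra.
have [delta [d0 hd]] := uniformly_continuous_ball M cf e10.
(* Chebyshev again: the smoothing noise exceeds the modulus delta with contribution at most e1. *)
have [sigma [s0 hs]] : exists sigma, 0 < sigma /\ K * (sigma ^+ 2 * p%:R) <= e1 * delta ^+ 2.
  pose B := 1 + K * p%:R; have B0 : 0 < B by rewrite ltr_pwDl// mulr_ge0.
  exists (Num.sqrt (e1 * delta ^+ 2 / B)); have z : 0 < e1 * delta ^+ 2 / B by rewrite divr_gt0// mulr_gt0// exprn_gt0.
  split; first by rewrite sqrtr_gt0.
  rewrite sqr_sqrtr ?(ltW z)//.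
  rewrite (_ : K * (e1 * delta ^+ 2 / B * p%:R) = (e1 * delta ^+ 2) * (K * p%:R / B)); last by ring.
  have X0 : 0 <= e1 * delta ^+ 2 by rewrite mulr_ge0 ?exprn_ge0 ?(ltW e10) ?(ltW d0).
  rewrite ler_piMr//.
  by rewrite ler_pdivrMr// mul1r /B lerDr.
pose g := smooth f sigma.
have gb x : 0 <= g x <= K := smooth_bounds cf fb sigma x.
have trp : \int[gauss p]_t (enorm (tuple_row (t : p.-tuple (measurableTypeR R))) ^+ 2) = p%:R :> R.
  have hI : moments (gauss p) (fun t => tuple_row t *m (1%:M : 'M[R]_p)) ((1%:M)^T *m 1%:M) by exact: gauss_moments.
  have := integral_enorm_sqr hI; rewrite trmx1 mulmx1.
  have -> : \int[gauss p]_t (enorm (tuple_row t *m (1%:M : 'M[R]_p)) ^+ 2) = \int[gauss p]_t (enorm (tuple_row (t : p.-tuple (measurableTypeR R))) ^+ 2).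
    by apply: eq_Rintegral => t _; rewrite mulmx1.
  move=> ->; rewrite (eq_bigr (fun=> 1)) ?sumr_const ?card_ord// => j _.
  by rewrite quad_scalar mul1r dotE (bigD1 j)//= big1 ?addr0 ?mxE ?eqxx ?mulr1// => l lj; rewrite mxE (negPf lj) andbF mul0r.
have isq : (gauss p).-integrable setT (EFin \o (fun t : p.-tuple (measurableTypeR R) => enorm (tuple_row t) ^+ 2)).
  have hI : moments (gauss p) (fun t => tuple_row t *m (1%:M : 'M[R]_p)) ((1%:M)^T *m 1%:M) by exact: gauss_moments.
  have := integrable_enorm_pow hI (isT : (2 <= 3)%N); congr (_.-integrable _ _).
  by apply/funext => t /=; rewrite mulmx1.
have fg x : `|f x - g x| <= 2 * e1 + K * enorm x ^+ 2 / M ^+ 2.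
  have [xM|xM] := leP (enorm x) M.
    apply: (@le_trans _ _ (2 * e1)); last by rewrite lerDl divr_ge0 ?mulr_ge0 ?exprn_ge0 ?enorm_ge0// ltW.
    have ish := integrable_fshift cf fb sigma x.
    have ish' := integrableD_fin (integrable_cst_fin (gauss p) (f x)) (integrableZ_fin (-1) ish).
    have -> : f x - g x = \int[gauss p]_t (f x + -1 * f (x + sigma *: tuple_row t)).
      rewrite (RintegralD_fin (integrable_cst_fin (gauss p) (f x)) (integrableZ_fin (-1) ish)).
      by rewrite Rintegral_cst_prob RintegralZl_fin// mulN1r.
    have /integrableP[/measurable_EFinP mdiff _] := ish'.
    pose c2 := K * sigma ^+ 2 / delta ^+ 2.
    have idom : (gauss p).-integrable setT (EFin \o (fun t => e1 + c2 * enorm (tuple_row t) ^+ 2)).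
      by apply: integrableD_fin; [exact: integrable_cst_fin|exact: integrableZ_fin].
    apply: (@le_trans _ _ (\int[gauss p]_t (e1 + c2 * enorm (tuple_row t) ^+ 2))); last first.
      rewrite (RintegralD_fin (integrable_cst_fin (gauss p) e1) (integrableZ_fin c2 isq)).
      rewrite Rintegral_cst_prob RintegralZl_fin// trp.
      have : c2 * p%:R <= e1 by rewrite /c2 mulrAC ler_pdivrMr ?exprn_gt0// -mulrA; lra.
      by lra.
    apply: Rintegral_norm_le => // t; rewrite mulN1r.
    have c20 : 0 <= c2 by rewrite /c2 divr_ge0 ?mulr_ge0 ?exprn_ge0 ?(ltW s0) ?(ltW d0).
    have [tl|tl] := leP (enorm (sigma *: tuple_row t)) delta.
      rewrite (@le_trans _ _ e1)//; first by apply: hd => //; rewrite addrC addKr.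
      by rewrite lerDl mulr_ge0// sqr_ge0.
    rewrite (le_trans (f_diff fb _ _))// (@le_trans _ _ (c2 * enorm (tuple_row t) ^+ 2))//; last first.
      by rewrite lerDr ltW.
    move: tl; rewrite enormZ (gtr0_norm s0) => tl.
    rewrite /c2 mulrAC ler_pdivlMr ?exprn_gt0// -mulrA ler_wpM2l// -exprMn lerXn2r ?nnegrE ?(ltW d0) ?(ltW tl)//.
    by rewrite mulr_ge0 ?enorm_ge0// ltW.
  have h : `|f x - g x| <= K.
    by have /andP[a b] := fb x; have /andP[c e] := gb x; rewrite ler_norml; apply/andP; split; lra.
  rewrite (le_trans h)// (@le_trans _ _ (K * enorm x ^+ 2 / M ^+ 2))//; last by rewrite lerDr; lra.
  rewrite ler_pdivlMr ?exprn_gt0// ler_wpM2l// lerXn2r ?nnegrE ?enorm_ge0 ?(ltW M0) ?(ltW xM)//.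
have mf := measurable_f cf.
have mg : measurable_fun setT (g : borel R 1 p -> R).
  have mt : measurable_fun setT ((fun t => sigma *: tuple_row t) : p.-tuple (measurableTypeR R) -> borel R 1 p).
    by apply: measurable_scalemx; [exact: measurable_cst|exact: measurable_tuple_row].
  have := measurable_avg (gauss p) mt (measurable_fE cf) (fE_ge0 fb).
  rewrite (_ : avg _ _ _ = EFin \o g); first by move/measurable_EFinP.
  by apply/funext => x; rewrite /= -(smoothE cf fb).
have compare d' (T' : measurableType d') (mu : probability T' R) (Y : T' -> 'rV[R]_p) :
    measurable_fun setT (Y : T' -> borel R 1 p) ->
    (\int[mu]_t ((enorm (Y t)) ^+ 2)%:E = total_variance%:E)%E ->
    [/\ mu.-integrable setT (EFin \o (fun t => f (Y t))), mu.-integrable setT (EFin \o (fun t => g (Y t))) &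
    `|\int[mu]_t f (Y t) - \int[mu]_t g (Y t)| <= 3 * e1].
  move=> mY hY; have mfY := measurableT_comp mf mY; have mgY := measurableT_comp mg mY.
  have bdd (h : 'rV[R]_p -> R) : measurable_fun setT (fun t => h (Y t)) -> (forall x, 0 <= h x <= K) ->
      mu.-integrable setT (EFin \o (fun t => h (Y t))).
    move=> mh hb; apply: (@integrable_dominated _ _ _ mu _ (fun=> K)) => //; first exact: integrable_cst_fin.
    by move=> t; have /andP[a b] := hb (Y t); rewrite ger0_norm.
  have i_f := bdd f mfY fb; have i_g := bdd g mgY gb.
  split => //; have i1 := integrableD_fin i_f (integrableZ_fin (-1) i_g).
  have -> : \int[mu]_t f (Y t) - \int[mu]_t g (Y t) = \int[mu]_t (f (Y t) + -1 * g (Y t)).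
    by rewrite (RintegralD_fin i_f (integrableZ_fin (-1) i_g)) RintegralZl_fin// mulN1r.
  have iY : mu.-integrable setT (EFin \o (fun t => enorm (Y t) ^+ 2)).
    apply/integrableP; split.
      by apply/measurable_EFinP; apply: measurable_funX; exact: (measurableT_comp (@measurable_enorm R p) mY).
    under eq_integral do rewrite /= ger0_norm ?sqr_ge0//.
    by rewrite hY ltry.
  have /integrableP[/measurable_EFinP mdiff _] := i1.
  pose c2 := K / M ^+ 2.
  have idom := integrableD_fin (integrable_cst_fin mu (2 * e1)) (integrableZ_fin c2 iY).
  apply: (@le_trans _ _ (\int[mu]_t (2 * e1 + c2 * enorm (Y t) ^+ 2))).
    apply: Rintegral_norm_le => // t; rewrite mulN1r (le_trans (fg _))// /c2 mulrAC; lra.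
  rewrite (RintegralD_fin (integrable_cst_fin mu (2 * e1)) (integrableZ_fin c2 iY)).
  rewrite Rintegral_cst_prob RintegralZl_fin// (_ : \int[mu]_t (enorm (Y t) ^+ 2) = total_variance); last by rewrite /Rintegral hY.
  have : c2 * total_variance <= e1 by rewrite /c2 mulrAC ler_pdivrMr ?exprn_gt0.
  by lra.
have [C [C0 hC]] := smooth_taylor cf fb s0.
pose m3 := third_moment Q psi + third_moment (gauss p) (fun t => tuple_row t *m msqrt V).
have m30 : 0 <= m3 by rewrite addr_ge0// third_moment_ge0.
have cm0 : 0 <= C * m3 / e1 by rewrite divr_ge0 ?mulr_ge0// ltW.
(* The n exchanges cost n C m3 / n^(3/2) = C m3 / sqrt n in total, which is at most e1 from this n
   on. *)
exists (Num.bound ((C * m3 / e1) ^+ 2)).+1 => n hn.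
have n0 : (0 < n)%N by exact: leq_ltn_trans hn.
have nR : 0 < n%:R :> R by rewrite ltr0n.
set c := (Num.sqrt n%:R)^-1; have sn0 : 0 < Num.sqrt n%:R :> R by rewrite sqrtr_gt0.
have c0 : 0 < c by rewrite invr_gt0.
have c2 : n%:R * c ^+ 2 = 1 by rewrite /c exprVn sqr_sqrtr ?ltW// divff// gt_eqF.
have Cc : C * m3 * c <= e1.
  rewrite -ler_pdivlMr// /c invrK -ler_pdivrMl// mulrC.
  rewrite -[leLHS]ger0_norm// -sqrtr_sqr ler_sqrt ?ltW//.
  apply: (lt_le_trans (archi_boundP (sqr_ge0 (C * m3 / e1)))).
  by rewrite ler_nat ltnW.
have [mpsi _ _ _] := hm.
have mcpsi : measurable_fun setT ((fun t => c *: psi t) : T -> borel R 1 p).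
  by apply: measurable_scalemx => //; exact: measurable_cst.
have mcg : measurable_fun setT ((fun t => c *: (tuple_row t *m msqrt V)) : p.-tuple (measurableTypeR R) -> borel R 1 p).
  apply: measurable_scalemx; first exact: measurable_cst.
  exact: (measurableT_comp (measurable_mulmx_cst _) (@measurable_tuple_row R p)).
pose F (x : borel R 1 p) : \bar R := (g x)%:E.
have mF : measurable_fun setT F by apply/measurable_EFinP.
have F0 x : (0 <= F x)%E by rewrite lee_fin; case/andP: (gb x).
have er0 : 0 <= C * c ^+ 3 * m3 by rewrite !mulr_ge0 ?exprn_ge0// ltW.
have cl : unif_close (C * c ^+ 3 * m3) (avg Q (fun t => c *: psi t) F) (avg (gauss p) (fun t => c *: (tuple_row t *m msqrt V)) F).
  move=> x; have [l [Mx hx]] := hC x.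
  have [i1 b1] := avg_taylor hm mg gb (ltW c0) hx.
  have [i2 b2] := avg_taylor hg mg gb (ltW c0) hx.
  rewrite -(moment_quad_eq Mx hm hg) in b2.
  have fE1 : avg Q (fun t => c *: psi t) F x = (\int[Q]_t g (x + c *: psi t))%:E.
    by rewrite /avg /F /Rintegral fineK//; exact: (integrable_fin_num measurableT i1).
  have fE2 : avg (gauss p) (fun t => c *: (tuple_row t *m msqrt V)) F x = (\int[gauss p]_t g (x + c *: (tuple_row t *m msqrt V)))%:E.
    by rewrite /avg /F /Rintegral fineK//; exact: (integrable_fin_num measurableT i2).
  rewrite fE1 fE2 -!EFinD !lee_fin; move: b1 b2; rewrite !ler_norml => /andP[a1 a2] /andP[a3 a4].
  rewrite /m3; split; lra.
have L := lindeberg n mcpsi mcg mF F0 er0 cl; have {L} := L 0.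
rewrite (iter_avg_power Q mcpsi n 0 mF F0) (iter_avg_gauss (msqrt V) c n 0 mF F0).
have csn : c * Num.sqrt n%:R = 1 by rewrite /c mulVf// gt_eqF.
rewrite csn.
have -> : (\int[power_prob Q n]_t F (0 + \sum_(i < n) c *: psi (tnth t i))%R = \int[power_prob Q n]_t (g (c *: \sum_(i < n) psi (tnth t i)))%:E)%E.
  by apply: eq_integral => t _; rewrite add0r -scaler_sumr.
have -> : (\int[gauss p]_t F (0 + 1 *: (tuple_row t *m msqrt V))%R = \int[gauss p]_t (g (tuple_row t *m msqrt V))%:E)%E.
  by apply: eq_integral => t _; rewrite add0r scale1r.
have [ia ja ka] := compare _ _ (power_prob Q n) _ (@measurable_power_sum n) (scaled_sum_second_moment n0).
have hgv : (\int[gauss p]_t ((enorm (tuple_row t *m msqrt V)) ^+ 2)%:E = total_variance%:E)%E.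
  have := integral_enorm_sqr hg; rewrite /Rintegral -/total_variance => <-; rewrite fineK//.
  exact: (integrable_fin_num measurableT (integrable_enorm_pow hg (isT : (2 <= 3)%N))).
have [mgv _ _ _] := hg.
have [ib jb kb] := compare _ _ (gauss p) _ mgv hgv.
rewrite -(fineK (integrable_fin_num measurableT ja)) -(fineK (integrable_fin_num measurableT jb)).
rewrite -!EFinD !lee_fin => -[l1 l2].
have nC : n%:R * (C * c ^+ 3 * m3) <= e1.
  by rewrite (_ : n%:R * (C * c ^+ 3 * m3) = n%:R * c ^+ 2 * (C * m3 * c)); [rewrite c2 mul1r|ring].
move: ka kb; rewrite /Rintegral -/c !ler_norml => /andP[a1 a2] /andP[a3 a4].
have e8 : eps = 8 * e1 by rewrite /e1; field.
apply/andP; split; lra.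
Qed.

End central_limit_theorem.

(** * Score and Fisher information *)

Section conull_integral.
Context {R : realType} {disp : measure_display} {T : measurableType disp}.
Variables (mu : {measure set T -> \bar R}) (D : set T).
Hypothesis mD : measurable D.
Hypothesis muD : mu (~` D) = 0%E.
Local Open Scope ereal_scope.
Import HBNNSimple.

Let nnint (f : T -> \bar R) := ereal_sup [set sintegral mu h |
  h in [set h : {nnsfun T >-> R} | forall x, (h x)%:E <= f x]].

(* The integral is a supremum over simple functions, so it ignores a null set  *)
(* even if the integrand is not measurable there.                               *)
Lemma ge0_integral_conull_le (f g : T -> \bar R) : (forall x, 0 <= g x) ->
  (forall x, 0 <= f x) -> (forall x, D x -> f x = g x) -> nnint f <= nnint g.
Proof.
move=> g0 f0 fg; apply: ge_ereal_sup => _ [h hf <-].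
apply: ereal_sup_ubound; exists (proj_nnsfun h mD) => /=.
  move=> x; rewrite /= /mindic indicE; have [xD|xD] := pselect (D x).
    by rewrite mem_set// mulr1 -fg.
  by rewrite memNset// mulr0.
rewrite -!integralT_nnsfun; apply: ae_eq_integral => //.
- exact/measurable_EFinP.
- exact/measurable_EFinP.
exists (~` D); split => //; first exact: measurableC.
move=> x /= hx xD; apply: hx => _; rewrite /= /mindic indicE mem_set// mulr1.
by [].
Qed.

Lemma integral_conull_eq (f g : T -> \bar R) : (forall x, D x -> f x = g x) ->
  \int[mu]_x f x = \int[mu]_x g x.
Proof.
move=> fg; rewrite /integral !patch_setT; congr (_ - _); apply/eqP; rewrite eq_le;
  apply/andP; split; apply: ge0_integral_conull_le => [x|x|x xD];
  rewrite ?funepos_ge0 ?funeneg_ge0// ?funeposE ?funenegE fg//.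
Qed.

End conull_integral.

(** * The wrapped normal model at the true parameter *)

Section model.
Context {R : realType} {n : nat}.
Notation d := n.+1.
Variables (m : 'rV[R]_d.+1) (S0 : 'M[R]_d) (iota : {linear 'rV[R]_d -> 'rV[R]_d.+1}).
Hypothesis hm : hyperboloid m.
Hypothesis pS : posdef S0.
Hypothesis iso : linear_isometry_onto_tangent m iota.
Local Notation p := (d + vech_dim d)%N.

Definition wrapf : {mfun d.-tuple (measurableTypeR R) >-> borel R 1 d.+1} :=
  mfun_Sub (mem_set (measurable_wrap S0 hm)).

Definition hwn : probability (borel R 1 d.+1) R := distribution (gauss d) wrapf.

Lemma HWN_hwn : HWN m S0 = hwn :> (set _ -> \bar R).
Proof.
apply/funext => A; rewrite /HWN /normal_law /hwn /distribution /pushforward /=.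
congr (gauss d _); apply/seteqP; split => t /=; by rewrite PT_originE.
Qed.

Lemma measurable_hyperboloid : measurable (@hyperboloid R d : set (borel R 1 d.+1)).
Proof.
rewrite (_ : hyperboloid = [set x | lift_point (spatial x) ord0 ord0 = x ord0 ord0]); last first.
  by apply/seteqP; split => x /=; rewrite /lift_point cons_row0 => h; [rewrite (hyperboloidP x).1|apply/hyperboloidP].
rewrite (_ : [set x | _] = (fun x : borel R 1 d.+1 => hyp0 (spatial x) - (x : 'rV[R]_d.+1) ord0 ord0) @^-1` [set 0]).
  rewrite -[X in measurable X]setTI; apply: (measurable_funB (f := fun x : borel R 1 d.+1 => hyp0 (spatial x))) => //.
  - exact: (measurableT_comp (@measurable_hyp0 R d) (@measurable_spatial R d)).
  - exact: measurable_coord.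
apply/seteqP; split => x /=; rewrite /lift_point cons_row0; first by move=> ->; rewrite subrr.
by move/eqP; rewrite subr_eq0 => /eqP.
Qed.

Lemma hwn_conull : hwn (~` @hyperboloid R d) = 0%E.
Proof.
have -> : hwn (~` @hyperboloid R d) = gauss d (wrapf @^-1` (~` @hyperboloid R d)) by [].
rewrite (_ : _ @^-1` _ = set0) ?measure0//.
apply/seteqP; split => // t /=; apply.
exact: (hyperboloid_Exp hm (tangent_frame _ hm)).
Qed.

Lemma ge0_integral_hwn (F : borel R 1 d.+1 -> \bar R) : measurable_fun setT F -> (forall x, 0 <= F x)%E ->
  (\int[hwn]_x F x = \int[gauss d]_t F (wrap_normal m S0 t))%E.
Proof. by move=> mF F0; rewrite /hwn ge0_integral_distribution. Qed.

(** A measurable retraction onto the hyperboloid: composing with it turns statements valid there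
    into statements for all x, without changing anything on the support of the law. *)
Definition proj_hyp (x : 'rV[R]_d.+1) : 'rV[R]_d.+1 := lift_point (spatial x).

Lemma hyperboloid_proj x : hyperboloid (proj_hyp x). Proof. exact: hyperboloid_lift. Qed.

Lemma proj_hypK x : hyperboloid x -> proj_hyp x = x. Proof. by move=> /hyperboloid_eta. Qed.

Lemma measurable_proj : measurable_fun setT (proj_hyp : borel R 1 d.+1 -> borel R 1 d.+1).
Proof. exact: (measurableT_comp (@measurable_lift R d) (@measurable_spatial R d)). Qed.

Lemma hyperboloid_wrap t : hyperboloid (wrap_normal m S0 t).
Proof. exact: (hyperboloid_Exp hm (tangent_frame _ hm)). Qed.

Definition wt (x : 'rV[R]_d.+1) : R := jet_weight m (proj_hyp x).

Lemma measurable_acosh_kbase : measurable_fun setT (rbase m : borel R 1 d.+1 -> R).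
Proof. exact: (measurableT_comp (@measurable_acosh R) (measurable_kbase m)). Qed.

Lemma measurable_wt : measurable_fun setT (wt : borel R 1 d.+1 -> R).
Proof.
have mr := measurableT_comp measurable_acosh_kbase measurable_proj.
by apply: measurable_funX; apply: measurable_funD => //; exact: measurable_cst.
Qed.

Lemma wt_ge1 x : 1 <= wt x. Proof. exact: jet_weight_ge1. Qed.

Lemma rbase_wrap t : rbase m (wrap_normal m S0 t) = enorm (tuple_row t *m msqrt S0).
Proof.
rewrite /rbase /kbase -enorm_Tmap//; last exact: hyperboloid_wrap.
by rewrite /wrap_normal Tmap_wrap.
Qed.

(** Under the model the distance to m is the norm of the Gaussian vector Z S0^(1/2), so the weight
    is at most a multiple of 1 + |Z|^2. *)
Lemma wt_exp : exists kappa, 0 < kappa /\ hwn.-integrable setT (EFin \o (fun x => expR (kappa * wt x))).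
Proof.
pose A := msqrt S0; pose C := \sum_i enorm (row i A^T).
have C0 : 0 <= C by apply: sumr_ge0 => i _; exact: enorm_ge0.
(* From (1 + r)^2 <= 2 (1 + r^2) and r <= C |Z|. *)
pose B := 2 * (1 + C ^+ 2); have B0 : 0 < B by rewrite mulr_gt0// ltr_pwDl// sqr_ge0.
exists (3 / 8 / B); split; first by rewrite divr_gt0//; lra.
have mE : measurable_fun setT ((fun x => expR (3 / 8 / B * wt x)) : borel R 1 d.+1 -> R).
  by apply: measurableT_comp => //; apply: measurable_funM; [exact: measurable_cst|exact: measurable_wt].
apply/integrableP; split; first exact/measurable_EFinP.
under eq_integral do rewrite /= ger0_norm ?expR_ge0//.
rewrite ge0_integral_hwn//; last exact/measurable_EFinP.
have /integrableP[_] := @gw_exp R d; apply: le_lt_trans.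
apply: ge0_le_integral => //.
- by apply/measurable_EFinP; exact: (measurableT_comp mE (measurable_wrap S0 hm)).
- apply: measurableT_comp => //; apply/measurable_EFinP; apply: measurableT_comp => //.
  by apply: measurable_funM; [exact: measurable_cst|exact: measurable_gw].
move=> t _; rewrite /= lee_fin [leRHS]ger0_norm ?expR_ge0// ler_expR.
rewrite /wt proj_hypK; last exact: hyperboloid_wrap.
rewrite /jet_weight rbase_wrap (_ : 3 / 8 / B * _ = 3 / 8 * (B^-1 * (1 + enorm (tuple_row t *m msqrt S0)) ^+ 2)); last by rewrite mulrA.
rewrite ler_wpM2l//.
rewrite ler_pdivrMl// /B.
have b : enorm (tuple_row t *m A) <= C * enorm (tuple_row t).
  rewrite (le_trans (enorm_le_sum _))// /C mulr_suml; apply: ler_sum => i _.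
  have -> : (tuple_row t *m A) ord0 i = dot (tuple_row t) (row i A^T).
    by rewrite dotE mxE; apply: eq_bigr => k _; rewrite !mxE.
  by rewrite mulrC ler_dot.
have e0 := enorm_ge0 (tuple_row t *m A); have t0 := enorm_ge0 (tuple_row t).
have b2 : enorm (tuple_row t *m A) ^+ 2 <= C ^+ 2 * enorm (tuple_row t) ^+ 2.
  by rewrite -exprMn lerXn2r ?nnegrE ?mulr_ge0.
rewrite /gw -enorm_sqr; set r := enorm (tuple_row t *m A) in e0 b2 *.
have r2 : (1 + r) ^+ 2 <= 2 * (1 + r ^+ 2) by have := sqr_ge0 (r - 1); nra.
rewrite (le_trans r2)// -mulrA ler_wpM2l//.
have c2 := sqr_ge0 C; have t2 := sqr_ge0 (enorm (tuple_row t)); nra.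
Qed.

Variables (f0 : borel R 1 d.+1 -> R) (f1 : borel R 1 d.+1 -> 'rV[R]_p) (f2 : borel R 1 d.+1 -> 'M[R]_p).
Local Notation B0 := (mlog S0).
Definition ld h x := logdens (muh m iota h) (mexp (B0 + mat (rsubmx h))) x.
Hypothesis J : jet (T := borel R 1 d.+1) (@hyperboloid R d) (jet_weight m) ld f0 f1 f2.

Lemma symB0 : B0^T = B0. Proof. by have [] := mlogP pS. Qed.

Lemma posdef_chart (h : 'rV[R]_p) : posdef (mexp (B0 + mat (rsubmx h))).
Proof. by apply: mexp_posdef; rewrite linearD /= symB0 mat_sym. Qed.

Lemma ld0 x : ld 0 x = logdens m S0 x.
Proof.
have [_ e] := mlogP pS; rewrite /ld muh0//; congr logdens.
rewrite linear0 (_ : mat 0 = 0) ?addr0//.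
by apply/matrixP => i j; rewrite !mxE big1// => k _; rewrite mxE.
Qed.

Definition dens_ratio h x := ld h (proj_hyp x) - ld 0 (proj_hyp x).

Lemma measurable_ld h : measurable_fun setT ((fun x => ld h (proj_hyp x)) : borel R 1 d.+1 -> R).
Proof.
rewrite (_ : (fun x => _) = fun x : borel R 1 d.+1 => logdensG (muh m iota h) (mexp (B0 + mat (rsubmx h))) (spatial x)).
  exact: (measurableT_comp (measurable_logdensG _ _) (@measurable_spatial R d)).
by apply/funext => x; rewrite /ld /proj_hyp logdens_lift//; exact: hyperboloid_muh.
Qed.

Lemma ratio_jet : jet (T := borel R 1 d.+1) setT wt dens_ratio (fun=> 0) (fun x => f1 (proj_hyp x)) (fun x => f2 (proj_hyp x)).
Proof.
have [m0 m1 m2 [C [rho [C0 rho0 H]]]] := J; split.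
- exact: measurable_cst.
- exact: (measurableT_comp m1 measurable_proj).
- exact: (measurableT_comp m2 measurable_proj).
exists C, rho; split => // x _; have [w0 b0 b1 b2 b3] := H _ (hyperboloid_proj x).
split => //; first by rewrite normr0 mulr_ge0// ltW.
move=> h hr; have := b3 h hr.
have e0 : ld 0 (proj_hyp x) = f0 (proj_hyp x).
  have := b3 0; rewrite enorm0 => /(_ (ltW rho0)).
  rewrite dot0r quadE mul0mx dot0l !addr0 expr0n mulr0 normr_le0 subr_eq0.
  by move=> /eqP.
rewrite /dens_ratio e0 add0r; congr (`|_| <= _); ring.
Qed.

Lemma ratio_exp h : (\int[hwn]_x (expR (dens_ratio h x))%:E = 1)%E.
Proof.
have mD : measurable_fun setT (dens_ratio h : borel R 1 d.+1 -> R).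
  by apply: measurable_funB; exact: measurable_ld.
rewrite ge0_integral_hwn//; last by apply/measurable_EFinP; exact: measurableT_comp.
rewrite -(likelihood_ratio hm pS (hyperboloid_muh hm iso h) (posdef_chart h)).
apply: eq_integral => t _; rewrite /dens_ratio proj_hypK ?ld0//; exact: hyperboloid_wrap.
Qed.

Lemma measurable_ratio h : measurable_fun setT (dens_ratio h : borel R 1 d.+1 -> R).
Proof. by apply: measurable_funB; exact: measurable_ld. Qed.

Definition theta0 : 'rV[R]_p := row_mx 0 (vech B0).

Lemma mu_of_theta0 h : mu_of m iota (theta0 + h) = muh m iota h.
Proof. by rewrite /mu_of /muh linearD /= /theta0 row_mxKl add0r. Qed.

Lemma Sigma_of_theta0 h : Sigma_of (theta0 + h) = mexp (B0 + mat (rsubmx h)).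
Proof.
rewrite /Sigma_of linearD /= /theta0 row_mxKr; congr mexp.
by rewrite -[vech B0]scale1r mat_linear scale1r vechK// symB0.
Qed.

(** The score is defined by partial derivatives; along a unit coordinate vector the jet makes the
    difference quotient f1 plus O(|h|). *)
Lemma score_jet x : hyperboloid x -> score m iota theta0 x = f1 x.
Proof.
move=> hx; have [_ _ _ [C [rho [C0 rho0 H]]]] := J; have [w0 b0 b1 b2 b3] := H x hx.
have e0 : ld 0 x = f0 x.
  have := b3 0; rewrite enorm0 => /(_ (ltW rho0)).
  rewrite dot0r quadE mul0mx dot0l !addr0 expr0n mulr0 normr_le0 subr_eq0.
  by move=> /eqP.
apply/rowP => k; rewrite mxE; set v : 'rV[R]_p := delta_mx ord0 k.
have v1 : enorm v = 1.
  rewrite enormE dotE (bigD1 k)//= big1 ?addr0 ?mxE ?eqxx ?mulr1 ?sqrtr1// => l lk.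
  by rewrite mxE (negPf lk) andbF mul0r.
apply: cvg_lim => //; apply/cvgrPdist_le => /= e eps0; near=> h.
have hn0 : h != 0 by near: h; exact: nbhs_dnbhs_neq.
have hr : `|h| <= Num.min rho (Num.min 1 (e / (2 * (C * jet_weight m x + 1)))).
  near: h; apply: dnbhs0_le; rewrite !lt_min rho0 ltr01 divr_gt0// mulr_gt0//.
  by rewrite ltr_wpDl// mulr_ge0// ltW.
move: hr; rewrite !le_min => /andP[hr1 /andP[hr2 hr3]].
have gE u : logdens (mu_of m iota (theta0 + u)) (Sigma_of (theta0 + u)) x = ld u x.
  by rewrite mu_of_theta0 Sigma_of_theta0.
have -> : logdens (mu_of m iota (h *: v + theta0)) (Sigma_of (h *: v + theta0)) x = ld (h *: v) x.
  by rewrite (addrC (h *: v)); exact: gE.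
have -> : logdens (mu_of m iota theta0) (Sigma_of theta0) x = f0 x by have := gE 0; rewrite addr0 e0.
have := b3 (h *: v); rewrite enormZ v1 mulr1 => /(_ hr1).
rewrite dotZr quadE -scalemxAl dotZl dotZr -quadE.
have -> : dot (f1 x) v = f1 x ord0 k.
  by rewrite dotE (bigD1 k)//= big1 ?addr0 ?mxE ?eqxx ?mulr1// => l lk; rewrite mxE (negPf lk) andbF mulr0.
set q := quad (f2 x) v; set D := ld _ _; set s := f1 x ord0 k => b.
have qb : `|q| <= C * jet_weight m x.
  by rewrite (le_trans (quad_bound _ _))// v1 expr1n mulr1.
set W := C * jet_weight m x in b qb hr3 *; have W0 : 0 <= W by rewrite mulr_ge0// ltW.
have h0 : 0 < `|h| by rewrite normr_gt0.
rewrite (_ : s - h^-1 *: (D - f0 x) = - (h^-1 * (D - (f0 x + h * s + h * (h * q)))) - h * q); last first.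
  by rewrite /GRing.scale /=; field.
rewrite (le_trans (ler_normB _ _))// normrN !normrM normfV.
have t1 : `|h|^-1 * `|D - (f0 x + h * s + h * (h * q))| <= W * `|h|.
  rewrite ler_pdivrMl// (le_trans b)// (_ : `|h| * (W * `|h|) = W * `|h| ^+ 2); last by ring.
  by rewrite ler_wpM2l// exprS ler_piMl// sqr_ge0.
have t2 : `|h| * `|q| <= W * `|h| by rewrite mulrC ler_wpM2r.
have t3 : `|h| * (2 * (W + 1)) <= e by rewrite -ler_pdivlMr// mulr_gt0// ltr_wpDl.
by have := normr_ge0 h; nra.
Unshelve. all: by end_near. Qed.

Definition scoreQ (x : borel R 1 d.+1) : 'rV[R]_p := f1 (proj_hyp x).

Lemma mu_of_base : mu_of m iota theta0 = m.
Proof. by rewrite -[theta0]addr0 mu_of_theta0 muh0. Qed.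

Lemma Sigma_of_base : Sigma_of theta0 = S0.
Proof. by rewrite /Sigma_of /theta0 row_mxKr vechK ?symB0//; have [] := mlogP pS. Qed.

Lemma score_moments : [/\ measurable_fun setT (scoreQ : _ -> borel R 1 p),
  hwn.-integrable setT (EFin \o (fun t => enorm (scoreQ t) ^+ 3)),
  forall h, \int[hwn]_x dot (scoreQ x) h = 0 &
  forall h, \int[hwn]_x quad (f2 (proj_hyp x)) h = - 2^-1 * \int[hwn]_x (dot (scoreQ x) h ^+ 2)].
Proof.
have [kappa [k0 ie]] := wt_exp.
have id h := score_identity measurable_wt wt_ge1 k0 ie ratio_jet measurable_ratio ratio_exp h.
have [_ m1 _ [C [rho [C0 rho0 H]]]] := ratio_jet.
split => //; last 2 first.
- by move=> h; have [] := id h.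
- by move=> h; have [] := id h.
apply: (@integrable_dominated _ _ _ hwn _ (fun x => C ^+ 3 * wt x ^+ 3)).
- by apply: measurable_funX; exact: (measurableT_comp (@measurable_enorm R p) m1).
- by apply: integrableZ_fin; exact: (integrable_weight_cube measurable_wt wt_ge1 k0 ie).
move=> x; have [w0 _ b1 _ _] := H x I.
have e0 := enorm_ge0 (scoreQ x).
by rewrite ger0_norm ?exprn_ge0// -exprMn lerXn2r// nnegrE (le_trans e0 b1).
Qed.

Lemma fisherE : fisher m iota theta0 = \matrix_(k, l) \int[hwn]_x (scoreQ x ord0 k * scoreQ x ord0 l).
Proof.
apply/matrixP => k l; rewrite [RHS]mxE [LHS]mxE mu_of_base Sigma_of_base HWN_hwn /Rintegral; congr fine.
apply: (integral_conull_eq measurable_hyperboloid hwn_conull) => x hx.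
by rewrite score_jet// mxE big_ord1 mxE /scoreQ proj_hypK.
Qed.

Lemma moments_score : moments hwn scoreQ (fisher m iota theta0).
Proof.
have [m1 i3 h1 h2] := score_moments; split => // h.
pose V := fisher m iota theta0.
have me : measurable_fun setT (fun t => enorm (scoreQ t)) by exact: (measurableT_comp (@measurable_enorm R p) m1).
have ip k l : hwn.-integrable setT (EFin \o (fun x => scoreQ x ord0 k * scoreQ x ord0 l)).
  apply: (@integrable_dominated _ _ _ hwn _ (fun x => 1 + enorm (scoreQ x) ^+ 3)).
  - by apply: measurable_funM; exact: measurable_entry.
  - by apply: integrableD_fin => //; exact: integrable_cst_fin.
  move=> x; have := normM_le (enorm_coord (scoreQ x) k) (enorm_coord (scoreQ x) l) => /le_trans; apply.
  have e0 := enorm_ge0 (scoreQ x); rewrite -expr2.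
  have [e1|e1] := leP (enorm (scoreQ x)) 1.
    by rewrite (@le_trans _ _ 1)// ?exprn_ile1// lerDl exprn_ge0.
  by apply: (@le_trans _ _ (enorm (scoreQ x) ^+ 3)); [rewrite ler_weXn2l// ltW|rewrite lerDr].
have e x : dot (scoreQ x) h ^+ 2 = \sum_l \sum_k (h ord0 k * h ord0 l) * (scoreQ x ord0 k * scoreQ x ord0 l).
  rewrite dotE expr2 mulr_sumr; apply: eq_bigr => l _; rewrite mulr_suml; apply: eq_bigr => k _; ring.
have -> : \int[hwn]_x (dot (scoreQ x) h ^+ 2) = \int[hwn]_x (\sum_l \sum_k (h ord0 k * h ord0 l) * (scoreQ x ord0 k * scoreQ x ord0 l)).
  by apply: eq_Rintegral => x _; exact: e.
rewrite Rintegral_sum_fin; last by move=> l; apply: integrable_sum_fin => k; exact: integrableZ_fin.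
rewrite quadE dotE; apply: eq_bigr => l _; rewrite Rintegral_sum_fin; last by move=> k; exact: integrableZ_fin.
rewrite mxE mulr_suml; apply: eq_bigr => k _.
by rewrite RintegralZl_fin// fisherE mxE; ring.
Qed.

(** The influence function: the score times the inverse information has covariance V^-1 V V^-1 =
    V^-1. *)
Lemma moments_psi : posdef (fisher m iota theta0) ->
  moments hwn (fun x => scoreQ x *m (invmx (fisher m iota theta0))^T) (invmx (fisher m iota theta0)).
Proof.
set V := fisher m iota theta0 => pV; have [ms i3 h1 h2] := moments_score.
have Vu := posdef_unit pV; have [sV _] := pV.
have sI : (invmx V)^T = invmx V by rewrite trmx_inv sV.
rewrite sI; have dE x h : dot (scoreQ x *m invmx V) h = dot (scoreQ x) (h *m invmx V).
  by rewrite dot_mulmxl sI.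
split.
- apply: measurable_mulmx => //; exact: measurable_cstmx.
- pose C := \sum_i enorm (row i (invmx V)^T).
  have C0 : 0 <= C by apply: sumr_ge0 => i _; exact: enorm_ge0.
  have mp : measurable_fun setT ((fun x => scoreQ x *m invmx V) : _ -> borel R 1 p).
    by apply: measurable_mulmx => //; exact: measurable_cstmx.
  apply: (@integrable_dominated _ _ _ hwn _ (fun t => C ^+ 3 * enorm (scoreQ t) ^+ 3)).
  + by apply: measurable_funX; exact: (measurableT_comp (@measurable_enorm R p) mp).
  + exact: integrableZ_fin.
  move=> t; rewrite ger0_norm ?exprn_ge0 ?enorm_ge0// -exprMn lerXn2r ?nnegrE ?mulr_ge0 ?enorm_ge0//.
  rewrite (le_trans (enorm_le_sum _))// /C mulr_suml; apply: ler_sum => i _.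
  have -> : (scoreQ t *m invmx V) ord0 i = dot (scoreQ t) (row i (invmx V)^T).
    by rewrite dotE mxE; apply: eq_bigr => k _; rewrite !mxE.
  by rewrite mulrC ler_dot.
- move=> h; rewrite -[RHS](h1 (h *m invmx V)); apply: eq_Rintegral => x _; exact: dE.
- move=> h; have -> : \int[hwn]_t (dot (scoreQ t *m invmx V) h ^+ 2) = \int[hwn]_t (dot (scoreQ t) (h *m invmx V) ^+ 2).
    by apply: eq_Rintegral => x _; rewrite dE.
  by rewrite h2 !quadE -mulmxA mulVmx// mulmx1 dotC.
Qed.

End model.

(** * Consistency *)

Section hyperbolic_distance.
Context {R : realType} {d : nat}.
Implicit Types (m mu x : 'rV[R]_d.+1) (S : 'M[R]_d).

Lemma ler_acosh (a b : R) : 1 <= a -> a <= b -> acosh a <= acosh b.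
Proof.
move=> a1 ab; have a0 : 0 < a by rewrite (lt_le_trans _ a1).
have b0 : 0 < b by rewrite (lt_le_trans a0).
rewrite /acosh ler_ln ?posrE ?ltr_pwDl ?sqrtr_ge0//.
by rewrite lerD// ler_wsqrtr// lerB// lerXn2r// nnegrE ltW.
Qed.

Lemma coshB (a b : R) : cosh (a - b) = cosh a * cosh b - sinh a * sinh b.
Proof.
rewrite /cosh /sinh opprB !expRD; have e1 : expR a * expR (- a) = 1 by rewrite -expRD subrr expR0.
by field.
Qed.

Lemma sinhc_ge1 (r : R) : 1 <= sinhc r.
Proof.
rewrite -sinhc_norm; have [->|r0] := eqVneq `|r| 0; first by rewrite /sinhc eqxx.
have rp : 0 < `|r| by rewrite lt_def r0 normr_ge0.
have cs := @cvg_sinh_continuous R.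
have [c _] := MVT_segment (ltW rp) (fun (y : R) _ => is_derive_sinh y) (continuous_subspaceT cs).
by rewrite sinh0 !subr0 /sinhc (negPf r0) => ->; rewrite mulfK// cosh_ge1.
Qed.

(* -<mu, x> = cosh a cosh b - sinhc a sinhc b (v . w) in polar coordinates at m *)
Lemma rbase_triangle m mu x : hyperboloid m -> hyperboloid mu -> hyperboloid x ->
  `|rbase m mu - rbase m x| <= rbase mu x.
Proof.
move=> hm hmu hx; rewrite /rbase /kbase -(enorm_Tmap hm hmu) -(enorm_Tmap hm hx).
set v := Tmap m mu; set w := Tmap m x.
rewrite -[leLHS]acosh_cosh// ler_acosh ?cosh_ge1// cosh_norm coshB.
rewrite -[leRHS]opprK -(lorentz_hyp hmu hx) -(wrap_Tmap hm hmu) -(wrap_Tmap hm hx) -/v -/w.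
rewrite !ExpE_frame// !lorentzDl !lorentzDr !lorentzZl !lorentzZr lorentz_frame//.
have [mm _] := hm; rewrite mm (tangent_frame w hm) (lorentzC (frame m v)) (tangent_frame v hm).
have cs : dot v w <= enorm v * enorm w by rewrite (le_trans (ler_norm _))// ler_dot.
have sg : 0 <= sinhc (enorm v) * sinhc (enorm w) by rewrite mulr_ge0// ltW// sinhc_gt0.
have := ler_wpM2l sg cs; rewrite mulrACA !mul_sinhc.
move: (cosh _) (cosh _) (sinh _) (sinh _) (sinhc _) (sinhc _) (dot v w) => a b s1 s2 c1 c2 e h.
nra.
Qed.

Lemma logdens_le_peak mu S x : posdef S -> hyperboloid mu -> hyperboloid x ->
  logdens mu S x <= - 2^-1 * ln (\det S) - 2^-1 * quad (invmx S) (Tmap mu x).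
Proof.
move=> pS hmu hx; rewrite /logdens phiE gerBl mulr_ge0// ln_ge0//; exact: sinhc_ge1.
Qed.

Lemma Tmap_self mu : hyperboloid mu -> Tmap mu mu = 0.
Proof.
move=> hmu; have e : Exp mu (frame mu 0) = mu.
  rewrite ExpE_frame// enorm0 cosh0 scale1r.
  by rewrite (_ : frame mu 0 = 0) ?scaler0 ?addr0//; apply/rowP => i; rewrite /frame dot0r mul0r scale0r addr0;
    case: (unliftP ord0 i) => [j|] ->; rewrite ?cons_rowS ?cons_row0 !mxE.
by rewrite -{2}e Tmap_wrap.
Qed.

Lemma logdens_self mu S : hyperboloid mu -> logdens mu S mu = - 2^-1 * ln (\det S).
Proof.
move=> hmu; rewrite /logdens Tmap_self// phiE enorm0 /sinhc eqxx ln1 quadE mul0mx dot0l.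
by rewrite !mulr0 !subr0.
Qed.

Lemma sym_quad_inj n (A B : 'M[R]_n) : A^T = A -> B^T = B -> (forall v, quad A v = quad B v) -> A = B.
Proof.
move=> sA sB e; apply/matrixP => i j.
pose ei : 'rV[R]_n := delta_mx ord0 i; pose ej : 'rV[R]_n := delta_mx ord0 j.
have ent (M : 'M[R]_n) : M^T = M -> 2 * M i j = quad M (ei + ej) - quad M ei - quad M ej.
  move=> sM; rewrite !quadE mulmxDl !dotDl !dotDr.
  have eM (k l : 'I_n) : dot (delta_mx ord0 k *m M) (delta_mx ord0 l) = M k l.
    rewrite -rowE dotE (bigD1 l)//= big1 ?addr0 ?mxE ?eqxx ?mulr1// => s sl.
    by rewrite !mxE (negPf sl) andbF mulr0.
  have Mji : M j i = M i j by rewrite -{1}sM mxE.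
  by rewrite /ei /ej !eM Mji; ring.
have h2 : (2 : R) != 0 by rewrite pnatr_eq0.
by apply: (mulfI h2); rewrite (ent A sA) (ent B sB) !e.
Qed.

(* x |-> logdens mu S x attains its maximum, -1/2 log det S, exactly at mu. *)
Lemma logdens_inj m S0 mu S : hyperboloid m -> posdef S0 -> hyperboloid mu -> posdef S ->
  (forall x, hyperboloid x -> logdens mu S x = logdens m S0 x) -> mu = m /\ S = S0.
Proof.
move=> hm pS0 hmu pS e.
have q0 (A : 'M[R]_d) v : posdef A -> 0 <= quad (invmx A) v.
  move=> /posdef_inv[_ pA]; have [->|v0] := eqVneq v 0; last exact/ltW/pA.
  by rewrite quadE mul0mx dot0l.
have e1 := e _ hmu; have e2 := e _ hm; rewrite (logdens_self S hmu) in e1; rewrite (logdens_self S0 hm) in e2.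
have l1 := logdens_le_peak pS hmu hm; have l2 := logdens_le_peak pS0 hm hmu.
have Q1 := q0 _ (Tmap mu m) pS; have Q2 := q0 _ (Tmap m mu) pS0.
(* Each peak bounds the other density: adding the two inequalities makes both quadratic terms
   vanish. *)
have T0 : Tmap m mu = 0.
  apply/eqP/negPn/negP => T0; have [_ /(_ _ T0)] := posdef_inv pS0; lra.
have mE : mu = m.
  rewrite -(wrap_Tmap hm hmu) T0 -[RHS](wrap_Tmap hm hm) Tmap_self//.
split => //; rewrite mE in e e1 e2.
have iE : invmx S = invmx S0.
  have [si _] := posdef_inv pS; have [si0 _] := posdef_inv pS0.
  apply: sym_quad_inj => // v; have hv := hyperboloid_Exp hm (tangent_frame v hm).
  have := e _ hv; rewrite /logdens (Tmap_wrap v hm).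
  have := e _ hm; rewrite (logdens_self S hm) (logdens_self S0 hm).
  by move: (ln _) (ln _) (quad _ _) (quad _ _) (phi v) => a b q1 q2 f; clear; lra.
by rewrite -(invmxK S) iE invmxK.
Qed.

End hyperbolic_distance.

Section continuity.
Context {R : realType}.

Lemma continuous_Gmom0 (c : R) : 0 < c -> {for c, continuous (@Gmom R 0)}.
Proof.
move=> c0; apply/cvgrPdist_le => /= eps e0.
pose G := Gmom 0 c; have G0 : 0 <= G := Gmom_ge0 0 c.
pose r := c * Num.min 2^-1 (eps / (3 * (G + 1))).
have d0 : 0 < 3 * (G + 1) by rewrite mulr_gt0// ltr_wpDl.
have r0 : 0 < r by rewrite mulr_gt0// lt_min invr_gt0 ltr0n divr_gt0.
near=> y; pose e := y / c - 1.
have cy : y = c * (1 + e) by rewrite /e addrC subrK mulrCA divff ?mulr1// gt_eqF.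
have er : `|e| <= Num.min 2^-1 (eps / (3 * (G + 1))).
  have : `|c - y| <= r by near: y; exact: cvgr_dist_le.
  by rewrite cy -{1}[c]mulr1 -mulrBr opprD addrA subrr add0r mulrN normrN normrM (gtr0_norm c0) ler_pM2l.
move: er; rewrite le_min => /andP[e1 e2].
have := Gmom_expansion c0 e1; rewrite -cy -/G => b.
have g1 := Gmom_le 1 c0; have g2 := Gmom_le 2 c0; rewrite -/G in g1 g2.
have p1 := Gmom_ge0 1 c; have p2 := Gmom_ge0 2 c.
have t1 : `|e * Gmom 1 c| <= `|e| * G by rewrite normrM ler_wpM2l// ger0_norm.
have ee : `|e| ^+ 2 <= `|e| by rewrite expr2 ler_piMr// (le_trans e1)//; lra.
have t2 : `|e ^+ 2 * Gmom 2 c| <= `|e| * G.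
  by rewrite normrM normrX (ger0_norm p2) ler_pM// exprn_ge0.
have t3 : 2 * `|e| ^+ 3 * G <= `|e| * G.
  rewrite ler_wpM2r// exprS; have := normr_ge0 e; have := exprn_ge0 2 (normr_ge0 e); nra.
have t4 : `|e| * (3 * (G + 1)) <= eps by rewrite -ler_pdivlMr// mulr_gt0// ltr_wpDl.
have a0 := normr_ge0 e.
move: b t1 t2; rewrite !ler_norml => /andP[b1 b2] /andP[b3 b4] /andP[b5 b6]; apply/andP; split; nra.
Unshelve. all: by end_near. Qed.

Lemma sinhcE_Gmom (r : R) : sinhc r = (Gmom 0 (cosh r))^-1.
Proof. by rewrite -Gfun_Gmom ?cosh_ge1// -cosh_norm /Gfun acosh_cosh// sinhc_norm invrK. Qed.

Lemma Gmom0_gt0 (c : R) : 1 <= c -> 0 < Gmom 0 c.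
Proof. by move=> c1; rewrite -Gfun_Gmom// Gfun_gt0. Qed.

(** The integral formula makes [sinhc] a composition of continuous maps, with no separate limit at
    0. *)
Lemma continuous_sinhc : continuous (@sinhc R).
Proof.
move=> r; rewrite (_ : sinhc = fun r => (Gmom 0 (cosh r))^-1 :> R); last exact/funext/sinhcE_Gmom.
apply: cvgV; first by rewrite gt_eqF// Gmom0_gt0 ?cosh_ge1.
have c1 := @continuous_cosh R r.
exact: (continuous_comp c1 (continuous_Gmom0 (cosh_gt0 r))).
Qed.

Lemma continuous_dotl n (m : 'rV[R]_n) : continuous (dot m).
Proof.
rewrite (_ : dot m = fun x => \sum_i m ord0 i * x ord0 i); last by apply/funext => x; rewrite dotE.
by apply: continuous_sum => i x; apply: continuousM; [exact: cst_continuous|exact: continuous_coord].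
Qed.

Lemma continuous_boost0 n (m : 'rV[R]_n) : continuous (boost0 m).
Proof.
move=> x; apply: (@continuousB _ _ _ (fun x => hyp0 m * hyp0 x) (dot m)); last exact: continuous_dotl.
by apply: continuousM; [exact: cst_continuous|exact: continuous_hyp0].
Qed.

Lemma continuous_boost n (m : 'rV[R]_n) : continuous (boost m).
Proof.
move=> x; apply: (@continuousB _ _ _ id (fun x => ((hyp0 x + boost0 m x) / (1 + hyp0 m)) *: m)); first exact: cvg_id.
apply: continuousZ; last exact: cst_continuous.
apply: continuousM; last exact: cst_continuous.
by apply: (@continuousD _ _ _ (@hyp0 R n) (boost0 m)); [exact: continuous_hyp0|exact: continuous_boost0].
Qed.

Lemma continuous_mulmxr n k (A : 'M[R]_(n, k)) : continuous (fun v : 'rV[R]_n => v *m A).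
Proof.
rewrite (_ : (fun v => _) = fun v : 'rV[R]_n => \sum_i v ord0 i *: row i A); last first.
  by apply/funext => v; exact: mulmx_sum_row.
elim: (index_enum _) => [|i s IH] v.
  by rewrite (_ : (fun y => _) = cst 0) ?funeqE => [|y]; [exact: cst_continuous|rewrite big_nil].
rewrite (_ : (fun y => _) = (fun y : 'rV[R]_n => y ord0 i *: row i A + \sum_(j <- s) y ord0 j *: row j A)).
  apply: (@continuousD _ _ _ (fun y : 'rV[R]_n => y ord0 i *: row i A)); last exact: IH.
  by apply: continuousZ; [exact: continuous_coord|exact: cst_continuous].
by apply/funext => y; rewrite big_cons.
Qed.

Lemma continuous_logdensG n (mu : 'rV[R]_n.+2) (S : 'M[R]_n.+1) : continuous (logdensG mu S).
Proof.
have cG : continuous (fun x : 'rV[R]_n.+1 => Gmom 0 (boost0 (spatial mu) x)).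
  move=> x; have b1 := boost0_ge1 (spatial mu) x.
  apply: (continuous_comp (@continuous_boost0 _ (spatial mu) x)).
  by apply: continuous_Gmom0; rewrite (lt_le_trans _ b1).
rewrite (_ : logdensG mu S = fun x => - 2^-1 * ln (\det S)
    - 2^-1 * Gmom 0 (boost0 (spatial mu) x) ^+ 2 * quad (invmx S) (boost (spatial mu) x)
    + n%:R * ln (Gmom 0 (boost0 (spatial mu) x))); last first.
  by apply/funext => x; rewrite /logdensG !Gfun_Gmom ?boost0_ge1.
move=> x; apply: (@continuousD _ _ _ (fun x => - 2^-1 * ln (\det S)
    - 2^-1 * Gmom 0 (boost0 (spatial mu) x) ^+ 2 * quad (invmx S) (boost (spatial mu) x))).
  apply: (@continuousB _ _ _ (cst (- 2^-1 * ln (\det S)))); first exact: cst_continuous.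
  apply: continuousM.
    apply: continuousM; first exact: cst_continuous.
    exact: (continuous_comp (cG x) (@exprn_continuous R 2 _)).
  exact: (continuous_comp (@continuous_boost _ (spatial mu) x) (@continuous_quad _ _ _ _)).
apply: continuousM; first exact: cst_continuous.
apply: (continuous_comp (cG x)); apply: continuous_ln.
by rewrite Gmom0_gt0// boost0_ge1.
Qed.

End continuity.

(** * Full support of the Gaussian law *)

Section full_support.
Context {R : realType}.

Lemma normal_prob_itv_gt0 (a r : R) : 0 < r ->
  (0 < (normal_prob 0 1 : probability (measurableTypeR R) R) `](a - r)%R, (a + r)%R[%classic)%E.
Proof.
move=> r0; pose c := normal_peak 1 * expR (- 2^-1 * (`|a| + r) ^+ 2) : R.
have c0 : 0 < c by rewrite mulr_gt0 ?expR_gt0// normal_peak_gt0.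
have step : (\int[lebesgue_measure]_(x in `](a - r)%R, (a + r)%R[) (cst c%:E) x <=
    (normal_prob 0 1 : probability (measurableTypeR R) R) `](a - r)%R, (a + r)%R[%classic)%E.
  rewrite /normal_prob; apply: ge0_le_integral => //.
  - by move=> x _; rewrite lee_fin ltW.
  - by apply/measurable_EFinP; apply: measurable_funTS; exact: measurable_normal_pdf.
  move=> x /=; rewrite in_itv /= => /andP[x1 x2]; rewrite lee_fin normal_pdfE ?oner_eq0//.
  rewrite /c ler_wpM2l ?normal_peak_ge0// /normal_fun ler_expR subr0 expr1n.
  have xa : `|x| <= `|a| + r.
    by rewrite -[x](subrK a) addrC (le_trans (ler_normD _ _))// lerD2l ler_norml; lra.
  have x2' : x ^+ 2 <= (`|a| + r) ^+ 2.
    by rewrite -[x ^+ 2]real_normK ?num_real// lerXn2r ?nnegrE// addr_ge0// ltW.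
  lra.
apply: (lt_le_trans _ step).
rewrite integral_cst//= lebesgue_measure_itv /= lte_fin ifT; last by lra.
by rewrite -EFinD -EFinM lte_fin mulr_gt0//; lra.
Qed.

(** A positive value would persist on a box, and a box has positive Gaussian measure coordinate by
    coordinate. *)
Lemma gauss_full_support n (F : 'rV[R]_n -> R) : continuous F -> (forall v, 0 <= F v) ->
  (\int[gauss n]_t (F (tuple_row t))%:E = 0)%E -> forall v, F v = 0.
Proof.
move=> cF F0 IF v; apply/eqP/negPn/negP => Fv.
have Fv0 : 0 < F v by rewrite lt_def Fv F0.
have mF : measurable_fun setT (fun t : n.-tuple (measurableTypeR R) => F (tuple_row t)).
  exact: (measurableT_comp (measurable_continuousR cF) (@measurable_tuple_row R n)).
have : \forall y \near v, 0 < F y.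
  by have /cvgr_gt := cF v; apply.
move=> /nbhs_ballP[r /= r0 vr].
pose A (i : nat) : set (measurableTypeR R) := if insub i is Some j then `]v ord0 j - r, v ord0 j + r[%classic else setT.
have mA i : measurable (A i) by rewrite /A; case: insubP.
have pA : (0 < gauss n (rectangle n A))%E.
  rewrite power_prob_rectangle//; elim/big_ind: _ => [|u u' u0 u0'|i _]; [exact: lte01|exact: mule_gt0|].
  by rewrite /A; case: insubP => [j _ _|]; [exact: normal_prob_itv_gt0|rewrite probability_setT].
have := IF; rewrite (eq_integral (fun t => `|(F (tuple_row t))%:E|)%E); last first.
  by move=> t _; rewrite gee0_abs// lee_fin.
move=> /ae_eq_integral_abs => /(_ measurableT); have /measurable_EFinP mF' := mF.
move=> /(_ mF')[N [mN N0 sN]].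
have : (gauss n (rectangle n A) <= gauss n N)%E.
  apply: le_measure; rewrite ?inE//; first exact: measurable_rectangle.
  move=> t tA; apply: sN => /= /(_ I) /eqP; rewrite eqe => /eqP Ft.
  have : 0 < F (tuple_row t); last by rewrite Ft ltxx.
  apply: vr; split => // i j; rewrite ord1 /ball/= mxE.
  have := tA j; rewrite /A; case: insubP => [k _ /val_inj ->|]; last by rewrite ltn_ord.
  by rewrite /= in_itv /= ltr_norml => /andP[??]; lra.
by rewrite N0 leNgt pA.
Qed.

End full_support.

(** If K failed, the sets whose complement in K has Pr would form a proper filter containing K; a
    cluster point in K contradicts the local hypothesis. *)
Lemma compact_induction (T : topologicalType) (K : set T) (Pr : set T -> Prop) : compact K ->
  Pr set0 -> (forall A B, Pr A -> Pr B -> Pr (A `|` B)) -> (forall A B, A `<=` B -> Pr B -> Pr A) ->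
  (forall x, K x -> exists2 U, nbhs x U & Pr U) -> Pr K.
Proof.
move=> cK P0 PU Psub Ploc; apply: contrapT => nPK.
pose F : set_system T := [set A | Pr (K `\` A)].
have FF : ProperFilter F.
  split; first by rewrite /F /= setD0.
  split; first by rewrite /F /= setDT.
  - by move=> A B FA FB; rewrite /F /= setDIr; exact: PU.
  - by move=> A B AB; apply: Psub; exact: setDS.
have FK : F K by rewrite /F /= setDv.
have [x [Kx]] := cK F FF FK; have [U nU PrU] := Ploc x Kx.
move=> /(_ (~` U) U) []; [|by []|by move=> y []].
by rewrite /F /= setDE setCK; apply: (Psub _ U) => // y [].
Qed.

Lemma expR_tangent_eq0 {R : realType} (u : R) : expR u + (-1) * (1 + u) = 0 -> u = 0.
Proof. by have [->//|/expR_gt1Dx] := eqVneq u 0; lra. Qed.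

Lemma diff_bound {R : realType} (a b c z : R) : a - b <= z -> a - c <= b - c + z.
Proof. lra. Qed.

Lemma far_bound {R : realType} (lS l1 q w u z lp c : R) : 0 < lp -> l1 <= lS -> lp^-1 * u <= q ->
  z / 2 <= w + u ->
  - 2^-1 * lS - 2^-1 * q - c <= - 2^-1 * l1 + (2 * lp)^-1 * w - c - (4 * lp)^-1 * z.
Proof.
move=> lp0 h1 h2 h3; rewrite !invfM; have i0 : 0 <= lp^-1 by rewrite invr_ge0 ltW.
by have := ler_wpM2l i0 h3; lra.
Qed.

Section contrast.
Context {R : realType} {n : nat}.
Notation d := n.+1.
Variables (m : 'rV[R]_d.+1) (S0 : 'M[R]_d) (iota : {linear 'rV[R]_d -> 'rV[R]_d.+1}).
Hypothesis hm : hyperboloid m.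
Hypothesis pS : posdef S0.
Hypothesis iso : linear_isometry_onto_tangent m iota.
Local Notation p := (d + vech_dim d)%N.
Local Notation Q := (hwn S0 hm).
Implicit Types (mu x : 'rV[R]_d.+1) (S : 'M[R]_d).

(** Growth at most that of the jet weight: such functions have all the moments needed for integrals
    and for the weak law. *)
Definition dominated (g : borel R 1 d.+1 -> R) : Prop :=
  measurable_fun setT g /\ exists2 C, 0 <= C & forall x, `|g x| <= C * wt m x.

Lemma dominatedD g h : dominated g -> dominated h -> dominated (fun x => g x + h x).
Proof.
move=> [mg [C C0 gC]] [mh [K K0 hK]]; split; first exact: measurable_funD.
exists (C + K); first exact: addr_ge0.
by move=> x; rewrite mulrDl (le_trans (ler_normD _ _))// lerD.
Qed.

Lemma dominatedZ a g : dominated g -> dominated (fun x => a * g x).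
Proof.
move=> [mg [C C0 gC]]; split; first by apply: measurable_funM => //; exact: measurable_cst.
by exists (`|a| * C); [exact: mulr_ge0|move=> x; rewrite normrM -mulrA ler_wpM2l].
Qed.

Lemma dominated_cst a : dominated (fun=> a).
Proof.
split; first exact: measurable_cst.
by exists `|a| => // x; rewrite ler_peMr// wt_ge1.
Qed.

Lemma dominatedB g h : dominated g -> dominated h -> dominated (fun x => g x - h x).
Proof.
move=> dg dh; have := dominatedD dg (dominatedZ (-1) dh).
by rewrite (_ : (fun x => _) = fun x => g x - h x)//; apply/funext => x; rewrite mulN1r.
Qed.

Lemma integrable_wt_cube : Q.-integrable setT (EFin \o (fun x => wt m x ^+ 3)).
Proof.
have [kappa [k0 ie]] := wt_exp S0 hm.
exact: (integrable_weight_cube (measurable_wt m) (wt_ge1 m) k0 ie).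
Qed.

Lemma integrable_dom g : dominated g -> Q.-integrable setT (EFin \o g).
Proof.
move=> [mg [C C0 gC]]; apply: (integrable_dominated mg (integrableZ_fin C integrable_wt_cube)) => x.
by rewrite (le_trans (gC x))// ler_wpM2l// ler_eXnr ?wt_ge1.
Qed.

(** By the triangle inequality, moving the base point changes the distance by a bounded amount, so
    weights at different base points are comparable. *)
Lemma wt_change mu : hyperboloid mu -> exists2 C, 0 <= C & forall x, wt mu x <= C * wt m x.
Proof.
move=> hmu; exists ((1 + rbase mu m) ^+ 2); first exact: sqr_ge0.
move=> x; have hx := hyperboloid_proj x; have := rbase_triangle hmu hm hx.
rewrite ler_norml => /andP[t _]; rewrite /wt /jet_weight -exprMn.
have r0 := rbase_ge0 mu (proj_hyp x); have r1 := rbase_ge0 mu m; have r2 := rbase_ge0 m (proj_hyp x).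
by rewrite lerXn2r ?nnegrE//; nra.
Qed.

Lemma dominated_wt mu : hyperboloid mu -> dominated (wt mu).
Proof.
move=> hmu; split; first exact: measurable_wt.
have [C C0 wC] := wt_change hmu; exists C => // x.
by rewrite ger0_norm// (le_trans ler01)// wt_ge1.
Qed.

Definition ldp mu S (x : borel R 1 d.+1) : R := logdens mu S (proj_hyp x).

Lemma ldpE mu S x : hyperboloid mu -> ldp mu S x = logdensG mu S (spatial x).
Proof. by move=> hmu; rewrite /ldp /proj_hyp logdens_lift. Qed.

Lemma measurable_ldp mu S : hyperboloid mu -> measurable_fun setT (ldp mu S).
Proof.
move=> hmu; rewrite (_ : ldp mu S = logdensG mu S \o spatial); last by apply/funext => x; exact: ldpE.
exact: (measurableT_comp (measurable_logdensG _ _) (@measurable_spatial R d)).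
Qed.

Lemma dominated_ldp mu S : hyperboloid mu -> dominated (ldp mu S).
Proof.
move=> hmu; split; first exact: measurable_ldp.
have [C C0 wC] := wt_change hmu.
pose K := `|ln (\det S)| + mnorm (invmx S) + n%:R.
have K0 : 0 <= K by rewrite !addr_ge0// mnorm_ge0.
exists (K * C); first exact: mulr_ge0.
move=> x; rewrite -mulrA; apply: le_trans (ler_wpM2l K0 (wC x)).
have hx := hyperboloid_proj x; rewrite /ldp /logdens /wt /jet_weight.
rewrite [rbase _ _](esym (enorm_Tmap hmu hx)); set T := Tmap mu _.
have q := quad_bound (invmx S) T; have t0 := enorm_ge0 T.
have p0 : 0 <= phi T by rewrite phiE ln_ge0// sinhc_ge1.
have p1 : phi T <= enorm T.
  rewrite phiE -[leRHS]expRK ler_ln ?posrE ?expR_gt0 ?sinhc_gt0//.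
  by have /andP[] := sinhc_bounds t0.
have n0 : 0 <= n%:R :> R by []; have m0 := mnorm_ge0 (invmx S).
have e1 : n%:R * phi T <= n%:R * (1 + enorm T) ^+ 2 by rewrite ler_wpM2l//; nra.
have e2 : mnorm (invmx S) * enorm T ^+ 2 <= mnorm (invmx S) * (1 + enorm T) ^+ 2 by rewrite ler_wpM2l//; nra.
have e3 : `|ln (\det S)| <= `|ln (\det S)| * (1 + enorm T) ^+ 2 by rewrite ler_peMr//; nra.
have e4 : 0 <= n%:R * phi T by rewrite mulr_ge0.
rewrite /K !mulrDl /=; have := ler_norm (ln (\det S)); have := ler_norm (- ln (\det S)).
have l0 := normr_ge0 (ln (\det S)).
move: q e1 e2 e3 e4 l0; rewrite normrN ler_norml => /andP[].
move: (`|ln (\det S)|) (ln (\det S)) (quad (invmx S) T) (mnorm (invmx S)) (phi T) (enorm T) (n%:R : R).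
clear; move=> *; rewrite ler_norml; apply/andP; split; lra.
Qed.

(* Equality would force e^D - 1 - D = 0 on the support of the wrapped normal law. *)
Lemma gibbs mu S : hyperboloid mu -> posdef S -> ~ (mu = m /\ S = S0) ->
  \int[Q]_x (ldp mu S x - ldp m S0 x) < 0.
Proof.
move=> hmu pS' ne; pose D x := ldp mu S x - ldp m S0 x.
have dD : dominated D by apply: dominatedB; exact: dominated_ldp.
have [mD _] := dD; have iD := integrable_dom dD.
have mE : measurable_fun setT (fun x : borel R 1 d.+1 => expR (D x)) by exact: measurableT_comp.
have eE : (\int[Q]_x (expR (D x))%:E = 1)%E.
  rewrite ge0_integral_hwn//; last exact/measurable_EFinP.
  rewrite -(likelihood_ratio hm pS hmu pS'); apply: eq_integral => t _.
  by rewrite /D /ldp proj_hypK//; exact: hyperboloid_wrap.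
have iE : Q.-integrable setT (EFin \o (fun x => expR (D x))).
  apply/integrableP; split; first exact/measurable_EFinP.
  by under eq_integral do rewrite /= ger0_norm ?expR_ge0//; rewrite eE ltry.
(* F is nonnegative, and because exp D has integral 1, the integral of F is minus that of D. *)
pose F x := expR (D x) + (-1) * (1 + D x).
have F0 x : 0 <= F x by have := expR_ge1Dx (D x); rewrite /F; lra.
have i1D := integrableD_fin (integrable_cst_fin Q 1) iD.
have iF : Q.-integrable setT (EFin \o F) by apply: integrableD_fin => //; exact: integrableZ_fin.
have EF : \int[Q]_x F x = - \int[Q]_x D x.
  rewrite RintegralD_fin//; last exact: integrableZ_fin.
  rewrite RintegralZl_fin// RintegralD_fin//; last exact: integrable_cst_fin.
  by rewrite Rintegral_cst_prob /Rintegral eE /=; lra.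
rewrite ltNge; apply/negP => ED; apply: ne.
have EF0 : (\int[Q]_x (F x)%:E = 0)%E.
  have f0 : (0 <= \int[Q]_x (F x)%:E)%E by apply: integral_ge0 => x _; rewrite lee_fin.
  have fin := integrable_fin_num measurableT iF; rewrite -(fineK fin); congr EFin.
  apply/eqP; rewrite eq_le; apply/andP; split; last by rewrite fine_ge0.
  by rewrite -[fine _]/(\int[Q]_x F x) EF; rewrite oppr_le0.
pose Z (v : 'rV[R]_d) : 'rV[R]_d := boost (- spatial m) (sinhc (enorm v) *: v).
have FZ x : F x = expR (logdensG mu S (spatial x) - logdensG m S0 (spatial x))
    + (-1) * (1 + (logdensG mu S (spatial x) - logdensG m S0 (spatial x))) by rewrite /F /D !ldpE.
have sE v : spatial (Exp m (frame m v)) = Z v by rewrite Exp_frame_lift// /lift_point spatial_cons.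
have cZ : continuous Z.
  move=> v; apply: (continuous_comp (f := fun v : 'rV[R]_d => sinhc (enorm v) *: v)); last exact: continuous_boost.
  apply: continuousZ; last exact: cvg_id.
  by apply: (continuous_comp (@continuous_enorm R d v)); exact: continuous_sinhc.
have cD : continuous (fun v : 'rV[R]_d => logdensG mu S (Z v) - logdensG m S0 (Z v)).
  move=> v; apply: (@continuousB _ _ _ (logdensG mu S \o Z) (logdensG m S0 \o Z)).
    by apply: continuous_comp; [exact: cZ|exact: continuous_logdensG].
  by apply: continuous_comp; [exact: cZ|exact: continuous_logdensG].
have cF : continuous (fun v : 'rV[R]_d => F (Exp m (frame m v))).
  move=> v; rewrite (_ : (fun v => _) = (fun u : R => expR u + (-1) * (u + 1)) \o
    (fun v : 'rV[R]_d => logdensG mu S (Z v) - logdensG m S0 (Z v))); last first.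
    by apply/funext => w; rewrite FZ sE /= (addrC 1).
  apply: continuous_comp; first exact: cD.
  apply: (@continuousD _ _ _ expR (fun u => -1 * (u + 1))); first exact: continuous_expR.
  apply: continuousM; first exact: cst_continuous.
  by apply: cvgD; [exact: cvg_id|exact: cvg_cst].
have [pA AA] := msqrtP pS; have Au := posdef_unit pA.
have cFA : continuous (fun v : 'rV[R]_d => F (Exp m (frame m (v *m msqrt S0)))).
  move=> v; apply: (continuous_comp (f := fun v : 'rV[R]_d => v *m msqrt S0) (g := fun v : 'rV[R]_d => F (Exp m (frame m v)))).
    exact: continuous_mulmxr.
  exact: cF.
have mF : measurable_fun setT ((EFin \o F) : borel R 1 d.+1 -> \bar R) by case/integrableP: iF.
have := EF0; rewrite (ge0_integral_hwn _ hm mF); last by move=> x; rewrite lee_fin.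
move=> /(gauss_full_support cFA (fun v => F0 _)) F00.
apply: (logdens_inj hm pS hmu pS') => x hx.
(* Every point of the hyperboloid is the wrapped image of some Gaussian value, namely its tangent
   coordinates times S0^(-1/2). *)
have hF : F x = 0.
  by rewrite -(F00 (Tmap m x *m invmx (msqrt S0))) (mulmxKV Au) (wrap_Tmap hm hx).
have D0 : D x = 0 := expR_tangent_eq0 hF.
have DE : D x = logdens mu S x - logdens m S0 x by rewrite /D /ldp (proj_hypK hx).
by apply: subr0_eq; rewrite -DE.
Qed.

End contrast.

(** * Majorants of the log-likelihood ratio away from the truth *)

Section cover.
Context {R : realType} {n : nat}.
Notation d := n.+1.
Implicit Types (mu x : 'rV[R]_d.+1) (S : 'M[R]_d).

Lemma frame_linear mu : linear (@frame R d mu).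
Proof.
move=> a u v; apply/rowP => i; rewrite /frame dotDr dotZr.
case: (unliftP ord0 i) => [j|] ->; first by rewrite !(cons_rowS, mxE); ring.
by rewrite !(cons_row0, mxE).
Qed.

HB.instance Definition _ mu := GRing.isLinear.Build R _ _ _ (@frame R d mu) (frame_linear mu).

Lemma frame_isometry mu : hyperboloid mu -> linear_isometry_onto_tangent mu (frame mu : {linear _ -> _}).
Proof.
move=> hmu; split; last by move=> a b; rewrite lorentz_frame.
apply/seteqP; split => [_ [z _ <-]|v tv]; first exact: tangent_frame.
by exists (unframe mu v) => //; exact: frameK.
Qed.

Lemma enorm_row_mx n1 n2 (a : 'rV[R]_n1) (b : 'rV[R]_n2) : enorm (row_mx a b) <= enorm a + enorm b.
Proof.
rewrite -(@ler_pXn2r _ 2) ?nnegrE ?addr_ge0 ?enorm_ge0// sqrrD !enorm_sqr.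
have -> : dot (row_mx a b) (row_mx a b) = dot a a + dot b b.
  by rewrite {1}/dot tr_row_mx mul_row_col mxE.
by rewrite addrAC lerDl mulrn_wge0// mulr_ge0 ?enorm_ge0.
Qed.

Variables (m : 'rV[R]_d.+1) (S0 : 'M[R]_d) (iota : {linear 'rV[R]_d -> 'rV[R]_d.+1}).
Hypothesis hm : hyperboloid m.
Hypothesis pS : posdef S0.
Hypothesis iso : linear_isometry_onto_tangent m iota.
Local Notation p := (d + vech_dim d)%N.
Local Notation Q := (hwn S0 hm).
Local Notation mu_of := (mu_of m iota).

Lemma mu_of_near (t1 : 'rV[R]_p) (e : R) : 0 < e ->
  \forall t \near t1, rbase (mu_of t1) (mu_of t) <= e.
Proof.
move=> e0; have h1 : hyperboloid (mu_of t1) := hyperboloid_mu_of hm iso t1.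
pose f (t : 'rV[R]_p) : R := - lorentz (mu_of t1) (mu_of t).
have cl : continuous (fun t : 'rV[R]_p => lsubmx t).
  rewrite (_ : (fun t => _) = fun t : 'rV[R]_p => t *m col_mx 1%:M 0); first exact: continuous_mulmxr.
  by apply/funext => t; rewrite -{2}[t]hsubmxK mul_row_col mulmx1 mulmx0 addr0.
have ce : continuous (fun t : 'rV[R]_p => enorm (lsubmx t)).
  by move=> t; apply: (continuous_comp (cl t)); exact: continuous_enorm.
have cf : continuous f.
  rewrite (_ : f = fun t : 'rV[R]_p => cosh (enorm (lsubmx t)) * - lorentz (mu_of t1) m +
      sinhc (enorm (lsubmx t)) * dot (\row_i - lorentz (mu_of t1) (iota (delta_mx ord0 i))) (lsubmx t)); last first.
    apply/funext => t; rewrite /f (mu_ofE hm iso t) lorentzDr !lorentzZr opprD mulrN; congr (_ + _).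
    rewrite -mulrN -(linear_functionalE (F := fun a => - lorentz (mu_of t1) (iota a)))//.
    by move=> a u v; rewrite linearP lorentzDr lorentzZr; ring.
  move=> t; apply: (@continuousD _ _ _ (fun t : 'rV[R]_p => cosh (enorm (lsubmx t)) * - lorentz (mu_of t1) m)).
    by apply: continuousM; [apply: (continuous_comp (ce t)); exact: continuous_cosh|exact: cst_continuous].
  apply: continuousM; first by apply: (continuous_comp (ce t)); exact: continuous_sinhc.
  by apply: (continuous_comp (cl t)); exact: continuous_dotl.
have c1 : 1 < cosh e.
  have s0 : 0 < sinh e by rewrite -mul_sinhc mulr_gt0// sinhc_gt0.
  have := cosh2_sinh2 e; have := cosh_ge1 e; nra.
have f1 : f t1 < cosh e by rewrite /f; have [-> _] := h1; rewrite opprK.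
have /cvgr_lt/(_ _ f1) := cf t1; apply: filterS => t ft.
have ht : hyperboloid (mu_of t) := hyperboloid_mu_of hm iso t.
rewrite -[leRHS]acosh_cosh ?(ltW e0)// /rbase ler_acosh ?kbase_ge1//.
by rewrite kbaseE// ltW.
Qed.

Lemma chart_inj (t : 'rV[R]_p) : mu_of t = m -> Sigma_of t = S0 -> t = theta0 S0.
Proof.
move=> e1 e2; rewrite -[t]hsubmxK /theta0; congr row_mx.
  apply: (iota_inj iso); rewrite linear0.
  rewrite -(Log_Exp hm (tangent_iota iso (lsubmx t))) -[Exp _ _]/(mu_of t) e1.
  rewrite -{2}(wrap_Tmap hm hm) Tmap_self// Log_Exp ?linear0//.
  by rewrite /tangent /= lorentz0r.
by rewrite -e2 /Sigma_of mlogK ?mat_sym// matK.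
Qed.

(** By [gibbs] the mean ratio at t1 is negative. The jet of the log-density based at t1 makes it
    Lipschitz in the parameter with an integrable constant, so a small neighbourhood has a common
    majorant of negative mean. *)
Lemma local_cover (t1 : 'rV[R]_p) : t1 <> theta0 S0 -> exists2 U, nbhs t1 U &
  exists g, [/\ dominated m g, \int[Q]_x g x < 0 & forall t x, U t -> hyperboloid x ->
    logdens (mu_of t) (Sigma_of t) x - logdens m S0 x <= g x].
Proof.
move=> ne; have h1 : hyperboloid (mu_of t1) := hyperboloid_mu_of hm iso t1.
set m1 := mu_of t1 in h1 *; pose B1 := mat (rsubmx t1); have sB1 : B1^T = B1 by exact: mat_sym.
have iso1 := frame_isometry h1.
have [C [rho [C0 rho0 lip]]] := has_jet_lip (has_jet_logdens h1 iso1 sB1).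
have neg := gibbs hm pS h1 (Sigma_of_posdef t1) (fun e => ne (chart_inj e.1 e.2)).
have d1 := dominatedB (dominated_ldp hm (Sigma_of t1) h1) (dominated_ldp hm S0 hm).
set a := \int[Q]_x _ in neg.
have dw := dominated_wt hm h1; pose W := \int[Q]_x wt m1 x.
have W0 : 0 <= W by apply: fine_ge0; apply: integral_ge0 => x _; rewrite lee_fin (le_trans ler01)// wt_ge1.
have CW0 : 0 < 2 * (C * W + 1) by rewrite mulr_gt0// ltr_wpDl// mulr_ge0// ltW.
(* The Lipschitz term then adds at most - a / 2 to the mean a. *)
pose e := Num.min rho (- a / (2 * (C * W + 1))).
have e0 : 0 < e by rewrite lt_min rho0 divr_gt0// oppr_gt0.
pose U := [set t : 'rV[R]_p | rbase m1 (mu_of t) <= e / 2 /\ enorm (t - t1) < e / 2].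
exists U.
  have := mu_of_near t1 (divr_gt0 e0 (ltr0n R 2)); have := nbhs_enorm_ball t1 (divr_gt0 e0 (ltr0n R 2)).
  by move=> n1 n2; near=> t; split; near: t.
exists (fun x => (ldp m1 (Sigma_of t1) x - ldp m S0 x) + e * C * wt m1 x); split.
- by apply: dominatedD => //; exact: dominatedZ.
- rewrite RintegralD_fin; [|exact: integrable_dom|by apply: integrable_dom; exact: dominatedZ].
  rewrite RintegralZl_fin; last exact: integrable_dom.
  rewrite -/a -/W.
  have : e * (2 * (C * W + 1)) <= - a by rewrite -ler_pdivlMr// ge_min lexx orbT.
  by rewrite -mulrA; nra.
move=> t x [t2 t3] hx.
have ht : hyperboloid (mu_of t) := hyperboloid_mu_of hm iso t.
(* Coordinates of t in the chart centred at t1: normal coordinates at m1 in the transported frame,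
   and the difference of the matrix logarithms. *)
pose h : 'rV[R]_p := row_mx (Tmap m1 (mu_of t)) (rsubmx (t - t1)).
have he : enorm h <= e.
  rewrite (le_trans (enorm_row_mx _ _))// (splitr e) lerD//; first by rewrite enorm_Tmap.
  rewrite (le_trans _ (ltW t3))// -[X in _ <= enorm X]hsubmxK.
  rewrite /enorm ler_sqrt ?dot_ge0// -/(dot _ _) -/(dot (row_mx _ _) _) {2}/dot tr_row_mx mul_row_col mxE.
  by rewrite lerDr dot_ge0.
have hr : enorm h <= rho by rewrite (le_trans he)// ge_min lexx.
have := lip x h hx hr.
have -> : muh m1 (frame m1) h = mu_of t by rewrite /muh row_mxKl wrap_Tmap.
have -> : B1 + mat (rsubmx h) = mat (rsubmx t).
  by rewrite row_mxKr linearB /= -scaleN1r addrC (addrC (rsubmx t)) mat_linear -/B1 scaleN1r addrAC addNr add0r.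
rewrite (muh0 h1 iso1) (_ : B1 + mat (rsubmx 0) = B1); last first.
  by rewrite linear0 -(scale0r (rsubmx t1)) -[_ *: _]addr0 mat_linear scale0r add0r
    (_ : mat 0 = 0) ?addr0//; apply/matrixP => i j; rewrite !mxE big1// => k _; rewrite mxE.
rewrite /ldp !proj_hypK// /wt proj_hypK// ler_norml => /andP[_ u].
have w0 : 0 <= C * jet_weight m1 x by rewrite mulr_ge0 ?(ltW C0)// (le_trans ler01)// jet_weight_ge1.
rewrite -[e * C * _]mulrA [e * _]mulrC; apply: diff_bound.
exact: (le_trans u (ler_wpM2l w0 he)).
Unshelve. all: by end_near. Qed.

(** When mu is far from m, any x is far from one of them. Far from mu, the quadratic penalty is
    large; far from m, the weight added to g pays. In both cases a constant of order r0^2 can be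
    subtracted. *)
Lemma far_cover (lm lp : R) : 0 < lm -> 0 < lp -> exists r0 g, [/\ 0 <= r0, dominated m g, \int[Q]_x g x < 0 &
  forall mu S x, hyperboloid mu -> covK lm lp S -> hyperboloid x -> r0 <= rbase m mu ->
    logdens mu S x - logdens m S0 x <= g x].
Proof.
move=> lm0 lp0; pose c := - 2^-1 * ln (lm ^+ d).
pose f x := (c + (2 * lp)^-1 * wt m x) - ldp m S0 x.
have df : dominated m f.
  apply: dominatedB; last exact: dominated_ldp.
  by apply: dominatedD; [exact: dominated_cst|apply: dominatedZ; exact: dominated_wt].
(* As r0 >= 1, r0^2 / (4 lp) is at least r0 / (4 lp), which exceeds K, so the subtracted constant
   makes the mean negative. *)
pose K := `|\int[Q]_x f x|; pose r0 := 1 + 4 * lp * (K + 1).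
have K0 : 0 <= K := normr_ge0 _; have k4 : 0 <= 4 * lp * (K + 1) by rewrite mulr_ge0 ?addr_ge0// mulr_ge0// ltW.
have r1 : 1 <= r0 by rewrite lerDl.
exists r0, (fun x => f x + - ((4 * lp)^-1 * r0 ^+ 2)); split; first lra.
- by apply: dominatedD => //; exact: dominated_cst.
- rewrite RintegralD_fin; [|exact: integrable_dom|exact: integrable_cst_fin].
  rewrite Rintegral_cst_prob subr_lt0 (le_lt_trans (ler_norm _))// -/K.
  rewrite -ltr_pdivrMl ?invr_gt0 ?mulr_gt0// invrK.
  have : r0 <= r0 ^+ 2 by rewrite ler_eXnr.
  by apply: lt_le_trans; rewrite /r0; lra.
move=> mu S x hmu KS hx rm; rewrite /f /ldp proj_hypK// /wt proj_hypK//.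
have pS' : posdef S by case: KS.
apply: (le_trans (lerB (logdens_le_peak pS' hmu hx) (lexx _))).
have /andP[q _] := covK_quad_inv (Tmap mu x) lm0 KS.
have D := covK_det lm0 KS.
have lD : ln (lm ^+ d) <= ln (\det S) by rewrite ler_ln ?posrE ?exprn_gt0// posdef_det.
rewrite -enorm_sqr enorm_Tmap// -[acosh _]/(rbase mu x) in q.
have := rbase_triangle hm hmu hx; rewrite ler_norml => /andP[_ t].
have b0 := rbase_ge0 mu x; have b1 := rbase_ge0 m x; rewrite /jet_weight.
have key : r0 ^+ 2 / 2 <= (1 + rbase m x) ^+ 2 + rbase mu x ^+ 2.
  have := sqr_ge0 (rbase m x - rbase mu x); nra.
exact: (far_bound (logdens m S0 x) lp0 lD q key).
Qed.

End cover.

(** * Events of vanishing outer probability *)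

Section vanishing_events.
Context {R : realType} {d1 : measure_display} {Omega : measurableType d1}.
Variable P : probability Omega R.
Implicit Types E F : nat -> set Omega.

(* E n need not be measurable: what matters is that it is covered by events of *)
(* small probability.                                                           *)
Definition small_cover E (e : R) : Prop := exists N, forall n, (N <= n)%N ->
  exists B, [/\ measurable B, E n `<=` B & (P B <= e%:E)%E].

Definition vanishing E : Prop := forall e, 0 < e -> small_cover E e.

Lemma small_coverU E F e e' : small_cover E e -> small_cover F e' -> small_cover (fun n => E n `|` F n) (e + e').
Proof.
move=> [N1 h1] [N2 h2]; exists (maxn N1 N2) => n; rewrite geq_max => /andP[n1 n2].
have [B1 [m1 s1 p1]] := h1 n n1; have [B2 [m2 s2 p2]] := h2 n n2.
exists (B1 `|` B2); split; [exact: measurableU|exact: setUSS|].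
by rewrite (le_trans (measureU2 P m1 m2))// EFinD leeD.
Qed.

Lemma small_cover_sub E F e : (exists N, forall n, (N <= n)%N -> E n `<=` F n) -> small_cover F e -> small_cover E e.
Proof.
move=> [N1 h1] [N2 h2]; exists (maxn N1 N2) => n; rewrite geq_max => /andP[n1 n2].
by have [B [mB sB pB]] := h2 n n2; exists B; split => //; exact: subset_trans (h1 n n1) sB.
Qed.

Lemma vanishing0 : vanishing (fun=> set0).
Proof.
by move=> e e0; exists 0%N => n _; exists set0; split => //; rewrite measure0 lee_fin ltW.
Qed.

Lemma vanishingU E F : vanishing E -> vanishing F -> vanishing (fun n => E n `|` F n).
Proof.
by move=> h1 h2 e e0; rewrite (splitr e); apply: small_coverU; [apply: h1|apply: h2]; rewrite divr_gt0.
Qed.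

Lemma vanishing_sub E F : (exists N, forall n, (N <= n)%N -> E n `<=` F n) -> vanishing F -> vanishing E.
Proof. by move=> h hF e e0; exact: small_cover_sub h (hF e e0). Qed.

Lemma vanishing_bigcup (I : finType) (E : I -> nat -> set Omega) : (forall i, vanishing (E i)) ->
  vanishing (fun n => [set w | exists i, E i n w]).
Proof.
move=> h; have : vanishing (fun n => [set w | exists2 i, i \in enum I & E i n w]).
  elim: (enum I) => [|i s IH].
    by apply: vanishing_sub vanishing0; exists 0%N => n _ w [].
  apply: vanishing_sub (vanishingU (h i) IH); exists 0%N => n _ w [j].
  by rewrite inE => /orP[/eqP -> ?|js ?]; [left|right; exists j].
by apply: vanishing_sub; exists 0%N => n _ w [i ?]; exists i; rewrite ?mem_enum.
Qed.

Lemma vanishing_cvg E : (forall n, measurable (E n)) -> vanishing E -> P (E n) @[n --> \oo] --> 0%E.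
Proof.
move=> mE vE; apply/fine_cvgP; split.
  by near=> n; exact: fin_num_measure.
apply/cvgrPdist_le => /= e e0; have [N h] := vE e e0; near=> n.
have Nn : (N <= n)%N by near: n; exact: nbhs_infty_ge.
have [B [mB sB pB]] := h n Nn.
rewrite sub0r normrN ger0_norm ?fine_ge0// -lee_fin fineK ?fin_num_measure//.
by rewrite (le_trans _ pB)// le_measure ?inE.
Unshelve. all: by end_near. Qed.

End vanishing_events.

(** * Weak law of large numbers *)

Section weak_law.
Context {R : realType} {d1 : measure_display} {Omega : measurableType d1}.
Variable P : probability Omega R.
Context {d2 : measure_display} {T : measurableType d2}.
Variables (Q : probability T R) (X : nat -> Omega -> T).
Hypothesis mX : forall i, measurable_fun setT (X i).
Hypothesis indep : forall n (A : nat -> set T), (forall i, measurable (A i)) ->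
  P (\bigcap_(i < n) X i @^-1` A i) = (\prod_(i < n) Q (A i))%E.

Lemma markov_sample n (G : n.-tuple T -> R) (a v : R) : 0 <= a -> measurable_fun setT G ->
  (forall t, 0 <= G t) -> (\int[power_prob Q n]_t (G t)%:E = v%:E)%E ->
  (a%:E * P [set w | (a <= G (sample X n w))%R] <= v%:E)%E.
Proof.
move=> a0 mG G0 iG.
have mS := @measurable_sample _ _ _ _ _ mX n.
have := markov_ineq P a0 (measurableT_comp mG mS) (fun w => G0 _).
move=> /le_trans; apply; rewrite -iG -(ge0_integral_sample mX indep)//; exact/measurable_EFinP.
Qed.

Lemma measurable_sample_ge n (G : n.-tuple T -> R) (a : R) : measurable_fun setT G ->
  measurable [set w | a <= G (sample X n w)].
Proof.
move=> mG; have := measurable_fun_le measurableT (measurable_cst a) (measurableT_comp mG (@measurable_sample _ _ _ _ _ mX n)).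
by rewrite setTI.
Qed.

Lemma weak_law (f : T -> R) (e : R) : measurable_fun setT f ->
  Q.-integrable setT (EFin \o (fun x => f x ^+ 2)) -> 0 < e ->
  vanishing P (fun n => [set w | e <= `|n%:R^-1 * \sum_(i < n) f (X i w) - \int[Q]_x f x|]).
Proof.
move=> mf if2 e0; set a := \int[Q]_x f x; pose g x := f x - a.
have if1 : Q.-integrable setT (EFin \o f).
  apply: (integrable_dominated mf (integrableD_fin (integrable_cst_fin Q 1) if2)) => x.
  have := sqr_ge0 (`|f x| - 1); rewrite -[f x ^+ 2]real_normK ?num_real//.
  by have := normr_ge0 (f x); nra.
have mg : measurable_fun setT g by apply: measurable_funB => //; exact: measurable_cst.
have ig : Q.-integrable setT (EFin \o g).
  have := integrableD_fin if1 (integrable_cst_fin Q (- a)).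
  by rewrite (_ : (fun x => _) = g).
have ig2 : Q.-integrable setT (EFin \o (fun x => g x ^+ 2)).
  apply: (@integrable_dominated _ _ _ Q _ (fun x => 2 * f x ^+ 2 + 2 * a ^+ 2)).
  - exact: measurable_funX.
  - by apply: integrableD_fin; [exact: integrableZ_fin|exact: integrable_cst_fin].
  by move=> x; rewrite ger0_norm ?sqr_ge0// /g; have := sqr_ge0 (f x + a); nra.
have g2 : (\int[Q]_x (g x ^+ 2)%:E < +oo)%E.
  have /integrableP[_] := ig2; under eq_integral do rewrite /= ger0_norm ?sqr_ge0//.
  by [].
have g1 : (\int[Q]_x (g x)%:E = 0)%E.
  rewrite -(fineK (integrable_fin_num measurableT ig)) -[fine _]/(\int[Q]_x g x).
  have -> : \int[Q]_x g x = \int[Q]_x (f x + - a) by apply: eq_Rintegral.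
  rewrite RintegralD_fin//; last exact: integrable_cst_fin.
  by rewrite Rintegral_cst_prob subrr.
set v := variance_of Q g.
have v0 : 0 <= v by apply: fine_ge0; apply: integral_ge0 => x _; rewrite lee_fin sqr_ge0.
(* Chebyshev's bound v / (n e^2) is below eps from this n on. *)
move=> eps eps0; exists (Num.truncn (v / (e ^+ 2 * eps))).+1 => n hn.
have n0 : 0 < n%:R :> R by rewrite ltr0n (leq_trans _ hn).
pose G (t : n.-tuple T) := (0 + \sum_(i < n) g (tnth t i)) ^+ 2.
have mG : measurable_fun setT G.
  apply: measurable_funX; apply: measurable_funD; first exact: measurable_cst.
  by apply: measurable_sum => i; apply: (measurableT_comp mg); exact: measurable_tnth.
have ne0 : 0 < (n%:R * e) ^+ 2 by rewrite exprn_gt0// mulr_gt0.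
exists [set w | (n%:R * e) ^+ 2 <= G (sample X n w)]; split.
- exact: measurable_sample_ge.
- move=> w /= h; rewrite /G add0r.
  have -> : \sum_(i < n) g (tnth (sample X n w) i) = n%:R * (n%:R^-1 * \sum_(i < n) f (X i w) - a).
    rewrite mulrBr mulrA divff ?gt_eqF// mul1r; under eq_bigr do rewrite tnth_mktuple.
    by rewrite /g sumrB sumr_const card_ord -[a *+ n]mulr_natl.
  rewrite !exprMn ler_wpM2l ?sqr_ge0// -[leRHS]real_normK ?num_real//.
  by rewrite lerXn2r// nnegrE ltW.
have := markov_sample (ltW ne0) mG (fun=> sqr_ge0 _) (sum_second_moment mg g2 g1 n 0).
rewrite expr0n add0r -/v => mk.
rewrite -(lee_pmul2l _ (_ : 0 < ((n%:R * e) ^+ 2)%:E)%E) ?lte_fin//.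
apply: (le_trans mk); rewrite -EFinM lee_fin.
have : v / (e ^+ 2 * eps) < n%:R.
  by rewrite (lt_le_trans (truncnS_gt _))// ler_nat.
rewrite ltr_pdivrMr ?mulr_gt0 ?exprn_gt0// => /ltW h.
by have := ler_wpM2l (ltW n0) h; rewrite exprMn; nra.
Qed.

End weak_law.

(** * Tightness and limit of the normalised sum *)

Section tightness.
Context {R : realType} {d1 : measure_display} {Omega : measurableType d1}.
Variable P : probability Omega R.
Context {d2 : measure_display} {T : measurableType d2} {p : nat}.
Variables (Q : probability T R) (X : nat -> Omega -> T) (psi : T -> 'rV[R]_p) (V : 'M[R]_p).
Hypothesis mX : forall i, measurable_fun setT (X i).
Hypothesis indep : forall n (A : nat -> set T), (forall i, measurable (A i)) ->
  P (\bigcap_(i < n) X i @^-1` A i) = (\prod_(i < n) Q (A i))%E.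
Hypothesis pV : posdef V.
Hypothesis hm : moments Q psi V.

Definition root_sum n (w : Omega) : 'rV[R]_p := (Num.sqrt n%:R)^-1 *: \sum_(i < n) psi (X i w).

Lemma root_sum_sample n w :
  root_sum n w = (Num.sqrt n%:R)^-1 *: \sum_(i < n) psi (tnth (sample X n w) i).
Proof. by rewrite /root_sum; congr (_ *: _); apply: eq_bigr => i _; rewrite tnth_mktuple. Qed.

Lemma measurable_root_sum n : measurable_fun setT (root_sum n : Omega -> borel R 1 p).
Proof.
rewrite (_ : root_sum n = (fun t : n.-tuple T => (Num.sqrt n%:R)^-1 *: \sum_(i < n) psi (tnth t i)) \o sample X n).
  exact: (measurableT_comp (@measurable_power_sum _ _ _ _ _ _ _ hm n) (@measurable_sample _ _ _ _ _ mX n)).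
by apply/funext => w; exact: root_sum_sample.
Qed.

(** The second moment of the normalised sum is the total variance for every n >= 1; A is chosen so
    that A^2 e exceeds it, and Markov applies. *)
Lemma tight_root_sum (e : R) : 0 < e -> exists2 A, 0 < A &
  small_cover P (fun n => [set w | A <= enorm (root_sum n w)]) e.
Proof.
move=> e0; pose tv := total_variance V; have tv0 : 0 <= tv := total_variance_ge0 hm.
exists (1 + tv / e); first by rewrite ltr_pwDl// divr_ge0// ltW.
set A := 1 + _; have A1 : 1 <= A by rewrite lerDl divr_ge0// ltW.
have A0 : 0 < A by rewrite (lt_le_trans _ A1).
exists 1%N => n n0.
pose G (t : n.-tuple T) := enorm ((Num.sqrt n%:R)^-1 *: \sum_(i < n) psi (tnth t i)) ^+ 2.
have mG : measurable_fun setT G.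
  by apply: measurable_funX; exact: (measurableT_comp (@measurable_enorm R p) (@measurable_power_sum _ _ _ _ _ _ _ hm n)).
exists [set w | A ^+ 2 <= G (sample X n w)]; split.
- exact: measurable_sample_ge.
- by move=> w /= h; rewrite /G -root_sum_sample lerXn2r// nnegrE ?enorm_ge0// ltW.
have mk := markov_sample mX indep (sqr_ge0 A) mG (fun=> sqr_ge0 _) (scaled_sum_second_moment hm n0).
rewrite -(lee_pmul2l _ (_ : 0 < (A ^+ 2)%:E)%E) ?lte_fin ?exprn_gt0//.
apply: (le_trans mk); rewrite -EFinM lee_fin -/tv.
have : tv <= A * e by rewrite /A mulrDl mul1r divfK ?gt_eqF// lerDr ltW.
by have : A <= A ^+ 2 by [rewrite ler_eXnr]; nra.
Qed.

Lemma clt_expectation (f : 'rV[R]_p -> R) (K eps : R) : continuous f -> (forall x, 0 <= f x <= K) -> 0 < eps ->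
  exists N, forall n, (N <= n)%N ->
  `|\int[P]_w f (root_sum n w) - \int[gauss p]_t f (tuple_row t *m msqrt V)| <= eps.
Proof.
move=> cf fK e0; have [N h] := clt_nonneg pV hm cf fK e0; exists N => n /h.
have mf : measurable_fun setT (f : borel R 1 p -> R) by exact: measurable_continuousR.
have e : (\int[P]_w (f (root_sum n w))%:E = \int[power_prob Q n]_t
    (f ((Num.sqrt n%:R)^-1 *: \sum_(i < n) psi (tnth t i)))%:E)%E.
  rewrite -(ge0_integral_sample mX indep).
  - by apply: eq_integral => w _; rewrite root_sum_sample.
  - by apply/measurable_EFinP; exact: (measurableT_comp mf (@measurable_power_sum _ _ _ _ _ _ _ hm n)).
  by move=> t; rewrite lee_fin; case/andP: (fK ((Num.sqrt n%:R)^-1 *: \sum_(i < n) psi (tnth t i))).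
by rewrite /Rintegral e.
Qed.

End tightness.

Section initial_segments.
Context {R : realType} {d1 : measure_display} {Omega : measurableType d1}.
Variable P : probability Omega R.

Lemma iid_initial m n (X : nat -> Omega -> borel R m n) (Q : probability (borel R m n) R) :
  iid_from P X Q -> forall k (A : nat -> set (borel R m n)), (forall i, measurable (A i)) ->
  P (\bigcap_(i < k) X i @^-1` A i) = (\prod_(i < k) Q (A i))%E.
Proof.
move=> [_ [ind law]] k A mA.
have := ind [fset i in iota 0 k]%fset A mA.
rewrite (_ : [set` _] = `I_k); last first.
  by apply/seteqP; split => i /=; rewrite !inE mem_iota.
move=> ->; rewrite -(big_mkord xpredT (fun i => Q (A i))) /index_iota subn0.
rewrite (perm_big (iota 0 k)) /=; last first.
  by apply: uniq_perm; rewrite ?fset_uniq ?iota_uniq// => i; rewrite !inE.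
by apply: eq_bigr => i _; exact: law.
Qed.

End initial_segments.

(** * Measurability of the chart *)

Section chart_measurability.
Context {R : realType}.

Lemma continuous_mexp_mat k : continuous (fun b : 'rV[R]_(vech_dim k) => mexp (mat b) : 'M[R]_k).
Proof.
move=> b; apply/(@cvg_ballP R _ _ _ (nbhs_filter b)) => e e0.
have lip i j : \forall c \near b, `|mexp (mat b) i j - mexp (mat c) i j| < e.
  have [C [rho [C0 rho0 h]]] := has_jet_lip (has_jet_mexp (T := measurableTypeR R) setT (mat b) i j (@mat_linear R k)).
  have r0 : 0 < Num.min rho (e / C) by rewrite lt_min rho0 divr_gt0.
  have := nbhs_enorm_ball b r0; apply: filterS => c; rewrite lt_min => /andP[c1 c2].
  have := h 0 (c - b) I (ltW c1); rewrite mulr1.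
  have -> : mat b + mat (c - b) = mat c.
    by rewrite addrC -[mat (c - b)]scale1r -mat_linear scale1r subrK.
  have -> : mat b + mat 0 = mat b by have := mat_linear 1 b 0; rewrite !scale1r addr0.
  rewrite distrC => /le_lt_trans; apply.
  by rewrite mulrC -ltr_pdivlMr.
have lips : nbhs b [set c | forall i j, `|mexp (mat b) i j - mexp (mat c) i j| < e].
  apply: (@filter_forall _ _ _ _ (nbhs_filter b)) => i.
  by apply: (@filter_forall _ _ _ _ (nbhs_filter b)) => j; exact: lip.
by apply: filterS lips => c h; split => // i j; exact: h.
Qed.

(* The preimage of a closed set F under vech (mlog _) is, on covK, the image of *)
(* a compact part of F under the continuous map mexp (mat _).                   *)
Lemma measurable_vech_mlog disp (T : measurableType disp) k (lm lp : R) (S : T -> 'M[R]_k) : 0 < lm ->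
  measurable_fun setT (S : T -> borel R k k) -> (forall w, covK lm lp (S w)) ->
  measurable_fun setT ((fun w => vech (mlog (S w))) : T -> borel R 1 (vech_dim k)).
Proof.
move=> lm0 mS KS; apply: measurable_preimage_open => B oB.
have [c hc] := covK_mlog_bound k lp lm0.
pose M := \sum_(l < vech_dim k) c.
pose F := [set b : 'rV[R]_(vech_dim k) | enorm b <= M] `&` ~` B.
have cF : compact ((fun b : 'rV[R]_(vech_dim k) => mexp (mat b)) @` F).
  apply: continuous_compact; first exact/continuous_subspaceT/continuous_mexp_mat.
  by apply: compact_closedI; [exact: compact_enorm_ball|exact: open_closedC].
rewrite (_ : _ @^-1` B = ~` (S @^-1` ((fun b => mexp (mat b)) @` F))).
  apply: measurableC; rewrite -[X in measurable X]setTI; apply: mS => //.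
  by apply: measurable_closed; apply: compact_closed => //; exact: norm_hausdorff.
apply/seteqP; split => w /=.
  move=> Bw [b [_ nB] e]; apply: nB; have := Bw; rewrite -e mlogK ?mat_sym// matK.
  by [].
apply: contra_notP => nB; exists (vech (mlog (S w))).
  split => //=; rewrite (le_trans (enorm_le_sum _))//; apply: ler_sum => l _.
  by rewrite mxE; exact: hc (KS w) _ _.
have [sl el] := mlogP (proj1 (KS w)); by rewrite vechK.
Qed.

Lemma measurable_chart disp (T : measurableType disp) k (lm lp : R) (m : 'rV[R]_k.+1)
    (iota : {linear 'rV[R]_k -> 'rV[R]_k.+1}) (mu : T -> 'rV[R]_k.+1) (S : T -> 'M[R]_k) :
  hyperboloid m -> linear_isometry_onto_tangent m iota -> 0 < lm ->
  measurable_fun setT (mu : T -> borel R 1 k.+1) -> measurable_fun setT (S : T -> borel R k k) ->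
  (forall w, hyperboloid (mu w)) -> (forall w, covK lm lp (S w)) ->
  measurable_fun setT ((fun w => chart m iota (mu w) (S w)) : T -> borel R 1 (k + vech_dim k)).
Proof.
move=> hm iso lm0 mmu mS hmu KS; apply: measurable_mxP => i j; rewrite ord1.
case: (split_ordP j) => l ->; last first.
  under eq_fun do rewrite /chart row_mxEr.
  exact: (measurable_entry _ _ (measurable_vech_mlog lm0 mS KS)).
under eq_fun do rewrite /chart row_mxEl (chart_coord hm iso l (hmu _)).
apply: measurable_funM.
  exact: (measurableT_comp (@measurable_Gfun R) (measurableT_comp (measurable_kbase m) mmu)).
exact: (measurableT_comp (measurable_lorentz (iota (delta_mx ord0 l))) mmu).
Qed.

End chart_measurability.

Section consistency.
Context {R : realType} {n : nat} {disp : measure_display} {Omega : measurableType disp}.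
Notation d := n.+1.
Local Notation p := (d + vech_dim d)%N.
Variables (lm lp : R) (m : 'rV[R]_d.+1) (S0 : 'M[R]_d) (iota : {linear 'rV[R]_d -> 'rV[R]_d.+1}).
Variables (P : probability Omega R) (X : nat -> Omega -> 'rV[R]_d.+1).
Variables (mu_hat : nat -> Omega -> 'rV[R]_d.+1) (Sigma_hat : nat -> Omega -> 'M[R]_d).
Hypothesis lm0 : 0 < lm.
Hypothesis lmlp : lm < lp.
Hypothesis hm : hyperboloid m.
Hypothesis intS : posdef_interior (covK lm lp) S0.
Hypothesis iso : linear_isometry_onto_tangent m iota.
Hypothesis hX : forall i w, hyperboloid (X i w).
Hypothesis iid : iid_from P X (HWN m S0).
Hypothesis hmax : measurable_maximizer X (covK lm lp) mu_hat Sigma_hat.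
Local Notation Q := (hwn S0 hm).

Let pS : posdef S0 := proj1 intS.
Definition theta_hat k w : 'rV[R]_p := chart m iota (mu_hat k w) (Sigma_hat k w).

Lemma iid_hwn : iid_from P X Q.
Proof. by move: iid; rewrite (HWN_hwn S0 hm). Qed.

Lemma measurable_obs i : measurable_fun setT (X i : Omega -> borel R 1 d.+1).
Proof. by have [h _] := iid; exact: h. Qed.

Lemma obs_indep k (A : nat -> set (borel R 1 d.+1)) : (forall i, measurable (A i)) ->
  P (\bigcap_(i < k) X i @^-1` A i) = (\prod_(i < k) Q (A i))%E.
Proof. exact: iid_initial iid_hwn k A. Qed.

Lemma weak_law_dominated g e : dominated m g -> 0 < e ->
  vanishing P (fun k => [set w | e <= `|k%:R^-1 * \sum_(i < k) g (X i w) - \int[Q]_x g x|]).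
Proof.
move=> [mg [C C0 gC]]; apply: (weak_law measurable_obs obs_indep mg).
apply: (@integrable_dominated _ _ _ Q _ (fun x => C ^+ 2 * wt m x ^+ 3)).
- exact: measurable_funX.
- by apply: integrableZ_fin; exact: integrable_wt_cube.
move=> x; rewrite ger0_norm ?sqr_ge0// -[leLHS]real_normK ?num_real//.
have w1 := wt_ge1 m x; have w0 : 0 <= wt m x by rewrite (le_trans ler01).
apply: (@le_trans _ _ ((C * wt m x) ^+ 2)); first by rewrite lerXn2r ?nnegrE// mulr_ge0.
by rewrite exprMn ler_wpM2l ?sqr_ge0// ler_weXn2l.
Qed.

(** The interior is relative to positive definite matrices, and exponentials of symmetric matrices
    are always such, so it pulls back to a ball in the logarithmic chart. *)
Lemma interior_ball : exists2 r, 0 < r & forall h : 'rV[R]_p, enorm h <= r ->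
  covK lm lp (mexp (mlog S0 + mat (rsubmx h))).
Proof.
have [_ nK] := intS; have [sB eB] := mlogP pS.
have nb : \forall b \near vech (mlog S0), posdef (mexp (mat b)) -> covK lm lp (mexp (mat b)).
  have c := @continuous_mexp_mat R d (vech (mlog S0)).
  by apply: (c [set S | posdef S -> covK lm lp S]); rewrite /= vechK// eB.
have [r [r0 h]] := enorm_ball_nbhs nb; exists r => // u ur.
have -> : mlog S0 + mat (rsubmx u) = mat (vech (mlog S0) + rsubmx u).
  by rewrite -[vech _]scale1r mat_linear scale1r vechK.
apply: h; last by apply: mexp_posdef; rewrite mat_sym.
rewrite addrC addKr (le_trans _ ur)// -[in leRHS](hsubmxK u).
rewrite /enorm ler_sqrt ?dot_ge0// -/(dot _ _) -/(dot (row_mx _ _) _) {2}/dot tr_row_mx mul_row_col mxE.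
by rewrite lerDr dot_ge0.
Qed.

Lemma covK_S0 : covK lm lp S0.
Proof.
have [r r0 h] := interior_ball; have [_ eB] := mlogP pS.
have := h 0; rewrite enorm0 => /(_ (ltW r0)); rewrite -{2}eB.
by rewrite linear0 -[mlog S0 + _](addrC) -[mlog S0]scale1r (_ : mat 0 = 0) ?add0r//;
  apply/matrixP => i j; rewrite !mxE big1// => k _; rewrite mxE.
Qed.

Lemma hat_valid k w : (0 < k)%N -> hyperboloid (mu_hat k w) /\ covK lm lp (Sigma_hat k w).
Proof. by move=> k0; have [_ _ h] := hmax k0; have [] := h w. Qed.

Lemma mu_of_hat k w : (0 < k)%N -> mu_of m iota (theta_hat k w) = mu_hat k w.
Proof. by move=> k0; have [h _] := hat_valid w k0; exact: mu_of_chart. Qed.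

Lemma Sigma_of_hat k w : (0 < k)%N -> Sigma_of (theta_hat k w) = Sigma_hat k w.
Proof. by move=> k0; have [_ [h _]] := hat_valid w k0; exact: Sigma_of_chart. Qed.

(** On E the maximiser does at least as well as the truth, which forces the empirical mean of g to
    be nonnegative; the weak law sends that mean to a negative number. *)
Lemma vanishing_contrast (E : nat -> set Omega) g : dominated m g -> \int[Q]_x g x < 0 ->
  (forall k w x, (0 < k)%N -> E k w -> hyperboloid x ->
    logdens (mu_hat k w) (Sigma_hat k w) x - logdens m S0 x <= g x) ->
  vanishing P E.
Proof.
move=> dg neg hE; have e0 : 0 < - \int[Q]_x g x by rewrite oppr_gt0.
apply: vanishing_sub (weak_law_dominated dg e0); exists 1%N => k k0 w Ew /=.
have kR : 0 < k%:R :> R by rewrite ltr0n.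
have s0 : 0 <= \sum_(i < k) g (X i w).
  have [_ _ h] := hmax k0; have [_ _ /(_ m S0 hm covK_S0)] := h w.
  rewrite /loglik -subr_ge0 -sumrB => /le_trans; apply; apply: ler_sum => i _.
  exact: hE (hX i w).
have : 0 <= k%:R^-1 * \sum_(i < k) g (X i w) by rewrite mulr_ge0// invr_ge0 ltW.
by move=> h; apply: le_trans (ler_norm _); lra.
Qed.

(** Distant mu are excluded at once by [far_cover]; the remaining parameters at distance at least e
    from the truth lie in a compact set of the chart, covered by finitely many neighbourhoods from
    [local_cover]. *)
Lemma consistency (e : R) : 0 < e ->
  vanishing P (fun k => [set w | e <= enorm (theta_hat k w - theta0 S0)]).
Proof.
move=> e0; have lp0 : 0 < lp by rewrite (lt_trans lm0).
have [r0 [g [r00 dg neg hg]]] := far_cover S0 hm lm0 lp0.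
have far : vanishing P (fun k => [set w | r0 <= rbase m (mu_hat k w)]).
  apply: (vanishing_contrast dg neg) => k w x k0 /= h hx; have [h1 h2] := hat_valid w k0.
  exact: hg.
have [c hc] := covK_mlog_bound d lp lm0.
(* Bounds the chart coordinates of the estimator whenever its mean is within r0 of m: r0 for the
   mean part, the sum for the logarithm of the covariance. *)
pose M := r0 + \sum_(l < vech_dim d) c + enorm (theta0 S0).
pose K := [set t : 'rV[R]_p | enorm (t - 0) <= M] `&` [set t | e <= enorm (t - theta0 S0)].
have cont : continuous (fun t : 'rV[R]_p => enorm (t - theta0 S0)).
  move=> t; apply: (@continuous_comp _ _ _ (fun y : 'rV[R]_p => y - theta0 S0) (@enorm R p)); last exact: continuous_enorm.
  by apply: continuousB; [exact: cvg_id|exact: cst_continuous].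
have cK : compact K.
  apply: compact_closedI.
    rewrite (_ : [set t | _] = [set t : 'rV[R]_p | enorm t <= M]); first exact: compact_enorm_ball.
    by apply/seteqP; split => t /=; rewrite subr0.
  rewrite (_ : [set t | _] = (fun t : 'rV[R]_p => enorm (t - theta0 S0)) @^-1` [set y | e <= y]) //.
  by apply: closed_comp => [t _|]; [exact: cont|exact: closed_ge].
have near : vanishing P (fun k => [set w | (0 < k)%N /\ K (theta_hat k w)]).
  pose Pr (U : set 'rV[R]_p) := vanishing P (fun k => [set w | (0 < k)%N /\ U (theta_hat k w)]).
  apply: (compact_induction (Pr := Pr) cK).
  - by apply: vanishing_sub (vanishing0 P); exists 0%N => k _ w [].
  - move=> A B hA hB; apply: vanishing_sub (vanishingU hA hB); exists 0%N => k _ w /= [k0 [?|?]]; [left|right]; split => //.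
  - by move=> A B AB hB; apply: vanishing_sub hB; exists 0%N => k _ w [k0 /AB].
  move=> t1 [_ /= t1e].
  have ne : t1 <> theta0 S0 by move=> E; move: t1e; rewrite E subrr enorm0 leNgt e0.
  have [U nU [f [df nf hf]]] := local_cover hm pS iso ne; exists U => //.
  apply: (vanishing_contrast df nf) => k w x k0 /= [_ Uh] hx.
  by have := hf _ x Uh hx; rewrite mu_of_hat// Sigma_of_hat.
apply: vanishing_sub (vanishingU far near); exists 1%N => k k0 w /= ew.
have [hr|hr] := leP r0 (rbase m (mu_hat k w)); [by left|right; split => //; split => //=].
have [h1 h2] := hat_valid w k0.
rewrite subr0 /M -[leLHS]addr0 lerD ?enorm_ge0// /theta_hat /chart (le_trans (enorm_row_mx _ _))// lerD//.
  by rewrite (enorm_chart hm iso h1) ltW.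
rewrite (le_trans (enorm_le_sum _))//; apply: ler_sum => l _.
by rewrite mxE; exact: hc h2 _ _.
Qed.

End consistency.

(** * Asymptotic normality *)

Section quadratic_forms.
Context {R : realType}.

(** Writing v as (v A) A^-1 with A the square root bounds |v| by a constant times |v A|, whose
    square is the form. *)
Lemma posdef_coercive k (V : 'M[R]_k) : posdef V -> exists2 l, 0 < l & forall v, l * dot v v <= quad V v.
Proof.
move=> pV; have [pA AA] := msqrtP pV; set A := msqrt V in pA AA.
have [sA _] := pA; have Au := posdef_unit pA.
pose C := \sum_i enorm (row i (invmx A)^T).
have C0 : 0 <= C by apply: sumr_ge0 => i _; exact: enorm_ge0.
have qE v : quad V v = enorm (v *m A) ^+ 2 by rewrite enorm_sqr quadE -AA mulmxA dot_mulmxl sA.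
have b v : enorm v <= C * enorm (v *m A).
  rewrite -{1}(mulmxK Au v) (le_trans (enorm_le_sum _))// /C mulr_suml; apply: ler_sum => i _.
  have -> : (v *m A *m invmx A) ord0 i = dot (v *m A) (row i (invmx A)^T).
    by rewrite dotE mxE; apply: eq_bigr => j _; rewrite !mxE.
  by rewrite mulrC ler_dot.
exists (1 + C ^+ 2)^-1; first by rewrite invr_gt0 ltr_pwDl// sqr_ge0.
move=> v; rewrite ler_pdivrMl ?ltr_pwDl ?sqr_ge0// -enorm_sqr qE.
have v0 := enorm_ge0 v; have a0 := enorm_ge0 (v *m A).
have : enorm v ^+ 2 <= (C * enorm (v *m A)) ^+ 2 by rewrite lerXn2r ?nnegrE// mulr_ge0.
by rewrite exprMn; have := sqr_ge0 (enorm (v *m A)); nra.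
Qed.

Lemma quad_sum k (I : Type) (s : seq I) (M : I -> 'M[R]_k) v :
  quad (\sum_(i <- s) M i) v = \sum_(i <- s) quad (M i) v.
Proof. by rewrite /quad mulmx_sumr mulmx_suml summxE. Qed.

Lemma dot_suml k (I : Type) (s : seq I) (u : I -> 'rV[R]_k) v :
  dot (\sum_(i <- s) u i) v = \sum_(i <- s) dot (u i) v.
Proof. by rewrite /dot mulmx_suml summxE. Qed.

Lemma quadZv k (a : R) (M : 'M[R]_k) v : quad M (a *: v) = a ^+ 2 * quad M v.
Proof. by rewrite !quadE -scalemxAl dotZl dotZr mulrA. Qed.

Lemma half_split (a e c : R) : 0 <= e -> e * (2 * (a + 1)) = c -> a * e <= c / 2.
Proof. by move=> e0 <-; lra. Qed.

Lemma le_sub_common (a b a' b' c : R) : a = a' - c -> b = b' - c -> a' <= b' -> a <= b.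
Proof. by move=> -> ->; rewrite lerD2r. Qed.

Lemma norm_shift (s b q c v : R) : `|s - (b - c * v)| <= `|q - - c * v| + `|s - (b + q)|.
Proof. by rewrite (_ : s - _ = (q - - c * v) + (s - (b + q))) ?ler_normD//; ring. Qed.

Lemma half_mul (a h c : R) : h * (2 * a) <= c -> a * h <= c / 2.
Proof. lra. Qed.

(* u maximises D.V.u - u.V.u/2 up to kappa |u|^2, hence is close to D. *)
Lemma quadratic_argmax k (V : 'M[R]_k) (D u : 'rV[R]_k) (l kappa A e M1 M2 : R) : V^T = V ->
  0 < l -> (forall v, l * dot v v <= quad V v) -> 0 <= kappa -> kappa <= l / 8 ->
  12 * kappa * A ^+ 2 <= l * e ^+ 2 -> 0 <= e -> enorm D <= A ->
  `|M1 - (dot (D *m V) u - 2^-1 * quad V u)| <= kappa * enorm u ^+ 2 ->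
  `|M2 - (dot (D *m V) D - 2^-1 * quad V D)| <= kappa * enorm D ^+ 2 ->
  M2 <= M1 -> enorm (u - D) <= e.
Proof.
move=> sV l0 hl k0 k1 k2 e0 DA b1 b2 M12.
have D0 := enorm_ge0 D; have u0 := enorm_ge0 u; have s0 := enorm_ge0 (u - D).
have VuD : dot (u *m V) D = dot (D *m V) u by rewrite dot_mulmxl sV dotC.
(* Completing the square: the quadratic at u is (V(D) - V(u - D)) / 2, so M2 <= M1 bounds V(u - D)
   by the two errors. *)
have qB : quad V (u - D) = quad V u - 2 * dot (D *m V) u + quad V D.
  by rewrite !quadE mulmxBl !dotDl !dotDr !dotNl !dotNr VuD; ring.
have tri : enorm u ^+ 2 <= 2 * enorm (u - D) ^+ 2 + 2 * enorm D ^+ 2.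
  have : enorm u <= enorm (u - D) + enorm D by rewrite -{1}(subrK D u) enormD.
  by move=> t; have := sqr_ge0 (enorm (u - D) - enorm D); nra.
have h := hl (u - D); rewrite -enorm_sqr qB in h.
have qD : dot (D *m V) D = quad V D by rewrite quadE.
rewrite qD in b2.
have DA2 : enorm D ^+ 2 <= A ^+ 2 by rewrite lerXn2r ?nnegrE// (le_trans D0).
suff : l * enorm (u - D) ^+ 2 <= l * e ^+ 2 by rewrite ler_pM2l// ler_pXn2r// nnegrE.
have s2 := sqr_ge0 (enorm (u - D)); have d2 := sqr_ge0 (enorm D).
move: b1 b2 tri DA2 s2 d2; rewrite !ler_norml => /andP[a1 a2] /andP[a3 a4].
move: (dot _ _) (quad V u) (quad V D) (enorm (u - D) ^+ 2) (enorm D ^+ 2) (enorm u ^+ 2) (A ^+ 2) (e ^+ 2) a1 a2 a3 a4 k2 h.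
clear -l0 k0 k1 M12 => a b c s D2 u2 A2 e2 a1 a2 a3 a4 k2 h tri DA2 s2 d2.
have h1 := ler_wpM2l k0 tri; have h2 := ler_wpM2l k0 DA2; have h3 := ler_wpM2r s2 k1.
lra.
Qed.

End quadratic_forms.

(** * Local quadratic expansion and linearisation of the estimator *)

Section expansion.
Context {R : realType} {n : nat} {disp : measure_display} {Omega : measurableType disp}.
Notation d := n.+1.
Local Notation p := (d + vech_dim d)%N.
Variables (lm lp : R) (m : 'rV[R]_d.+1) (S0 : 'M[R]_d) (iota : {linear 'rV[R]_d -> 'rV[R]_d.+1}).
Variables (P : probability Omega R) (X : nat -> Omega -> 'rV[R]_d.+1).
Variables (mu_hat : nat -> Omega -> 'rV[R]_d.+1) (Sigma_hat : nat -> Omega -> 'M[R]_d).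
Hypothesis lm0 : 0 < lm.
Hypothesis lmlp : lm < lp.
Hypothesis hm : hyperboloid m.
Hypothesis intS : posdef_interior (covK lm lp) S0.
Hypothesis iso : linear_isometry_onto_tangent m iota.
Hypothesis hX : forall i w, hyperboloid (X i w).
Hypothesis iid : iid_from P X (HWN m S0).
Hypothesis hmax : measurable_maximizer X (covK lm lp) mu_hat Sigma_hat.
Local Notation Q := (hwn S0 hm).
Local Notation V := (fisher m iota (theta0 S0)).
Hypothesis pV : posdef V.
Variables (f0 : borel R 1 d.+1 -> R) (f1 : borel R 1 d.+1 -> 'rV[R]_p) (f2 : borel R 1 d.+1 -> 'M[R]_p).
Hypothesis J : jet (T := borel R 1 d.+1) (@hyperboloid R d) (jet_weight m) (ld m S0 iota) f0 f1 f2.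

Let pS : posdef S0 := proj1 intS.
Local Notation that := (theta_hat m iota mu_hat Sigma_hat).
Local Notation ratio := (dens_ratio m S0 iota).
Let q (x : borel R 1 d.+1) : 'M[R]_p := f2 (proj_hyp x).
Let psi (x : borel R 1 d.+1) : 'rV[R]_p := scoreQ f1 x *m (invmx V)^T.
Local Notation L := (root_sum (X : nat -> Omega -> borel R 1 d.+1) psi).

Lemma root_sum_score k w :
  ((Num.sqrt k%:R)^-1 *: \sum_(i < k) score m iota (theta0 S0) (X i w)) *m (invmx V)^T = L k w.
Proof.
rewrite /root_sum -scalemxAl mulmx_suml; congr (_ *: _); apply: eq_bigr => i _.
by rewrite (score_jet pS J (hX i w)) /psi /scoreQ proj_hypK.
Qed.

Lemma moments_influence : moments Q psi (invmx V).
Proof. by have := moments_psi hm pS iso J pV. Qed.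

Lemma dominated_hessian i j : dominated m (fun x => q x i j).
Proof.
have [_ _ m2 [C [rho [C0 rho0 H]]]] := ratio_jet J; split.
  exact: measurable_entry.
exists C; first exact: ltW.
by move=> x; have [_ _ _ b _] := H x I; exact: le_trans (mnorm_entry _ _ _) b.
Qed.

Let qm : 'M[R]_p := \matrix_(i, j) \int[Q]_x q x i j.

Lemma mean_hessian u : quad qm u = - 2^-1 * quad V u.
Proof.
have [_ _ _ h] := score_moments hm pS iso J; have [_ _ _ hV] := moments_score hm pS iso J.
have e : \int[Q]_x quad (f2 (proj_hyp x)) u = - 2^-1 * quad V u by rewrite (h u) (hV u).
rewrite -e quadE dotE.
have qE (M : 'M[R]_p) : quad M u = \sum_j \sum_i (u ord0 i * u ord0 j) * M i j.
  rewrite quadE dotE; apply: eq_bigr => j _; rewrite mxE mulr_suml; apply: eq_bigr => i _.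
  by rewrite mulrAC.
have idom i j : Q.-integrable setT (EFin \o (fun x => q x i j)) by exact/integrable_dom/dominated_hessian.
have -> : \int[Q]_x quad (f2 (proj_hyp x)) u = \int[Q]_x (\sum_j \sum_i (u ord0 i * u ord0 j) * q x i j).
  by apply: eq_Rintegral => x _; rewrite qE.
rewrite Rintegral_sum_fin; last by move=> j; apply: integrable_sum_fin => i; exact: integrableZ_fin.
apply: eq_bigr => j _; rewrite Rintegral_sum_fin; last by move=> i; exact: integrableZ_fin.
rewrite mxE mulr_suml; apply: eq_bigr => i _.
by rewrite RintegralZl_fin// /qm mxE mulrAC.
Qed.

(** Sum of the jets over the sample. The linear terms give L V u exactly; the empirical Hessian is
    replaced by its mean - V / 2 with entrywise error e; the cubic remainder is the average weight
    times |h| |u|^2. *)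
Lemma loglik_expansion : exists C rho, [/\ 0 < C, 0 < rho &
  forall k w (h : 'rV[R]_p) e, (0 < k)%N -> enorm h <= rho ->
    (forall i j, `|k%:R^-1 * \sum_(l < k) q (X l w) i j - \int[Q]_x q x i j| <= e) ->
    let u := Num.sqrt k%:R *: h in
    `|\sum_(l < k) ratio h (X l w) - (dot (L k w *m V) u - 2^-1 * quad V u)| <=
      (p%:R ^+ 2 * e + C * (k%:R^-1 * \sum_(l < k) wt m (X l w)) * enorm h) * enorm u ^+ 2].
Proof.
have [_ _ _ [C [rho [C0 rho0 H]]]] := ratio_jet J.
exists C, rho; split; [exact: C0|exact: rho0|move=> k w h e k0 hr he; cbv zeta; set u := Num.sqrt _ *: h].
have kR : 0 < k%:R :> R by rewrite ltr0n.
have sk : 0 < Num.sqrt k%:R :> R by rewrite sqrtr_gt0.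
have u2 : enorm u ^+ 2 = k%:R * enorm h ^+ 2.
  by rewrite /u enormZ exprMn ger0_norm ?sqrtr_ge0// sqr_sqrtr// ltW.
have lin : dot (L k w *m V) u = \sum_(l < k) dot (scoreQ f1 (X l w)) h.
  have [sV _] := pV.
  have -> : L k w *m V = (Num.sqrt k%:R)^-1 *: \sum_(l < k) scoreQ f1 (X l w).
    rewrite /root_sum -scalemxAl mulmx_suml; congr (_ *: _); apply: eq_bigr => l _.
    by rewrite /psi trmx_inv sV mulmxKV// posdef_unit.
  by rewrite dotZl /u dotZr mulrA mulVf ?gt_eqF// mul1r dot_suml.
pose qa : 'M[R]_p := k%:R^-1 *: \sum_(l < k) q (X l w).
have qu : \sum_(l < k) quad (q (X l w)) h = quad qa u.
  rewrite /qa quadZl quad_sum /u; under [in RHS]eq_bigr do rewrite quadZv.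
  by rewrite -mulr_sumr sqr_sqrtr ?ltW// mulKf// gt_eqF.
have rem : `|\sum_(l < k) ratio h (X l w) - (dot (L k w *m V) u + quad qa u)| <=
    C * (k%:R^-1 * \sum_(l < k) wt m (X l w)) * enorm h * enorm u ^+ 2.
  rewrite lin -qu -big_split /= -sumrB (le_trans (ler_norm_sum _ _ _))//.
  rewrite u2 (_ : _ * (k%:R * _) = \sum_(l < k) C * wt m (X l w) * enorm h ^+ 3).
    apply: ler_sum => l _; have [_ _ _ _ b] := H (X l w) I.
    by have := b h hr; rewrite add0r.
  rewrite -mulr_suml -mulr_sumr; field.
  by rewrite gt_eqF.
have qd : `|quad qa u - quad qm u| <= p%:R ^+ 2 * e * enorm u ^+ 2.
  rewrite -quadB (le_trans (quad_bound _ _))// ler_wpM2r ?sqr_ge0//.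
  have -> : p%:R ^+ 2 * e = \sum_(i < p) \sum_(j < p) e.
    by rewrite !sumr_const !card_ord -mulrnA -[RHS]mulr_natl natrM expr2.
  apply: ler_sum => i _; apply: ler_sum => j _.
  by rewrite /qa /qm !mxE summxE; exact: he.
rewrite mean_hessian in qd; rewrite mulrDl.
have := lerD qd rem; apply: le_trans.
exact: norm_shift.
Qed.

Lemma mle_ratio k w : (0 < k)%N -> forall h : 'rV[R]_p, covK lm lp (mexp (mlog S0 + mat (rsubmx h))) ->
  \sum_(l < k) ratio h (X l w) <= \sum_(l < k) ratio (that k w - theta0 S0) (X l w).
Proof.
move=> k0 h Kh; have [_ _ /(_ w)[_ _ hw]] := hmax k0.
have E (u : 'rV[R]_p) : \sum_(l < k) ratio u (X l w) =
    \sum_(l < k) ld m S0 iota u (X l w) - \sum_(l < k) ld m S0 iota 0 (X l w).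
  by rewrite -sumrB; apply: eq_bigr => l _; rewrite /dens_ratio (proj_hypK (hX l w)).
have e2 : \sum_(l < k) ld m S0 iota (that k w - theta0 S0) (X l w) = loglik k (X ^~ w) (mu_hat k w) (Sigma_hat k w).
  apply: eq_bigr => l _; rewrite /ld -(mu_of_theta0 m S0) -(Sigma_of_theta0 pS) (addrC (theta0 S0)) subrK.
  by rewrite (mu_of_hat hm iso hmax w k0) (Sigma_of_hat m iota hmax w k0).
apply: (le_sub_common (E h) (E _)); apply: (le_trans (hw _ _ (hyperboloid_muh hm iso h) Kh)).
by rewrite e2.
Qed.

(** Outside events of small probability L is bounded, the estimator is close to the truth and the
    empirical averages are near their means; the expansion then holds both at the estimator and at
    theta0 + L / sqrt k, and [quadratic_argmax] concludes. *)
Lemma linearization (e : R) : 0 < e -> vanishing P (fun k =>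
  [set w | e < enorm (Num.sqrt k%:R *: (that k w - theta0 S0) - L k w)]).
Proof.
move=> e0 eps eps0.
have [A A0 tA] := tight_root_sum (measurable_obs iid) (obs_indep hm iid) moments_influence (divr_gt0 eps0 (ltr0n R 2)).
have [l l0 hl] := posdef_coercive pV.
have [C [rho [C0 rho0 ex]]] := loglik_expansion.
have [r r0 hK] := interior_ball intS.
(* The relative error that [quadratic_argmax] tolerates for accuracy e when |L| <= A. *)
pose kappa := Num.min (l / 8) (l * e ^+ 2 / (12 * A ^+ 2)).
have A2 : 0 < 12 * A ^+ 2 by rewrite mulr_gt0// exprn_gt0.
have kap0 : 0 < kappa by rewrite lt_min !divr_gt0// mulr_gt0// exprn_gt0.
pose Mw := \int[Q]_x wt m x + 1.
have Mw0 : 0 < Mw.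
  rewrite ltr_wpDl//; apply: Rintegral_ge0 => x _; rewrite (le_trans ler01)// wt_ge1.
  by [].
have pp0 : 0 < 2 * (p%:R ^+ 2 + 1) :> R by rewrite mulr_gt0// ltr_wpDl// sqr_ge0.
pose e' := kappa / (2 * (p%:R ^+ 2 + 1)); have e'0 : 0 < e' by rewrite divr_gt0.
have CM0 : 0 < 2 * (C * Mw) by rewrite mulr_gt0// mulr_gt0.
(* Within del the expansion is valid, the competitor stays in the constraint set, and the cubic
   remainder uses half of kappa; e' uses the other half. *)
pose del := Num.min (Num.min rho r) (kappa / (2 * (C * Mw))).
have del0 : 0 < del by rewrite !lt_min rho0 r0 divr_gt0.
have vc := consistency lm0 lmlp hm intS iso hX iid hmax del0.
have vw := weak_law_dominated hm iid (dominated_wt hm hm) ltr01.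
have vq := vanishing_bigcup (fun ij : 'I_p * 'I_p => weak_law_dominated hm iid (dominated_hessian ij.1 ij.2) e'0).
have vall := vanishingU vc (vanishingU vw vq).
rewrite (splitr eps); have := small_coverU tA (vall _ (divr_gt0 eps0 (ltr0n R 2))).
(* From this k on, A / sqrt k <= del, so the competitor theta0 + L / sqrt k lies in the ball. *)
apply: small_cover_sub; exists (Num.truncn ((A / del) ^+ 2)).+1 => k kN w /= ew.
have k0 : (0 < k)%N by exact: leq_trans kN.
have kR : 0 < k%:R :> R by rewrite ltr0n.
have sk : 0 < Num.sqrt k%:R :> R by rewrite sqrtr_gt0.
have Ad : A <= del * Num.sqrt k%:R.
  rewrite mulrC -ler_pdivrMr// -(@ler_pXn2r _ 2) ?nnegrE ?divr_ge0 ?sqrtr_ge0 ?(ltW A0) ?(ltW del0)//.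
  by rewrite sqr_sqrtr ?(ltW kR)// (le_trans (ltW (truncnS_gt _)))// ler_nat.
have [AL|LA] := leP A (enorm (L k w)); [by left|right].
have [dh|hd] := leP del (enorm (that k w - theta0 S0)); [by left|right].
have [w1|w1] := leP 1 `|k%:R^-1 * \sum_(i < k) wt m (X i w) - \int[Q]_x wt m x|; [by left|right].
apply: contrapT => nq.
have hq i j : `|k%:R^-1 * \sum_(l < k) q (X l w) i j - \int[Q]_x q x i j| <= e'.
  by have [h|/ltW//] := leP e' `|k%:R^-1 * \sum_(l < k) q (X l w) i j - \int[Q]_x q x i j|; case: nq; exists (i, j).
have bw : 0 <= k%:R^-1 * \sum_(i < k) wt m (X i w) <= Mw.
  apply/andP; split; last by move: w1; rewrite /Mw ltr_norml => /andP[_]; rewrite ltrBlDl => /ltW.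
  by rewrite mulr_ge0 ?invr_ge0 ?(ltW kR)// sumr_ge0// => i _; rewrite (le_trans ler01)// wt_ge1.
have small (h : 'rV[R]_p) : enorm h <= del ->
    `|\sum_(l < k) ratio h (X l w) - (dot (L k w *m V) (Num.sqrt k%:R *: h) - 2^-1 * quad V (Num.sqrt k%:R *: h))|
     <= kappa * enorm (Num.sqrt k%:R *: h) ^+ 2.
  rewrite !le_min => /andP[/andP[h1 _] h2].
  apply: (le_trans (ex k w h e' k0 h1 hq)); rewrite ler_wpM2r ?sqr_ge0// (splitr kappa).
  move/andP: bw => [bw1 bw2]; have h0 := enorm_ge0 h; apply: lerD.
    have : e' * (2 * (p%:R ^+ 2 + 1)) = kappa by rewrite divfK// gt_eqF.
    by move=> E; apply: (half_split (ltW e'0)); rewrite E.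
  apply: (@le_trans _ _ (C * Mw * enorm h)).
    by rewrite ler_wpM2r// ler_wpM2l// ltW.
  by move: h2; rewrite ler_pdivlMr// => h2; exact: half_mul.
have h2small : enorm ((Num.sqrt k%:R)^-1 *: L k w) <= del.
  rewrite enormZ ger0_norm ?invr_ge0 ?sqrtr_ge0// ler_pdivrMl// mulrC.
  exact: le_trans (ltW LA) Ad.
have b1 := small _ (ltW hd); have b2 := small _ h2small.
rewrite (scalerA (Num.sqrt _)) mulfV ?gt_eqF// scale1r in b2.
have h2r : enorm ((Num.sqrt k%:R)^-1 *: L k w) <= r.
  by rewrite (le_trans h2small)// !ge_min lexx orbT.
have M12 := mle_ratio w k0 (hK _ h2r).
have [sV _] := pV.
have kl : kappa <= l / 8 by rewrite ge_min lexx.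
have kA : 12 * kappa * A ^+ 2 <= l * e ^+ 2.
  by rewrite mulrAC mulrC -ler_pdivlMr// ge_min lexx orbT.
have := quadratic_argmax sV l0 hl (ltW kap0) kl kA (ltW e0) (ltW LA) b1 b2 M12.
by rewrite leNgt ew.
Qed.

End expansion.

Lemma entry_scale_sub {R : realType} k l a (u v : 'M[R]_(k, l)) i j :
  (a *: (u - v)) i j = a * (u i j - v i j).
Proof. by rewrite !mxE. Qed.

Lemma entry_sub {R : realType} k l (u v : 'M[R]_(k, l)) i j : (u - v) i j = u i j - v i j.
Proof. by rewrite !mxE. Qed.

(** * Negligible perturbations do not change the limit law *)

Section slutsky.
Context {R : realType} {d1 : measure_display} {Omega : measurableType d1} {p : nat}.
Variable P : probability Omega R.

Lemma integrable_bounded disp (T : measurableType disp) (mu : probability T R) (f : T -> R) K :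
  measurable_fun setT f -> (forall x, `|f x| <= K) -> mu.-integrable setT (EFin \o f).
Proof. by move=> mf; apply: integrable_dominated => //; exact: integrable_cst_fin. Qed.

Variables Y L : nat -> Omega -> 'rV[R]_p.
Hypothesis mY : forall k, measurable_fun setT (Y k : Omega -> borel R 1 p).
Hypothesis mL : forall k, measurable_fun setT (L k : Omega -> borel R 1 p).
Hypothesis YL : forall e, 0 < e -> vanishing P (fun k => [set w | e < enorm (Y k w - L k w)]).
Hypothesis tight : forall e : R, 0 < e -> exists2 A : R, 0 < A & small_cover P (fun k => [set w | A <= enorm (L k w)]) e.

(** Tightness of L confines it to a ball, where f has a uniform modulus of continuity; closeness of
    Y and L then transfers to f off a small event. *)
Lemma slutsky (f : 'rV[R]_p -> R) (K eps : R) : continuous f -> (forall x, `|f x| <= K) -> 0 < eps ->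
  exists N, forall k, (N <= k)%N -> `|\int[P]_w f (Y k w) - \int[P]_w f (L k w)| <= eps.
Proof.
move=> cf fK eps0; have K0 : 0 <= K by exact: le_trans (normr_ge0 _) (fK 0).
have mf : measurable_fun setT (f : borel R 1 p -> R) by exact: measurable_continuousR.
have K1 : 0 < 8 * (K + 1) by rewrite mulr_gt0// ltr_wpDl.
(* The exceptional event has probability at most 2 e2, and there the values of f differ by at most 2
   K, for a total of at most eps / 2. *)
pose e2 := eps / (8 * (K + 1)); have e20 : 0 < e2 by rewrite divr_gt0.
have [A A0 tA] := tight e20.
have [del [del0 uc]] := uniformly_continuous_ball A cf (divr_gt0 eps0 (ltr0n R 2)).
have [N hN] := small_coverU tA (YL del0 e20); exists N => k /hN[B [mB sB pB]].
have mfY : measurable_fun setT (fun w => f (Y k w)) by exact: (measurableT_comp mf (mY k)).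
have mfL : measurable_fun setT (fun w => f (L k w)) by exact: (measurableT_comp mf (mL k)).
have iY := integrable_bounded P mfY (fun w => fK (Y k w)).
have iL := integrable_bounded P mfL (fun w => fK (L k w)).
have iB : P.-integrable setT (EFin \o (\1_B : Omega -> R)).
  by apply: (@integrable_bounded _ _ P _ 1) => // w; rewrite indicE; case: (_ \in _); rewrite ?normr1 ?normr0.
have -> : \int[P]_w f (Y k w) - \int[P]_w f (L k w) = \int[P]_w (f (Y k w) + (-1) * f (L k w)).
  by rewrite RintegralD_fin//; [rewrite RintegralZl_fin// mulN1r|exact: integrableZ_fin].
apply: (@le_trans _ _ (\int[P]_w (eps / 2 + 2 * K * \1_B w))).
  apply: Rintegral_norm_le.
  - apply: measurable_funD => //; apply: measurable_funM => //; exact: measurable_cst.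
  - by apply: integrableD_fin; [exact: integrable_cst_fin|exact: integrableZ_fin].
  move=> w; rewrite mulN1r indicE.
  have [wB|wB] := boolP (w \in B).
    rewrite mulr1; have := fK (Y k w); have := fK (L k w); rewrite !ler_norml => /andP[a1 a2] /andP[a3 a4].
    by apply/andP; split; lra.
  rewrite mulr0 addr0 distrC; move/negP: wB => wB.
  have [AL|LA] := leP A (enorm (L k w)); first by case: wB; rewrite inE; apply: sB; left.
  have [le|le] := ltP del (enorm (Y k w - L k w)); first by case: wB; rewrite inE; apply: sB; right.
  by apply: uc => //; exact: ltW.
rewrite RintegralD_fin; [|exact: integrable_cst_fin|exact: integrableZ_fin].
rewrite Rintegral_cst_prob RintegralZl_fin// /Rintegral integral_indic// setIT.
have pB' : fine (P B) <= e2 + e2 by rewrite -lee_fin fineK ?fin_num_measure.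
have : e2 * (8 * (K + 1)) = eps by rewrite divfK// gt_eqF.
have := ler_wpM2l K0 pB'.
by move: (fine _) => b h E; nra.
Qed.

End slutsky.

Theorem theorem5p1 (R : realType) (d : nat) (lm lp : R)
  (mu0 : 'rV[R]_d.+1) (Sigma0 : 'M[R]_d)
  (iota : {linear 'rV[R]_d -> 'rV[R]_d.+1})
  (disp : measure_display) (Omega : measurableType disp)
  (P : probability Omega R)
  (X : nat -> Omega -> 'rV[R]_d.+1)
  (mu_hat : nat -> Omega -> 'rV[R]_d.+1) (Sigma_hat : nat -> Omega -> 'M[R]_d) :
  let theta0 : 'rV[R]_(d + vech_dim d) := row_mx 0 (vech (mlog Sigma0)) in
  let I0 := fisher mu0 iota theta0 in
  let theta_hat n w := chart mu0 iota (mu_hat n w) (Sigma_hat n w) in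
  let Z n w := Num.sqrt n%:R *: (theta_hat n w - theta0) in
  let L n w := ((Num.sqrt n%:R)^-1 *: \sum_(i < n) score mu0 iota theta0 (X i w))
               *m (invmx I0)^T in
  (2 <= d)%N -> 0 < lm -> lm < lp ->
  hyperboloid mu0 -> posdef_interior (covK lm lp) Sigma0 ->
  linear_isometry_onto_tangent mu0 iota ->
  (forall i w, hyperboloid (X i w)) ->
  iid_from P X (HWN mu0 Sigma0) ->
  posdef I0 ->
  measurable_maximizer X (covK lm lp) mu_hat Sigma_hat ->
  o_p1 P (fun n w => Z n w - L n w) /\
  cvg_in_distribution P Z (normal_law (invmx I0)).
Proof.
case: d mu0 Sigma0 iota X mu_hat Sigma_hat => [|n] m S0 iota X mu_hat Sigma_hat th I0 that Z L d2 lm0 lmlp hm intS iso hX iid pV hmax; first by [].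
have pS : posdef S0 := proj1 intS.
have [f0 [f1 [f2 J0]]] := has_jet_logdens hm iso (symB0 pS).
have J : jet (T := borel R 1 n.+2) (@hyperboloid R n.+1) (jet_weight m) (ld m S0 iota) f0 f1 f2 := J0.
set p := (n.+1 + vech_dim n.+1)%N in th I0 that Z L pV *.
pose psi (x : borel R 1 n.+2) : 'rV[R]_p := scoreQ f1 x *m (invmx I0)^T.
have LE k : L k = root_sum (X : nat -> Omega -> borel R 1 n.+2) psi k.
  by apply/funext => w; exact: (root_sum_score intS hX J).
have mom : moments (hwn S0 hm) psi (invmx I0) := moments_influence hm intS iso pV J.
have mX := measurable_obs iid; have ind := obs_indep hm iid.
have mL k : measurable_fun setT (L k : Omega -> borel R 1 p).
  by rewrite LE; exact: measurable_root_sum mX mom k.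
have mZ k : measurable_fun setT (Z k : Omega -> borel R 1 p).
  (* The maximiser is constrained only for positive sample sizes; at 0 the factor sqrt 0 makes Z
     constant. *)
  case: k => [|k].
    rewrite (_ : Z 0%N = cst 0); first exact: measurable_cst.
    by apply/funext => w; rewrite /Z sqrtr0 scale0r.
  have [mmu mS hw] := hmax k.+1 isT.
  have mt : measurable_fun setT (that k.+1 : Omega -> borel R 1 p).
    by apply: (measurable_chart (lp := lp) hm iso lm0 mmu mS) => w; have [? ? _] := hw w.
  apply: measurable_mxP => i j.
  have -> : (fun w => Z k.+1 w i j) = fun w => Num.sqrt k.+1%:R * (that k.+1 w i j - th i j).
    by apply/funext => w; exact: entry_scale_sub.
  apply: measurable_funM; first exact: measurable_cst.
  by apply: measurable_funB; [exact: measurable_entry|exact: measurable_cst].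
have lin e : 0 < e -> vanishing P (fun k => [set w | e < enorm (Z k w - L k w)]).
  move=> e0; have := linearization lm0 lmlp hm intS iso hX iid hmax pV J e0.
  by apply: vanishing_sub; exists 0%N => k _ w /=; rewrite LE.
have mZL k : measurable_fun setT ((fun w => Z k w - L k w) : Omega -> borel R 1 p).
  apply: measurable_mxP => i j; 
  have -> : (fun w => (Z k w - L k w) i j) = fun w => Z k w i j - L k w i j.
    by apply/funext => w; exact: entry_sub.
  by apply: measurable_funB; exact: measurable_entry.
split.
  split=> // e e0; apply: (vanishing_cvg _ (lin e e0)) => k.
  have := measurable_fun_le measurableT (measurableT_comp (@measurable_enorm R p) (mZL k)) (measurable_cst e).
  rewrite setTI => /measurableC; congr (measurable _).
  by apply/seteqP; split => w /=; [move/negP; rewrite -ltNge|move=> ew; apply/negP; rewrite -ltNge].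
split=> // f cf [K fK].
have mf : measurable_fun setT (f : borel R 1 p -> R) by exact: measurable_continuousR.
pose g (t : p.-tuple (measurableTypeR R)) : borel R 1 p := tuple_row t *m msqrt (invmx I0).
have mg : measurable_fun setT g.
  by apply: measurable_mulmx; [exact: measurable_tuple_row|exact: measurable_cstmx].
pose G : {mfun p.-tuple (measurableTypeR R) >-> borel R 1 p} := mfun_Sub (mem_set mg).
have mfg : measurable_fun setT (fun t => f (g t)) by exact: (measurableT_comp mf mg).
have ifg := integrable_bounded (gauss p) mfg (fun t => fK (g t)).
have -> : normal_law (invmx I0) = distribution (gauss p) G :> (set _ -> \bar R) by [].
rewrite integral_distribution//; last exact/measurable_EFinP.
rewrite -(fineK (integrable_fin_num measurableT ifg)) -[fine _]/(\int[gauss p]_t f (g t)).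
have mfY k : measurable_fun setT (fun w => f (Z k w)) by exact: (measurableT_comp mf (mZ k)).
have mfL k : measurable_fun setT (fun w => f (L k w)) by exact: (measurableT_comp mf (mL k)).
have iY k := integrable_bounded P (mfY k) (fun w => fK (Z k w)).
have iL k := integrable_bounded P (mfL k) (fun w => fK (L k w)).
apply/fine_cvgP; split.
  by near=> k; exact: (integrable_fin_num measurableT (iY k)).
apply/cvgrPdist_le => e e0.
have e2 : 0 < e / 2 by rewrite divr_gt0.
have tL e' : 0 < e' -> exists2 A : R, 0 < A & small_cover P (fun k => [set w | A <= enorm (L k w)]) e'.
  move=> e'0; have [A A0 h] := tight_root_sum mX ind mom e'0; exists A => //.
  by apply: small_cover_sub h; exists 0%N => k _ w /=; rewrite LE.
have [N1 h1] := slutsky mZ mL lin tL cf fK e2.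
(* The central limit theorem was proved for nonnegative test functions; the shift by K cancels in
   the difference of the two integrals. *)
pose F x := f x + K.
have cF : continuous F by move=> x; apply: (@continuousD _ _ _ f (cst K)); [exact: cf|exact: cst_continuous].
have FK x : 0 <= F x <= 2 * K by have := fK x; rewrite ler_norml /F => /andP[a b]; apply/andP; split; lra.
have [N2 h2] := clt_expectation mX ind (posdef_inv pV) mom cF FK e2.
near=> k.
have k1 : (N1 <= k)%N by near: k; exact: nbhs_infty_ge.
have k2 : (N2 <= k)%N by near: k; exact: nbhs_infty_ge.
have := h2 k k2.
have -> : \int[P]_w F (root_sum (X : nat -> Omega -> borel R 1 n.+2) psi k w) = \int[P]_w f (L k w) + K.
  rewrite -LE RintegralD_fin//; first by rewrite Rintegral_cst_prob.
  exact: integrable_cst_fin.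
have -> : \int[gauss p]_t F (tuple_row t *m msqrt (invmx I0)) = \int[gauss p]_t f (g t) + K.
  rewrite RintegralD_fin//; first by rewrite Rintegral_cst_prob.
  exact: integrable_cst_fin.
have := h1 k k1; rewrite -[(fine \o _) k]/(\int[P]_w f (Z k w)) !ler_norml => /andP[a b] /andP[c b'].
by apply/andP; split; lra.
Unshelve. all: by end_near. Qed.
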